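(* Let $X$ be a complete $d$-dimensional variety with $\mathrm{Cl}(X)\cong\mathbb{Z}$ and notation as in the context. For any $\overline{x}=(\overline{x}_1,\ldots,\overline{x}_\nu)\in\widehat{X}$ the local divisor class group $\mathrm{Cl}(X,x)$ of $x:=p(\overline{x})$ is finite of order $\gcd(w_i;\ \overline{x}_i\ne0)$. The index of the Picard group $\mathrm{Pic}(X)$ in $\mathrm{Cl}(X)$ is given by $$[\mathrm{Cl}(X):\mathrm{Pic}(X)]=\mathrm{lcm}_{x\in X}\big(|\mathrm{Cl}(X,x)|\big).$$ Suppose that the ideal of $\overline{X}\subseteq\mathbb{K}^\nu$ is generated by $\mathrm{Cl}(X)$-homogeneous polynomials $g_1,\ldots,g_{\nu-d-1}$ of degree $\gamma_j:=\deg(g_j)$. Then one obtains $$-\mathcal{K}_X=\sum_{i=1}^\nu w_i-\sum_{j=1}^{\nu-d-1}\gamma_j,\qquad(-\mathcal{K}_X)^d=\Big(\sum_{i=1}^\nu w_i-\sum_{j=1}^{\nu-d-1}\gamma_j\Big)^d\frac{\gamma_1\cdots\gamma_{\nu-d-1}}{w_1\cdots w_\nu}$$ for the anticanonical class $-\mathcal{K}_X\in\mathrm{Cl}(X)\cong\mathbb{Z}$. In particular, $X$ is a Fano variety if and only if $\sum_{j=1}^{\nu-d-1}\gamma_j<\sum_{i=1}^\nu w_i$.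
   Context: $\mathbb{K}$ is an algebraically closed field of characteristic zero; varieties are normal over $\mathbb{K}$. The Cox ring is $\mathcal{R}(X)=\bigoplus_{D\in\mathrm{Cl}(X)}\Gamma(X,\mathcal{O}_X(D))$; for $X$ complete with $\mathrm{Cl}(X)\cong\mathbb{Z}$ in the setting considered, $\mathcal{R}(X)$ is finitely generated and factorial, and the total coordinate space $\overline{X}:=\mathrm{Spec}\,\mathcal{R}(X)$ is an affine variety with the $\mathbb{K}^*$-action defined by the $\mathrm{Cl}(X)$-grading. Choose a system $f_1,\ldots,f_\nu$ of homogeneous pairwise nonassociated prime generators of $\mathcal{R}(X)$. It gives a $\mathbb{K}^*$-equivariant embedding $\overline{X}\to\mathbb{K}^\nu$, $\overline{x}\mapsto(f_1(\overline{x}),\ldots,f_\nu(\overline{x}))$, where $\mathbb{K}^*$ acts diagonally with weights $w_i=\deg(f_i)\in\mathrm{Cl}(X)\cong\mathbb{Z}$ (identified so that the $w_i$ are positive). $X$ is the geometric $\mathbb{K}^*$-quotient of $\widehat{X}:=\overline{X}\setminus\{0\}$, with quotient map $p\colon\widehat{X}\to X$. The local divisor class group $\mathrm{Cl}(X,x)$ of a point $x\in X$ is the group of Weil divisors on $X$ modulo those that are principal near $x$. A Fano variety is one with ample anticanonical class. *)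

(* Defs.v *)
(* Varieties are encoded in the classical language of models of a function
   field (Chevalley, Zariski-Samuel II, ch. VI par. 17).  An integral separated
   K-scheme X of finite type is the set of its local rings, viewed as subrings
   of its function field F; it is covered by finitely many affine models
   { A_p : p prime in A }, A a finitely generated K-algebra with fraction field
   F, and the valuative criteria of separatedness and properness say that every
   valuation ring of F/K dominates at most, resp. at least, one local ring of X.
   An inclusion O1 `<=` O2 of local rings of X means that the point O1 lies in
   the closure of the point O2; the generic point is F itself. *)
From HB Require Import structures.
From mathcomp Require Import all_boot all_order all_algebra.
From mathcomp Require Export ring_quotient boolp classical_sets.
From mathcomp Require Export mpoly freeg.

Set Implicit Arguments.
Unset Strict Implicit.
Unset Printing Implicit Defensive.

Import Order.TTheory GRing.Theory Num.Theory.
Local Open Scope classical_set_scope.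
Local Open Scope ring_scope.
Local Open Scope quotient_scope.

Definition has_order (T : Type) (n : nat) := exists e : 'I_n -> T, bijective e.

Definition is_lcm (T : Type) (A : set T) (c : T -> nat) (N : nat) :=
  forall m, (N %| m)%N <-> (forall x, A x -> (c x %| m)%N).

Section Subrings.
Variable F : fieldType.
Implicit Types (A O V p : set F) (f : F).

Definition is_subring A :=
  [/\ A 1, (forall a b, A a -> A b -> A (a - b))
    & (forall a b, A a -> A b -> A (a * b))].

Definition is_unit A u := [/\ u != 0, A u & A u^-1].

Definition proper_ideal A p :=
  [/\ p `<=` A, p 0 /\ ~ p 1, (forall a b, p a -> p b -> p (a + b))
    & (forall a b, A a -> p b -> p (a * b))].

Definition prime_ideal A p :=
  proper_ideal A p /\ (forall a b, A a -> A b -> p (a * b) -> p a \/ p b).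

Definition maximal_ideal A p :=
  proper_ideal A p /\ (forall q, proper_ideal A q -> p `<=` q -> q = p).

Definition localization A p : set F :=
  [set f | exists a s, [/\ A a, A s, ~ p s & f = a / s]].

Definition spec A : set (set F) :=
  [set O | exists2 p, prime_ideal A p & O = localization A p].

Definition max_spec A : set (set F) :=
  [set O | exists2 p, maximal_ideal A p & O = localization A p].

Definition integrally_closed A :=
  forall q : {poly F}, q \is monic -> (forall i, A q`_i) ->
  forall f, root q f -> A f.

Definition dominates V O :=
  O `<=` V /\ (forall a, O a -> V a^-1 -> O a^-1).

Definition uniformizer O (t : F) :=
  [/\ t != 0, O t, ~ O t^-1 &
      forall f, f != 0 -> exists2 u, is_unit O u & exists n : int, f = u * t ^ n].

Definition is_dvr O := is_subring O /\ exists t, uniformizer O t.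

(* The normalized valuation of the discrete valuation ring O; it does not
   depend on the chosen uniformizer. *)
Definition ord O f : int :=
  xget 0 [set n : int | exists2 u, is_unit O u &
                          f = u * (xget 0 (uniformizer O)) ^ n].

Lemma is_unitM O u v : is_subring O -> is_unit O u -> is_unit O v ->
  is_unit O (u * v).
Proof.
case=> _ _ OM [u0 Ou Ou'] [v0 Ov Ov']; split; first by rewrite mulf_neq0.
  exact: OM.
by rewrite invfM; apply: OM.
Qed.

Lemma is_unitV O u : is_unit O u -> is_unit O u^-1.
Proof. by case=> u0 Ou Ou'; split; rewrite ?invr_eq0 ?invrK. Qed.

Lemma ord_uniq O f u n : is_dvr O -> is_unit O u ->
  f = u * (xget 0 (uniformizer O)) ^ n -> ord O f = n.
Proof.
move=> [Osub [t0 Ut0]]; have [O1 OB OM] := Osub.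
have: uniformizer O (xget 0 (uniformizer O)) by exact: (xgetI _ Ut0).
rewrite /ord; set t := xget 0 _; move=> [tn0 Ot Ot' _] Uu fE.
have powO k : O (t ^+ k).
  by elim: k => [|k IHk]; rewrite ?expr0 // exprS; apply: OM.
have aux u1 u2 (a b : int) : is_unit O u1 -> is_unit O u2 ->
    u1 * t ^ a = u2 * t ^ b -> a <= b.
  move=> U1 U2 E; rewrite leNgt; apply/negP => ltba; apply: Ot'.
  have [k ak] : exists k : nat, a = b + k.+1%:Z.
    exists (absz (a - b)).-1; rewrite prednK; last by rewrite absz_gt0 subr_eq0 gt_eqF.
    by rewrite gez0_abs ?subr_ge0 ?ltW // addrCA subrr addr0.
  have {E} E : t^-1 = (u1 / u2) * t ^+ k.
    move: E; rewrite ak expfzDr // mulrCA [u2 * _]mulrC.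
    move=> /(mulfI (expfz_neq0 _ tn0)) E.
    have [u20 _ _] := U2; apply: (mulfI u20); apply: (mulIf tn0).
    by rewrite divfK // mulrA mulrCA divff // mulr1 -mulrA -exprSr -[LHS]E.
  rewrite E; apply: OM => //.
  by case: (is_unitM Osub U1 (is_unitV U2)).
case: xgetP => [m -> [v Uv fE']|/(_ n)/=]; last by case; exists u.
by apply/eqP; rewrite eq_le; apply/andP; split; [apply: (aux v u)|apply: (aux u v)];
  rewrite -?fE -?fE'.
Qed.

Lemma ord1 O : is_dvr O -> ord O 1 = 0.
Proof.
move=> DO; apply: (@ord_uniq _ _ 1) => //; last by rewrite expr0z mulr1.
by case: DO => -[? _ _] _; split; rewrite ?oner_neq0 ?invr1.
Qed.

Lemma ordB O f g : is_dvr O -> f != 0 -> g != 0 ->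
  ord O (f / g) = ord O f - ord O g.
Proof.
move=> DO f0 g0; have [Osub [t0 Ut0]] := DO.
have: uniformizer O (xget 0 (uniformizer O)) by exact: (xgetI _ Ut0).
case=> tn0 _ _ gen.
have [u Uu [n fE]] := gen _ f0; have [v Uv [m gE]] := gen _ g0.
rewrite (ord_uniq DO Uu fE) (ord_uniq DO Uv gE).
apply: (ord_uniq DO (is_unitM Osub Uu (is_unitV Uv))).
by rewrite {1}fE {1}gE invfM expfzDr // -invr_expz -!mulrA; congr (_ * _); rewrite mulrCA.
Qed.

End Subrings.

Section Varieties.
Variables (K F : fieldType) (iota : {rmorphism K -> F}).

Definition affine_algebra (A : set F) :=
  (exists n (a : 'I_n -> F), A = range (mmap iota a))
  /\ (forall f, exists a b, [/\ A a, A b & f = a / b]).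

Definition valuation_ring (V : set F) :=
  [/\ is_subring V, (forall c, V (iota c)) & (forall f, V f \/ V f^-1)].

Record normal_variety := NormalVariety {
  nchart : nat;
  chart : 'I_nchart -> set F;
  chart_affine : forall i, affine_algebra (chart i);
  chart_normal : forall i, integrally_closed (chart i);
  separated : forall V, valuation_ring V -> forall O O' i i',
    spec (chart i) O -> spec (chart i') O' ->
    dominates V O -> dominates V O' -> O = O'
}.

Arguments chart : clear implicits.

Definition alg_indep n (x : 'I_n -> F) :=
  forall p : {mpoly K[n]}, mmap iota x p = 0 -> p = 0.

(* The dimension of a variety is the transcendence degree of its function field. *)
Definition has_dim (d : nat) :=
  (exists x : 'I_d -> F, alg_indep x)
  /\ (forall y : 'I_d.+1 -> F, ~ alg_indep y).

Definition derivation (delta : F -> F) :=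
  [/\ (forall c, delta (iota c) = 0),
      (forall a b, delta (a + b) = delta a + delta b)
    & (forall a b, delta (a * b) = delta a * b + a * delta b)].

Definition derivation_of (O : set F) (delta : F -> F) :=
  derivation delta /\ (forall a, O a -> O (delta a)).

Definition derivation_basis (O : set F) d (delta : 'I_d -> F -> F) :=
  (forall i, derivation_of O (delta i)) /\
  (forall eps, derivation_of O eps -> exists! c : 'rV[F]_d,
     (forall i, O (c 0 i)) /\ forall a, eps a = \sum_i c 0 i * delta i a).

Variable X : normal_variety.

Definition points : set (set F) := [set O | exists i, spec (chart X i) O].

Definition closed_points : set (set F) := [set O | exists i, max_spec (chart X i) O].

Definition complete :=
  forall V, valuation_ring V -> exists2 O, points O & dominates V O.

(* A prime divisor is identified with its generic point; on a normal variety
   the points of codimension one are those whose local ring is a discrete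
   valuation ring. *)
Record prime_divisor := PrimeDivisor {
  pd_ring :> set F;
  pd_point : points pd_ring;
  pd_dvr : is_dvr pd_ring
}.

HB.instance Definition _ := gen_eqMixin prime_divisor.
HB.instance Definition _ := gen_choiceMixin prime_divisor.

Definition WDiv := {freeg prime_divisor / int}.
HB.instance Definition _ := GRing.Zmodule.on WDiv.

Definition mult (P : prime_divisor) (D : WDiv) : int := coeff P D.

Definition principal_on (U : set prime_divisor) (D : WDiv) :=
  exists2 f : F, f != 0 & forall P, U P -> mult P D = ord P f.

Definition principal : {pred WDiv} := fun D => `[< principal_on setT D >].

(* For finite s, the points O with s contained in O form an open subset (the
   common domain of definition of the elements of s), and these sets are a
   base of the Zariski topology of X. *)
Definition principal_near (O : set F) : {pred WDiv} := fun D =>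
  `[< exists2 s : seq F, (forall a, a \in s -> O a) &
        principal_on [set P | forall a, a \in s -> (P : set F) a] D >].

Lemma principal_onS (U U' : set prime_divisor) D :
  U `<=` U' -> principal_on U' D -> principal_on U D.
Proof. by move=> sUU' [f f0 fP]; exists f => // P /sUU'; apply: fP. Qed.

Lemma principal_on0 U : principal_on U 0.
Proof.
by exists 1; rewrite ?oner_neq0 // => P _; rewrite /mult coeff0 ord1 //; apply: pd_dvr.
Qed.

Lemma principal_onB U D E :
  principal_on U D -> principal_on U E -> principal_on U (D - E).
Proof.
move=> [f f0 fD] [g g0 gE]; exists (f / g); first by rewrite mulf_neq0 ?invr_eq0.
move=> P UP; rewrite ordB //; last exact: pd_dvr.
by rewrite -fD // -gE // /mult coeffB.
Qed.

Fact principal_zmod_closed : zmod_closed principal.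
Proof.
split=> [|D E /asboolP pD /asboolP pE]; apply/asboolP; first exact: principal_on0.
exact: principal_onB.
Qed.

HB.instance Definition _ :=
  GRing.isZmodClosed.Build WDiv principal principal_zmod_closed.

Fact principal_near_zmod_closed O : zmod_closed (principal_near O).
Proof.
split=> [|D E /asboolP [s sO pD] /asboolP [s' s'O pE]]; apply/asboolP.
  by exists [::] => //; apply: principal_on0.
exists (s ++ s') => [a|]; first by rewrite mem_cat => /orP[/sO|/s'O].
by apply: principal_onB; [apply: principal_onS pD|apply: principal_onS pE] => P h a ha;
  apply: h; rewrite mem_cat ha ?orbT.
Qed.

HB.instance Definition _ O :=
  GRing.isZmodClosed.Build WDiv (principal_near O) (principal_near_zmod_closed O).

Definition Cl := {ideal_quot principal}.
HB.instance Definition _ := GRing.Zmodule.on Cl.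

Definition cl (D : WDiv) : Cl := \pi_({ideal_quot principal}) D.

Definition local_Cl (O : set F) := {ideal_quot (principal_near O)}.

Definition cartier (D : WDiv) := forall O, closed_points O -> D \in principal_near O.

Definition Pic : {pred Cl} := fun c => `[< exists2 D, cartier D & c = cl D >].

Fact Pic_zmod_closed : zmod_closed Pic.
Proof.
split=> [|c e /asboolP [D cD ->] /asboolP [E cE ->]]; apply/asboolP.
  by exists 0; [move=> O _; apply: rpred0 | rewrite /cl raddf0].
exists (D - E); last by rewrite /cl raddfB.
by move=> O cO; apply: rpredB; [apply: cD | apply: cE].
Qed.

HB.instance Definition _ := GRing.isZmodClosed.Build Cl Pic Pic_zmod_closed.

Definition Cl_mod_Pic := {ideal_quot Pic}.

(* div (g dx_1 /\ ... /\ dx_d): a d-form is a multiple of a generator of the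
   top exterior power of Omega_{O_P/K}, and the multiple is read off, up to a
   unit, by evaluating the form on a basis of Der_K(O_P). *)
Definition canonical_divisor d (D : WDiv) :=
  exists g (x : 'I_d -> F), [/\ g != 0, alg_indep x &
    forall P : prime_divisor, exists2 delta : 'I_d -> F -> F,
      derivation_basis P delta &
      mult P D = ord P (g * \det (\matrix_(i, j) delta i (x j)))].

Definition canonical_class d : Cl :=
  xget 0 [set c | exists2 D, canonical_divisor d D & c = cl D].

(* Gamma(U, O_X(D)) inside F *)
Definition sections (D : WDiv) (U : set (set F)) : set F :=
  [set f | f != 0 -> forall P : prime_divisor, U P -> 0 <= ord P f + mult P D].

Definition nonvanishing (D : WDiv) (f : F) : set (set F) :=
  [set O | points O /\
     forall P : prime_divisor, O `<=` P -> ord P f + mult P D = 0].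

Definition affine_open (U : set (set F)) :=
  exists2 B, affine_algebra B & U = spec B.

(* EGA II 4.5.2 for the invertible sheaf O_X(D) *)
Definition ample_cartier (D : WDiv) := forall O, points O ->
  exists n f, [/\ (0 < n)%N, f != 0, sections (D *+ n) points f,
    nonvanishing (D *+ n) f O & affine_open (nonvanishing (D *+ n) f)].

Definition ample (c : Cl) := exists m D,
  [/\ (0 < m)%N, cartier D, cl D = c *+ m & ample_cartier D].

(* Alternating Cech complex of O_X(D) for the affine cover of X by its charts:
   the cochains of degree q are the functions on the (q+1)-element sets of
   charts. *)
Definition cech_fun := {ffun {set 'I_(nchart X)} -> F^o}.

Definition chart_inter (sigma : {set 'I_(nchart X)}) : set (set F) :=
  [set O | forall i, i \in sigma -> spec (chart X i) O].

Definition cech_cochain (D : WDiv) (k : nat) : set cech_fun :=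
  [set phi : cech_fun | forall sigma : {set 'I_(nchart X)}, if (0 < #|sigma|)%N && (#|sigma| == k)
     then sections D (chart_inter sigma) (phi sigma) else phi sigma = 0].

Definition coboundary (phi : cech_fun) : cech_fun :=
  [ffun sigma : {set 'I_(nchart X)} => \sum_(i in sigma)
     (-1) ^+ #|[set j in sigma | (j < i)%N]%SET| * phi (sigma :\ i)%SET].

Definition quotient_dim (Z B : set cech_fun) (n : nat) :=
  exists e : 'I_n -> cech_fun, (forall i, Z (e i)) /\
    forall z, Z z -> exists! c : 'rV[K]_n, B (z - \sum_i iota (c 0 i) *: e i).

Definition cohom_dim (D : WDiv) (q : nat) : nat :=
  xget 0%N (quotient_dim
    (cech_cochain D q.+1 `&` [set phi | coboundary phi = 0])
    (coboundary @` cech_cochain D q)).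

Definition euler_char (D : WDiv) : int :=
  \sum_(q < nchart X) (-1) ^+ q * (cohom_dim D q)%:Z.

(* Snapper-Kleiman: (D_1...D_d) is the alternating sum over I of
   chi(- \sum_(i in I) D_i); here all D_i are equal. *)
Definition cartier_self_intersection d (D : WDiv) : int :=
  \sum_(i < d.+1) (-1) ^+ i * ('C(d, i))%:Z * euler_char (- (D *+ i)).

Definition self_intersection d (c : Cl) : rat :=
  xget 0 [set q | exists m D, [/\ (0 < m)%N, cartier D, cl D = c *+ m &
    q = (cartier_self_intersection d D)%:~R / m%:R ^+ d]].

Definition fano d := ample (- canonical_class d).

(* The Cox ring. If the class of D0 generates Cl(X) and has infinite order,
   then R(X) is the sum over n of Gamma(X, O_X(n D0)), realized as a ring of
   Laurent polynomials in 'X over F, inside F('X). *)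
Local Notation L := {fraction {poly F}}.

Definition fconst (a : F) : L := tofrac a%:P.
Definition kconst (c : K) : L := fconst (iota c).

Definition cox_ring (D0 : WDiv) : set L :=
  [set z | exists N (p : {poly F}), z = tofrac p / tofrac 'X^N /\
     forall n, sections (D0 *~ (n%:Z - N%:Z)) points p`_n].

Definition cox_elt (f : F) (n : nat) : L := tofrac (f *: 'X^n).

(* divisibility in the subring R of the field L *)
Definition divides_in (R : set L) (a b : L) := exists2 c, R c & b = c * a.

Definition prime_in (R : set L) (p : L) :=
  [/\ R p, p != 0, ~ divides_in R p 1 &
      forall a b, R a -> R b -> divides_in R p (a * b) ->
        divides_in R p a \/ divides_in R p b].

Definition associated_in (R : set L) (a b : L) :=
  divides_in R a b /\ divides_in R b a.

Section TotalCoordinateSpace.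
Variables (nu : nat) (f : 'I_nu -> F) (w : 'I_nu -> nat).

Definition cox_eval : {mpoly K[nu]} -> L :=
  mmap kconst (fun i => cox_elt (f i) (w i)).

(* the ideal of the image of Spec R(X) in K^nu *)
Definition tcs_ideal : set {mpoly K[nu]} := [set G | cox_eval G = 0].

Definition tcs : set ('I_nu -> K) :=
  [set x | forall G, tcs_ideal G -> G.@[x] = 0].

Definition tcs_hat : set ('I_nu -> K) := [set x | tcs x /\ exists i, x i != 0].

Definition tcs_local_ring (x : 'I_nu -> K) : set L :=
  [set z | exists G H : {mpoly K[nu]}, H.@[x] != 0 /\ z = cox_eval G / cox_eval H].

(* The quotient morphism has as comorphism the inclusion of F = K(X), the
   homogeneous fractions of degree 0, into the fraction field of R(X); it sends
   x to the unique closed point of X whose local ring is dominated by the local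
   ring at x. *)
Definition tcs_quot (x : 'I_nu -> K) : set F :=
  xget setT [set O | closed_points O /\
                     dominates (fconst @^-1` tcs_local_ring x) O].

Definition weighted_homog (G : {mpoly K[nu]}) (gamma : nat) :=
  G != 0 /\ forall m, m \in msupp G -> (\sum_i m i * w i)%N = gamma.

Definition ideal_generated_by r (g : 'I_r -> {mpoly K[nu]}) : set {mpoly K[nu]} :=
  [set G | exists c : 'I_r -> {mpoly K[nu]}, G = \sum_j c j * g j].

End TotalCoordinateSpace.

End Varieties.

(* Main.v *)
From HB Require Import structures.
From mathcomp Require Import all_boot all_order all_algebra.
From mathcomp Require Import perm cyclotomic.
From mathcomp Require Import boolp classical_sets.
From mathcomp Require Import mpoly freeg.
From mathcomp Require Import ring lra zify.
Require Import Defs.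

Set Implicit Arguments.
Unset Strict Implicit.
Unset Printing Implicit Defensive.

Import Order.TTheory GRing.Theory Num.Theory.
Local Open Scope classical_set_scope.
Local Open Scope ring_scope.

(** The proof takes place in the function field.  A homogeneous element of degree
    n of the Cox ring is a section of n D0, hence a function, and a homogeneous
    polynomial G in the generators is identified with its value at f; a Laurent
    variable is only needed to separate the degrees.  Three facts make this
    graded ring a model of X: its elements of degree zero are constants, because
    X is complete; every prime divisor is the zero divisor of one homogeneous
    element (prime_divisor_equation); and every chart is the locus where one
    homogeneous element of positive degree does not vanish (chart_equation),
    because the complement of an affine chart is purely of codimension one
    (hartogs, divisors_detect_chart).

    Local class groups.  A point of the punctured total coordinate space gives a
    local ring of homogeneous fractions of degree zero.  By completeness some
    chart equation does not vanish at the point (hat_in_chart), so this local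
    ring is a closed point of X, and the Nullstellensatz gives all closed points
    (closed_point_lift).  A divisor of degree n is principal near the point
    exactly if some invertible homogeneous fraction there has degree n, that is,
    if n is a multiple of the gcd of the weights of the nonvanishing coordinates
    (principal_nearP).  The local class groups, the Picard group as the multiples
    of the lcm, and ampleness as positivity of the degree follow.

    Self-intersection.  The equations form a regular sequence: standard monomials
    bound the growth of the coordinate ring by its dimension (growth_tcs), the
    variables show that the polynomial ring has full depth, and depth does not
    depend on the regular sequence (regular_exchange, growth_regular).  So the
    Hilbert series is the quotient of the product of the 1 - t^gamma_j by the
    product of the 1 - t^w_i.  Its poles at roots of unity are bounded through
    the loci of the points with given gcd (pole_orders), whence the Hilbert
    function is a polynomial on the multiples of the lcm Lam of the local orders,
    with leading coefficient read off at t = 1 (hilbert_polynomial).  The Cech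
    complex of n D0 is exhausted by complexes of functions with poles of bounded
    order along the chart equations.  These have finite-dimensional terms, given
    by the Hilbert function, and the inclusions do not change cohomology once the
    poles are large (exact_poles, by induction on the number of charts whose
    equation does not annihilate a quotient).  Hence the Euler characteristic of
    a Cartier divisor is a value of the Hilbert polynomial, and its d-th
    difference gives the degree (cartier_self_intersectionE).

    Canonical class.  At a prime divisor P the generators, divided by powers of a
    function tau of the order of D0 along P, become regular and do not all vanish
    (some_coordinate_unit).  A relation of least degree for each variable outside
    a maximal set of variables independent along P is separable in that variable,
    which shows that the Jacobian matrix of the equations has a minor that is
    invertible at P (unit_minor).  Derivations of the local ring at P are then
    the tangent vectors in the kernel of the Jacobian, modulo the Euler vector,
    and a frame adapted to the minor is a basis (local_derivations).  For
    coordinates x_j that are quotients of powers of the generators, the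
    determinant of the values of the basis at x is, up to a unit, a complementary
    minor of the Jacobian.  Its dependence on P is the power of tau with exponent
    the sum of the w_i minus the sum of the gamma_j, so minus this multiple of D0
    is a canonical divisor; all canonical divisors are equivalent
    (canonical_unique). *)

(** * Points of polynomial rings *)

Lemma ex_min_nat (T : Type) (E : T -> Prop) (m : T -> nat) :
  (exists x, E x) -> exists x, E x /\ forall y, E y -> (m x <= m y)%N.
Proof.
move=> [x0 Ex0]; pose Q n := `[< exists2 x, E x & m x = n >].
have exQ : exists n, Q n by exists (m x0); apply/asboolP; exists x0.
case: (ex_minnP exQ) => n /asboolP[x Ex xn] nmin.
by exists x; split=> // y Ey; rewrite xn; apply: nmin; apply/asboolP; exists y.
Qed.

Section RingIdeals.
Variable T : comNzRingType.
Implicit Types (J q : T -> Prop).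

Definition ring_ideal J :=
  [/\ J 0, forall a b, J a -> J b -> J (a + b) & forall a b, J b -> J (a * b)].

Definition ring_prime q :=
  [/\ ring_ideal q, ~ q 1 & forall a b, q (a * b) -> q a \/ q b].

Lemma ring_ideal_sum J (I : Type) (r : seq I) (P : pred I) (c : I -> T) :
  ring_ideal J -> (forall i, P i -> J (c i)) -> J (\sum_(i <- r | P i) c i).
Proof. by case=> J0 JD _ Jc; apply: big_ind. Qed.

Lemma ring_idealN J a : ring_ideal J -> J a -> J (- a).
Proof. by case=> _ _ JM Ja; rewrite -mulN1r; apply: JM. Qed.

Lemma ring_idealB J a b : ring_ideal J -> J a -> J b -> J (a - b).
Proof. by move=> IJ Ja Jb; case: (IJ) => _ JD _; apply: JD => //; apply: ring_idealN. Qed.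

Lemma ring_idealMr J a b : ring_ideal J -> J a -> J (a * b).
Proof. by case=> _ _ JM Ja; rewrite mulrC; apply: JM. Qed.

Lemma ring_primeX q a k : ring_prime q -> q (a ^+ k) -> q a.
Proof.
case=> Iq q1 qM; elim: k => [|k IHk]; first by rewrite expr0.
by rewrite exprS => /qM[].
Qed.

End RingIdeals.

Section PointExtension.
Variables (K : closedFieldType) (T : idomainType) (c : {rmorphism K -> T}).

Definition pointful (T' : idomainType) (c' : K -> T') :=
  forall q : T' -> Prop, ring_prime q -> forall b, ~ q b ->
  exists chi : {rmorphism T' -> K},
    [/\ forall k, chi (c' k) = k, forall a, q a -> chi a = 0 & chi b != 0].

Let minus_lead (p : {poly T}) : p != 0 ->
  (size (p - lead_coef p *: 'X ^+ (size p).-1)%R < size p)%N.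
Proof.
move=> p0; rewrite -[X in (_ < X)%N]prednK ?size_poly_gt0 // ltnS.
apply/leq_sizeP => j lej; rewrite coefB coefZ coefXn.
case: eqP => [->|/eqP nj]; first by rewrite mulr1 lead_coefE subrr.
rewrite mulr0 subr0 nth_default //.
have: ((size p).-1 < j)%N by rewrite ltn_neqAle eq_sym nj.
by rewrite -[in X in _ -> X](@prednK (size p)) ?size_poly_gt0.
Qed.

Let coefs_in (q : {poly T} -> Prop) (p : {poly T}) := forall i, q (p`_i)%:P.

Let coefs_inq q p : ring_prime q -> coefs_in q p -> q p.
Proof.
case=> -[q0 qD qM] _ _ qp; rewrite -[p]coefK poly_def.
by apply: ring_ideal_sum => // i _; rewrite -mul_polyC mulrC; apply: qM.
Qed.

Let strip (E : {poly T} -> Prop) q p : ring_prime q -> ring_ideal E ->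
  (forall p, q p -> E p) -> E p -> ~ coefs_in q p ->
  exists r, [/\ E r, ~ q (lead_coef r)%:P & (size r <= size p)%N].
Proof.
move=> Pq IE qE; have [n] := ubnP (size p); elim: n p => // n IHn p ltn Ep nq.
have [ql|nql] := EM (q (lead_coef p)%:P); last by exists p.
have p0 : p != 0.
  apply/eqP=> p0; apply: nq => i; rewrite p0 coef0.
  by case: Pq => -[].
have lt := minus_lead p0; set r := _ - _ in lt.
have [|||s [Es ns le]] := IHn r; first exact: leq_trans lt _.
- apply: ring_idealB => //; apply: qE; rewrite -mul_polyC.
  by apply: ring_idealMr => //; case: Pq.
- move=> qr; apply: nq => i; have := qr i; rewrite /r coefB coefZ coefXn.
  case: eqP => [->|_]; first by rewrite -lead_coefE.
  by rewrite mulr0 subr0.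
by exists s; split=> //; apply: leq_trans le (ltnW lt).
Qed.

(** A prime q of {poly T} either comes from a prime of T, and then any value of
    the variable avoiding b will do, or contains a polynomial whose leading
    coefficient is outside q; keeping that coefficient nonzero, the value of the
    variable is found among the roots of the specialized polynomial. *)
Lemma pointful_poly : pointful c -> pointful (polyC \o c).
Proof.
move=> ptT q Pq b nqb; have [Iq nq1 qP] := Pq; have [q0 qD qM] := Iq.
pose q' a := q a%:P.
have Pq' : ring_prime q'.
  split=> //; last by move=> a a'; rewrite /q' polyCM; apply: qP.
  split=> // [a a'|a a']; rewrite /q' ?polyCD ?polyCM; [exact: qD|exact: qM].
have lift (chi : {rmorphism T -> K}) t :
    (forall k, chi (c k) = k) -> (forall p, q p -> root (map_poly chi p) t) ->
    ~~ root (map_poly chi b) t ->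
    exists chi : {rmorphism {poly T} -> K}, [/\ forall k, chi ((polyC \o c) k) = k,
      forall a, q a -> chi a = 0 & chi b != 0].
  move=> chic qr br; exists (horner_eval t \o map_poly chi); split=> //= [k|a /qr/rootP //].
  by rewrite map_polyC /= /horner_eval hornerC.
have [allq|/existsNP[p1 /not_implyP[qp1 np1]]] := EM (forall p, q p -> coefs_in q p).
  have /existsNP[i nbi] : ~ coefs_in q b by move=> /(coefs_inq Pq).
  have [chi [chic chiq chib]] := ptT q' Pq' b`_i nbi.
  have : map_poly chi b != 0.
    by apply/eqP => /polyP/(_ i)/eqP; rewrite coef_map coef0 (negPf chib).
  move=> /closed_nonrootP[t bt]; apply: (lift chi t) => // p qp.
  have -> : map_poly chi p = 0.
    by apply/polyP => j; rewrite coef_map coef0; apply: chiq; apply: allq.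
  exact: root0.
have [|p0 [[qp0 np0] p0min]] := @ex_min_nat _
  (fun p => q p /\ ~ q (lead_coef p)%:P) (fun p => size p).
  by have [r [? ? _]] := strip Pq Iq (fun p h => h) qp1 np1; exists r.
have small p : q p -> (size p < size p0)%N -> coefs_in q p.
  move=> qp lt; apply: contrapT => np.
  have [r [qr nr le]] := strip Pq Iq (fun p h => h) qp np.
  by have := leq_trans (p0min r (conj qr nr)) le; rewrite leqNgt lt.
pose E p := exists u v, q v /\ p = u * b + v.
have IE : ring_ideal E.
  split; first by exists 0, 0; rewrite mul0r addr0.
    move=> x y [u [v [qv ->]]] [u' [v' [qv' ->]]]; exists (u + u'), (v + v').
    by split; [exact: qD|rewrite mulrDl addrACA].
  move=> x y [u [v [qv ->]]]; exists (x * u), (x * v).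
  by split; [exact: qM|rewrite mulrDr mulrA].
have qE p : q p -> E p by exists 0, p; rewrite mul0r add0r.
have [|r [[Er nr] rmin]] := @ex_min_nat _
  (fun p => E p /\ ~ q (lead_coef p)%:P) (fun p => size p).
  by exists p0; split=> //; apply: qE.
have smallE p : E p -> (size p < size r)%N -> coefs_in q p.
  move=> qp lt; apply: contrapT => np.
  have [s [qs ns le]] := strip Pq IE qE qp np.
  by have := leq_trans (rmin s (conj qs ns)) le; rewrite leqNgt lt.
have r0 : r != 0 by apply/eqP => r0; apply: nr; rewrite r0 lead_coef0.
have p00 : p0 != 0 by apply/eqP => p00; apply: np0; rewrite p00 lead_coef0.
have nlX (a : T) k : ~ q a%:P -> ~ q (a ^+ k)%:P.
  by move=> na; rewrite polyC_exp => /(ring_primeX Pq).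
have modE p s : E p -> E s -> E (Pdiv.Idomain.modp p s).
  move=> Ep Es; have := Pdiv.Idomain.divp_eq p s => /esym/(canRL (addKr _)) ->.
  have [_ ED EM] := IE; apply: ED; first by rewrite -mulNr; apply: EM.
  by rewrite -mul_polyC; apply: EM.
have lerp : (size r <= size p0)%N by apply: rmin; split=> //; apply: qE.
have r1 : size r = 1%N.
  apply/eqP; rewrite eqn_leq size_poly_gt0 r0 andbT leqNgt; apply/negP => r2.
  have qm p : E p -> coefs_in q (Pdiv.Idomain.modp p r).
    by move=> Ep; apply: smallE; rewrite ?Pdiv.Idomain.ltn_modp //; apply: modE.
  have Eb : E b by exists 1, 0; rewrite mul1r addr0.
  have eb := Pdiv.Idomain.divp_eq b r.
  have ep := Pdiv.Idomain.divp_eq p0 r.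
  have nqr : ~ q r.
    move=> qr; have: q (lead_coef r ^+ Pdiv.Idomain.scalp b r *: b).
      by rewrite eb; apply: qD; [exact: qM|apply: coefs_inq => //; exact: qm].
    by rewrite -mul_polyC => /qP[/(nlX _ _ nr)|/nqb].
  have : q (Pdiv.Idomain.divp p0 r * r).
    rewrite (canRL (addrK _) (esym ep)) -mul_polyC; apply: ring_idealB => //.
      exact: qM.
    by apply: coefs_inq => //; apply: qm; apply: qE.
  move=> /qP[qd|] //.
  have lt : (size (Pdiv.Idomain.divp p0 r) < size p0)%N.
    rewrite Pdiv.Idomain.size_divp // ltn_subrL !size_poly_gt0 p00 andbT.
    by rewrite -ltnS prednK // ltnW.
  have cd := small _ qd lt.
  have /(congr1 (fun p : {poly T} => p`_(size p0).-1)) := ep.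
  rewrite coefZ -lead_coefE coefD [X in _ + X]nth_default ?addr0; last first.
    rewrite -ltnS prednK ?size_poly_gt0 //; apply: leq_trans lerp.
    by rewrite Pdiv.Idomain.ltn_modp.
  rewrite coefM => e; have : q' (lead_coef r ^+ Pdiv.Idomain.scalp p0 r * lead_coef p0).
    rewrite e; apply: ring_ideal_sum; first by case: Pq'.
    by move=> i _; apply: ring_idealMr; [case: Pq'|exact: cd].
  by rewrite /q' polyCM => /qP[/(nlX _ _ nr)|/np0].
have [a aE] : exists a, r = a%:P by exists r`_0; apply: size1_polyC; rewrite r1.
have nqa : ~ q' a by move=> qa; apply: nr; rewrite aE lead_coefC.
have nqla : ~ q' (lead_coef p0 * a) by rewrite /q' polyCM => /qP[].
have [chi [chic chiq]] := ptT q' Pq' _ nqla.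
rewrite rmorphM mulf_eq0 negb_or => /andP[chil chia].
have sz : size (map_poly chi p0) != 1%N.
  rewrite size_map_poly_id0 //; apply/eqP => p01; apply: np0.
  by move: (p01) => /eqP/size_poly1P[l _ el]; rewrite el lead_coefC -el.
have [t rt] := closed_rootP _ sz.
have chiq0 p : coefs_in q p -> map_poly chi p = 0.
  by move=> cp; apply/polyP => j; rewrite coef_map coef0; apply: chiq; apply: cp.
have qroot p : q p -> root (map_poly chi p) t.
  move=> qp; have e := Pdiv.Idomain.divp_eq p p0.
  have qmod : q (Pdiv.Idomain.modp p p0).
    rewrite (canRL (addKr _) (esym e)) -mul_polyC; apply: qD; last exact: qM.
    by rewrite -mulNr; apply: qM.
  have c0 := small _ qmod; rewrite Pdiv.Idomain.ltn_modp in c0.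
  move/(congr1 (fun p => (map_poly chi p).[t])): e.
  rewrite -mul_polyC rmorphD !rmorphM /= map_polyC (chiq0 _ (c0 p00)) addr0 hornerM.
  rewrite hornerM (rootP rt) mulr0 hornerC => /eqP; rewrite mulf_eq0.
  case/orP=> [/eqP h|/rootP //]; move: chil.
  suff : chi (lead_coef p0) ^+ Pdiv.Idomain.scalp p p0 == 0.
    by rewrite expf_eq0 => /andP[_ ->].
  by rewrite -rmorphXn; apply/eqP.
apply: (lift chi t) => //; apply/negP => /rootP bt.
move: Er => [u [v [qv rE]]].
move: chia; rewrite -[chi a](hornerC _ t) -map_polyC -aE rE rmorphD rmorphM /= hornerD hornerM bt.
by rewrite (rootP (qroot _ qv)) mulr0 addr0 eqxx.
Qed.

End PointExtension.

Lemma nondecreasing_subseq (f : nat -> nat) :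
  exists phi : nat -> nat, {homo phi : i j / (i < j)%N} /\
    {homo f \o phi : i j / (i <= j)%N}.
Proof.
have /choice[b bP] : forall a, exists b, (a <= b)%N /\ forall c, (a <= c)%N -> (f b <= f c)%N.
  move=> a; have [|b [ab bmin]] := @ex_min_nat nat (fun b => (a <= b)%N) f; first by exists a.
  by exists b.
pose phi := fix phi k := if k is k'.+1 then b (phi k').+1 else b 0%N.
have phiS k : (phi k < phi k.+1)%N by case: (bP (phi k).+1).
have incr : {homo phi : i j / (i < j)%N} by apply: homo_ltn => //; apply: ltn_trans.
exists phi; split=> //; apply: homo_leq => //; first exact: leq_trans.
have phi_min k c : (phi k <= c)%N -> (f (phi k) <= f c)%N.
  by case: k => [|k] le; apply: (bP _).2 => //; apply: leq_trans le; case: (bP (phi k).+1).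
by move=> k /=; apply: phi_min; apply: ltnW.
Qed.

Lemma dickson n (u : nat -> 'X_{1..n}) : exists i j, (i < j)%N /\ (u i <= u j)%MM.
Proof.
suff: forall k, exists phi : nat -> nat, {homo phi : i j / (i < j)%N} /\
    forall l : 'I_n, (l < k)%N -> {homo (fun i => u (phi i) l) : i j / (i <= j)%N}.
  case/(_ n) => phi [incr mono]; exists (phi 0%N), (phi 1%N); split; first exact: incr.
  by apply/mnm_lepP => l; apply: (mono l (ltn_ord l)).
elim=> [|k [phi [incr mono]]]; first by exists id; split=> // l; rewrite ltn0.
have [lt|le] := ltnP k n; last first.
  by exists phi; split=> // l _; apply: mono; apply: leq_trans (ltn_ord l) _.
have [psi [incr' mono']] := nondecreasing_subseq (fun i => u (phi i) (Ordinal lt)).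
exists (phi \o psi); split=> [i j /incr'/incr //|l].
rewrite ltnS leq_eqVlt => /orP[/eqP lk|lk] i j /=.
  by have -> : l = Ordinal lt by [apply: val_inj]; apply: mono'.
by move=> ij; apply: mono => //; apply: (ltnW_homo incr').
Qed.

Section Noetherian.
Variables (K : fieldType) (n : nat).
Implicit Types (J : {mpoly K[n]} -> Prop).

(** Otherwise one could choose, again and again, a member with minimal leading
    monomial outside the ideal generated so far; by Dickson, one of the leading
    monomials would divide a later one, and could be cancelled. *)
Lemma mpoly_noetherian J : ring_ideal J ->
  exists s : seq {mpoly K[n]}, (forall x, x \in s -> J x) /\
    forall g, J g -> forall J', ring_ideal J' -> (forall x, x \in s -> J' x) -> J' g.
Proof.
move=> IJ; pose gen (s : seq {mpoly K[n]}) g :=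
  forall J', ring_ideal J' -> (forall x, x \in s -> J' x) -> J' g.
apply: contrapT => nfg.
have /choice[next nextP] : forall s : seq {mpoly K[n]}, exists g,
    (forall x, x \in s -> J x) -> [/\ J g, ~ gen s g &
      forall h, J h -> ~ gen s h -> (mlead g <= mlead h)%O].
  move=> s; have [sJ|] := EM (forall x, x \in s -> J x); last by exists 0.
  have [g [Jg ng]] : exists g, J g /\ ~ gen s g.
    apply: contrapT => H; apply: nfg; exists s; split=> // g Jg.
    by apply: contrapT => ng; apply: H; exists g.
  suff [g' [? ? ?]] : exists g, [/\ J g, ~ gen s g &
      forall h, J h -> ~ gen s h -> (mlead g <= mlead h)%O] by exists g'.
  elim/mleadrect: g Jg ng => g IHg Jg ng.
  have [[h [Jh nh lt]]|H] := EM (exists h, [/\ J h, ~ gen s h & (mlead h < mlead g)%O]).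
    exact: IHg lt Jh nh.
  exists g; split=> // h Jh nh; rewrite leNgt; apply/negP => lt.
  by apply: H; exists h.
pose l := fix l k := if k is k'.+1 then rcons (l k') (next (l k')) else [::].
have lJ k x : x \in l k -> J x.
  elim: k x => [|k IHk] x //=; rewrite mem_rcons inE => /orP[/eqP->|/IHk//].
  by case: (nextP (l k) IHk).
have l_in i j : (i < j)%N -> next (l i) \in l j.
  elim: j => // j IHj; rewrite ltnS leq_eqVlt /= mem_rcons inE.
  by case/orP => [/eqP->|/IHj->]; rewrite ?eqxx ?orbT.
have [i [j [ij le]]] := dickson (fun k => mlead (next (l k))).
have [Jj nj minj] := nextP (l j) (@lJ j).
have [Ji ni _] := nextP (l i) (@lJ i).
set gj := next (l j) in Jj nj minj le; set gi := next (l i) in Ji ni le.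
have gi0 : gi != 0 by apply/eqP => g0; apply: ni => J' [J0 _ _]; rewrite g0.
have gj0 : gj != 0 by apply/eqP => g0; apply: nj => J' [J0 _ _]; rewrite g0.
pose c := mleadc gj / mleadc gi.
pose h := (c *: 'X_[(mlead gj - mlead gi)]) * gi.
have gi_in : gen (l j) gi by move=> J' _; apply; apply: l_in.
have Jh : J h by case: IJ => _ _; apply.
have lgi : mleadc gi != 0 by rewrite mleadc_eq0.
have lgj : mleadc gj != 0 by rewrite mleadc_eq0.
have c0 : c != 0 by rewrite mulf_neq0 ?invr_eq0.
have cX0 : c *: 'X_[(mlead gj - mlead gi)] != 0 :> {mpoly K[n]}.
  by rewrite -mleadc_eq0 mleadZ // mcoeffZ mleadXm mcoeffX eqxx mulr1.
have lead_h : mlead h = mlead gj by rewrite /h mleadM // mleadZ // mleadXm submK.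
have c_h : h@_(mlead gj) = mleadc gj.
  by rewrite -{1}lead_h /h mleadM // mleadcM mleadZ // mleadXm mcoeffZ mcoeffX eqxx mulr1 divfK.
have nJ : ~ gen (l j) (gj - h).
  move=> gh; apply: nj => J' IJ' inJ'; rewrite -(subrK h gj).
  have [_ JD JM] := IJ'; apply: JD; first exact: gh.
  by apply: JM; apply: gi_in.
have gjh0 : gj - h != 0 by apply/eqP => g0; apply: nJ => J' [J0 _ _]; rewrite g0.
have le2 := minj _ (ring_idealB IJ Jj Jh) nJ.
have le3 : (mlead (gj - h) <= mlead gj)%O.
  by apply: le_trans (mleadB_le _ _) _; rewrite lead_h joinxx.
have e : mlead (gj - h) = mlead gj by apply/eqP; rewrite eq_le le2 le3.
have := gjh0; rewrite -mleadc_eq0 e mcoeffB c_h subrr eqxx //.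
Qed.

Lemma mpoly_max_ideal (Fam : ({mpoly K[n]} -> Prop) -> Prop) J0 :
  (forall J, Fam J -> ring_ideal J) -> Fam J0 ->
  exists J, [/\ Fam J, forall g, J0 g -> J g &
     forall J', Fam J' -> (forall g, J g -> J' g) -> forall g, J' g -> J g].
Proof.
move=> Famid FJ0; apply: contrapT => nmax.
pose T := {J | Fam J /\ forall g, J0 g -> J g}.
have /choice[next nextP] : forall t : T, exists t' : T,
    (forall g, sval t g -> sval t' g) /\ exists2 g, sval t' g & ~ sval t g.
  move=> [J [FJ J0J]] /=; apply: contrapT => H; apply: nmax; exists J; split=> //.
  move=> J' FJ' JJ' g J'g; apply: contrapT => nJg; apply: H.
  by exists (exist _ J' (conj FJ' (fun g h => JJ' g (J0J g h)))); split=> //; exists g.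
pose ch k := sval (iter k next (exist _ J0 (conj FJ0 (fun g => id)))).
have chS k g : ch k g -> ch k.+1 g by rewrite /ch iterS; apply: (nextP _).1.
have chle i j g : (i <= j)%N -> ch i g -> ch j g.
  by move/subnK <-; elim: (j - i)%N => // k IHk /IHk; apply: chS.
have chid k : ring_ideal (ch k) by apply: Famid; rewrite /ch; case: (iter _ _ _) => ? [].
have IU : ring_ideal (fun g => exists k, ch k g).
  split; first by exists 0%N; case: (chid 0%N).
    move=> a b [i ai] [j bj]; exists (maxn i j); case: (chid (maxn i j)) => _ D _.
    by apply: D; [apply: chle ai; rewrite leq_maxl|apply: chle bj; rewrite leq_maxr].
  by move=> a b [k bk]; exists k; case: (chid k) => _ _; apply.
have [s [sU sgen]] := mpoly_noetherian IU.
have [k sk] : exists k, forall x, x \in s -> ch k x.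
  elim: s sU {sgen} => [|x s IHs] sU; first by exists 0%N.
  have [k sk] := IHs (fun y ys => sU y (mem_behead (ys : y \in behead (x :: s)))).
  have [j xj] := sU x (mem_head _ _).
  exists (maxn j k) => y; rewrite inE => /orP[/eqP->|/sk].
    by apply: chle xj; rewrite leq_maxl.
  by apply: chle; rewrite leq_maxr.
have [g gk ngk] : exists2 g, ch k.+1 g & ~ ch k g by rewrite /ch iterS; apply: (nextP _).2.
have H : exists j, ch j g by exists k.+1.
exact: ngk (sgen g H _ (chid k) sk).
Qed.

End Noetherian.

(** Radical membership: an element whose powers avoid an ideal is avoided by a
    prime above it, namely a maximal ideal among those free of its powers. *)
Lemma prime_avoiding (K : fieldType) n (J : {mpoly K[n]} -> Prop) G :
  ring_ideal J -> (forall k, ~ J (G ^+ k)) ->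
  exists q, [/\ ring_prime q, forall g, J g -> q g & ~ q G].
Proof.
move=> IJ nJ; pose Fam q := ring_ideal q /\ forall k, ~ q (G ^+ k).
have [q [[Iq nq] Jq qmax]] := @mpoly_max_ideal _ _ Fam J (fun J h => h.1) (conj IJ nJ).
have [q0 qD qM] := Iq.
exists q; split=> //; last by have := nq 1%N; rewrite expr1.
have ext a : ~ q a -> exists k, exists u, q (G ^+ k - u * a).
  move=> na; pose qa g := exists u, q (g - u * a).
  have Iqa : ring_ideal qa.
    split; first by exists 0; rewrite mul0r subr0.
      by move=> x y [u ux] [v vy]; exists (u + v); rewrite mulrDl opprD addrACA; apply: qD.
    by move=> x y [u uy]; exists (x * u); rewrite -mulrA -mulrBr; apply: qM.
  apply: contrapT => H; apply: na; apply: (qmax qa).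
  - by split=> // k [u uk]; apply: H; exists k, u.
  - by move=> g qg; exists 0; rewrite mul0r subr0.
  - by exists 1; rewrite mul1r subrr.
split=> //; first by have := nq 0%N; rewrite expr0.
move=> a b qab; have [|/ext[k [u ku]]] := EM (q a); first by left.
have [|/ext[l [v lv]]] := EM (q b); first by right.
exfalso; apply: (nq (k + l)%N); rewrite exprD.
have -> : G ^+ k * G ^+ l = G ^+ k * (G ^+ l - v * b) + v * b * (G ^+ k - u * a) + u * v * (a * b).
  ring.
by apply: (qD); [apply: (qD)|]; apply: (qM).
Qed.

Section Nullstellensatz.
Variable K : closedFieldType.

Let universal n (T : idomainType) (c : K -> T) (X : 'I_n -> T) :=
  forall (B : comNzRingType) (h : {rmorphism K -> B}) (b : 'I_n -> B),
    exists psi : {rmorphism T -> B}, (forall k, psi (c k) = h k) /\ forall i, psi (X i) = b i.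

Let pointful_universal n :
  exists (T : idomainType) (c : {rmorphism K -> T}) (X : 'I_n -> T),
    pointful c /\ universal c X.
Proof.
elim: n => [|n [T [c [X [ptT univ]]]]].
  exists K, idfun, (fun i => 0); split; last first.
    by move=> B h b; exists h; split=> // -[].
  move=> q [Iq q1 _] b nqb; exists idfun; split=> // [a qa|]; last first.
    by apply/eqP => /= b0; apply: nqb; rewrite b0; case: Iq.
  apply: contrapT => /eqP a0; apply: q1; rewrite -(mulVf a0).
  by case: Iq => _ _; apply.
exists {poly T}, (polyC \o c), (fun i => if unlift ord_max i is Some j then (X j)%:P else 'X).
split; first exact: pointful_poly.
move=> B h b; have [psi [psic psiX]] := univ B h (fun i => b (fintype.lift ord_max i)).
have cfu : commr_rmorph psi (b ord_max) by move=> x; apply: mulrC.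
exists (horner_morph cfu); split=> [k|i] /=; first by rewrite horner_morphC.
by case: unliftP => [j|] ->; rewrite ?horner_morphC ?horner_morphX.
Qed.

Theorem nullstellensatz n (J : {mpoly K[n]} -> Prop) G :
  ring_ideal J -> (forall k, ~ J (G ^+ k)) ->
  exists x : 'I_n -> K, (forall g, J g -> g.@[x] = 0) /\ G.@[x] != 0.
Proof.
move=> IJ nJ; have [q [[[q0 qD qM] q1 qP] Jq nqG]] := prime_avoiding IJ nJ.
have [T [c [X [ptT univ]]]] := pointful_universal n.
have [psi [psic psiX]] := univ _ (@mpolyC n K) (fun i => 'X_i).
pose lift := mmap c X.
have liftK g : psi (lift g) = g.
  rewrite [lift g]/mmap /mmap1 rmorph_sum /= [RHS]mpolyE; apply: eq_bigr => m _.
  rewrite rmorphM /= psic mul_mpolyC; congr (_ *: _).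
  rewrite rmorph_prod mpolyXE_id; apply: eq_bigr => i _.
  by rewrite rmorphXn /= psiX.
have Pq : ring_prime (fun t => q (psi t)).
  split; [split=> [|a b|a b]; rewrite ?rmorph0 ?rmorphD ?rmorphM //;
     [exact: qD|exact: qM]|by rewrite rmorph1|by move=> a b; rewrite rmorphM => /qP].
have [|chi [chic chiq chiG]] := ptT _ Pq (lift G); first by rewrite liftK.
have chiE g : chi (lift g) = g.@[fun i => chi (X i)].
  rewrite mevalE [lift g]/mmap /mmap1 rmorph_sum /=; apply: eq_bigr => m _.
  rewrite rmorphM chic rmorph_prod; congr (_ * _); apply: eq_bigr => i _.
  by rewrite rmorphXn.
exists (fun i => chi (X i)); split=> [g /Jq qg|]; last by rewrite -chiE.
by rewrite -chiE; apply: chiq; rewrite liftK.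
Qed.

End Nullstellensatz.

(** * Existence of valuation rings *)

Section SubringTheory.
Variable F : fieldType.
Implicit Types (A O V p I : set F).

Lemma subring0 A : is_subring A -> A 0.
Proof. by case=> A1 AB _; rewrite -(subrr 1); apply: AB. Qed.

Lemma subringN A a : is_subring A -> A a -> A (- a).
Proof. by move=> SA Aa; rewrite -sub0r; case: (SA) => _ AB _; apply: AB => //; apply: subring0. Qed.

Lemma subringD A a b : is_subring A -> A a -> A b -> A (a + b).
Proof. by move=> SA Aa Ab; rewrite -[b]opprK; case: (SA) => _ AB _; apply: AB => //; apply: subringN. Qed.

Lemma subringM A a b : is_subring A -> A a -> A b -> A (a * b).
Proof. by case=> _ _; apply. Qed.

Lemma subringX A a k : is_subring A -> A a -> A (a ^+ k).
Proof.
move=> SA Aa; elim: k => [|k IHk]; first by rewrite expr0; case: SA.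
by rewrite exprS; apply: subringM.
Qed.

Lemma subring_sum A (J : Type) (r : seq J) (P : pred J) (c : J -> F) :
  is_subring A -> (forall i, P i -> A (c i)) -> A (\sum_(i <- r | P i) c i).
Proof.
move=> SA Ac; apply: big_ind => //; first exact: subring0.
by move=> x y; apply: subringD.
Qed.

Lemma subring_prod A (J : Type) (r : seq J) (P : pred J) (c : J -> F) :
  is_subring A -> (forall i, P i -> A (c i)) -> A (\prod_(i <- r | P i) c i).
Proof.
move=> SA Ac; apply: big_ind => //; first by case: SA.
by move=> x y; apply: subringM.
Qed.

Lemma proper_ideal_sum A I (J : Type) (r : seq J) (P : pred J) (c : J -> F) :
  proper_ideal A I -> (forall i, P i -> I (c i)) -> I (\sum_(i <- r | P i) c i).
Proof. by case=> _ [I0 _] ID _ Ic; apply: big_ind. Qed.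

Lemma proper_idealN A I a : is_subring A -> proper_ideal A I -> I a -> I (- a).
Proof.
move=> SA [_ _ _ IM] Ia; rewrite -mulN1r; apply: IM => //.
by apply: subringN => //; case: SA.
Qed.

Lemma proper_idealMr A I a b : proper_ideal A I -> I a -> A b -> I (a * b).
Proof. by case=> _ _ _ IM Ia Ab; rewrite mulrC; apply: IM. Qed.

Definition adjoin (A : set F) (f : F) : set F :=
  [set x | exists2 P : {poly F}, (forall i, A P`_i) & x = P.[f]].

Lemma adjoin_subring A f : is_subring A -> is_subring (adjoin A f).
Proof.
move=> SA; split.
- exists 1; rewrite ?hornerC // => i; rewrite coef1.
  by case: (i == 0%N); [case: SA|apply: subring0].
- move=> _ _ [P AP ->] [Q AQ ->]; exists (P - Q); rewrite ?hornerD ?hornerN // => i.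
  by rewrite coefB; case: SA => _ AB _; apply: AB.
- move=> _ _ [P AP ->] [Q AQ ->]; exists (P * Q); rewrite ?hornerM // => i.
  by rewrite coefM; apply: subring_sum => // j _; apply: subringM.
Qed.

Lemma sub_adjoin A f a : is_subring A \/ (exists B, proper_ideal B A) -> A a -> adjoin A f a.
Proof.
move=> SA Aa; exists a%:P; rewrite ?hornerC // => i; rewrite coefC.
by case: (i == 0%N) => //; case: SA => [/subring0|[B [_ []]]].
Qed.

Lemma adjoin_ideal A I f : is_subring A -> proper_ideal A I -> ~ adjoin I f 1 ->
  proper_ideal (adjoin A f) (adjoin I f).
Proof.
move=> SA IA n1; have [IsA [I0 _] ID IM] := IA; split.
- by move=> _ [P IP ->]; exists P => // i; apply: IsA.
- by split=> //; exists 0; rewrite ?horner0 // => i; rewrite coef0.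
- move=> _ _ [P AP ->] [Q AQ ->]; exists (P + Q); rewrite ?hornerD // => i.
  by rewrite coefD; apply: ID.
- move=> _ _ [P AP ->] [Q AQ ->]; exists (P * Q); rewrite ?hornerM // => i.
  by rewrite coefM; apply: (proper_ideal_sum _ IA) => j _; apply: IM.
Qed.

(** The classical step of the extension theorem: of two relations that express 1
    by f and by its inverse, the longer one is shortened by the other. *)
Lemma reduce_relation B M f (P Q : {poly F}) : is_subring B -> proper_ideal B M -> f != 0 ->
  (forall i, M P`_i) -> (forall i, M Q`_i) -> P.[f] = 1 -> Q.[f^-1] = 1 ->
  (size Q <= size P)%N ->
  exists P' : {poly F}, [/\ forall i, M P'`_i, P'.[f] = 1 & (size P' < size P)%N].
Proof.
move=> SB IM f0 MP MQ P1 Q1 le; have [MB [M0 M1] MD MM] := IM.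
have Q0 : Q != 0 by apply/eqP => Q0; move: Q1; rewrite Q0 horner0 => /eqP; rewrite eq_sym oner_eq0.
have sQ : (0 < size Q)%N by rewrite size_poly_gt0.
have sP : (0 < size P)%N by apply: leq_trans le.
pose m := (size Q).-1; pose n := (size P).-1.
have mn : (m <= n)%N by rewrite -ltnS !prednK.
pose q0 := Q`_0; pose pn := P`_n.
pose P' := \poly_(i < n) ((1 - q0) * P`_i) + q0%:P + pn *: \sum_(j < m) Q`_j.+1 *: 'X^(n - j.+1).
have M1B a : M a -> M ((1 - q0) * a).
  by move=> Ma; apply: MM => //; case: (SB) => B1 BB _; apply: BB => //; apply/MB/MQ.
exists P'; split.
- move=> i; rewrite !coefD coefZ coef_poly coefC coef_sum; apply: (MD); first apply: (MD).
  + by case: (i < n)%N => //; exact/M1B/MP.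
  + by case: (i == 0%N) => //; exact: MQ.
  apply: MM; first exact/MB/MP.
  apply: (proper_ideal_sum _ IM) => j _; rewrite coefZ coefXn.
  by apply: (proper_idealMr IM) => //; case: (_ == _); [case: SB|apply: subring0].
- have eP : \sum_(i < n) P`_i * f ^+ i + pn * f ^+ n = 1.
    by rewrite -P1 horner_coef -[in RHS](prednK sP) big_ord_recr.
  have eQ : q0 + \sum_(j < m) Q`_j.+1 * f^-1 ^+ j.+1 = 1.
    by rewrite -Q1 horner_coef -[in RHS](prednK sQ) big_ord_recl expr0 mulr1.
  have eQ' : \sum_(j < m) Q`_j.+1 * f ^+ (n - j.+1) = (1 - q0) * f ^+ n.
    rewrite (_ : 1 - q0 = \sum_(j < m) Q`_j.+1 * f^-1 ^+ j.+1); last by rewrite -eQ addrAC subrr add0r.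
    rewrite mulr_suml; apply: eq_bigr => j _; rewrite -mulrA; congr (_ * _).
    have lejn : (j.+1 <= n)%N by apply: leq_trans mn.
    by rewrite -[in RHS](subnK lejn) exprD mulrCA -exprMn mulVf // expr1n mulr1.
  rewrite !hornerD hornerZ hornerC horner_poly horner_sum.
  rewrite (eq_bigr (fun i : 'I_n => (1 - q0) * (P`_i * f ^+ i))); last by move=> i _; rewrite mulrA.
  rewrite -mulr_sumr (canRL (addrK _) eP).
  rewrite (eq_bigr (fun j : 'I_m => Q`_j.+1 * f ^+ (n - j.+1))); last first.
    by move=> j _; rewrite hornerZ hornerXn.
  by rewrite eQ'; ring.
have nP : n.+1 = size P by rewrite prednK.
rewrite -[X in (_ < X)%N]nP ltnS.
have n0 : (0 < n)%N.
  rewrite lt0n; apply/eqP => n0; apply: M1; rewrite -P1 horner_coef -nP n0 big_ord1 expr0 mulr1 //.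
apply: leq_trans (size_polyD _ _) _; rewrite geq_max; apply/andP; split.
  apply: leq_trans (size_polyD _ _) _; rewrite geq_max size_poly /=.
  by apply: leq_trans (size_polyC_leq1 _) _.
apply: leq_trans (size_scale_leq _ _) _; apply: leq_trans (size_sum _ _ _) _.
apply/bigmax_leqP => j _; apply: leq_trans (size_scale_leq _ _) _.
by rewrite size_polyXn -subSn ?subSS ?leq_subr //; apply: leq_trans mn.
Qed.

End SubringTheory.

Section Chevalley.
Variables (K F : fieldType) (iota : {rmorphism K -> F}).

(** Existence of a valuation ring through a given proper ideal: a pair maximal
    for domination is a valuation ring, because adjoining either f or its
    inverse keeps the ideal proper. *)
Lemma chevalley (A I : set F) :
  is_subring A -> (forall c, A (iota c)) -> proper_ideal A I ->
  exists V, [/\ valuation_ring iota V, (A `<=` V)%classic &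
    forall a, I a -> a != 0 -> ~ V a^-1].
Proof.
move=> SA KA IA.
pose ok (q : set F * set F) := [/\ is_subring q.1, proper_ideal q.1 q.2, (A `<=` q.1)%classic & (I `<=` q.2)%classic].
pose T := {q | ok q}.
have ok0 : ok (A, I) by split.
pose R (q r : T) := `[< ((sval q).1 `<=` (sval r).1)%classic /\ ((sval q).2 `<=` (sval r).2)%classic >].
have [| | |[[B M] okB] Bmax] := @ZL_preorder T (exist _ _ ok0) R.
- by move=> q; apply/asboolP; split.
- move=> q r s /asboolP[a b] /asboolP[c d]; apply/asboolP; split=> x; [by move=> /a/c|by move=> /b/d].
- move=> Ch tot; have [[q0 Cq0]|nC] := EM (exists q, Ch q); last first.
    by exists (exist _ _ ok0) => q Cq; exfalso; apply: nC; exists q.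
  pose U1 : set F := [set x | exists2 q, Ch q & (sval q).1 x].
  pose U2 : set F := [set x | exists2 q, Ch q & (sval q).2 x].
  have two x y (g h : set F * set F -> set F) :
      (g = fst \/ g = snd) -> (h = fst \/ h = snd) ->
      (exists2 q, Ch q & g (sval q) x) -> (exists2 q, Ch q & h (sval q) y) ->
      exists q, [/\ Ch q, g (sval q) x & h (sval q) y].
    move=> gE hE [q Cq qx] [r Cr ry]; case: (tot q r Cq Cr) => /asboolP[s1 s2].
      by exists r; split=> //; case: gE qx => -> qx; [apply: s1|apply: s2].
    by exists q; split=> //; case: hE ry => -> ry; [apply: s1|apply: s2].
  have okU : ok (U1, U2).
    split=> /=.
    - split; first by exists q0 => //; case: (svalP q0) => -[].
        move=> x y x1 y1; have [||q [Cq qx qy]] := two x y fst fst _ _ x1 y1; try by left.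
        by exists q => //; case: (svalP q) => -[_ + _] _ _ _; apply.
      move=> x y x1 y1; have [||q [Cq qx qy]] := two x y fst fst _ _ x1 y1; try by left.
      by exists q => //; case: (svalP q) => -[_ _ +] _ _ _; apply.
    - split.
      + by move=> x [q Cq qx]; exists q => //; case: (svalP q) => _ [+ _ _ _] _ _; apply.
      + split; first by exists q0 => //; case: (svalP q0) => _ [_ []].
        by case=> q Cq; case: (svalP q) => _ [_ []].
      + move=> x y x1 y1; have [||q [Cq qx qy]] := two x y snd snd _ _ x1 y1; try by right.
        by exists q => //; case: (svalP q) => _ [_ _ + _] _ _; apply.
      + move=> x y x1 y1; have [||q [Cq qx qy]] := two x y fst snd _ _ x1 y1; [by left|by right|].
        by exists q => //; case: (svalP q) => _ [_ _ _ +] _ _; apply.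
    - by move=> x Ax; exists q0 => //; case: (svalP q0) => _ _ + _; apply.
    - by move=> x Ax; exists q0 => //; case: (svalP q0) => _ _ _; apply.
  by exists (exist _ _ okU) => q Cq; apply/asboolP; split=> x qx; exists q.
case: (okB) => /= SB MB AB IM.
have grow f : ~ B f -> exists2 P : {poly F}, (forall i, M P`_i) & P.[f] = 1.
  move=> nBf; apply: contrapT => n1; apply: nBf.
  have n1' : ~ adjoin M f 1 by case=> P MP P1; apply: n1; exists P.
  have okf : ok (adjoin B f, adjoin M f).
    split=> /=; [exact: adjoin_subring|exact: adjoin_ideal| |].
      by move=> x /AB Bx; apply: sub_adjoin => //; left.
    by move=> x /IM Mx; apply: sub_adjoin => //; right; exists B.
  have /asboolP[/= + _] : R (exist _ _ okf) (exist _ _ okB).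
    apply: Bmax; apply/asboolP; split=> /= x ?; apply: sub_adjoin => //; [by left|by right; exists B].
  apply; exists 'X; rewrite ?hornerX // => i; rewrite coefX.
  by case: (i == 1%N); [case: SB|apply: subring0].
exists B; split=> //; last first.
  move=> a Ia a0 Bi; case: MB => _ [_ M1] _ MM; apply: M1.
  by rewrite -(mulVf a0); apply: MM => //; apply: IM.
split=> // [c|f]; first exact: AB.
apply: contrapT => /not_orP[nf nfi].
have f0 : f != 0 by apply/eqP => f0; apply: nf; rewrite f0; apply: subring0.
have minrel g : ~ B g -> exists P : {poly F}, ((forall i, M P`_i) /\ P.[g] = 1) /\
    forall Q : {poly F}, ((forall i, M Q`_i) /\ Q.[g] = 1) -> (size P <= size Q)%N.
  move=> /grow[P MP P1].
  by apply: (@ex_min_nat _ (fun P : {poly F} => (forall i, M P`_i) /\ P.[g] = 1)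
    (fun P : {poly F} => size P)); exists P.
have [P [[MP P1] Pmin]] := minrel _ nf.
have [Q [[MQ Q1] Qmin]] := minrel _ nfi.
have [le|/ltnW le] := leqP (size Q) (size P).
  have [P' [MP' P1' lt]] := reduce_relation SB MB f0 MP MQ P1 Q1 le.
  by have := Pmin P' (conj MP' P1'); rewrite leqNgt lt.
have [||P' [MP' P1' lt]] := reduce_relation SB MB _ MQ MP Q1 _ le; rewrite ?invrK ?invr_eq0 //.
by have := Qmin P' (conj MP' P1'); rewrite leqNgt lt.
Qed.

End Chevalley.

(** * Local rings and discrete valuation rings *)

Section LocalRings.
Variables (K F : fieldType) (iota : {rmorphism K -> F}).
Implicit Types (A O V p : set F).

Definition nonunits O : set F := [set a | O a /\ ~ is_unit O a].

Lemma is_unit1 O : is_subring O -> is_unit O 1.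
Proof. by case=> O1 _ _; split; rewrite ?invr1 ?oner_eq0. Qed.

Lemma prime_ideal0 A p : prime_ideal A p -> p 0. Proof. by case=> -[_ []]. Qed.

Lemma prime_idealN1 A p : prime_ideal A p -> ~ p 1. Proof. by case=> -[_ []]. Qed.

Lemma prime_idealS A p : prime_ideal A p -> p `<=` A. Proof. by case=> -[]. Qed.

Lemma localization_sub A p : is_subring A -> prime_ideal A p -> A `<=` localization A p.
Proof.
move=> SA Pp a Aa; exists a, 1; split=> //; [by case: SA|exact: prime_idealN1 Pp|by rewrite divr1].
Qed.

Lemma localization_subring A p : is_subring A -> prime_ideal A p ->
  is_subring (localization A p).
Proof.
move=> SA Pp; have [A1 AB AM] := SA; have [[pA [p0 p1] _ _] pM] := Pp.
split; first exact: localization_sub.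
- move=> _ _ [a [s [Aa As ps ->]]] [b [t [Ab At pt ->]]].
  exists (a * t - b * s), (s * t); split; try (by apply: (AM)); try by apply: (AB); apply: (AM).
    by case/pM.
  have s0 : s != 0 by apply/eqP => s0; apply: ps; rewrite s0.
  have t0 : t != 0 by apply/eqP => t0; apply: pt; rewrite t0.
  by field; rewrite s0 t0.
- move=> _ _ [a [s [Aa As ps ->]]] [b [t [Ab At pt ->]]].
  by exists (a * b), (s * t); split; try (by apply: (AM)); [case/pM|rewrite mulf_div].
Qed.

Lemma localization_nonunitP A p a : is_subring A -> prime_ideal A p ->
  nonunits (localization A p) a <-> exists x s, [/\ p x, A s, ~ p s & a = x / s].
Proof.
move=> SA Pp; have [A1 AB AM] := SA; have [[pA [p0 p1] pD pMl] pM] := Pp.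
split.
  case=> -[x [s [Ax As ps ->]]] nu; exists x, s; split=> //.
  apply: contrapT => px; apply: nu.
  have s0 : s != 0 by apply/eqP => s0; apply: ps; rewrite s0.
  have x0 : x != 0 by apply/eqP => x0; apply: px; rewrite x0.
  split; first by rewrite mulf_neq0 ?invr_eq0.
    by exists x, s.
  by exists s, x; rewrite invf_div.
case=> x [s [px As ps ->]]; split; first by exists x, s; split=> //; apply: pA.
case=> n0 _ [y [t [Ay At pt e]]].
have s0 : s != 0 by apply/eqP => s0; apply: ps; rewrite s0.
have t0 : t != 0 by apply/eqP => t0; apply: pt; rewrite t0.
have : p (s * t); last by case/pM.
have -> : s * t = y * x.
  move: e; rewrite invf_div => /eqP; rewrite eqr_div //; first by move/eqP.
  by move: n0; rewrite mulf_eq0 negb_or => /andP[].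
exact: pMl.
Qed.

Lemma localization_local A p : is_subring A -> prime_ideal A p ->
  proper_ideal (localization A p) (nonunits (localization A p)).
Proof.
move=> SA Pp; have [A1 AB AM] := SA; have [[pA [p0 p1] pD pMl] pM] := Pp.
have SO := localization_subring SA Pp.
split; first by move=> a [].
- split; first by split; [exact: subring0|case; rewrite eqxx].
  by case=> _; apply; apply: is_unit1.
- move=> a b /(localization_nonunitP _ SA Pp)[x [s [px As ps ->]]].
  move=> /(localization_nonunitP _ SA Pp)[y [t [py At pt ->]]].
  apply/(localization_nonunitP _ SA Pp); exists (t * x + s * y), (s * t).
  have s0 : s != 0 by apply/eqP => s0; apply: ps; rewrite s0.
  have t0 : t != 0 by apply/eqP => t0; apply: pt; rewrite t0.
  split; [by apply: (pD); apply: (pMl)|exact: AM|by case/pM|by field; rewrite s0 t0].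
- move=> _ b [z [t [Az At pt ->]]] /(localization_nonunitP _ SA Pp)[x [s [px As ps ->]]].
  apply/(localization_nonunitP _ SA Pp); exists (z * x), (t * s).
  by split; [exact: pMl|exact: AM|case/pM|rewrite mulf_div].
Qed.

Definition center A V : set F := [set a | A a /\ ~ is_unit V a].

Lemma center_prime A V : valuation_ring iota V -> is_subring A -> A `<=` V ->
  prime_ideal A (center A V).
Proof.
move=> [SV KV totV] SA AV; have [A1 AB AM] := SA.
split; [split|].
- by move=> a [].
- split; first by split; [exact: subring0|case; rewrite eqxx].
  by case=> _; apply; apply: is_unit1.
- move=> a b [Aa na] [Ab nb]; split; first exact: subringD.
  have [->|a0] := eqVneq a 0; first by rewrite add0r.
  have [->|b0] := eqVneq b 0; first by rewrite addr0.
  have aux x y : x != 0 -> y != 0 -> V x -> V y -> ~ is_unit V y -> V (x / y) -> ~ is_unit V (x + y).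
    move=> x0 y0 Vx Vy ny Vxy [u0 _ Vu]; apply: ny; split=> //.
    have -> : y^-1 = (x / y + 1) * (x + y)^-1 by field; rewrite y0 u0.
    by apply: subringM => //; apply: subringD => //; case: SV.
  have [Vab|] := totV (a / b); first by apply: aux => //; apply: AV.
  by rewrite invf_div => Vba; rewrite addrC; apply: aux => //; apply: AV.
- move=> a b Aa [Ab nb]; split; first exact: AM.
  case=> ab0 _ Vi; apply: nb; split; first by move: ab0; rewrite mulf_eq0 negb_or => /andP[].
    exact: AV.
  have -> : b^-1 = a * (a * b)^-1.
    by field; move: ab0; rewrite mulf_eq0 negb_or andbC.
  by apply: subringM => //; apply: AV.
- move=> a b Aa Ab [_ nab]; apply: contrapT => /not_orP[ca cb]; apply: nab.
  apply: is_unitM => //; apply: contrapT => nu; [exact: ca|exact: cb].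
Qed.

Lemma dominates_center A V : valuation_ring iota V -> is_subring A -> A `<=` V ->
  dominates V (localization A (center A V)).
Proof.
move=> VV SA AV; have [SV KV totV] := VV; have Pp := center_prime VV SA AV.
have unit s : A s -> ~ center A V s -> is_unit V s.
  by move=> As ns; apply: contrapT => nu; apply: ns.
have sub : localization A (center A V) `<=` V.
  move=> _ [a [s [Aa As ps ->]]]; apply: subringM => //; first exact: AV.
  by case: (unit s As ps).
split=> // a Oa Va; apply: contrapT => nOa.
have : nonunits (localization A (center A V)) a by split=> // -[].
move=> /(localization_nonunitP _ SA Pp)[x [s [[Ax nx] As ps aE]]]; apply: nx.
have [s0 _ _] := unit s As ps.
have [x0|x0] := eqVneq x 0.
  exfalso; apply: nOa; rewrite aE x0 mul0r invr0.
  exact: subring0 (localization_subring SA Pp).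
split=> //; first exact: AV.
have -> : x^-1 = a^-1 * s^-1 by rewrite aE invf_div; field; rewrite s0 x0.
by apply: subringM => //; case: (unit s As ps).
Qed.

Lemma dominating_valuation O : is_subring O -> (forall c, O (iota c)) ->
  proper_ideal O (nonunits O) -> exists2 V, valuation_ring iota V & dominates V O.
Proof.
move=> SO KO IO; have [V [VV OV nV]] := chevalley SO KO IO.
exists V => //; split=> // a Oa Va; have [->|a0] := eqVneq a 0.
  by rewrite invr0; apply: subring0.
apply: contrapT => nOa; apply: nV Va => //; split=> // -[] //.
Qed.

End LocalRings.

Section DVR.
Variables (F : fieldType) (O : set F).
Hypothesis dvrO : is_dvr O.

Let SO : is_subring O. Proof. by case: dvrO. Qed.

Lemma dvr_uniformizer : exists t, [/\ t != 0, O t, ~ O t^-1, ord O t = 1 &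
  forall f, f != 0 -> is_unit O (f / t ^ ord O f)].
Proof.
case: (dvrO) => _ [t0 Ut0].
have: uniformizer O (xget 0 (uniformizer O)) by exact: (xgetI _ Ut0).
set t := xget _ _ => -[tn0 Ot Ot' gen]; exists t; split=> //.
  by apply: (@ord_uniq _ _ _ 1) => //; [apply: is_unit1|rewrite mul1r expr1z].
move=> f f0; have [u Uu [n fE]] := gen _ f0.
by rewrite (ord_uniq dvrO Uu fE) {1}fE mulfK // expfz_neq0.
Qed.

Lemma ord_unit f : f != 0 -> (ord O f = 0 <-> is_unit O f).
Proof.
move=> f0; have [t [t0 Ot Ot' t1 gen]] := dvr_uniformizer.
split=> [f00|Uf]; first by have := gen _ f0; rewrite f00 expr0z divr1.
apply: (ord_uniq dvrO Uf); by rewrite expr0z mulr1.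
Qed.

Lemma ordV f : f != 0 -> ord O f^-1 = - ord O f.
Proof. by move=> f0; rewrite -div1r ordB ?oner_eq0 // ord1 // sub0r. Qed.

Lemma ordM f g : f != 0 -> g != 0 -> ord O (f * g) = ord O f + ord O g.
Proof. by move=> f0 g0; rewrite -{1}[g]invrK ordB ?invr_eq0 // ordV // opprK. Qed.

Lemma ordX f k : f != 0 -> ord O (f ^+ k) = ord O f *+ k.
Proof.
move=> f0; elim: k => [|k IHk]; first by rewrite expr0 mulr0n ord1.
by rewrite exprS ordM ?expf_neq0 // IHk mulrS.
Qed.

Lemma ordXz f (k : int) : f != 0 -> ord O (f ^ k) = ord O f * k.
Proof.
move=> f0; case: k => k; first by rewrite -exprnP ordX // -mulr_natr natz.
by rewrite NegzE -exprz_inv -exprnP ordX ?invr_eq0 // ordV // mulNrn mulrN -mulr_natr natz.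
Qed.

Lemma ord_prod (I : finType) (f : I -> F) : (forall i, f i != 0) ->
  ord O (\prod_i f i) = \sum_i ord O (f i).
Proof.
move=> f0; elim: (index_enum I) => [|i r IHr]; first by rewrite !big_nil ord1.
by rewrite !big_cons ordM ?IHr // prodf_seq_neq0; apply/allP => j _; apply: f0.
Qed.

Lemma ord_ge0 f : f != 0 -> (0 <= ord O f) <-> O f.
Proof.
move=> f0; have [t [t0 Ot Ot' t1 gen]] := dvr_uniformizer.
have Uf := gen _ f0; split=> [|Of].
  case: (ord O f) Uf => [n|//] [u0 Ou _] _.
  rewrite -[f](divfK (expfz_neq0 n t0)); apply: subringM => //; exact: subringX.
rewrite leNgt; apply/negP; case e : (ord O f) Uf => [//|n] [u0 Ou Ou'] _; apply: Ot'.
have -> : t^-1 = f * (f / t ^ Negz n)^-1 * t ^+ n.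
  rewrite (_ : t ^ Negz n = (t ^+ n.+1)^-1) // exprS.
  by field; rewrite expf_neq0 // t0 f0 oner_eq0.
by apply: subringM => //; [exact: subringM|exact: subringX].
Qed.

Lemma ord_gt0 f : f != 0 -> (0 < ord O f) <-> nonunits O f.
Proof.
move=> f0; split=> [lt|[Of nu]].
  split; first by apply/ord_ge0 => //; apply: ltW.
  by move/ord_unit => e; rewrite e // ltxx in lt.
rewrite lt_neqAle; apply/andP; split; last exact/ord_ge0.
by apply/eqP => /esym/(ord_unit f0).
Qed.

Lemma dvr_nonunits : prime_ideal O (nonunits O).
Proof.
have [t [t0 Ot Ot' t1 gen]] := dvr_uniformizer.
have nP a : nonunits O a <-> O (a / t).
  have [->|a0] := eqVneq a 0.
    rewrite mul0r; split=> _; first exact: subring0.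
    by split; [exact: subring0|case; rewrite eqxx].
  rewrite -ord_gt0 // -ord_ge0 ?mulf_neq0 ?invr_eq0 // ordB // t1; lia.
split; first split.
- by move=> a [].
- by split; [apply/nP; rewrite mul0r; apply: subring0|case=> _; apply; apply: is_unit1].
- by move=> a b /nP na /nP nb; apply/nP; rewrite mulrDl; apply: subringD.
- by move=> a b Oa /nP nb; apply/nP; rewrite -mulrA; apply: subringM.
move=> a b Oa Ob [_ nu]; apply: contrapT => /not_orP[na nb]; apply: nu.
apply: is_unitM => //; apply: contrapT => nu; [exact: na|exact: nb].
Qed.

(** A ring that contains O and the inverse of a uniformizer contains all
    fractions. *)
Lemma dvr_maximal B : is_subring B -> O `<=` B -> (exists x, ~ B x) -> B = O.
Proof.
move=> SB OB [x nx]; apply/seteqP; split=> // f Bf; apply: contrapT => nOf; apply: nx.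
have [t [t0 Ot Ot' t1 gen]] := dvr_uniformizer.
have f0 : f != 0 by apply/eqP => f0; apply: nOf; rewrite f0; apply: subring0.
have x0 : x != 0 \/ x = 0 by case: eqP => ?; [right|left].
case: x0 => [x0|->]; last exact: subring0.
have lt : ord O f < 0 by rewrite ltNge; apply/negP => /(ord_ge0 f0).
pose k := absz (ord O x).
have -> : x = f ^+ k * (x / f ^+ k) by rewrite mulrC divfK // expf_neq0.
apply: subringM => //; first exact: subringX.
apply: OB; apply/ord_ge0; rewrite ?mulf_neq0 ?invr_eq0 ?expf_neq0 //.
rewrite ordB ?expf_neq0 // ordX // subr_ge0 -mulr_natr natz /k; nia.
Qed.

End DVR.

Section ChartGeometry.
Variables (K F : fieldType) (iota : {rmorphism K -> F}) (X : normal_variety iota).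

Lemma affine_subring (A : set F) : affine_algebra iota A -> is_subring A.
Proof.
move=> [[n [a ->]] _]; split.
- by exists 1 => //; rewrite rmorph1.
- by move=> _ _ [p _ <-] [q _ <-]; exists (p - q) => //; rewrite rmorphB.
- by move=> _ _ [p _ <-] [q _ <-]; exists (p * q) => //; rewrite rmorphM.
Qed.

Lemma affine_scalars (A : set F) c : affine_algebra iota A -> A (iota c).
Proof. by move=> [[n [a ->]] _]; exists c%:MP => //; rewrite mmapC. Qed.

Lemma chart_subring i : is_subring (chart (n:=X) i).
Proof. exact/affine_subring/chart_affine. Qed.

Lemma chart_scalars i c : chart (n:=X) i (iota c).
Proof. by apply: affine_scalars; apply: chart_affine. Qed.

Lemma points_subring O : points X O -> is_subring O.
Proof. by case=> i [p Pp ->]; apply: localization_subring => //; apply: chart_subring. Qed.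

Lemma points_scalars O c : points X O -> O (iota c).
Proof.
case=> i [p Pp ->]; apply: localization_sub => //; [exact: chart_subring|exact: chart_scalars].
Qed.

Lemma points_local O : points X O -> proper_ideal O (nonunits O).
Proof. by case=> i [p Pp ->]; apply: localization_local => //; apply: chart_subring. Qed.

Lemma points_unique V O O' : valuation_ring iota V -> points X O -> points X O' ->
  dominates V O -> dominates V O' -> O = O'.
Proof. by move=> VV [i sO] [j sO']; apply: separated VV _ _ _ _ sO sO'. Qed.

(** A point whose local ring contains the coordinates of an affine chart lies in
    that chart: it and its center there are dominated by one valuation ring. *)
Lemma point_in_chart i O : points X O -> chart (n:=X) i `<=` O -> spec (chart (n:=X) i) O.
Proof.
move=> pO AO; have SO := points_subring pO.
have [V VV dV] := dominating_valuation SO (fun c => points_scalars c pO) (points_local pO).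
have AV : chart i `<=` V by move=> a /AO; apply: (dV.1).
have dc := dominates_center VV (chart_subring i) AV.
have sc : spec (chart i) (localization (chart i) (center (chart i) V)).
  by exists (center (chart i) V) => //; apply: (center_prime VV) => //; apply: chart_subring.
by rewrite (points_unique VV pO _ dV dc) //; exists i.
Qed.

End ChartGeometry.

(** * Affine algebras and regularity in codimension one *)

Section AffineAlgebra.
Variables (K F : fieldType) (iota : {rmorphism K -> F}) (A : set F).
Hypothesis affA : affine_algebra iota A.
Implicit Types (J p q : set F).

Let SA : is_subring A. Proof. exact: affine_subring affA. Qed.

Definition sub_ideal J :=
  [/\ J `<=` A, J 0, forall a b, J a -> J b -> J (a + b) & forall a b, A a -> J b -> J (a * b)].

Lemma affine_max_ideal (Fam : set F -> Prop) J0 :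
  (forall J, Fam J -> sub_ideal J) -> Fam J0 ->
  exists J, [/\ Fam J, J0 `<=` J & forall J', Fam J' -> J `<=` J' -> J' `<=` J].
Proof.
move=> Famid FJ0; case: (affA) => -[n [x AE]] _; pose e := mmap iota x.
have e0 : e 0 = 0 by apply: rmorph0.
have eD g h : e (g + h) = e g + e h by apply: rmorphD.
have eM g h : e (g * h) = e g * e h by apply: rmorphM.
have Ae g : A (e g) by rewrite AE; exists g.
pose Fam' (Q : {mpoly K[n]} -> Prop) := exists2 J, Fam J & Q = (fun g => J (e g)).
have [||Q [[J FJ QE] J0Q Qmax]] := @mpoly_max_ideal K n Fam' (fun g => J0 (e g)).
- move=> _ [J /Famid[JA J0' JD JM] ->]; split; rewrite ?e0 //.
    by move=> a b Ja Jb; rewrite eD; apply: JD.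
  by move=> a b Jb; rewrite eM; apply: JM.
- by exists J0.
exists J; split=> //.
  move=> a J0a; have [JA _ _ _] := Famid _ FJ0.
  by have := JA _ J0a; rewrite AE => -[g _ ga]; have := J0Q g; rewrite QE -ga; apply; rewrite /e ga.
move=> J' FJ' JJ' a J'a; have [JA _ _ _] := Famid _ FJ'.
have := JA _ J'a; rewrite AE => -[g _ ga].
have := Qmax (fun g => J' (e g)); rewrite QE /= => H.
by rewrite -ga; apply: H; [exists J'|move=> h; apply: JJ'|rewrite /e ga].
Qed.

Lemma affine_finite_gen J : sub_ideal J -> exists m (c : 'I_m -> F),
  (forall i, J (c i)) /\
  forall z, J z -> exists2 a : 'I_m -> F, (forall i, A (a i)) & z = \sum_i a i * c i.
Proof.
case=> JA J0 JD JM; case: (affA) => -[n [x AE]] _; pose e := mmap iota x.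
have e0 : e 0 = 0 by apply: rmorph0.
have eD g h : e (g + h) = e g + e h by apply: rmorphD.
have eM g h : e (g * h) = e g * e h by apply: rmorphM.
have Ae g : A (e g) by rewrite AE; exists g.
have [|s [sJ sgen]] := @mpoly_noetherian K n (fun g => J (e g)).
  split; rewrite ?e0 //; first by move=> a b Ja Jb; rewrite eD; apply: JD.
  by move=> a b Jb; rewrite eM; apply: JM.
exists (size s), (fun i => e s`_i); split=> [i|z Jz]; first by apply: sJ; rewrite mem_nth.
have : range (mmap iota x) z by rewrite -AE; apply: JA.
move=> [g _ gz]; rewrite -gz in Jz *.
pose JJ g := exists2 a : 'I_(size s) -> F, (forall i, A (a i)) & e g = \sum_i a i * e s`_i.
suff: JJ g by []; apply: (sgen g Jz).
  split.
  - exists (fun=> 0) => [i|]; first exact: subring0.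
    by rewrite e0 big1 // => i _; rewrite mul0r.
  - move=> g1 g2 [a Aa ga] [b Ab gb]; exists (fun i => a i + b i) => [i|]; first exact: subringD.
    by rewrite eD ga gb -big_split; apply: eq_bigr => i _; rewrite mulrDl.
  - move=> g1 g2 [a Aa ga]; exists (fun i => e g1 * a i) => [i|]; first exact: subringM.
    by rewrite eM ga mulr_sumr; apply: eq_bigr => i _; rewrite mulrA.
move=> y ys; have lt : (index y s < size s)%N by rewrite index_mem.
exists (fun i => if i == Ordinal lt then 1 else 0) => [i|].
  by case: ifP => _; [case: SA|apply: subring0].
rewrite (bigD1 (Ordinal lt)) //= eqxx mul1r nth_index // big1 ?addr0 //.
by move=> i /negPf ->; rewrite mul0r.
Qed.

Lemma finitely_many_minimal_primes J : sub_ideal J ->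
  exists m (q : nat -> set F), forall p, prime_ideal A p -> J `<=` p ->
    exists i, [/\ (i < m)%N, prime_ideal A (q i), J `<=` q i & q i `<=` p].
Proof.
pose good J := exists m (q : nat -> set F), forall p, prime_ideal A p -> J `<=` p ->
    exists i, [/\ (i < m)%N, prime_ideal A (q i), J `<=` q i & q i `<=` p].
move=> IJ; apply: contrapT => nJ.
have [|J' [[IJ' nJ'] _ Jmax]] := @affine_max_ideal (fun J => sub_ideal J /\ ~ good J) J _ (conj IJ nJ).
  by move=> ? [].
have [JA J0 JD JM] := IJ'; have [A1 AB AM] := SA.
have nJ1 : ~ J' 1.
  move=> J1; apply: nJ'; exists 0%N, (fun=> J') => p Pp Jp.
  by case: (prime_idealN1 Pp); apply: Jp.
have [Pj|nPj] := EM (prime_ideal A J').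
  by apply: nJ'; exists 1%N, (fun=> J') => p Pp Jp; exists 0%N; split.
have [a [b [Aa Ab Jab nJa nJb]]] : exists a b, [/\ A a, A b, J' (a * b), ~ J' a & ~ J' b].
  apply: contrapT => H; apply: nPj; split; first by split.
  by move=> a b Aa Ab Jab; apply: contrapT => /not_orP[na nb]; apply: H; exists a, b.
pose ext c : set F := [set x | exists2 y, A y & J' (x - y * c)].
have Jext c : J' `<=` ext c by move=> x Jx; exists 0; rewrite ?mul0r ?subr0 //; apply: subring0.
have Iext c : A c -> sub_ideal (ext c).
  move=> Ac; split.
  - by move=> x [y Ay Jx]; rewrite -(subrK (y * c) x); apply: subringD => //; [exact: JA|exact: AM].
  - exact: Jext.
  - move=> x x' [y Ay Jx] [y' Ay' Jx']; exists (y + y'); first exact: subringD.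
    by rewrite mulrDl opprD addrACA; apply: JD.
  - move=> z x Az [y Ay Jx]; exists (z * y); first exact: AM.
    by rewrite -mulrA -mulrBr; apply: JM.
have extc c : A c -> ext c c by move=> Ac; exists 1; rewrite ?mul1r ?subrr.
have goodext c : A c -> ~ J' c -> good (ext c).
  move=> Ac nc; apply: contrapT => ng; apply: nc.
  by apply: (Jmax (ext c)); [split=> //; exact: Iext|exact: Jext|exact: extc].
have [m [q qP]] := goodext a Aa nJa; have [m' [q' qP']] := goodext b Ab nJb.
apply: nJ'; exists (m + m')%N, (fun i => if (i < m)%N then q i else q' (i - m)%N) => p Pp Jp.
have lift c : p c -> ext c `<=` p.
  case: (Pp) => -[pA p0 pD pM] _ pc x [y Ay Jx].
  by rewrite -(subrK (y * c) x); apply: pD; [exact: Jp|exact: pM].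
case: (Pp) => _ /(_ a b Aa Ab (Jp _ Jab)) [pa|pb].
  have [i [im Pq Jq qp]] := qP p Pp (lift _ pa).
  by exists i; rewrite im; split=> //; [rewrite ltn_addr|apply: subset_trans Jq; apply: Jext].
have [i [im Pq Jq qp]] := qP' p Pp (lift _ pb).
have e : (m + i < m)%N = false by rewrite ltnNge leq_addr.
exists (m + i)%N; rewrite e addKn; split=> //; first by rewrite ltn_add2l.
by apply: subset_trans Jq; apply: Jext.
Qed.

Hypothesis normA : integrally_closed A.

(** Determinant trick: an element that multiplies a nonzero finitely generated
    ideal into itself is integral. *)
Lemma integral_multiplier q e : sub_ideal q -> (exists2 z, q z & z != 0) ->
  (forall z, q z -> q (e * z)) -> A e.
Proof.
move=> Iq [z0 qz0 z00] eq; have [m [c [qc gen]]] := affine_finite_gen Iq.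
have /choice[M MP] : forall i, exists a : 'I_m -> F, (forall j, A (a j)) /\ e * c i = \sum_j a j * c j.
  by move=> i; have [a Aa ea] := gen _ (eq _ (qc i)); exists a.
pose N := \matrix_(j < m, i < m) M i j.
have coefs_prod (I : finType) (P : I -> {poly F}) : (forall i k, A (P i)`_k) -> forall k, A (\prod_i P i)`_k.
  move=> AP; apply: (big_ind (fun Q : {poly F} => forall k, A Q`_k)) => //.
    by move=> k; rewrite coef1; case: (k == _); [case: SA|apply: subring0].
  by move=> Q R AQ AR k; rewrite coefM; apply: subring_sum => // j _; apply: subringM.
apply: (normA (char_poly_monic N)) => [k|].
  rewrite /char_poly /determinant coef_sum; apply: subring_sum => // s _.
  rewrite -(rmorph_sign (@polyC F)) mulrC coefMC; apply: subringM => //; last first.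
    by apply: subringX => //; apply: subringN => //; case: SA.
  apply: coefs_prod => i j; rewrite !mxE coefB coefMn coefX coefC.
  have A1 : A 1 by case: SA.
  have A0 : A 0 by apply: subring0.
  case: SA => _ AB _; apply: AB; last by case: ifP => // _; apply: (MP _).1.
  by case: (_ == 1%N); case: (_ == _).
rewrite -eigenvalue_root_char; apply/eigenvalueP; exists (\row_i c i).
  apply/rowP => i; rewrite !mxE; have [_ ->] := MP i.
  by apply: eq_bigr => j _; rewrite !mxE mulrC.
apply/eqP => c0; move: z00; have [a Aa ->] := gen _ qz0.
rewrite big1 ?eqxx // => i _; have /rowP/(_ i) := c0; rewrite !mxE => ->.
by rewrite mulr0.
Qed.

(** Krull: at a point of a normal affine variety, a function without polar
    divisor through the point is regular there.  A maximal denominator ideal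
    inside the prime of the point defines such a divisor. *)
Lemma hartogs p x : prime_ideal A p -> ~ localization A p x ->
  exists q, [/\ prime_ideal A q, q `<=` p, is_dvr (localization A q) & ~ localization A q x].
Proof.
move=> Pp nOx; have [A1 AB AM] := SA; have A0 := subring0 SA.
pose den e : set F := [set z | A z /\ A (z * e)].
have Iden e : sub_ideal (den e).
  split; first by move=> z [].
  - by split=> //; rewrite mul0r.
  - by move=> a b [Aa Aae] [Ab Abe]; split; [exact: subringD|rewrite mulrDl; exact: subringD].
  - by move=> a b Aa [Ab Abe]; split; [exact: AM|rewrite -mulrA; exact: AM].
have den_in y e z : A y -> den e z -> den (y * e) z.
  by move=> Ay [Az Aze]; split=> //; rewrite mulrCA; apply: AM.
pose Fam J := exists y, [/\ A y, J = den (y * x) & J `<=` p].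
have FJ0 : Fam (den x).
  exists 1; rewrite mul1r; split=> // z [Az Azx]; apply: contrapT => npz; apply: nOx.
  have z0 : z != 0 by apply/eqP => z0; apply: npz; rewrite z0; apply: prime_ideal0 Pp.
  by exists (z * x), z; split=> //; rewrite mulrAC mulfV // mul1r.
have [|q [[y [Ay qE qp]] _ qmax]] := affine_max_ideal _ FJ0.
  by move=> J [y [_ -> _]]; apply: Iden.
pose e := y * x; have {}qE : q = den e by [].
have Pq : prime_ideal A q.
  split; first split.
  - by rewrite qE => z [].
  - split; first by rewrite qE; split=> //; rewrite mul0r.
    by move/qp; apply: prime_idealN1 Pp.
  - by rewrite qE; case: (Iden e).
  - by rewrite qE; case: (Iden e).
  move=> u v Au Av quv; have [|nqv] := EM (q v); first by right.
  left; have [sub|nsub] := EM (den (v * e) `<=` p).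
    apply: (qmax (den (v * e))); first by exists (v * y); rewrite /e -mulrA; split=> //; apply: AM.
      by move=> z; rewrite qE; apply: den_in.
    by split=> //; move: quv; rewrite qE mulrA => -[].
  have [y0 [[Ay0 Ay0ve] npy0]] : exists y0, den (v * e) y0 /\ ~ p y0.
    apply: contrapT => H; apply: nsub => z dz; apply: contrapT => npz.
    by apply: H; exists z.
  exfalso; apply: nqv; apply: (qmax (den (y0 * e))).
  - exists (y0 * y); rewrite /e -mulrA; split=> //; first exact: AM.
    move=> z [Az Aze]; have /qp : q (z * y0) by rewrite qE; split; [exact: AM|rewrite -mulrA].
    by case: Pp => _ H /H[].
  - by move=> z; rewrite qE; apply: den_in.
  - by split=> //; rewrite mulrCA.
exists q; split=> //; last first.
  move=> [a [s [Aa As nqs xE]]]; apply: nqs; rewrite qE; split=> //.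
  have [s0|s0] := eqVneq s 0; first by rewrite s0 mul0r.
  by rewrite /e xE mulrCA [s * _]mulrC divfK //; apply: AM.
set P := localization A q.
have SP : is_subring P by apply: localization_subring.
have AP : A `<=` P by apply: localization_sub.
have nPe : ~ P e.
  move=> [a [s [Aa As nqs eE]]]; apply: nqs; rewrite qE; split=> //.
  have [s0|s0] := eqVneq s 0; first by rewrite s0 mul0r.
  by rewrite eE mulrC divfK.
have e0 : e != 0 by apply/eqP => e0; apply: nPe; rewrite e0; apply: subring0.
have [z [qz nqez]] : exists z, q z /\ ~ q (e * z).
  apply: contrapT => H.
  have : A e; last by move/AP.
  apply: (@integral_multiplier q); [by rewrite qE|..]; last first.
    by move=> z qz; apply: contrapT => nz; apply: H; exists z.
  have [b [c [Ab Ac xE]]] := (affA.2 x).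
  have c0 : c != 0.
    apply/eqP => c0; apply: nOx; rewrite xE c0 invr0 mulr0.
    by apply: localization_sub => //; apply: subring0.
  by exists c => //; rewrite qE; split=> //; rewrite /e xE mulrCA [c * _]mulrC divfK //; apply: AM.
have Aez : A (e * z) by move: qz; rewrite qE mulrC => -[].
have Uez : is_unit P (e * z).
  have ez0 : e * z != 0 by apply/eqP => h; apply: nqez; rewrite h; apply: prime_ideal0 Pq.
  by split=> //; [exact: AP|exists 1, (e * z); split; rewrite ?div1r].
have Pt : P e^-1.
  have -> : e^-1 = z * (e * z)^-1.
    have z0 : z != 0 by apply/eqP => h; case: Uez; rewrite h mulr0 eqxx.
    by field; rewrite e0 z0.
  by apply: subringM => //; [apply: AP; apply: prime_idealS qz|case: Uez].
have nonunitP w : nonunits P w -> P (w * e).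
  move=> /(localization_nonunitP _ SA Pq)[a [s [qa As nqs ->]]].
  by exists (a * e), s; split=> //; [move: qa; rewrite qE => -[]|rewrite mulrAC].
have expand f : A f -> f != 0 -> exists2 u, is_unit P u & exists n : nat, f = u * e^-1 ^+ n.
  move=> Af f0.
  have [k nk] : exists k, ~ P (f * e ^+ k).
    apply: contrapT => H.
    have allP k : P (f * e ^+ k) by apply: contrapT => nk; apply: H; exists k.
    pose Ik k : set F := [set a | A a /\ P (a / (f * e ^+ k))].
    have fe0 k : f * e ^+ k != 0 by rewrite mulf_neq0 ?expf_neq0.
    have [|J [[k ->] _ kmax]] := @affine_max_ideal (fun J => exists k, J = Ik k) (Ik 0%N) _ (ex_intro _ 0%N erefl).
      move=> _ [k ->]; split.
      - by move=> a [].
      - by split=> //; rewrite mul0r; apply: subring0.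
      - by move=> a b [Aa Pa] [Ab Pb]; split; [exact: subringD|rewrite mulrDl; exact: subringD].
      - by move=> a b Aa [Ab Pb]; split; [exact: AM|rewrite -mulrA; apply: subringM => //; exact: AP].
    have [a [s [Aa As nqs aE]]] := allP k.+1.
    have s0 : s != 0 by apply/eqP => s0; apply: nqs; rewrite s0; apply: prime_ideal0 Pq.
    have a0 : a != 0.
      by apply/eqP => a0; move: (fe0 k.+1); rewrite aE a0 mul0r eqxx.
    have [_ Pa] : Ik k a.
      apply: (kmax (Ik k.+1)); first by exists k.+1.
        move=> b [Ab Pb]; split=> //.
        have -> : b / (f * e ^+ k.+1) = b / (f * e ^+ k) * e^-1.
          by rewrite exprS; field; rewrite expf_neq0 // f0 e0.
        exact: subringM.
      by split=> //; rewrite aE invf_div mulrCA divff // mulr1; apply: AP.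
    apply: nPe.
    have -> : e = a / (f * e ^+ k) * s^-1.
      have -> : a = f * e ^+ k.+1 * s by rewrite aE divfK.
      by rewrite exprS; field; rewrite expf_neq0 // f0 s0.
    by apply: subringM => //; exists 1, s; split; rewrite ?div1r.
  have [k' [nk' kmin]] := @ex_min_nat nat (fun k => ~ P (f * e ^+ k)) id (ex_intro _ k nk).
  case: k' nk' kmin => [|k'] nk' kmin; first by case: nk'; rewrite expr0 mulr1; apply: AP.
  have Pk : P (f * e ^+ k') by apply: contrapT => /kmin; rewrite ltnn.
  exists (f * e ^+ k'); last by exists k'; rewrite -mulrA -exprMn mulfV // expr1n mulr1.
  apply: contrapT => nu; apply: nk'; rewrite exprSr mulrA; apply: nonunitP; split=> //.
split=> //; exists e^-1; split=> //; rewrite ?invr_eq0 ?invrK //.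
move=> f f0; have [a [b [Aa Ab fE]]] := affA.2 f.
have a0 : a != 0 by apply/eqP => h; move: f0; rewrite fE h mul0r eqxx.
have b0 : b != 0 by apply/eqP => h; move: f0; rewrite fE h invr0 mulr0 eqxx.
have [u Uu [n aE]] := expand _ Aa a0; have [v Uv [m bE]] := expand _ Ab b0.
exists (u / v); first by apply: is_unitM => //; apply: is_unitV.
have ie0 : e^-1 != 0 by rewrite invr_eq0.
exists (n%:Z - m%:Z).
have -> : e^-1 ^ (n%:Z - m%:Z) = e^-1 ^+ n / e^-1 ^+ m.
  by rewrite expfzDr // -exprnP -exprnN.
by rewrite fE aE bE mulf_div.
Qed.

End AffineAlgebra.

(** * Divisors on a normal variety *)

Section Divisors.
Variables (K F : fieldType) (iota : {rmorphism K -> F}) (X : normal_variety iota).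
Implicit Types (P Q : prime_divisor X) (D E : WDiv X).

Lemma prime_divisor_eq P Q : (P : set F) = Q -> P = Q.
Proof.
case: P Q => [P pP dP] [Q pQ dQ] /= e; subst Q.
by rewrite (Prop_irrelevance pP pQ) (Prop_irrelevance dP dQ).
Qed.

Lemma pd_subring P : is_subring P. Proof. by apply: points_subring; apply: pd_point. Qed.

Lemma pd_scalars P c : (P : set F) (iota c). Proof. by apply: points_scalars; apply: pd_point. Qed.

Lemma pd_fiber (O : set F) : exists r : seq (prime_divisor X), forall P, (P : set F) = O -> P \in r.
Proof.
have [[P PO]|nP] := EM (exists P : prime_divisor X, (P : set F) = O).
  by exists [:: P] => Q QO; rewrite inE; apply/eqP/prime_divisor_eq; rewrite QO.
by exists [::] => Q QO; exfalso; apply: nP; exists Q.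
Qed.

(** On a chart, a divisor of zeros contains a prime minimal over the function,
    hence is that prime; and there are finitely many of these. *)
Lemma finite_support a : a != 0 -> exists s : seq (prime_divisor X),
  forall P, ord P a != 0 -> P \in s.
Proof.
have on_chart (i : 'I_(nchart X)) c : chart i c -> c != 0 -> exists s : seq (prime_divisor X),
    forall P, spec (chart i) P -> ord P c != 0 -> P \in s.
  move=> Ac c0; have SA := chart_subring i.
  pose J : set F := [set x | exists2 y, chart i y & x = y * c].
  have IJ : sub_ideal (chart i) J.
    split.
    - by move=> _ [y Ay ->]; apply: subringM.
    - by exists 0; rewrite ?mul0r //; apply: subring0.
    - by move=> _ _ [y Ay ->] [z Az ->]; exists (y + z); rewrite ?mulrDl //; apply: subringD.
    - by move=> x _ Ax [y Ay ->]; exists (x * y); rewrite ?mulrA //; apply: subringM.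
  have [m [q qP]] := finitely_many_minimal_primes (chart_affine i) IJ.
  have /choice[r rP] : forall j, exists r : seq (prime_divisor X),
      forall P, (P : set F) = localization (chart i) (q j) -> P \in r.
    by move=> j; apply: pd_fiber.
  exists (flatten [seq r j | j <- seq.iota 0 m]) => P [p Pp PE] oc.
  have pc : p c.
    apply: contrapT => npc; move/eqP: oc; apply; apply/(ord_unit (pd_dvr P)) => //.
    split=> //; rewrite PE; first exact: localization_sub.
    by exists 1, c; split; rewrite ?div1r //; case: SA.
  have Jp : J `<=` p by move=> _ [y Ay ->]; case: Pp => -[_ _ _ pM] _; apply: pM.
  have [j [jm Pq Jq qp]] := qP p Pp Jp.
  apply/flatten_mapP; exists j; rewrite ?mem_iota //; apply: rP; apply/esym.
  apply: (dvr_maximal (pd_dvr P)); first exact: localization_subring.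
    rewrite PE => _ [x [s [Ax As ps ->]]]; exists x, s; split=> //.
    by move/qp.
  exists c^-1 => Oc.
  have [_] : nonunits (localization (chart i) (q j)) c.
    apply/localization_nonunitP => //; exists c, 1; rewrite divr1; split=> //.
    - by apply: Jq; exists 1; rewrite ?mul1r //; case: SA.
    - by case: SA.
    - exact: prime_idealN1 Pq.
  by apply; split=> //; apply: localization_sub.
move=> a0.
have /choice[s sP] : forall i : 'I_(nchart X), exists s : seq (prime_divisor X),
    forall P, spec (chart i) P -> ord P a != 0 -> P \in s.
  move=> i; have [u [v [Au Av aE]]] := (chart_affine i).2 a.
  have u0 : u != 0 by apply/eqP => u0; rewrite aE u0 mul0r eqxx in a0.
  have v0 : v != 0 by apply/eqP => v0; rewrite aE v0 invr0 mulr0 eqxx in a0.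
  have [s sP] := on_chart i u Au u0; have [t tP] := on_chart i v Av v0.
  exists (s ++ t) => P sP'; rewrite aE ordB //; last exact: pd_dvr.
  rewrite mem_cat; have [u1|/(sP P sP')-> //] := eqVneq (ord P u) 0.
  have [v1|/(tP P sP')->] := eqVneq (ord P v) 0; last by rewrite orbT.
  by rewrite u1 v1 subrr eqxx.
exists (flatten [seq s i | i <- enum 'I_(nchart X)]) => P oP.
have [i Pi] := pd_point P.
by apply/flatten_mapP; exists i; [rewrite mem_enum|apply: sP].
Qed.

Lemma multB P D E : mult P (D - E) = mult P D - mult P E. Proof. exact: coeffB. Qed.
Lemma multMz P D n : mult P (D *~ n) = mult P D * n.
Proof. by rewrite /mult raddfMz mulrzz. Qed.
Lemma multMn P D n : mult P (D *+ n) = mult P D *+ n.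
Proof. exact: coeffMn. Qed.

Lemma WDiv_eq D E : (forall P, mult P D = mult P E) -> D = E.
Proof. by move=> e; apply/eqP/freeg_eqP. Qed.

Lemma WDiv_of_function (c : prime_divisor X -> int) (s : seq (prime_divisor X)) :
  (forall P, c P != 0 -> P \in s) -> exists D, forall P, mult P D = c P.
Proof.
move=> cs; exists (\sum_(Q <- undup s) << c Q *g Q >>) => P.
rewrite /mult raddf_sum /=; have [Ps|nPs] := boolP (P \in undup s).
  rewrite (bigD1_seq P) ?undup_uniq //= coeffU eqxx mulr1 big1 ?addr0 // => Q /negPf QP.
  by rewrite coeffU QP mulr0.
rewrite big_seq big1 => [|Q Qs]; last first.
  rewrite coeffU; case: eqP => [QP|_]; last by rewrite mulr0.
  by rewrite -QP Qs in nPs.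
apply/esym/eqP; apply: contraNT nPs => /cs; by rewrite mem_undup.
Qed.

Lemma clD D E : cl (D + E) = cl D + cl E. Proof. exact: raddfD. Qed.
Lemma clMz D n : cl (D *~ n) = cl D *~ n. Proof. exact: raddfMz. Qed.

Lemma cl_eqP D E : cl D = cl E <->
  exists2 f, f != 0 & forall P, mult P D - mult P E = ord P f.
Proof.
split=> [/eqP|[f f0 fP]].
  rewrite -Quotient.idealrBE => /asboolP[f f0 fP]; exists f => // P.
  by rewrite -multB fP.
apply/eqP; rewrite -Quotient.idealrBE; apply/asboolP; exists f => // P _.
by rewrite multB fP.
Qed.

Lemma cl_surj (c : Cl X) : exists D, c = cl D.
Proof. by exists (repr c); rewrite /cl reprK. Qed.

Lemma prime_ideal_above (i : 'I_(nchart X)) (J : set F) : sub_ideal (chart i) J -> ~ J 1 ->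
  exists2 p, prime_ideal (chart i) p & J `<=` p.
Proof.
move=> IJ J1; have SA := chart_subring i; have [A1 AB AM] := SA.
have [|p [[Ip p1] Jp pmax]] := @affine_max_ideal _ _ _ _ (chart_affine i)
    (fun J => sub_ideal (chart i) J /\ ~ J 1) J _ (conj IJ J1).
  by move=> ? [].
exists p => //; have [pA p0 pD pM] := Ip.
split; first by split.
move=> a b Aa Ab pab; apply: contrapT => /not_orP[na nb].
pose ext : set F := [set x | exists2 y, chart i y & p (x - y * a)].
have pe : p `<=` ext by move=> x Jx; exists 0; rewrite ?mul0r ?subr0 //; apply: subring0.
have ea : ext a by exists 1; rewrite ?mul1r ?subrr.
have [e1|ne1] := EM (ext 1).
  case: e1 => y Ay py; apply: nb.
  have -> : b = b * (1 - y * a) + y * (a * b) by ring.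
  by apply: pD; apply: (pM).
apply: na; apply: (pmax ext) => //; split=> //; split=> //.
- by move=> x [y Ay Jx]; rewrite -(subrK (y * a) x); apply: subringD => //; [exact: pA|exact: AM].
- exact: pe.
- move=> x x' [y Ay Jx] [y' Ay' Jx']; exists (y + y'); first exact: subringD.
  by rewrite mulrDl opprD addrACA; apply: pD.
- move=> z x Az [y Ay Jx]; exists (z * y); first exact: AM.
  by rewrite -mulrA -mulrBr; apply: pM.
Qed.

Lemma hartogs_point (O : set F) x : points X O ->
  (forall P, O `<=` P -> (P : set F) x) -> O x.
Proof.
case=> i [p Pp OE] Px; rewrite OE; apply: contrapT => nx.
have [q [Pq qp dq nqx]] := hartogs (chart_affine i) (@chart_normal _ _ _ X i) Pp nx.
have pq : points X (localization (chart i) q) by exists i, q.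
apply: nqx; apply: (Px (PrimeDivisor pq dq)); rewrite OE /= => _ [a [s [Aa As ps ->]]].
by exists a, s; split=> // /qp.
Qed.

Lemma hartogs_chart (i : 'I_(nchart X)) x : (forall P, chart i `<=` P -> (P : set F) x) -> chart i x.
Proof.
move=> Px; apply: contrapT => nx; have SA := chart_subring i.
pose J : set F := [set z | chart i z /\ chart i (z * x)].
have [|J1|p Pp Jp] := @prime_ideal_above i J.
- split; first by move=> z [].
  + by split; rewrite ?mul0r; apply: subring0.
  + by move=> a b [Aa Aax] [Ab Abx]; split; rewrite ?mulrDl; apply: subringD.
  + by move=> a b Aa [Ab Abx]; split; rewrite -?mulrA; apply: subringM.
- by case: J1; rewrite mul1r.
have pO : points X (localization (chart i) p) by exists i, p.
have Osub := localization_sub SA Pp.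
have [a [s [Aa As ps xE]]] : localization (chart i) p x.
  by apply: hartogs_point => // P OP; apply: Px; apply: subset_trans OP.
apply: ps; apply: Jp; split=> //.
have [s0|s0] := eqVneq s 0; first by rewrite s0 mul0r; apply: subring0.
by rewrite xE mulrC divfK.
Qed.

(** The coordinates of the chart have no poles through the point, hence are
    regular there; so the complement of a chart is purely of codimension one. *)
Lemma divisors_detect_chart (O : set F) (i : 'I_(nchart X)) : points X O ->
  (forall P, O `<=` P -> chart i `<=` P) -> spec (chart i) O.
Proof.
move=> pO H; apply: point_in_chart => // a Aa; apply: hartogs_point => // P OP.
exact: H.
Qed.

Lemma chart_boundary (i : 'I_(nchart X)) : exists s : seq (prime_divisor X), forall P, ~ chart i `<=` P -> P \in s.
Proof.
have [[n [a AE]] _] := chart_affine (n:=X) i.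
have /choice[s sP] : forall l : 'I_n, exists s : seq (prime_divisor X),
    forall P, ~ (P : set F) (a l) -> P \in s.
  move=> l; have [a0|a0] := eqVneq (a l) 0.
    by exists [::] => P; rewrite a0; case; apply: subring0 (pd_subring P).
  have [s sP] := finite_support a0; exists s => P nP; apply: sP.
  apply/eqP => o0; apply: nP; apply/(ord_ge0 (pd_dvr P)) => //; by rewrite o0.
exists (flatten [seq s l | l <- enum 'I_n]) => P nP.
apply: contrapT => nf; apply: nP; rewrite AE => _ [g _ <-].
have Pa l : (P : set F) (a l).
  apply: contrapT => nPl; apply: nf; apply/flatten_mapP; exists l; first by rewrite mem_enum.
  exact: sP.
rewrite /mmap; apply: subring_sum (pd_subring P) _ => m _.
apply: subringM (pd_subring P) (pd_scalars P _) _.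
by apply: subring_prod (pd_subring P) _ => l _; apply: subringX (pd_subring P) _.
Qed.

End Divisors.

(** * The Cox ring as a graded ring of functions *)

Definition mwt nu (w : 'I_nu -> nat) (m : 'X_{1..nu}) : nat := (\sum_i m i * w i)%N.

Fact mwt0 nu (w : 'I_nu -> nat) : mwt w 0%MM = 0%N.
Proof. by rewrite /mwt big1 // => i _; rewrite mnm0E. Qed.

Fact mwtD nu (w : 'I_nu -> nat) : {morph mwt w : m1 m2 / (m1 + m2)%MM >-> (m1 + m2)%N}.
Proof.
by move=> m1 m2; rewrite /mwt -big_split; apply: eq_bigr => i _; rewrite mnmDE mulnDl.
Qed.

HB.instance Definition _ nu (w : 'I_nu -> nat) := isMeasure.Build nu (mwt w) (mwt0 w) (mwtD w).

Lemma mwtU nu (w : 'I_nu -> nat) i : mwt w U_(i)%MM = w i.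
Proof.
rewrite /mwt (bigD1 i) //= mnm1E eqxx mul1n big1 ?addn0 // => j /negPf ji.
by rewrite mnm1E eq_sym ji.
Qed.

Notation whomog w n := (ishomog1 n (mwt w)).

Section Grading.
Variables (K F : fieldType) (iota : {rmorphism K -> F}).
Variables (nu : nat) (f : 'I_nu -> F) (w : 'I_nu -> nat).
Hypothesis w_gt0 : forall i, (0 < w i)%N.
Implicit Types G H : {mpoly K[nu]}.

Definition ev : {mpoly K[nu]} -> F := mmap iota f.

HB.instance Definition _ := GRing.RMorphism.copy ev (mmap iota f).

Lemma evC c : ev c%:MP = iota c. Proof. exact: mmapC. Qed.

Lemma evX i : ev 'X_i = f i. Proof. by rewrite /ev mmapX mmap1U. Qed.

Lemma evZ c G : ev (c *: G) = iota c * ev G. Proof. exact: mmapZ. Qed.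

Definition cox_poly : {mpoly K[nu]} -> {poly F} :=
  mmap (polyC \o iota) (fun i => f i *: 'X^(w i)).

HB.instance Definition _ := GRing.RMorphism.copy cox_poly
  (mmap (polyC \o iota) (fun i => f i *: 'X^(w i))).

Lemma cox_polyD G H : cox_poly (G + H) = cox_poly G + cox_poly H.
Proof. exact: (rmorphD cox_poly). Qed.

Lemma cox_polyM G H : cox_poly (G * H) = cox_poly G * cox_poly H.
Proof. exact: (rmorphM cox_poly). Qed.

Lemma evD G H : ev (G + H) = ev G + ev H. Proof. exact: (rmorphD ev). Qed.

Lemma evB G H : ev (G - H) = ev G - ev H. Proof. exact: (rmorphB ev). Qed.

Lemma evM G H : ev (G * H) = ev G * ev H. Proof. exact: (rmorphM ev). Qed.

Lemma evXn G n : ev (G ^+ n) = ev G ^+ n. Proof. exact: (rmorphXn ev). Qed.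

Lemma ev0 : ev 0 = 0. Proof. exact: (rmorph0 ev). Qed.

Lemma ev1 : ev 1 = 1. Proof. exact: (rmorph1 ev). Qed.

Lemma ev_sum I (r : seq I) (P : pred I) (E : I -> {mpoly K[nu]}) :
  ev (\sum_(i <- r | P i) E i) = \sum_(i <- r | P i) ev (E i).
Proof. exact: (rmorph_sum ev). Qed.

Lemma cox_evalE G : cox_eval iota f w G = tofrac (cox_poly G).
Proof.
rewrite /cox_eval /cox_poly /mmap rmorph_sum; apply: eq_bigr => m _.
rewrite rmorphM; congr (_ * _).
by rewrite /mmap1 rmorph_prod; apply: eq_bigr => i _; rewrite rmorphXn.
Qed.

Lemma coef_cox_poly G n : (cox_poly G)`_n = ev (pihomog (mwt w) n G).
Proof.
rewrite pihomogE rmorph_sum /= /cox_poly /mmap coef_sum [RHS]big_mkcond /=.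
apply: eq_bigr => m _; rewrite coefCM.
have -> : mmap1 (fun i => f i *: 'X^(w i)) m = mmap1 f m *: 'X^(mwt w m).
  rewrite /mmap1 /mwt -prodrXr -scaler_prod; apply: eq_bigr => i _.
  by rewrite exprZn -exprM mulnC.
rewrite coefZ coefXn eq_sym; case: eqP => _; last by rewrite !mulr0.
by rewrite mulr1 evZ /ev mmapX.
Qed.

Lemma cox_poly_homog n G : G \is whomog w n -> cox_poly G = ev G *: 'X^n.
Proof.
move=> hG; apply/polyP => k; rewrite coef_cox_poly coefZ coefXn.
have [->|kn] := eqVneq k n; first by rewrite pihomog_dE // mulr1.
by rewrite (pihomog_ne0 _ hG) 1?eq_sym // rmorph0 mulr0.
Qed.

Lemma tcs_idealP G : tcs_ideal iota f w G <-> forall n, ev (pihomog (mwt w) n G) = 0.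
Proof.
rewrite /tcs_ideal /= cox_evalE; split=> [/eqP|H].
  by rewrite tofrac_eq0 => /eqP G0 n; rewrite -coef_cox_poly G0 coef0.
by rewrite (_ : cox_poly G = 0) ?rmorph0 //; apply/polyP => n; rewrite coef_cox_poly H coef0.
Qed.

Lemma tcs_ideal_homog n G : G \is whomog w n -> (tcs_ideal iota f w G <-> ev G = 0).
Proof.
move=> hG; rewrite tcs_idealP; split=> [/(_ n)|G0 k]; first by rewrite pihomog_dE.
have [->|kn] := eqVneq k n; first by rewrite pihomog_dE.
by rewrite (pihomog_ne0 _ hG) 1?eq_sym // rmorph0.
Qed.

Lemma tcs_ideal_ideal : ring_ideal (tcs_ideal iota f w).
Proof.
have E G : tcs_ideal iota f w G <-> cox_poly G = 0.
  rewrite /tcs_ideal /= cox_evalE; split=> [/eqP|->]; last exact: rmorph0.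
  by rewrite tofrac_eq0 => /eqP.
split; first by apply/E; exact: rmorph0.
- by move=> G H /E e /E e'; apply/E; rewrite cox_polyD e e' addr0.
- by move=> G H /E e; apply/E; rewrite cox_polyM e mulr0.
Qed.

Lemma tcs_ideal_pihomog n G : tcs_ideal iota f w G -> tcs_ideal iota f w (pihomog (mwt w) n G).
Proof. by move=> /tcs_idealP H; apply/(tcs_ideal_homog (pihomogP _ _ _)). Qed.

Lemma mwt_ge (m : 'X_{1..nu}) i : (m i <= mwt w m)%N.
Proof.
rewrite /mwt (bigD1 i) //=; apply: leq_trans (leq_addr _ _).
by rewrite leq_pmulr.
Qed.

Lemma whomog0 G : G \is whomog w 0 -> exists c, G = c%:MP.
Proof.
move=> /dhomogP h; exists (G@_0%MM); apply/mpolyP => m; rewrite mcoeffC.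
have [->|m0] := eqVneq m 0%MM; first by rewrite mulr1.
rewrite mulr0; apply: memN_msupp_eq0.
apply: contra m0 => /h h0; apply/eqP/mnmP => i; rewrite mnm0E.
by apply/eqP; rewrite -leqn0 -h0 mwt_ge.
Qed.

Lemma whomogX i : ('X_i : {mpoly K[nu]}) \is whomog w (w i).
Proof. by rewrite dhomogX; apply/eqP; apply: mwtU. Qed.

Lemma whomog_weight G n : G != 0 -> weighted_homog w G n <-> G \is whomog w n.
Proof.
move=> G0; split=> [[_ h]|/dhomogP h]; first by apply/dhomogP => m /h.
by split=> // m /h.
Qed.

End Grading.

(** Completeness, the grading of Cl(X) and the generation of the Cox ring are
    used together throughout. *)
Record cox_setting (K : closedFieldType) (F : fieldType) (iota : {rmorphism K -> F})
    (X : normal_variety iota) (d nu : nat) (degCl : {additive Cl X -> int}) (D0 : WDiv X)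
    (f : 'I_nu -> F) (w : 'I_nu -> nat) : Prop := CoxSetting {
  cs_char : [pchar K] =i pred0;
  cs_complete : complete X;
  cs_dim : has_dim iota d;
  cs_bij : bijective degCl;
  cs_gen : degCl (cl D0) = 1;
  cs_w : forall i, (0 < w i)%N;
  cs_fgen : cox_ring D0 = range (cox_eval iota f w);
  cs_f0 : forall i, f i != 0
}.

Section CoxRing.
Variables (K : closedFieldType) (F : fieldType) (iota : {rmorphism K -> F}).
Variables (X : normal_variety iota) (d nu : nat) (degCl : {additive Cl X -> int}).
Variables (D0 : WDiv X) (f : 'I_nu -> F) (w : 'I_nu -> nat).
Hypothesis S : cox_setting d degCl D0 f w.
Implicit Types (P Q : prime_divisor X) (D E : WDiv X) (G H : {mpoly K[nu]}) (i : 'I_(nchart X)).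

Local Notation evf := (ev iota f).

(** Elements of degree n of the Cox ring, as functions. *)
Definition sec (n : int) : set F := sections (D0 *~ n) (points X).

(** Vanishing order along P of a function seen as an element of degree n. *)
Definition vord (n : int) (P : prime_divisor X) (a : F) : int := ord P a + mult P D0 * n.

Lemma vordE n P a : vord n P a = ord P a + mult P D0 * n. Proof. by []. Qed.

Lemma secP n a : a != 0 -> sec n a <-> forall P, 0 <= vord n P a.
Proof.
move=> a0; rewrite /vord; split=> [Sa P|H _ P _]; rewrite ?multMz.
  by have := Sa a0 P (pd_point P); rewrite multMz.
exact: H.
Qed.

Lemma sec00 n : sec n 0. Proof. by rewrite /sec /sections /= eqxx. Qed.

Lemma vordM n m P a b : a != 0 -> b != 0 -> vord (n + m) P (a * b) = vord n P a + vord m P b.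
Proof. by move=> a0 b0; rewrite /vord ordM //; [ring|exact: pd_dvr]. Qed.

Lemma vordV n P a : a != 0 -> vord (- n) P a^-1 = - vord n P a.
Proof. by move=> a0; rewrite /vord ordV //; [ring|exact: pd_dvr]. Qed.

Lemma vordX n P a k : a != 0 -> vord (n * k%:Z) P (a ^+ k) = vord n P a * k%:Z.
Proof. by move=> a0; rewrite /vord ordX //; [rewrite -mulr_natr natz; ring|exact: pd_dvr]. Qed.

Lemma vord0 P a : vord 0 P a = ord P a. Proof. by rewrite /vord mulr0 addr0. Qed.

Lemma secM n m a b : sec n a -> sec m b -> sec (n + m) (a * b).
Proof.
have [->|a0] := eqVneq a 0; first by rewrite mul0r => _ _; apply: sec00.
have [->|b0] := eqVneq b 0; first by rewrite mulr0 => _ _; apply: sec00.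
move=> /secP - /(_ a0) Ha /secP - /(_ b0) Hb; apply/secP; first by rewrite mulf_neq0.
by move=> P; rewrite vordM // addr_ge0.
Qed.

Lemma secX n a k : sec n a -> sec (n * k%:Z) (a ^+ k).
Proof.
have [->|a0] := eqVneq a 0.
  case: k => [|k]; last by rewrite expr0n => _; apply: sec00.
  rewrite expr0 mulr0 => _; apply/secP; rewrite ?oner_neq0 // => P.
  by rewrite vord0 ord1 //; apply: pd_dvr.
move=> /secP - /(_ a0) Ha; apply/secP; first by rewrite expf_neq0.
by move=> P; rewrite vordX // mulr_ge0.
Qed.

Lemma sec_scalar c : sec 0 (iota c).
Proof.
have [->|c0] := eqVneq c 0; first by rewrite rmorph0; apply: sec00.
have ic0 : iota c != 0 by rewrite fmorph_eq0.
apply/secP => // P; rewrite vord0; apply/(ord_ge0 (pd_dvr P)) => //; exact: pd_scalars.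
Qed.

Lemma sec_ev n G : G \is whomog w n -> sec n%:Z (evf G).
Proof.
move=> hG; have : range (cox_eval iota f w) (cox_eval iota f w G) by exists G.
rewrite -(cs_fgen S) => -[N [p [e pP]]].
move: e; rewrite cox_evalE (cox_poly_homog iota f hG) => /(congr1 (fun z => z * tofrac 'X^N)).
have XN0 : tofrac ('X^N : {poly F}) != 0 by rewrite tofrac_eq0 expf_neq0 // polyX_eq0.
rewrite divfK // -rmorphM => /eqP; rewrite tofrac_eq => /eqP e.
have := pP (n + N)%N; rewrite -e -scalerAl -exprD coefZ coefXn eqxx mulr1.
by rewrite PoszD addrK.
Qed.

Lemma sec_lift (n : nat) a : sec n%:Z a -> exists2 G, G \is whomog w n & a = evf G.
Proof.
move=> sa; have : cox_ring D0 (cox_elt a n).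
  exists 0%N, (a *: 'X^n); rewrite expr0 rmorph1 divr1; split=> // k.
  rewrite coefZ coefXn subr0; case: eqP => [->|_]; first by rewrite mulr1.
  by rewrite mulr0; apply: (sec00 k).
rewrite (cs_fgen S) => -[G _]; rewrite cox_evalE => /eqP; rewrite tofrac_eq => /eqP e.
exists (pihomog (mwt w) n G); first exact: pihomogP.
by rewrite -coef_cox_poly e coefZ coefXn eqxx mulr1.
Qed.

Lemma sec_neg n a : n < 0 -> sec n a -> a = 0.
Proof.
case: n => // n _ sa; have : cox_ring D0 (tofrac a%:P / tofrac ('X ^+ n.+1)).
  exists n.+1, a%:P; split=> // k; rewrite coefC.
  by case: eqP => [->|_]; [rewrite sub0r -NegzE|apply: sec00].
rewrite (cs_fgen S) => -[G _]; rewrite cox_evalE => /(congr1 (fun z => z * tofrac ('X ^+ n.+1))).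
have XN0 : tofrac ('X ^+ n.+1 : {poly F}) != 0 by rewrite tofrac_eq0 expf_neq0 // polyX_eq0.
rewrite divfK // -rmorphM => /eqP; rewrite tofrac_eq => /eqP/polyP/(_ 0%N).
by rewrite coefMXn coefC /= => <-.
Qed.

Lemma sec_degree_ge0 n a : sec n a -> a != 0 -> 0 <= n.
Proof. by move=> sa a0; rewrite leNgt; apply/negP => /sec_neg/(_ sa)/eqP; rewrite (negPf a0). Qed.

Lemma sec_degree0 a : sec 0 a -> exists c, a = iota c.
Proof.
by move=> /(@sec_lift 0%N)[G /(whomog0 (cs_w S))[c ->] ->]; exists c; rewrite evC.
Qed.

Lemma secD n a b : sec n a -> sec n b -> sec n (a + b).
Proof.
have [lt|] := ltP n 0; first by move=> /(sec_neg lt)-> /(sec_neg lt)->; rewrite addr0; apply: sec00.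
case: n => // n _ /sec_lift[G hG ->] /sec_lift[H hH ->]; rewrite -rmorphD.
by apply: sec_ev; apply: rpredD.
Qed.

Lemma secZ n c a : sec n a -> sec n (iota c * a).
Proof. by move=> sa; rewrite -[n]add0r; apply: secM => //; apply: sec_scalar. Qed.

Lemma f_sec j : sec (w j)%:Z (f j).
Proof. by rewrite -(evX iota f); apply: sec_ev; apply: whomogX. Qed.

Definition dg D : int := degCl (cl D).

Lemma dgE D : dg D = degCl (cl D). Proof. by []. Qed.

Lemma dgD D E : dg (D + E) = dg D + dg E. Proof. by rewrite /dg clD raddfD. Qed.
Lemma dgMz D n : dg (D *~ n) = dg D * n. Proof. by rewrite /dg clMz raddfMz mulrzz. Qed.
Lemma dgD0 : dg D0 = 1. Proof. exact: cs_gen S. Qed.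

Lemma divisor_degree D : exists2 a, a != 0 & forall P, mult P D = vord (dg D) P a.
Proof.
have : cl D = cl (D0 *~ dg D).
  by apply: (bij_inj (cs_bij S)); rewrite -!/(dg _) dgMz dgD0 mul1r.
by move=> /cl_eqP[a a0 aP]; exists a => // P; rewrite /vord -aP multMz subrK.
Qed.

Lemma dg_eq D n a : a != 0 -> (forall P, mult P D = vord n P a) -> dg D = n.
Proof.
move=> a0 aP; rewrite /dg; suff -> : cl D = cl (D0 *~ n) by rewrite -/(dg _) dgMz dgD0 mul1r.
by apply/cl_eqP; exists a => // P; rewrite aP multMz /vord addrK.
Qed.

Lemma exists_prime_divisor : exists P : prime_divisor X, True.
Proof.
apply: contrapT => nP; have : D0 = 0 by apply: WDiv_eq => P; case: nP; exists P.
by move=> D00; have := dgD0; rewrite D00 /dg /cl !raddf0.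
Qed.

Lemma not_all_scalars : ~ (forall a, exists c, a = iota c).
Proof.
move=> H; have [P _] := exists_prime_divisor.
have [t [_ _ nt _ _]] := dvr_uniformizer (pd_dvr P).
by have [c tc] := H t; apply: nt; rewrite tc -fmorphV; apply: pd_scalars.
Qed.

Lemma ord_scalar P c : iota c != 0 -> ord P (iota c) = 0.
Proof.
move=> c0; apply/(ord_unit (pd_dvr P) c0); split=> //; rewrite -?fmorphV; exact: pd_scalars.
Qed.

(** The divisor is equivalent to a multiple of D0, hence the zero divisor of a
    homogeneous element; this element is not of degree zero, where all elements
    are constants. *)
Lemma prime_divisor_equation P : exists (e : nat) (s : F), [/\ (0 < e)%N, s != 0 &
  forall Q, vord e%:Z Q s = (Q == P)%:Z].
Proof.
pose D : WDiv X := << 1 *g P >>.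
have mD Q : mult Q D = (Q == P)%:Z.
  by rewrite /mult coeffU mul1r eq_sym; case: (Q == P).
have [s s0 sP] := divisor_degree D.
have ss : sec (dg D) s by apply/secP => // Q; rewrite -sP mD; case: (_ == _).
have := sec_degree_ge0 ss s0; case: (dg D) ss sP => // e ss sP _.
exists e, s; split=> // [|Q]; last by rewrite -sP mD.
rewrite lt0n; apply/eqP => e0; rewrite e0 in ss sP; have [c sc] := sec_degree0 ss.
have := sP P; rewrite mD eqxx vord0 sc.
by rewrite (ord_scalar P) -?sc.
Qed.

(** The boundary of the chart is a divisor; its equation is a homogeneous
    element, not of degree zero, because X is complete while the chart is
    affine. *)
Lemma chart_equation i : exists (e : nat) (s : F), [/\ (0 < e)%N, s != 0 &
  forall P, vord e%:Z P s = (~~ `[< chart i `<=` P >])%:Z].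
Proof.
have [r rP] := chart_boundary i.
have [|D mD] := @WDiv_of_function _ _ _ X (fun P => (~~ `[< chart i `<=` P >])%:Z) r.
  by move=> P nP; apply: rP => AP; move: nP; rewrite asboolT.
have [s s0 sP] := divisor_degree D.
have ss : sec (dg D) s by apply/secP => // Q; rewrite -sP mD; case: (~~ _).
have := sec_degree_ge0 ss s0; case: (dg D) ss sP => // e ss sP _.
exists e, s; split=> // [|P]; last by rewrite -sP mD.
rewrite lt0n; apply/eqP => e0; rewrite e0 in ss sP; have [c sc] := sec_degree0 ss.
have all P : chart i `<=` P.
  apply: contrapT => nP; have := sP P; rewrite mD asboolF // vord0 sc.
  by rewrite (ord_scalar P) -?sc.
have Ac a : chart i a -> exists c, a = iota c.
  have [->|a0] := eqVneq a 0; first by exists 0; rewrite rmorph0.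
  move=> Aa; apply: sec_degree0; apply/secP => // P; rewrite vord0.
  by apply/(ord_ge0 (pd_dvr P)) => //; apply: all.
apply: not_all_scalars => a; have [u [v [/Ac[b ->] /Ac[b' ->] ->]]] := (chart_affine i).2 a.
by exists (b / b'); rewrite fmorph_div.
Qed.

Definition is_chart_eq i (e : nat) (s : F) := [/\ (0 < e)%N, s != 0 &
  forall P, vord e%:Z P s = (~~ `[< chart i `<=` P >])%:Z].

Lemma chart_eq_sec i e s : is_chart_eq i e s -> sec e%:Z s.
Proof. by case=> _ s0 sP; apply/secP => // P; rewrite sP; case: (~~ _). Qed.

(** Only finitely many divisors are poles of a, and s vanishes along each of
    them. *)
Lemma clear_poles n a e s : a != 0 -> s != 0 ->
  (forall P, 0 <= vord e P s) -> (forall P, vord e P s = 0 -> 0 <= vord n P a) ->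
  exists k : nat, forall l : nat, (k <= l)%N -> sec (n + e * l%:Z) (a * s ^+ l).
Proof.
move=> a0 s0 sP aP; have [r rP] := finite_support X a0.
pose c P := absz (vord n P a); pose r' := r ++ dom D0.
have c0 P : P \notin r' -> c P = 0%N.
  rewrite mem_cat negb_or => /andP[nr nd]; rewrite /c /vord /mult coeff_outdom // mul0r addr0.
  by apply/eqP; rewrite absz_eq0; apply: contraNT nr; apply: rP.
have cle P : (c P <= \sum_(Q <- r') c Q)%N.
  have [Pr|/c0 -> //] := boolP (P \in r').
  by rewrite (big_rem P) //= leq_addr.
exists (\sum_(Q <- r') c Q)%N => l le; apply/secP; first by rewrite mulf_neq0 ?expf_neq0.
move=> P; rewrite vordM ?expf_neq0 // vordX //.
have [s00|sn0] := eqVneq (vord e P s) 0; first by rewrite s00 mul0r addr0 aP.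
have := leq_trans (cle P) le; have := sP P; move: sn0; rewrite /c; nia.
Qed.

Lemma chart_secP i e s a : is_chart_eq i e s ->
  chart i a <-> exists k : nat, sec (e%:Z * k%:Z) (a * s ^+ k).
Proof.
move=> [e0 s0 sP]; have [->|a0] := eqVneq a 0.
  split=> _; first by exists 0%N; rewrite mul0r; apply: sec00.
  by apply: subring0; apply: chart_subring.
split=> [Aa|[k sk]].
  have [||k kP] := @clear_poles 0 a e%:Z s a0 s0.
  - by move=> P; rewrite sP; case: (~~ _).
  - move=> P; rewrite sP vord0; case: asboolP => // AP _.
    by apply/(ord_ge0 (pd_dvr P)) => //; apply: AP.
  by exists k; have := kP k (leqnn _); rewrite add0r.
apply: hartogs_chart => P AP; apply/(ord_ge0 (pd_dvr P)) => //.
have/secP := sk; rewrite mulf_neq0 ?expf_neq0 // => /(_ isT)/(_ P).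
by rewrite -[X in vord X]add0r vordM ?expf_neq0 // vordX // sP asboolT // mul0r addr0 vord0.
Qed.

(** The equations of the prime divisors have degrees that are combinations of
    the weights, and prime divisors generate Cl(X). *)
Lemma weights_coprime m : (forall j, (m %| w j)%N) -> m = 1%N.
Proof.
move=> mw.
have dvd_homog n G : G \is whomog w n -> G != 0 -> (m %| n)%N.
  move=> /dhomogP hG G0; have <- : mwt w (mlead G) = n := hG _ (mlead_supp G0).
  by rewrite /mwt; apply: dvdn_sum => j _; apply: dvdn_mull.
have dvdP P : (m%:Z %| dg << 1 *g P >>)%Z.
  have [e [s [e0 s0 sP]]] := prime_divisor_equation P.
  rewrite (@dg_eq _ e%:Z s) // => [|Q]; last first.
    by rewrite sP /mult coeffU mul1r eq_sym; case: (_ == _).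
  have [|G hG sG] := @sec_lift e s; first by apply/secP => // Q; rewrite sP; case: (_ == _).
  apply: (dvd_homog e G hG); apply/eqP => G0; move: s0; rewrite sG G0.
  by rewrite rmorph0 eqxx.
have dvdD D : (m%:Z %| dg D)%Z.
  rewrite -[D]freeg_sumE /dg /cl !raddf_sum /=; apply: rpred_sum => P _.
  have -> : << coeff P D *g P >> = << 1 *g P >> *~ coeff P D :> WDiv X.
    by apply: WDiv_eq => Q; rewrite multMz /mult !coeffU mul1r mulrC.
  by rewrite -/(cl _) -/(dg _) dgMz dvdz_mulr.
by have := dvdD D0; rewrite dgD0 dvdz1 => /eqP.
Qed.

End CoxRing.

(** * Points of the total coordinate space *)

Section HasOrder.
Variables (V : zmodType) (Pd : zmodClosed V) (dg : {additive V -> int}) (v1 : V).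

Lemma has_order_quot (c : nat) : (0 < c)%N -> dg v1 = 1 ->
  (forall v, v \in Pd <-> (c%:Z %| dg v)%Z) -> has_order {ideal_quot Pd} c.
Proof.
move=> c0 d1 PdP; pose e (i : 'I_c) : {ideal_quot Pd} := \pi_({ideal_quot Pd})%qT (v1 *~ (i : nat)%:Z).
have piE u v : (\pi_({ideal_quot Pd})%qT u = \pi_({ideal_quot Pd})%qT v) <-> (c%:Z %| dg u - dg v)%Z.
  rewrite -raddfB -PdP Quotient.idealrBE; by split=> [->|/eqP].
have dgv (n : int) : dg (v1 *~ n) = n by rewrite raddfMz d1 mulrzz mul1r.
have inj : injective e.
  move=> i j /piE; rewrite !dgv => h; apply: val_inj => /=.
  have : (i%:Z == j%:Z %[mod c%:Z])%Z by rewrite eqz_mod_dvd.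
  by rewrite !modz_small ?ltz_nat ?ltn_ord //= => /eqP[].
have /choice[g gP] : forall q, exists i, e i = q.
  move=> q; pose n := (dg (repr q) %% c%:Z)%Z.
  have n0 : 0 <= n by apply: modz_ge0; lia.
  have nc : n < c%:Z by apply: ltz_pmod.
  have lt : (absz n < c)%N by lia.
  exists (Ordinal lt); rewrite -[q]reprK; apply/piE; rewrite dgv /= gez0_abs //.
  rewrite -eqz_mod_dvd /n modz_mod; exact/eqP.
exists e; exists g => i //; by apply: inj; rewrite gP.
Qed.

End HasOrder.

Section Points.
Variables (K : closedFieldType) (F : fieldType) (iota : {rmorphism K -> F}).
Variables (X : normal_variety iota) (d nu : nat) (degCl : {additive Cl X -> int}).
Variables (D0 : WDiv X) (f : 'I_nu -> F) (w : 'I_nu -> nat).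
Hypothesis S : cox_setting d degCl D0 f w.
Implicit Types (P Q : prime_divisor X) (D E : WDiv X) (G H : {mpoly K[nu]}) (i : 'I_(nchart X)).
Implicit Types (x : 'I_nu -> K).

Local Notation evf := (ev iota f).
Local Notation I := (tcs_ideal iota f w).
Local Notation xbar := (tcs iota f w).
Local Notation xhat := (tcs_hat iota f w).
Local Notation sec := (sec D0).

Lemma pihomogM n l G H : G \is whomog w n ->
  pihomog (mwt w) (n + l) (G * H) = G * pihomog (mwt w) l H.
Proof.
move=> hG; pose N := maxn l.+1 (mmeasure (mwt w) H).
rewrite {1}(@pihomog_partitionE _ _ (mwt w) N H) ?leq_maxr // mulr_sumr raddf_sum /=.
have lN : (l < N)%N by rewrite /N leq_max ltnSn.
rewrite (bigD1 (Ordinal lN)) //= pihomog_dE; last by apply: dhomogM => //; apply: pihomogP.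
rewrite big1 ?addr0 // => j jl; apply: (@pihomog_ne0 _ _ _ (n + j)%N); last first.
  by apply: dhomogM => //; apply: pihomogP.
by rewrite eqn_add2l; apply: contra jl => /eqP jl; apply/eqP/val_inj.
Qed.

Lemma pihomogM0 n l G H : G \is whomog w n -> (l < n)%N -> pihomog (mwt w) l (G * H) = 0.
Proof.
move=> hG ln; rewrite (@pihomog_partitionE _ _ (mwt w) (mmeasure (mwt w) H) H) //.
rewrite mulr_sumr raddf_sum /= big1 // => j _; apply: (@pihomog_ne0 _ _ _ (n + j)%N).
  by rewrite gtn_eqF // ltn_addr.
by apply: dhomogM => //; apply: pihomogP.
Qed.

Definition wgcd x : nat := \big[gcdn/0%N]_(j | x j != 0) w j.

Lemma wgcd_dvd x n G : G \is whomog w n -> G.@[x] != 0 -> (wgcd x %| n)%N.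
Proof.
move=> /dhomogP hG; rewrite mevalE => Gx.
have [m mG mx] : exists2 m, m \in msupp G & \prod_j x j ^+ m j != 0.
  apply: contrapT => H; move/eqP: Gx; apply; rewrite big_seq big1 // => m mG.
  have [->|mx] := eqVneq (\prod_j x j ^+ m j) 0; first by rewrite mulr0.
  by case: H; exists m.
have <- : mwt w m = n := hG _ mG.
apply: dvdn_sum => j _; have [xj|xj] := eqVneq (x j) 0; last first.
  by apply: dvdn_mull; apply: biggcdn_inf (dvdnn _).
suff -> : m j = 0%N by rewrite mul0n dvdn0.
apply/eqP; rewrite -leqn0 leqNgt; apply/negP => mj.
by case/negP: mx; apply/eqP; rewrite (bigD1 j) //= xj expr0n eqn0Ngt mj mul0r.
Qed.

Lemma wgcd_gt0 x : xhat x -> (0 < wgcd x)%N.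
Proof.
case=> _ [j xj]; rewrite lt0n; apply/eqP => g0.
have : (wgcd x %| w j)%N by apply: biggcdn_inf (dvdnn _).
by rewrite g0 dvd0n; have := cs_w S j; case: (w j).
Qed.

Lemma homog_value n x G H : xbar x -> G \is whomog w n -> H \is whomog w n ->
  evf G = evf H -> G.@[x] = H.@[x].
Proof.
move=> Xx hG hH e; apply/eqP; rewrite -subr_eq0 -mevalB; apply/eqP/Xx.
by apply/(@tcs_ideal_homog _ _ _ _ f w n); rewrite ?rpredB // evB e subrr.
Qed.

Lemma homog_value0 n x G : xbar x -> G \is whomog w n -> G.@[x] != 0 -> evf G != 0.
Proof.
move=> Xx hG Gx; apply/eqP => e; case/eqP: Gx.
by rewrite (homog_value Xx hG (rpred0 _)) ?ev0 // meval0.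
Qed.

(** Local ring of X at the image of a point of the total coordinate space. *)
Definition pt x : set F := [set a | exists n G H,
  [/\ G \is whomog w n, H \is whomog w n, H.@[x] != 0 & a = evf G / evf H]].

Lemma pt_local_ring x : xbar x -> (@fconst F) @^-1` tcs_local_ring iota f w x = pt x.
Proof.
move=> Xx; apply/seteqP; split=> a /=.
  case=> G [H [Hx e]].
  have [n Hnx] : exists n, (pihomog (mwt w) n H).@[x] != 0.
    apply: contrapT => nH; move/eqP: Hx; apply.
    rewrite (@pihomog_partitionE _ _ (mwt w) _ H (leqnn _)) raddf_sum big1 //= => n _.
    by apply: contrapT => /eqP h; apply: nH; exists n.
  have H0 : cox_eval iota f w H != 0.
    apply/eqP => h; move/eqP: Hnx; apply; apply: Xx.
    by apply: tcs_ideal_pihomog; rewrite /tcs_ideal.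
  exists n, (pihomog (mwt w) n G), (pihomog (mwt w) n H); split=> //; try exact: pihomogP.
  have Hn0 := homog_value0 Xx (pihomogP _ _ _) Hnx.
  move/(congr1 (fun z => z * cox_eval iota f w H)): e; rewrite divfK // /fconst !cox_evalE -rmorphM.
  move/eqP; rewrite tofrac_eq => /eqP/polyP/(_ n); rewrite coefCM !coef_cox_poly => e.
  by rewrite -e mulfK.
case=> n [G [H [hG hH Hx ->]]]; exists G, H; split=> //.
have H0 := homog_value0 Xx hH Hx.
rewrite !cox_evalE (cox_poly_homog _ _ hG) (cox_poly_homog _ _ hH).
have tH0 : tofrac (evf H *: 'X^n) != 0.
  by rewrite tofrac_eq0 scaler_eq0 negb_or H0 expf_neq0 // polyX_eq0.
apply: (mulIf tH0); rewrite divfK // /fconst -rmorphM; congr (tofrac _).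
by rewrite -mul_polyC mulrA -polyCM divfK // mul_polyC.
Qed.

Lemma pt_intro n x G H : G \is whomog w n -> H \is whomog w n -> H.@[x] != 0 ->
  pt x (evf G / evf H).
Proof. by move=> hG hH Hx; exists n, G, H. Qed.

Lemma pt_subring x : xbar x -> is_subring (pt x).
Proof.
move=> Xx; split.
- exists 0%N, 1, 1; split; try exact: dhomog1.
    by rewrite meval1 oner_neq0.
  by rewrite divff ?ev1 ?oner_neq0.
- move=> _ _ [n [G [H [hG hH Hx ->]]]] [n' [G' [H' [hG' hH' Hx' ->]]]].
  have H0 := homog_value0 Xx hH Hx; have H0' := homog_value0 Xx hH' Hx'.
  exists (n + n')%N, (G * H' - H * G'), (H * H'); split.
  + by apply: rpredB; apply: dhomogM.
  + exact: dhomogM.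
  + by rewrite mevalM mulf_neq0.
  + by rewrite evB !evM; field; rewrite H0 H0'.
- move=> _ _ [n [G [H [hG hH Hx ->]]]] [n' [G' [H' [hG' hH' Hx' ->]]]].
  exists (n + n')%N, (G * G'), (H * H'); split; try exact: dhomogM.
  + by rewrite mevalM mulf_neq0.
  + by rewrite !evM mulf_div.
Qed.

Lemma pt_scalars x c : pt x (iota c).
Proof.
exists 0%N, c%:MP, 1; split; try exact: dhomog1.
- by apply/dhomogP => m; rewrite msuppC; case: eqP => //= _; rewrite inE => /eqP->; apply: mwt0.
- by rewrite meval1 oner_neq0.
- by rewrite ev1 divr1 evC.
Qed.

Lemma pt_nonunitP x n G H : xbar x -> G \is whomog w n -> H \is whomog w n -> H.@[x] != 0 ->
  nonunits (pt x) (evf G / evf H) <-> G.@[x] = 0.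
Proof.
move=> Xx hG hH Hx; have H0 := homog_value0 Xx hH Hx.
split=> [[_ nun]|Gx].
  apply: contrapT => /eqP Gx; apply: nun; have G0 := homog_value0 Xx hG Gx.
  split; [by rewrite mulf_neq0 ?invr_eq0|exact: pt_intro hG hH Hx|].
  by rewrite invf_div; apply: pt_intro hH hG Gx.
split; first exact: pt_intro hG hH Hx.
case=> u0 _ [n' [G' [H' [hG' hH' Hx' e]]]].
have H0' := homog_value0 Xx hH' Hx'.
have [G0 _] : evf G != 0 /\ True by move: u0; rewrite mulf_eq0 negb_or => /andP[].
move: e; rewrite invf_div => /eqP; rewrite eqr_div // -!evM => /eqP e.
have := homog_value Xx (dhomogM hH hH') _ e; rewrite addnC => /(_ (dhomogM hG' hG)).
by rewrite !mevalM Gx mulr0 => /eqP; rewrite mulf_eq0 (negPf Hx) (negPf Hx').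
Qed.

Lemma pt_local x : xbar x -> proper_ideal (pt x) (nonunits (pt x)).
Proof.
move=> Xx; have SO := pt_subring Xx; split; first by move=> a [].
- split; first by split; [exact: subring0|case; rewrite eqxx].
  by case=> _; apply; apply: is_unit1.
- move=> a b na nb; have [n [G [H [hG hH Hx aE]]]] := na.1.
  have [n' [G' [H' [hG' hH' Hx' bE]]]] := nb.1.
  have H0 := homog_value0 Xx hH Hx; have H0' := homog_value0 Xx hH' Hx'.
  move: na nb; rewrite aE bE => /(pt_nonunitP Xx hG hH Hx) Gx /(pt_nonunitP Xx hG' hH' Hx') Gx'.
  have -> : evf G / evf H + evf G' / evf H' = evf (G * H' + H * G') / evf (H * H').
    by rewrite evD !evM; field; rewrite H0 H0'.
  apply/(@pt_nonunitP x (n + n')%N) => //; try by apply: dhomogM.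
  + by apply: rpredD; apply: dhomogM.
  + by rewrite mevalM mulf_neq0.
  + by rewrite mevalD !mevalM Gx Gx' mul0r mulr0 addr0.
- move=> a b Oa nb; have [n [G [H [hG hH Hx aE]]]] := Oa.
  have [n' [G' [H' [hG' hH' Hx' bE]]]] := nb.1.
  move: nb; rewrite aE bE => /(pt_nonunitP Xx hG' hH' Hx') Gx'.
  rewrite mulf_div -!evM; apply/(@pt_nonunitP x (n + n')%N) => //; try by apply: dhomogM.
  + by rewrite mevalM mulf_neq0.
  + by rewrite mevalM Gx' mulr0.
Qed.

Definition is_chart_poly i e (G : {mpoly K[nu]}) :=
  is_chart_eq D0 i e (evf G) /\ G \is whomog w e.

Lemma chart_polynomial i : exists e G, is_chart_poly i e G.
Proof.
have [e [s [e0 s0 sP]]] := chart_equation S i.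
have ce : is_chart_eq D0 i e s by split.
have [G hG sE] := sec_lift S (chart_eq_sec ce).
by exists e, G; split=> //; rewrite -sE.
Qed.

Lemma chart_fraction i e G k H : is_chart_poly i e G -> H \is whomog w (e * k) ->
  chart i (evf H / evf G ^+ k).
Proof.
move=> [ce hG] hH; have [_ s0 _] := ce; apply/(chart_secP _ ce); exists k.
by rewrite divfK ?expf_neq0 // -PoszM; apply: (sec_ev S).
Qed.

Lemma chart_fractionP i e G a : is_chart_poly i e G -> chart i a ->
  exists k H, H \is whomog w (e * k) /\ a = evf H / evf G ^+ k.
Proof.
move=> [ce hG] /(chart_secP _ ce)[k]; rewrite -PoszM => /(sec_lift S)[H hH e1].
have [_ s0 _] := ce.
by exists k, H; split=> //; rewrite -e1 mulfK // expf_neq0.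
Qed.

Lemma pt_in_chart i e Gs x : is_chart_poly i e Gs -> xbar x -> Gs.@[x] != 0 ->
  [/\ prime_ideal (chart i) [set a | chart i a /\ nonunits (pt x) a],
      maximal_ideal (chart i) [set a | chart i a /\ nonunits (pt x) a] &
      pt x = localization (chart i) [set a | chart i a /\ nonunits (pt x) a]].
Proof.
move=> cs Xx Gsx; have [[e0 s0 _] hGs] := cs.
have hGk k : Gs ^+ k \is whomog w (e * k) by apply: dhomogMn.
have Gkx k : (Gs ^+ k).@[x] != 0 by rewrite rmorphXn expf_neq0.
have AO : chart i `<=` pt x.
  move=> a /(chart_fractionP cs)[k [H [hH ->]]]; rewrite -evXn.
  exact: pt_intro hH (hGk k) (Gkx k).
have SA := chart_subring i; have SO := pt_subring Xx.
have [nsub [n0 n1] nD nM] := pt_local Xx.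
set m := [set a | _].
have pm : proper_ideal (chart i) m.
  split; first by move=> a [].
  - by split; [split=> //; apply: subring0|case].
  - by move=> a b [Aa na] [Ab nb]; split; [exact: subringD|exact: nD].
  - by move=> a b Aa [Ab nb]; split; [exact: subringM|apply: (nM) => //; apply: AO].
have Pm : prime_ideal (chart i) m.
  split=> // a b Aa Ab [_ nab]; apply: contrapT => /not_orP[na nb].
  case: nab => _; apply; apply: is_unitM => //; apply: contrapT => nun.
    by apply: na; split=> //; split=> //; apply: AO.
  by apply: nb; split=> //; split=> //; apply: AO.
have value b : chart i b -> exists c, m (b - iota c).
  move=> Ab; have [k [H [hH bE]]] := chart_fractionP cs Ab.
  pose c := H.@[x] / (Gs ^+ k).@[x]; exists c; split.
    by case: SA => _ AB _; apply: AB => //; apply: chart_scalars.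
  have Gk0 := homog_value0 Xx (hGk k) (Gkx k).
  have -> : b - iota c = evf (H - c *: Gs ^+ k) / evf (Gs ^+ k).
    by rewrite bE evB evZ evXn in Gk0 *; field.
  apply/(@pt_nonunitP x (e * k)%N) => //; first by rewrite rpredB ?rpredZ.
  by rewrite mevalB mevalZ /c divfK // subrr.
split=> //; first split=> //.
  move=> q [qA [q0 q1] qD qM] mq; apply/seteqP; split=> // b qb.
  have Ab := qA _ qb; have [c mc] := value b Ab.
  have [c0|c0] := eqVneq c 0; first by move: mc; rewrite c0 rmorph0 subr0.
  have ic0 : iota c != 0 by rewrite fmorph_eq0.
  exfalso; apply: q1; rewrite -(mulVf ic0) -fmorphV; apply: (qM); first exact: chart_scalars.
  have -> : iota c = b + - 1 * (b - iota c) by ring.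
  apply: (qD) => //; apply: (qM); last exact: mq.
  by apply: subringN => //; case: SA.
apply/seteqP; split=> [_ [n [G [H [hG hH Hx ->]]]]|_ [a [s [Aa As ms ->]]]]; last first.
  apply: subringM => //; first exact: AO.
  by apply: contrapT => nun; apply: ms; split=> //; split; [exact: AO|case].
have H0 := homog_value0 Xx hH Hx.
have sn0 : evf Gs ^+ n != 0 by rewrite expf_neq0.
exists (evf (G * H ^+ e.-1) / evf Gs ^+ n), (evf (H ^+ e) / evf Gs ^+ n).
have hHe : H ^+ e \is whomog w (e * n) by rewrite mulnC; apply: dhomogMn.
split.
- apply: (chart_fraction cs).
  have -> : (e * n = n + n * e.-1)%N by rewrite -{1}(prednK e0) mulSn mulnC.
  by apply: dhomogM => //; apply: dhomogMn.
- exact: (chart_fraction cs hHe).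
- case=> _; rewrite -evXn => /(@pt_nonunitP x (e * n)%N) h.
  by have /eqP := h Xx hHe (hGk n) (Gkx n); rewrite rmorphXn expf_eq0 (negPf Hx) andbF.
- rewrite -[in H ^+ e](prednK e0) exprS !evM.
  have Hk0 : evf (H ^+ e.-1) != 0 by rewrite evXn expf_neq0.
  by field; rewrite Hk0 H0 sn0.
Qed.

(** A valuation ring dominating the local ring of the point has a center in some
    chart by completeness, and the equation of that chart cannot vanish at the
    point. *)
Lemma hat_in_chart x : xhat x -> exists i e Gs, is_chart_poly i e Gs /\ Gs.@[x] != 0.
Proof.
move=> [Xx [j xj]].
have [V VV dV] := dominating_valuation (pt_subring Xx) (pt_scalars x) (pt_local Xx).
have [O [i sO] dO] := cs_complete S VV.
have [e [Gs cs]] := chart_polynomial i; exists i, e, Gs; split=> //.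
apply/eqP => Gsx; have [[e0 s0 _] hGs] := cs.
have AV : chart i `<=` V.
  case: sO => p Pp OE a Aa; apply: dO.1; rewrite OE.
  by apply: localization_sub => //; apply: chart_subring.
have hXe : ('X_j ^+ e : {mpoly K[nu]}) \is whomog w (e * w j).
  by rewrite [(e * w j)%N]mulnC; apply: dhomogMn; apply: whomogX.
have Xex : ('X_j ^+ e : {mpoly K[nu]}).@[x] != 0 by rewrite rmorphXn /= mevalXU expf_neq0.
have hGw : Gs ^+ w j \is whomog w (e * w j) by apply: dhomogMn.
have Vb : V (evf ('X_j ^+ e) / evf Gs ^+ w j) by apply: AV; apply: (chart_fraction cs hXe).
have nb : nonunits (pt x) (evf (Gs ^+ w j) / evf ('X_j ^+ e)).
  apply/(@pt_nonunitP x (e * w j)%N) => //; rewrite rmorphXn /= Gsx expr0n.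
  by have := cs_w S j; case: (w j).
case: nb => Ob; apply; split=> //.
  by rewrite mulf_neq0 ?invr_eq0 ?evXn ?expf_neq0 // evX; apply: cs_f0 S j.
by apply: dV.2 => //; rewrite invf_div [evf (Gs ^+ _)]evXn.
Qed.

Lemma pt_closed x : xhat x -> closed_points X (pt x).
Proof.
move=> hx; have [i [e [Gs [cs Gsx]]]] := hat_in_chart hx.
by have [_ mx ->] := pt_in_chart cs hx.1 Gsx; exists i; exists [set a | chart i a /\ nonunits (pt x) a].
Qed.

Lemma pt_point x : xhat x -> points X (pt x).
Proof.
move=> hx; have [i [e [Gs [cs Gsx]]]] := hat_in_chart hx.
by have [mx _ ->] := pt_in_chart cs hx.1 Gsx; exists i; exists [set a | chart i a /\ nonunits (pt x) a].
Qed.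

Lemma closed_points_points O : closed_points X O -> points X O.
Proof.
case=> i [p mp ->]; exists i; exists p => //; have [pp pmax] := mp.
have [pA [p0 p1] pD pM] := pp.
have [|//|q Pq pq] := @prime_ideal_above _ _ _ X i p; first by split.
suff -> : p = q by [].
by apply/esym/pmax => //; case: Pq.
Qed.

Lemma tcs_quotE x : xhat x -> tcs_quot X f w x = pt x.
Proof.
move=> hx; rewrite /tcs_quot pt_local_ring ?hx.1 //; last exact: hx.1.
apply: xget_unique; first by split; [exact: pt_closed|split].
move=> O [cO [OO dO]].
have [V VV dV] := dominating_valuation (pt_subring hx.1) (pt_scalars x) (pt_local hx.1).
apply: (points_unique VV (closed_points_points cO) (pt_point hx)) => //.
split=> [a /OO/dV.1//|a Oa Va]; apply: dO => //; apply: dV.2 => //; exact: OO.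
Qed.

(** The Nullstellensatz applies to the homogeneous ideal lying over the maximal
    ideal of the point. *)
Lemma closed_point_lift O : closed_points X O -> exists2 x, xhat x & O = pt x.
Proof.
case=> i [m mm OE]; have [e [Gs cs]] := chart_polynomial i.
have [[e0 s0 _] hGs] := cs; have [[mA [m0 m1] mD mM] mmax] := mm.
pose J G := forall H k, m (evf (pihomog (mwt w) (e * k) (G * H)) / evf Gs ^+ k).
have IJ : ring_ideal J.
  split.
  - by move=> H k; rewrite mul0r pihomog0 ev0 mul0r.
  - by move=> G G' JG JG' H k; rewrite mulrDl pihomogD evD mulrDl; apply: (mD).
  - by move=> G G' JG' H k; rewrite [G * G']mulrC -mulrA; apply: JG'.
have SI : forall G, I G -> J G.
  move=> G IG H k; have := tcs_ideal_pihomog (e * k) (ring_idealMr H (tcs_ideal_ideal iota f w) IG).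
  by move/(tcs_ideal_homog _ _ (pihomogP _ _ _)) => ->; rewrite mul0r.
have nJ k : ~ J (Gs ^+ k).
  move=> /(_ 1 k); rewrite mulr1 pihomog_dE; last exact: dhomogMn.
  by rewrite evXn divff ?expf_neq0.
have [x [Jx Gsx]] := nullstellensatz IJ nJ.
have Xx : xbar x by move=> G /SI/Jx.
have hx : xhat x.
  split=> //; apply: contrapT => H; have := wgcd_dvd hGs Gsx.
  rewrite /wgcd big_pred0 => [|j]; first by rewrite dvd0n eqn0Ngt e0.
  by apply/negbTE/negP => xj; apply: H; exists j.
exists x => //; have [Pn mn ptE] := pt_in_chart cs Xx Gsx.
rewrite OE ptE; congr localization; apply/esym/mmax; first by case: Pn.
move=> a ma; have Aa := mA _ ma; split=> //.
have [k [H [hH aE]]] := chart_fractionP cs Aa; rewrite aE -evXn.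
apply/(@pt_nonunitP x (e * k)%N) => //; first exact: dhomogMn.
  by rewrite rmorphXn expf_neq0.
apply: Jx => H' k'; have [lt|le] := ltnP k' k.
  by rewrite (pihomogM0 _ hH) ?ltn_pmul2l // ev0 mul0r.
rewrite -(subnKC le) mulnDr (pihomogM _ _ hH) evM exprD -mulf_div -aE.
rewrite mulrC; apply: (mM) => //; apply: (chart_fraction cs); exact: pihomogP.
Qed.

End Points.

(** * Local class groups, Picard group and ampleness *)

Lemma opposite_degrees (n : int) (h k m1 m2 : nat) :
  n + h%:Z * k%:Z = m1%:Z -> - n + h%:Z * k%:Z = m2%:Z -> (m1 + m2 = h * (k + k))%N.
Proof. by move=> *; lia. Qed.

Section ClassGroups.
Variables (K : closedFieldType) (F : fieldType) (iota : {rmorphism K -> F}).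
Variables (X : normal_variety iota) (d nu : nat) (degCl : {additive Cl X -> int}).
Variables (D0 : WDiv X) (f : 'I_nu -> F) (w : 'I_nu -> nat).
Hypothesis S : cox_setting d degCl D0 f w.
Implicit Types (P Q : prime_divisor X) (D E : WDiv X) (G H : {mpoly K[nu]}) (i : 'I_(nchart X)).
Implicit Types (x : 'I_nu -> K).

Local Notation evf := (ev iota f).
Local Notation xbar := (tcs iota f w).
Local Notation xhat := (tcs_hat iota f w).
Local Notation sec := (sec D0).
Local Notation pt := (pt iota f w).
Local Notation wgcd := (wgcd w).
Local Notation vord := (vord D0).
Local Notation dg := (dg degCl).

Lemma ord_frac n P a b : a != 0 -> b != 0 -> ord P (a / b) = vord n P a - vord n P b.
Proof. by move=> a0 b0; rewrite ordB //; [rewrite !vordE; ring|exact: pd_dvr]. Qed.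

Lemma chart_gens i : exists s : seq F, (forall a, a \in s -> chart i a) /\
  forall B : set F, is_subring B -> (forall c, B (iota c)) -> (forall a, a \in s -> B a) ->
  chart i `<=` B.
Proof.
have [[n [a AE]] _] := chart_affine i; exists (codom a); split.
  by move=> _ /codomP[l ->]; rewrite AE; exists 'X_l; rewrite // mmapX mmap1U.
move=> B SB KB aB; rewrite AE => _ [g _ <-].
rewrite /mmap; apply: (subring_sum _ SB) => m _; apply: (subringM SB (KB _)).
apply: (subring_prod _ SB) => l _; apply: (subringX _ SB); apply: aB; exact: codom_f.
Qed.

Lemma wgcd_combination x (n : int) : (wgcd x %| n)%Z ->
  exists a : 'I_nu -> int, (forall j, x j = 0 -> a j = 0) /\ \sum_j a j * (w j)%:Z = n.
Proof.
move=> /dvdzP[q ->].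
suff [a [a0 aE]] : exists a : 'I_nu -> int, (forall j, x j = 0 -> a j = 0) /\
    \sum_j a j * (w j)%:Z = wgcd x.
  exists (fun j => q * a j); split=> [j /a0->|]; first by rewrite mulr0.
  by rewrite -aE mulr_sumr; apply: eq_bigr => j _; rewrite mulrA.
rewrite /wgcd; pose Q (g : nat) := exists a : 'I_nu -> int, (forall j, x j = 0 -> a j = 0) /\
    \sum_j a j * (w j)%:Z = g%:Z.
apply: (big_ind Q).
- by exists (fun=> 0); split=> //; rewrite big1 // => j _; rewrite mul0r.
- move=> m m' [a [a0 aE]] [b [b0 bE]]; have [u [v e]] := Bezoutz m%:Z m'%:Z.
  exists (fun j => u * a j + v * b j); split=> [j xj|]; first by rewrite a0 // b0 // !mulr0.
  rewrite -[RHS]/(gcdz m%:Z m'%:Z) -e -aE -bE !mulr_sumr -big_split.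
  by apply: eq_bigr => j _; rewrite mulrDl !mulrA.
- move=> j xj; exists (fun k => (k == j)%:Z); split=> [k xk|].
    by case: eqP => // kj; rewrite -kj xk eqxx in xj.
  rewrite (bigD1 j) //= eqxx mul1r big1 ?addr0 // => k /negPf ->; exact: mul0r.
Qed.

Lemma vord_prod P (a : 'I_nu -> int) :
  vord (\sum_j a j * (w j)%:Z) P (\prod_j f j ^ a j) = \sum_j a j * vord (w j)%:Z P (f j).
Proof.
have dP := pd_dvr P; have f0 := cs_f0 S.
rewrite /vord (ord_prod dP) => [|j]; last by rewrite expfz_neq0.
rewrite mulr_sumr -big_split; apply: eq_bigr => j _.
by rewrite ordXz // mulrDr mulrC; congr (_ + _); ring.
Qed.

(** A monomial with integer exponents in the nonvanishing coordinates is
    invertible near the point and has any given multiple of the gcd as degree;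
    conversely all homogeneous polynomials that do not vanish at the point have
    degrees divisible by the gcd. *)
Lemma principal_nearP x D : xhat x -> D \in principal_near (pt x) <-> (wgcd x %| dg D)%Z.
Proof.
move=> hx; have Xx := hx.1; have f0 := cs_f0 S.
have [i [e [Gs [cs Gsx]]]] := hat_in_chart S hx; have [[e0 s0 sP] hGs] := cs.
have [gs [gsA gsB]] := chart_gens i.
have [_ _ ptE] := pt_in_chart S cs Xx Gsx; have [Pm _ _] := pt_in_chart S cs Xx Gsx.
have AO : chart i `<=` pt x by rewrite ptE; apply: localization_sub => //; apply: chart_subring.
have nearP P : (forall a, a \in gs -> (P : set F) a) -> vord e%:Z P (evf Gs) = 0.
  move=> H; rewrite sP asboolT //; apply: gsB H; [exact: pd_subring|exact: pd_scalars].
split=> [/asboolP[s sO [b b0 bP]]|/wgcd_combination[a [a0 aE]]]; last first.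
  have [c c0 cP] := divisor_degree S D.
  pose r j := evf Gs ^+ w j / f j ^+ e.
  apply/asboolP; exists (gs ++ [seq r j | j <- enum 'I_nu & x j != 0]).
    move=> z; rewrite mem_cat => /orP[/gsA/AO //|/mapP[j]].
    rewrite mem_filter => /andP[xj _] ->.
    have -> : r j = evf (Gs ^+ w j) / evf ('X_j ^+ e) by rewrite !evXn evX.
    apply: (@pt_intro _ _ _ _ _ _ (e * w j)%N); first exact: dhomogMn.
      by rewrite mulnC; apply: dhomogMn; apply: whomogX.
    by rewrite rmorphXn /= mevalXU expf_neq0.
  pose b := \prod_j f j ^ a j.
  have b0 : b != 0 by apply/prodf_neq0 => j _; rewrite expfz_neq0.
  exists (c / b) => [|P UP]; first by rewrite mulf_neq0 ?invr_eq0.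
  have sP0 : vord e%:Z P (evf Gs) = 0.
    by apply: nearP => z zg; apply: UP; rewrite mem_cat zg.
  have bP : vord (dg D) P b = 0.
    rewrite -aE vord_prod big1 // => j _; have [xj|xj] := eqVneq (x j) 0.
      by rewrite a0 // mul0r.
    have Pr : (P : set F) (r j).
      apply: UP; rewrite mem_cat; apply/orP; right; apply/mapP; exists j => //.
      by rewrite mem_filter xj mem_enum.
    have r0 : r j != 0 by rewrite mulf_neq0 ?invr_eq0 ?expf_neq0.
    have := (ord_ge0 (pd_dvr P) r0).2 Pr.
    have -> : ord P (r j) = vord e%:Z P (evf Gs) * (w j)%:Z - vord (w j)%:Z P (f j) * e%:Z.
      rewrite -!vordX // /r ordB ?expf_neq0 //; last exact: pd_dvr.
      by rewrite !vordE; ring.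
    have /secP := f_sec S (j:=j); rewrite f0 => /(_ isT)/(_ P); rewrite sP0 => g1 g2.
    by rewrite (_ : vord _ _ _ = 0) ?mulr0 //; nia.
  by rewrite cP (ord_frac (dg D)) // bP subr0.
have [c c0 cP] := divisor_degree S D; pose n := dg D.
(* an element of degree n without zeros or poles near x *)
pose q := c / b; have q0 : q != 0 by rewrite mulf_neq0 ?invr_eq0.
have qP P : (forall a, a \in s -> (P : set F) a) -> vord n P q = 0.
  move=> /bP; rewrite cP => h; rewrite -[n]addr0 -oppr0 vordM ?invr_eq0 //.
  by rewrite vordV // vord0 -h subrr.
have [h [H0 [hH0 H0x H0s]]] : exists h H0, [/\ H0 \is whomog w h, H0.@[x] != 0 &
    forall P, vord h%:Z P (evf H0) = 0 -> forall a, a \in s -> (P : set F) a].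
  elim: s sO {bP qP} => [|a s IHs] sO.
    exists e, Gs; split=> //.
  have [|h [H0 [hH0 H0x H0s]]] := IHs; first by move=> z zs; apply: sO; rewrite inE zs orbT.
  have [n' [G [H [hG hH Hx aE]]]] := sO a (mem_head _ _).
  exists (h + n')%N, (H0 * H); split; [exact: dhomogM|by rewrite mevalM mulf_neq0|].
  have H00 := homog_value0 Xx hH0 H0x; have H00' := homog_value0 Xx hH Hx.
  move=> P; rewrite evM PoszD vordM // => v0.
  have /secP := sec_ev S hH0; rewrite H00 => /(_ isT)/(_ P) v1.
  have /secP := sec_ev S hH; rewrite H00' => /(_ isT)/(_ P) v2.
  move: v0 => /eqP; rewrite paddr_eq0 // => /andP[/eqP v3 /eqP v4].
  move=> z; rewrite inE => /orP[/eqP->|]; last exact: H0s.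
  rewrite aE; have [G0|G0] := eqVneq (evf G) 0.
    by rewrite G0 mul0r; apply: subring0; apply: pd_subring.
  apply/(ord_ge0 (pd_dvr P)); first by rewrite mulf_neq0 ?invr_eq0.
  rewrite (ord_frac n'%:Z) // v4 subr0.
  have /secP := sec_ev S hG; rewrite G0 => /(_ isT); exact.
have H00 := homog_value0 Xx hH0 H0x.
have H0ge P : 0 <= vord h%:Z P (evf H0) by have /secP := sec_ev S hH0; rewrite H00 => /(_ isT).
have [k1 k1P] := @clear_poles _ _ _ X D0 n q h%:Z (evf H0) q0 H00 H0ge
  (fun P v0 => eq_ind_r (fun z => 0 <= z) (lexx 0) (qP P (H0s P v0))).
have q'0 : q^-1 != 0 by rewrite invr_eq0.
have q'P P : vord h%:Z P (evf H0) = 0 -> 0 <= vord (- n) P q^-1.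
  by move=> v0; rewrite vordV // qP ?oppr0 //; apply: H0s.
have [k2 k2P] := @clear_poles _ _ _ X D0 (- n) q^-1 h%:Z (evf H0) q'0 H00 H0ge q'P.
pose k := maxn k1 k2; have sk1 := k1P k (leq_maxl _ _); have sk2 := k2P k (leq_maxr _ _).
have Hk0 : evf H0 ^+ k != 0 by rewrite expf_neq0.
have := sec_degree_ge0 S sk1 (mulf_neq0 q0 Hk0); case e1: (n + _) => [m1|//] _.
have := sec_degree_ge0 S sk2 (mulf_neq0 q'0 Hk0); case e2: (- n + _) => [m2|//] _.
rewrite e1 in sk1; rewrite e2 in sk2.
have [G1 hG1 E1] := sec_lift S sk1; have [G2 hG2 E2] := sec_lift S sk2.
have G12 : (G1 * G2).@[x] = (H0 ^+ (k + k)).@[x].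
  have h12 : H0 ^+ (k + k) \is whomog w (m1 + m2).
    have -> : (m1 + m2 = h * (k + k))%N by exact: opposite_degrees e1 e2.
    exact: dhomogMn.
  apply: (homog_value Xx (dhomogM hG1 hG2) h12).
  by rewrite evM -E1 -E2 evXn exprD /q; field; rewrite b0 c0.
have G1x : G1.@[x] != 0.
  have : (G1 * G2).@[x] != 0 by rewrite G12 rmorphXn expf_neq0.
  by rewrite mevalM mulf_eq0 negb_or => /andP[].
have d1 := wgcd_dvd hG1 G1x; have d2 := wgcd_dvd hH0 H0x.
have -> : dg D = m1%:Z - h%:Z * k%:Z by rewrite -e1 addrK.
by rewrite rpredB // ?dvdz_mulr.
Qed.

Lemma local_Cl_order x : xhat x -> has_order (local_Cl X (pt x)) (wgcd x).
Proof.
move=> hx; apply: (@has_order_quot _ (principal_near (pt x)) (degCl \o @cl _ _ _ X) D0).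
- exact: (wgcd_gt0 S hx).
- exact: cs_gen S.
- by move=> D; apply: principal_nearP.
Qed.

(** The least positive common multiple; the product of all weights is one. *)
Lemma local_orders_lcm : exists N : nat, (0 < N)%N /\
  forall m : int, (N %| m)%Z <-> forall x, xhat x -> (wgcd x %| m)%Z.
Proof.
pose com m := forall x, xhat x -> (wgcd x %| m)%N.
have [|N [[N0 comN] Nmin]] := @ex_min_nat nat (fun m => (0 < m)%N /\ com m) id.
  exists (\prod_j w j)%N; split; first by rewrite prodn_gt0 // => j; apply: cs_w S j.
  move=> x [Xx [j xj]]; rewrite (bigD1 j) //=; apply: dvdn_mulr.
  by apply: biggcdn_inf (dvdnn _).
exists N; split=> // m; split=> [Nm x hx|mx].
  by apply: dvdz_trans Nm; apply: comN.
apply/dvdz_mod0P; have r0 : 0 <= (m %% N%:Z)%Z by apply: modz_ge0; lia.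
have rN : (m %% N%:Z)%Z < N%:Z by apply: ltz_pmod.
apply: contrapT => rn.
have cr : (0 < absz (m %% N%:Z)%Z)%N /\ com (absz (m %% N%:Z)%Z).
  split; first by move: rn r0; clear; lia.
  move=> x hx; have : (wgcd x %| m %% N%:Z)%Z; last by [].
  have e := divz_eq m N%:Z; have -> : (m %% N%:Z)%Z = m - (m %/ N%:Z)%Z * N%:Z.
    by rewrite {2}e addrAC subrr add0r.
  by rewrite rpredB ?mx // dvdz_mull //; apply: comN.
by have := Nmin _ cr; move: rN r0; clear; lia.
Qed.

Lemma cartierP N : (forall m : int, (N %| m)%Z <-> forall x, xhat x -> (wgcd x %| m)%Z) ->
  forall D, cartier D <-> (N %| dg D)%Z.
Proof.
move=> NP D; rewrite NP; split=> [cD x hx|H O /(closed_point_lift S)[x hx ->]].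
  by apply/(principal_nearP D hx)/cD; exact: (pt_closed S hx).
by apply/principal_nearP => //; apply: H.
Qed.

Lemma picard_index : exists (c : set F -> nat) (N : nat),
  [/\ forall O, closed_points X O -> has_order (local_Cl X O) (c O),
      has_order (Cl_mod_Pic X) N & is_lcm (closed_points X) c N].
Proof.
have [N [N0 NP]] := local_orders_lcm; have cN := cartierP NP.
have /choice[c cP] : forall O, exists n, closed_points X O ->
    exists x, [/\ xhat x, O = pt x & n = wgcd x].
  move=> O; have [cO|] := EM (closed_points X O); last by exists 0%N.
  by have [x hx OE] := closed_point_lift S cO; exists (wgcd x) => _; exists x.
exists c, N; split.
- by move=> O /cP[x [hx -> ->]]; apply: local_Cl_order.
- rewrite /Cl_mod_Pic; refine (@has_order_quot (Cl X) _ degCl (cl D0) N N0 (cs_gen S) _).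
  move=> z; split=> [/asboolP[D cD ->]|Nz]; first exact/(cN D).
  have [D zD] := cl_surj z; apply/asboolP; exists D => //.
  by apply/cN; rewrite dgE -zD.
- move=> m; have := NP m%:Z; rewrite /dvdz /= => ->; split=> [H O /cP[x [hx _ ->]]|H x hx].
    exact: H.
  have ptc := pt_closed S hx; have [y [hy pxy cx]] := cP _ ptc.
  suff -> : wgcd x = c (pt x) by apply: H.
  have e : (wgcd x %| wgcd y)%N /\ (wgcd y %| wgcd x)%N.
    split.
      have := (principal_nearP (D0 *~ (wgcd y)%:Z) hx); rewrite pxy dgMz (dgD0 S) mul1r => h.
      by apply/h; apply/principal_nearP => //; rewrite dgMz (dgD0 S) mul1r dvdzz.
    have := (principal_nearP (D0 *~ (wgcd x)%:Z) hx); rewrite pxy dgMz (dgD0 S) mul1r => h.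
    by have/h/(principal_nearP _ hy) := dvdzz (wgcd x); rewrite dgMz (dgD0 S) mul1r.
  by rewrite cx; apply/eqP; rewrite eqn_dvd e.1 e.2.
Qed.

Lemma exists_point : exists O, points X O.
Proof.
have VF : valuation_ring iota setT by split=> //; left.
by have [O pO _] := cs_complete S VF; exists O.
Qed.

(** Powers of the chart equations give affine nonvanishing loci in positive
    degree, while in degree zero the whole complete variety would be affine. *)
Lemma ampleP (c : Cl X) : ample c <-> 0 < degCl c.
Proof.
have [N [N0 NP]] := local_orders_lcm; have cN := cartierP NP.
split=> [[m [D [m0 cD cE aD]]]|c0].
  have dgD' : dg D = degCl c * m%:Z.
    by rewrite dgE cE raddfMn -mulr_natr natz.
  have [O pO] := exists_point; have [n [a [n0 a0 sa Oa [B affB nB]]]] := aD O pO.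
  have [b b0 bP] := divisor_degree S D.
  have vE P : ord P a + mult P (D *+ n) = vord (dg D * n%:Z) P (a * b ^+ n).
    rewrite multMn bP -[dg D * n%:Z]add0r vordM ?expf_neq0 // vordX // vord0.
    by rewrite -mulr_natr natz.
  have sab : sec (dg D * n%:Z) (a * b ^+ n).
    by apply/secP; [rewrite mulf_neq0 ?expf_neq0|move=> P; rewrite -vE; apply: sa => //; apply: pd_point].
  have := sec_degree_ge0 S sab; rewrite mulf_neq0 ?expf_neq0 // => /(_ isT) ge0.
  have: 0 <= degCl c by move: ge0; rewrite dgD'; nia.
  rewrite le_eqVlt => /orP[/eqP c0|//]; exfalso.
  rewrite dgD' -c0 !mul0r in sab vE; have [k kE] := sec_degree0 S sab.
  have k0 : iota k != 0 by rewrite -kE mulf_neq0 ?expf_neq0.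
  have allB P : B `<=` P.
    have : nonvanishing (D *+ n) a P.
      split; first exact: pd_point.
      by move=> Q _; rewrite vE kE vord0; apply: ord_scalar.
    rewrite nB => -[p Pp ->]; apply: localization_sub => //; exact: affine_subring affB.
  have Bc z : B z -> exists c, z = iota c.
    have [->|z0] := eqVneq z 0; first by exists 0; rewrite rmorph0.
    move=> Bz; apply: (sec_degree0 S); apply/secP => // P; rewrite vord0.
    by apply/(ord_ge0 (pd_dvr P)) => //; apply: allB.
  apply: (not_all_scalars S) => z; have [u [v [/Bc[b1 ->] /Bc[b2 ->] ->]]] := affB.2 z.
  by exists (b1 / b2); rewrite fmorph_div.
have [D cD] := cl_surj c.
have cED : cl (D *+ N) = c *+ N by rewrite cD /cl raddfMn.
have dgDN : dg (D *+ N) = degCl c * N%:Z by rewrite dgE cED raddfMn -mulr_natr natz.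
exists N, (D *+ N); split=> //; first by apply/cN; rewrite dgDN dvdz_mull.
move=> O [i sO]; have [e [s [e0 s0 sP]]] := chart_equation S i.
have [b b0 bP] := divisor_degree S (D *+ N).
pose l := (absz (degCl c) * N)%N.
have dgl : dg (D *+ N) = l%:Z by rewrite dgDN /l PoszM gez0_abs // ltW.
pose a := s ^+ l / b ^+ e.
have a0 : a != 0 by rewrite mulf_neq0 ?invr_eq0 ?expf_neq0.
have vE P : ord P a + mult P (D *+ N *+ e) = vord e%:Z P s * l%:Z.
  rewrite multMn bP (ord_frac (e%:Z * l%:Z)) ?expf_neq0 // vordX //.
  by rewrite [e%:Z * _]mulrC -dgl vordX // -mulr_natr natz dgl; ring.
have l0 : (0 < l)%N by rewrite /l; lia.
have nvE : nonvanishing (D *+ N *+ e) a = spec (chart i).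
  apply/seteqP; split=> O' /=.
    move=> [pO' nO']; apply: divisors_detect_chart => // P OP.
    have := nO' P OP; rewrite vE sP; case: asboolP => //= _; lia.
  move=> sO'; split; first by exists i.
  move=> P OP; rewrite vE sP asboolT ?mul0r //.
  case: sO' => p Pp OE z Az; apply: OP; rewrite OE; apply: localization_sub => //.
  exact: chart_subring.
exists e, a; split=> //.
- by move=> _ P _; rewrite vE sP; case: (~~ _); lia.
- by rewrite nvE.
- by rewrite nvE; exists (chart i) => //; apply: chart_affine.
Qed.

End ClassGroups.

(** * Dimensions of quotients *)

Section QuotientDimension.
Variables (K : fieldType).
Implicit Types (V : lmodType K).

Definition subspace V (Z : set V) := Z 0 /\ forall c u v, Z u -> Z v -> Z (c *: u + v).

Definition qdim V (Z B : set V) (n : nat) :=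
  exists e : 'I_n -> V, (forall i, Z (e i)) /\
    forall z, Z z -> exists! c : 'rV[K]_n, B (z - \sum_i c 0 i *: e i).

Section OneSpace.
Variables (V : lmodType K).
Implicit Types (Z B C : set V).

Lemma subspaceD Z u v : subspace Z -> Z u -> Z v -> Z (u + v).
Proof. by case=> _ H Zu Zv; rewrite -[u]scale1r; apply: H. Qed.

Lemma subspaceZ Z c u : subspace Z -> Z u -> Z (c *: u).
Proof. by case=> Z0 H Zu; rewrite -[_ *: _]addr0; apply: H. Qed.

Lemma subspaceN Z u : subspace Z -> Z u -> Z (- u).
Proof. by move=> SZ Zu; rewrite -scaleN1r; apply: subspaceZ. Qed.

Lemma subspaceB Z u v : subspace Z -> Z u -> Z v -> Z (u - v).
Proof. by move=> SZ Zu Zv; apply: subspaceD => //; apply: subspaceN. Qed.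

Lemma subspace_sum Z (I : Type) (r : seq I) (P : pred I) (u : I -> V) :
  subspace Z -> (forall i, P i -> Z (u i)) -> Z (\sum_(i <- r | P i) u i).
Proof.
by move=> SZ Zu; apply: big_ind => //; [case: SZ|move=> x y; apply: subspaceD].
Qed.

(** A coordinate map spares the choice of bases in dimension counts. *)
Lemma qdim_coord Z B n : subspace Z -> subspace B -> B `<=` Z ->
  qdim Z B n <-> exists c : V -> 'rV[K]_n, [/\
    forall a u v, Z u -> Z v -> c (a *: u + v) = a *: c u + c v,
    forall x, exists2 z, Z z & c z = x & forall z, Z z -> (c z = 0 <-> B z)].
Proof.
move=> SZ SB BZ; split=> [[e [Ze eP]]|[c [cL cS cK]]].
  have /choice[c cP] : forall z, exists c : 'rV[K]_n, Z z ->
      B (z - \sum_i c 0 i *: e i) /\ forall c' : 'rV[K]_n, B (z - \sum_i c' 0 i *: e i) -> c = c'.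
    move=> z; have [Zz|nZ] := EM (Z z); last by exists 0.
    by have [c [Bc cu]] := eP z Zz; exists c => _; split=> // c' /cu.
  have Zs (x : 'rV[K]_n) : Z (\sum_i x 0 i *: e i).
    by apply: subspace_sum => // i _; apply: subspaceZ.
  exists c; split.
  - move=> a u v Zu Zv; have Zuv : Z (a *: u + v) by case: SZ => _; apply.
    have [_ H] := cP _ Zuv; apply: H.
    have [Bu _] := cP u Zu; have [Bv _] := cP v Zv.
    have -> : a *: u + v - \sum_i (a *: c u + c v) 0 i *: e i =
        a *: (u - \sum_i c u 0 i *: e i) + (v - \sum_i c v 0 i *: e i).
      rewrite scalerBr addrACA -opprD; congr (_ - _).
      rewrite scaler_sumr -big_split; apply: eq_bigr => i _.
      by rewrite !mxE scalerDl scalerA.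
    by case: SB => _; apply.
  - move=> x; exists (\sum_i x 0 i *: e i) => //.
    by have [_ H] := cP _ (Zs x); apply: H; rewrite subrr; case: SB.
  - move=> z Zz; have [Bz cu] := cP z Zz; split=> [cz0|Bz'].
      by move: Bz; rewrite cz0 big1 ?subr0 // => i _; rewrite mxE scale0r.
    by apply: cu; rewrite big1 ?subr0 // => i _; rewrite mxE scale0r.
have c0 : c 0 = 0 by apply/(cK 0); [case: SZ|case: SB].
have cB u v : Z u -> Z v -> c (u - v) = c u - c v.
  move=> Zu Zv; rewrite -scaleN1r addrC cL // ?scaleN1r ?[- c v + _]addrC //.
have /choice[e eP] : forall i : 'I_n, exists z, Z z /\ c z = delta_mx 0 i.
  by move=> i; have [z Zz ez] := cS (delta_mx 0 i); exists z.
have Zs (x : 'rV[K]_n) : Z (\sum_i x 0 i *: e i).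
  by apply: subspace_sum => // i _; apply: subspaceZ => //; case: (eP i).
have cs (x : 'rV[K]_n) : c (\sum_i x 0 i *: e i) = x.
  rewrite [RHS]row_sum_delta.
  have [] : Z (\sum_i x 0 i *: e i) /\ c (\sum_i x 0 i *: e i) = \sum_i x 0 i *: delta_mx 0 i; last by [].
  elim/big_rec2: _ => [|i y1 y2 _ [Zy ey]]; first by split=> //; case: SZ.
  have [Zi ei] := eP i; split; first by case: SZ => _; apply.
  by rewrite cL // ei ey.
exists e; split=> [i|z Zz]; first by case: (eP i).
exists (c z); split.
  by apply/cK; [exact: subspaceB|rewrite cB // cs subrr].
move=> x Bx; have := (cK _ (subspaceB SZ Zz (Zs x))).2 Bx.
by rewrite cB // cs => /eqP; rewrite subr_eq0 => /eqP.
Qed.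

Lemma qdim_leq Z B n m : subspace Z -> subspace B -> B `<=` Z ->
  qdim Z B n -> (exists e : 'I_m -> V, (forall i, Z (e i)) /\ forall z, Z z -> exists a : 'rV[K]_m, B (z - \sum_i a 0 i *: e i)) ->
  (n <= m)%N.
Proof.
move=> SZ SB BZ /(qdim_coord _ SZ SB BZ)[c [cL cS cK]] [e [Ze eP]].
have c0 : c 0 = 0 by apply/(cK 0); [case: SZ|case: SB].
have cB u v : Z u -> Z v -> c (u - v) = c u - c v.
  move=> Zu Zv; rewrite -scaleN1r addrC cL // ?scaleN1r ?[- c v + _]addrC //.
pose M := \matrix_(i < m) c (e i).
have Zs (x : 'rV[K]_m) : Z (\sum_i x 0 i *: e i).
  by apply: subspace_sum => // i _; apply: subspaceZ.
have cs (x : 'rV[K]_m) : c (\sum_i x 0 i *: e i) = x *m M.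
  rewrite mulmx_sum_row.
  have [] : Z (\sum_i x 0 i *: e i) /\ c (\sum_i x 0 i *: e i) = \sum_i x 0 i *: row i M; last by [].
  elim/big_rec2: _ => [|i y1 y2 _ [Zy ey]]; first by split=> //; case: SZ.
  by split; [case: SZ => _; apply|rewrite cL // rowK ey].
have full : row_full M.
  rewrite -sub1mx; apply/row_subP => i; have [z Zz <-] := cS (row i 1%:M).
  have [a Ba] := eP z Zz; have := (cK _ (subspaceB SZ Zz (Zs a))).2 Ba.
  by rewrite cB // cs => /eqP; rewrite subr_eq0 => /eqP->; apply: submxMl.
by move: full; rewrite /row_full => /eqP <-; apply: rank_leq_row.
Qed.

Lemma qdim_uniq Z B n m : subspace Z -> subspace B -> B `<=` Z ->
  qdim Z B n -> qdim Z B m -> n = m.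
Proof.
move=> SZ SB BZ dn dm; apply/eqP; rewrite eqn_leq.
have span k : qdim Z B k -> exists e : 'I_k -> V, (forall i, Z (e i)) /\
    forall z, Z z -> exists a : 'rV[K]_k, B (z - \sum_i a 0 i *: e i).
  by case=> e [Ze eP]; exists e; split=> // z /eP[a [Ba _]]; exists a.
by rewrite (qdim_leq SZ SB BZ dn (span _ dm)) (qdim_leq SZ SB BZ dm (span _ dn)).
Qed.

Lemma qdim_split Z C B n : subspace Z -> subspace C -> subspace B ->
  B `<=` C -> C `<=` Z -> qdim Z B n ->
  exists a b, [/\ qdim C B a, qdim Z C b & (a + b = n)%N].
Proof.
move=> SZ SC SB BC CZ dZ; have BZ : B `<=` Z by move=> x /BC/CZ.
have /(qdim_coord _ SZ SB BZ)[c [cL cS cK]] := dZ.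
have cB u v : Z u -> Z v -> c (u - v) = c u - c v.
  move=> Zu Zv; rewrite -scaleN1r addrC cL // ?scaleN1r ?[- c v + _]addrC //.
pose W (x : 'rV[K]_n) := exists2 z, C z & c z = x.
have WL a x y : W x -> W y -> W (a *: x + y).
  move=> [u Cu <-] [v Cv <-]; exists (a *: u + v); first by case: SC => _; apply.
  by rewrite cL //; apply: CZ.
have W0 : W 0 by exists 0; [case: SC|apply/cK; [case: SZ|case: SB]].
have cC z : Z z -> W (c z) -> C z.
  move=> Zz [u Cu e]; rewrite -(subrK u z); apply: subspaceD => //; apply: BC.
  by apply/cK; [apply: subspaceB => //; exact: CZ|rewrite cB ?e ?subrr //; exact: CZ].
have [|M [MW Mmax]] := @ex_min_nat 'M[K]_n (fun M => forall i, W (row i M)) (fun M => n - \rank M)%N.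
  by exists 0 => i; rewrite row0.
have inM x : W x <-> (x <= M)%MS.
  split=> [Wx|/submxP[y ->]]; last first.
    by rewrite mulmx_sum_row; apply: big_rec => // i y' _ Wy; apply: (WL).
  apply: contrapT => /negP nx.
  pose M' := (M + x)%MS.
  have rows i : W (row i M').
    have : (row i M' <= M + x)%MS by apply: row_sub.
    move/sub_addsmxP => [[y1 y2] /= ->]; rewrite -[y1 *m M]scale1r; apply: (WL).
      by rewrite mulmx_sum_row; apply: big_rec => // j y' _ Wy; apply: (WL).
    rewrite (_ : y2 *m x = y2 0 0 *: x + 0); first by apply: (WL).
    by rewrite addr0 [y2]mx11_scalar mul_scalar_mx mxE eqxx mulr1n.
  have lt : (\rank M < \rank M')%N.
    rewrite ltn_neqAle mxrankS ?addsmxSl // andbT; apply: contraNneq nx => e.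
    apply: submx_trans (addsmxSr M x) _.
    by rewrite -(geq_leqif (mxrank_leqif_sup (addsmxSl M x))) -e.
  have := Mmax M' rows; have := rank_leq_row M'; lia.
pose r := \rank M; pose Bs := row_base M; pose Cp := (M^C)%MS; pose Bc := row_base Cp.
have dC : qdim C B r.
  apply/(qdim_coord _ SC SB BC); exists (fun z => c z *m pinvmx Bs); split.
  - by move=> a u v Cu Cv; rewrite cL ?mulmxDl ?scalemxAl //; apply: CZ.
  - move=> x; have [] : W (x *m Bs).
      by apply/inM; apply: submx_trans (submxMl _ _) _; rewrite eq_row_base.
    move=> z Cz e; exists z => //; rewrite e.
    by apply: (row_free_inj (row_base_free M)); rewrite mulmxKpV // submxMl.
  - move=> z Cz; rewrite -cK; last exact: CZ.
    have zM : (c z <= Bs)%MS by rewrite eq_row_base; apply/inM; exists z.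
    by split=> [e|->]; [rewrite -(mulmxKpV zM) e mul0mx|rewrite mul0mx].
have dI : (M :&: Cp = 0)%MS by apply: capmx_compl.
have dZC : qdim Z C (\rank Cp).
  apply/(qdim_coord _ SZ SC CZ).
  exists (fun z => c z *m proj_mx Cp M *m pinvmx Bc).
  have dI' : (Cp :&: M = 0)%MS by rewrite capmxC.
  have full (x : 'rV[K]_n) : (x <= Cp + M)%MS.
    by apply: submx_full; rewrite addsmxC addsmx_compl_full.
  split.
  - by move=> a u v Zu Zv; rewrite cL // !mulmxDl !scalemxAl.
  - move=> x; have [z Zz e] := cS (x *m Bc); exists z => //; rewrite e.
    have sub : (x *m Bc <= Cp)%MS by apply: submx_trans (submxMl _ _) _; rewrite eq_row_base.
    rewrite proj_mx_id //.
    by apply: (row_free_inj (row_base_free Cp)); rewrite mulmxKpV // submxMl.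
  - move=> z Zz; have sub : (c z *m proj_mx Cp M <= Bc)%MS by rewrite eq_row_base proj_mx_sub.
    split=> [e|Cz].
      apply: cC => //; apply/inM.
      have p0 : c z *m proj_mx Cp M = 0 by rewrite -(mulmxKpV sub) e mul0mx.
      have := proj_mx_compl_sub (full (c z)).
      by rewrite p0 subr0.
    have zM : (c z <= M)%MS by apply/inM; exists z.
    by rewrite proj_mx_0 ?mul0mx.
exists r, (\rank Cp); split=> //.
by rewrite /Cp mxrank_compl subnKC // rank_leq_col.
Qed.

End OneSpace.

Lemma qdim_iso V V' (phi : V -> V') (Z B : set V) (Z' B' : set V') n :
  subspace Z -> subspace B -> B `<=` Z -> subspace Z' -> subspace B' -> B' `<=` Z' ->
  (forall a u v, Z u -> Z v -> phi (a *: u + v) = a *: phi u + phi v) ->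
  (forall z, Z z -> Z' (phi z)) -> (forall z', Z' z' -> exists2 z, Z z & B' (z' - phi z)) ->
  (forall z, Z z -> (B z <-> B' (phi z))) ->
  qdim Z B n -> qdim Z' B' n.
Proof.
move=> SZ SB BZ SZ' SB' BZ' phiL phiZ phiS phiB [e [Ze eP]].
have phi0 : phi 0 = 0.
  have Z0 : Z 0 by case: SZ.
  by have := phiL (-1) 0 0 Z0 Z0; rewrite scaler0 addr0 scaleN1r addNr.
have phis (x : 'rV[K]_n) : Z (\sum_i x 0 i *: e i) /\
    phi (\sum_i x 0 i *: e i) = \sum_i x 0 i *: phi (e i).
  elim/big_rec2: _ => [|i y1 y2 _ [Zy ey]]; first by split=> //; case: SZ.
  by split; [case: SZ => _; apply|rewrite phiL // ey].
have phiB' u v : Z u -> Z v -> phi (u - v) = phi u - phi v.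
  by move=> Zu Zv; rewrite -scaleN1r addrC phiL // scaleN1r addrC.
exists (fun i => phi (e i)); split=> [i|z' Z'z]; first exact: phiZ.
have [z Zz B'z] := phiS z' Z'z; have [c [Bc cu]] := eP z Zz.
have equiv (x : 'rV[K]_n) : B (z - \sum_i x 0 i *: e i) <-> B' (z' - \sum_i x 0 i *: phi (e i)).
  have [Zx ex] := phis x; rewrite phiB; last exact: subspaceB.
  rewrite phiB' // ex; split=> H.
    by rewrite -(subrKA (phi z)); apply: subspaceD.
  rewrite (_ : phi z - _ = (z' - \sum_i x 0 i *: phi (e i)) - (z' - phi z)); first exact: subspaceB.
  by rewrite opprB [RHS]addrC subrKA.
by exists c; split=> [|x /equiv/cu //]; apply/equiv.
Qed.

End QuotientDimension.

(** * Hilbert functions and their growth *)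

Section HilbertFunction.
Variables (K : closedFieldType) (nu : nat) (w : 'I_nu -> nat).
Hypothesis w_gt0 : forall i, (0 < w i)%N.
Local Notation MP := {mpoly K[nu]}.
Local Notation pih := (pihomog (mwt w)).
Implicit Types (J N : MP -> Prop) (x u v g : MP).

Definition hideal J := ring_ideal J /\ forall n g, J g -> J (pih n g).
Definition addp J x : MP -> Prop := fun g => exists u, J (g - u * x).
Definition colon J x : MP -> Prop := fun g => J (g * x).

Lemma addp_ideal J x : ring_ideal J -> ring_ideal (addp J x).
Proof.
move=> [J0 JD JM]; split.
- by exists 0; rewrite mul0r subr0.
- by move=> g h [u ju] [v jv]; exists (u + v); rewrite mulrDl opprD addrACA; apply: JD.
- by move=> g h [u ju]; exists (g * u); rewrite -mulrA -mulrBr; apply: JM.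
Qed.

Lemma addp_sub J x g : J g -> addp J x g.
Proof. by exists 0; rewrite mul0r subr0. Qed.

Lemma addp_in J x u : ring_ideal J -> addp J x (u * x).
Proof. by case=> J0 _ _; exists u; rewrite subrr. Qed.

Lemma addpC J x y : addp (addp J x) y = addp (addp J y) x.
Proof.
suff H a b g : addp (addp J a) b g -> addp (addp J b) a g.
  by apply/funext => g; apply: propext; split; apply: H.
by case=> u [v H]; exists v, u; rewrite addrAC.
Qed.

Lemma colon_ideal J x : ring_ideal J -> ring_ideal (colon J x).
Proof.
move=> [J0 JD JM]; rewrite /colon; split; first by rewrite mul0r.
  by move=> g h; rewrite mulrDl; apply: JD.
by move=> g h; rewrite -mulrA; apply: JM.
Qed.

Lemma pihomogMr n l x u : x \is whomog w n -> pih (n + l) (u * x) = pih l u * x.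
Proof. by move=> hx; rewrite mulrC pihomogM // mulrC. Qed.

Lemma pihomogM0r n l x u : x \is whomog w n -> (l < n)%N -> pih l (u * x) = 0.
Proof. by move=> hx lt; rewrite mulrC (pihomogM0 _ hx). Qed.

Lemma addp_hideal J x a : x \is whomog w a -> hideal J -> hideal (addp J x).
Proof.
move=> hx [IJ HJ]; split=> [|n g [u ju]]; first exact: addp_ideal.
have [lt|le] := ltnP n a.
  by exists 0; rewrite mul0r subr0; have := HJ n _ ju; rewrite raddfB /= (pihomogM0r _ hx lt) subr0.
exists (pih (n - a) u); rewrite -(pihomogMr _ _ hx) subnKC // -raddfB; exact: HJ.
Qed.

Lemma colon_hideal J x a : x \is whomog w a -> hideal J -> hideal (colon J x).
Proof.
move=> hx [IJ HJ]; split=> [|n g]; first exact: colon_ideal.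
by rewrite /colon -(pihomogMr _ _ hx); apply: HJ.
Qed.

Definition piece n : set MP := [set g | g \is whomog w n].

Lemma piece_subspace n : subspace (piece n).
Proof. by split=> [|c u v hu hv]; [exact: rpred0|rewrite /piece /= rpredD ?rpredZ]. Qed.

Lemma ideal_piece_subspace J n : ring_ideal J -> subspace (piece n `&` J).
Proof.
move=> [J0 JD JM]; split; first by split=> //; exact: rpred0.
move=> c u v [hu Ju] [hv Jv]; split; first by case: (piece_subspace n) => _; apply.
by apply: JD => //; rewrite -mul_mpolyC; apply: JM.
Qed.

Definition monos n := [set m : 'X_{1..nu < n.+1} | mwt w m == n]%SET.
Definition nmon n := #|monos n|.

Lemma mdeg_mwt (m : 'X_{1..nu}) : (mdeg m <= mwt w m)%N.
Proof. by rewrite mdegE; apply: leq_sum => i _; rewrite leq_pmulr. Qed.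

Lemma homog_monos n g : g \is whomog w n -> g = \sum_(m in monos n) g@_m *: 'X_[m].
Proof.
move=> /dhomogP hg; rewrite {1}(@mpolywE _ _ n.+1 g); last first.
  rewrite msizeE; apply/bigmax_leqP_seq => m mg _; rewrite ltnS.
  by apply: leq_trans (mdeg_mwt m) _; rewrite (hg m mg).
rewrite [RHS]big_mkcond /=; apply: eq_bigr => m _; rewrite inE; case: ifP => // nm.
suff -> : g@_m = 0 by rewrite scale0r.
apply: memN_msupp_eq0; apply/negP => /hg e; by move/eqP: nm; apply.
Qed.

Lemma qdim_piece0 n : qdim (piece n) [set 0] (nmon n).
Proof.
have mon_hom (m : 'X_{1..nu < n.+1}) : m \in monos n -> ('X_[m] : MP) \is whomog w n.
  by rewrite inE dhomogX.
rewrite /nmon; pose mi (i : 'I_#|monos n|) : 'X_{1..nu < n.+1} := enum_val i.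
have mi_in i : mi i \in monos n by apply: enum_valP.
exists (fun i => 'X_[mi i]); split=> [i|g hg]; first exact: mon_hom.
have E (c : 'rV[K]_#|monos n|) : \sum_i c 0 i *: 'X_[mi i] = g <-> c = \row_i g@_(mi i).
  split=> [<-|->]; last first.
    rewrite [RHS](homog_monos hg) [RHS]big_enum_val.
    by apply: eq_bigr => i _; rewrite mxE.
  apply/rowP => i; rewrite mxE raddf_sum (bigD1 i) //= mcoeffZ mcoeffX eqxx mulr1.
  rewrite big1 ?addr0 // => j ji; rewrite mcoeffZ mcoeffX; case: eqP; rewrite ?mulr0 // => e.
  case/negP: ji; apply/eqP; apply: enum_val_inj; exact: val_inj.
exists (\row_i g@_(mi i)); split=> [|c] /=.
  by rewrite (_ : \sum_i _ = g) ?subrr //; apply/E.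
by move=> /eqP; rewrite subr_eq0 => /eqP/esym/E.
Qed.

Definition hf J n : nat := xget 0%N [set k | qdim (piece n) (piece n `&` J) k].

Lemma hf_unique J n k : ring_ideal J -> qdim (piece n) (piece n `&` J) k -> hf J n = k.
Proof.
move=> IJ dk; apply: xget_unique => // l dl.
by apply: (qdim_uniq (piece_subspace n) (ideal_piece_subspace n IJ) _ dl dk) => u [].
Qed.

Lemma hfP J n : ring_ideal J -> qdim (piece n) (piece n `&` J) (hf J n).
Proof.
move=> IJ; have S0 : subspace [set 0 : MP] by split=> // c u v -> ->; rewrite scaler0 addr0.
have [||a [b [_ db _]]] := qdim_split (piece_subspace n) (ideal_piece_subspace n IJ) S0 _ _ (qdim_piece0 n).
- by move=> _ ->; case: (ideal_piece_subspace n IJ).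
- by move=> u [].
by rewrite (hf_unique IJ db).
Qed.

Lemma hf0 n : hf (fun g => g = 0) n = nmon n.
Proof.
have I0 : ring_ideal (fun g => g = 0 :> MP).
  by split=> // [a b -> ->|a b ->]; rewrite ?addr0 ?mulr0.
apply: hf_unique => //; suff -> : piece n `&` (fun g => g = 0) = [set 0] by apply: qdim_piece0.
by apply/seteqP; split=> [u []|u ->] //; split=> //; apply: rpred0.
Qed.

Lemma hf_split J N n : ring_ideal J -> ring_ideal N -> (forall g, J g -> N g) ->
  exists2 k, qdim (piece n `&` N) (piece n `&` J) k & (k + hf N n = hf J n)%N.
Proof.
move=> IJ IN JN.
have [||a [b [da db ab]]] := qdim_split (piece_subspace n) (ideal_piece_subspace n IN)
   (ideal_piece_subspace n IJ) _ _ (hfP n IJ).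
- by move=> u [hu /JN].
- by move=> u [].
by exists a => //; rewrite (hf_unique IN db).
Qed.

Lemma hf_le J N n : ring_ideal J -> ring_ideal N -> (forall g, J g -> N g) -> (hf N n <= hf J n)%N.
Proof. by move=> IJ IN JN; have [k _ <-] := hf_split n IJ IN JN; rewrite leq_addl. Qed.

Lemma hf_lt J N n u : ring_ideal J -> ring_ideal N -> (forall g, J g -> N g) ->
  u \is whomog w n -> N u -> ~ J u -> (hf N n < hf J n)%N.
Proof.
move=> IJ IN JN hu Nu nJu; have [[|k] + <-] := hf_split n IJ IN JN; last by rewrite addSn ltnS leq_addl.
case=> e [_ /(_ u (conj hu Nu))[c [[_ Jc] _]]]; case: nJu.
by move: Jc; rewrite big_ord0 subr0.
Qed.

Lemma hf_full n : hf (fun=> True) n = 0%N.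
Proof.
apply: hf_unique => //; exists (fun=> 0); split=> [[]//|z hz].
by exists 0; split=> [|c _]; [rewrite big_ord0 subr0|apply/rowP => -[]].
Qed.

(** Multiplication by x identifies the part of degree n of S/(J:x) with the
    kernel of the quotient map from S/J to S/(J + x) in degree a + n. *)
Lemma hf_exact J x a n : x \is whomog w a -> hideal J ->
  hf J (a + n) = (hf (addp J x) (a + n) + hf (colon J x) n)%N.
Proof.
move=> hx HJ; have [IJ pJ] := HJ; have IC := colon_ideal x IJ; have IA := addp_ideal x IJ.
have [k dk <-] := hf_split (a + n) IJ IA (@addp_sub J x); rewrite addnC; congr (_ + _)%N.
apply: (qdim_uniq _ _ _ dk); try exact: ideal_piece_subspace.
  by move=> u [hu Ju]; split=> //; apply: addp_sub.
apply: (@qdim_iso _ _ _ (fun u => u * x) (piece n) (piece n `&` colon J x)) (hfP n IC).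
- exact: piece_subspace.
- exact: ideal_piece_subspace.
- by move=> u [].
- exact: ideal_piece_subspace.
- exact: ideal_piece_subspace.
- by move=> u [hu Ju]; split=> //; apply: addp_sub.
- by move=> c u v _ _; rewrite mulrDl scalerAl.
- move=> u hu; split; last exact: addp_in.
  by rewrite /piece /= addnC; apply: dhomogM.
- move=> z [hz [u ju]]; exists (pih n u); first exact: pihomogP.
  have E : z - pih n u * x = pih (a + n) (z - u * x).
    by rewrite raddfB /= (pihomogMr _ _ hx) [pih _ z]pihomog_dE.
  by rewrite E; split; [exact: pihomogP|exact: pJ].
- move=> u hu; split=> [[_ Ju]|[_ Ju]]; split=> //.
  by rewrite /piece /= addnC; apply: dhomogM.
Qed.

Lemma hf_small J x a n : x \is whomog w a -> hideal J -> (n < a)%N -> hf (addp J x) n = hf J n.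
Proof.
move=> hx [IJ pJ] lt; apply: hf_unique; first exact: addp_ideal.
suff -> : piece n `&` addp J x = piece n `&` J by apply: hfP.
apply/seteqP; split=> u [hu Ju]; split=> //; last exact: addp_sub.
case: Ju => v /(pJ n); rewrite raddfB /= (pihomogM0r _ hx lt) subr0 pihomog_dE //.
Qed.

(** Cumulative sums are monotone, so that their orders of growth behave like
    dimensions. *)
Definition cum (h : nat -> nat) m := (\sum_(i < m.+1) h i)%N.
Definition bigO p (h : nat -> nat) := exists C, forall m, (h m <= C * m.+1 ^ p)%N.

Lemma bigO_le p h h' : (forall m, h m <= h' m)%N -> bigO p h' -> bigO p h.
Proof. by move=> le [C H]; exists C => m; apply: leq_trans (le m) (H m). Qed.

Lemma leq_exp2r_weak m n p : (m <= n)%N -> (m ^ p <= n ^ p)%N.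
Proof. by case: p => // p le; rewrite leq_exp2r. Qed.

Lemma bigO_shift p a h h' : (forall m, h m <= h' (m + a))%N -> bigO p h' -> bigO p h.
Proof.
move=> le [C H]; exists (C * a.+1 ^ p)%N => m; apply: leq_trans (le m) _; apply: leq_trans (H _) _.
by rewrite -mulnA leq_mul2l -expnMn leq_exp2r_weak ?orbT //; nia.
Qed.

Lemma bigO_difference p a (b c : nat -> nat) : {homo c : m n / (m <= n)%N} ->
  (forall m, c (m + a) + b m <= b (m + a))%N -> bigO p.+1 b -> bigO p c.
Proof.
move=> mono cb [C H]; have L l m : (l * c m <= b (m + l * a))%N.
  elim: l => // l IHl; have := cb (m + l * a)%N; rewrite -addnA -mulSnr.
  have := mono m (m + l.+1 * a)%N (leq_addr _ _); rewrite !mulSn in IHl *; lia.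
exists (C * a.+1 ^ p.+1)%N => m; rewrite -(leq_pmul2l (ltn0Sn m)).
apply: leq_trans (L _ _) _; apply: leq_trans (H _) _.
rewrite [leqRHS]mulnCA -!mulnA leq_mul2l -expnS; apply/orP; right.
rewrite -expnMn; apply: leq_exp2r_weak; nia.
Qed.

Lemma bigO_difference0 a (b c : nat -> nat) : {homo c : m n / (m <= n)%N} ->
  (forall m, c (m + a) + b m <= b (m + a))%N -> bigO 0 b -> forall m, c m = 0%N.
Proof.
move=> mono cb [C H] m; have L l : (l * c m <= b (m + l * a))%N.
  elim: l => // l IHl; have := cb (m + l * a)%N; rewrite -addnA -mulSnr.
  have := mono m (m + l.+1 * a)%N (leq_addr _ _); rewrite !mulSn in IHl *; lia.
have := leq_trans (L C.+1) (H _); rewrite expn0 muln1; nia.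
Qed.

Lemma bigO_sum p a (b c : nat -> nat) : (0 < a)%N -> {homo c : m n / (m <= n)%N} ->
  (forall m, b (m + a) <= c (m + a) + b m)%N -> (forall m, (m < a)%N -> (b m <= c m)%N) ->
  bigO p c -> bigO p.+1 b.
Proof.
move=> a0 mono bc b0 [C H]; exists C => m.
suff le : (b m <= m.+1 * c m)%N.
  by apply: leq_trans le _; rewrite expnS mulnCA leq_mul2l H orbT.
elim/ltn_ind: m => m IHm; have [lt|le] := ltnP m a.
  by apply: leq_trans (b0 m lt) _; rewrite leq_pmull.
have lt : (m - a < m)%N by lia.
have := bc (m - a)%N; rewrite subnK // => h; have h1 := IHm _ lt.
have h2 := mono (m - a)%N m (leq_subr _ _); have h3 : ((m - a).+1 * c (m - a) <= m * c m)%N.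
  by apply: leq_mul => //; lia.
rewrite mulSn; lia.
Qed.

Lemma cum_exact J x a m : x \is whomog w a -> hideal J ->
  cum (hf J) (m + a) = (cum (hf (addp J x)) (m + a) + cum (hf (colon J x)) m)%N.
Proof.
move=> hx HJ; rewrite /cum -addSn addnC !big_split_ord /= -addnA -big_split /=.
congr (_ + _)%N; last by apply: eq_bigr => i _; rewrite (hf_exact _ hx HJ).
by apply: eq_bigr => i _; rewrite (hf_small hx HJ).
Qed.

Lemma cum_small J x a m : x \is whomog w a -> hideal J -> (m < a)%N ->
  cum (hf (addp J x)) m = cum (hf J) m.
Proof.
move=> hx HJ lt; apply: eq_bigr => i _; apply: (hf_small hx HJ).
exact: leq_trans (ltn_ord i) lt.
Qed.

Lemma cum_mono h : {homo cum h : m n / (m <= n)%N}.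
Proof.
move=> m n /subnKC <-; rewrite /cum -addSn big_split_ord /=; exact: leq_addr.
Qed.

Lemma cum_le h h' : (forall n, h n <= h' n)%N -> forall m, (cum h m <= cum h' m)%N.
Proof. by move=> le m; apply: leq_sum => i _. Qed.

Lemma growth_quotient J x a p : (0 < a)%N -> x \is whomog w a -> hideal J ->
  bigO p (cum (hf (addp J x))) -> bigO p.+1 (cum (hf J)).
Proof.
move=> a0 hx HJ; apply: (bigO_sum a0); first exact: cum_mono.
  move=> m; rewrite (cum_exact _ hx HJ) leq_add2l; apply: cum_le => n.
  by apply: hf_le; [case: HJ|apply: colon_ideal; case: HJ|move=> g Jg; apply: ring_idealMr Jg; case: HJ].
by move=> m lt; rewrite (cum_small hx HJ lt).
Qed.

Definition nzd J x := forall u, J (u * x) -> J u.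

Lemma colon_nzd J x : ring_ideal J -> nzd J x -> colon J x = J.
Proof.
move=> IJ zx; apply/funext => g; apply: propext; split; first exact: zx.
by move=> Jg; apply: ring_idealMr.
Qed.

Lemma growth_nzd J x a p : x \is whomog w a -> hideal J -> nzd J x ->
  bigO p.+1 (cum (hf J)) -> bigO p (cum (hf (addp J x))).
Proof.
move=> hx HJ zx; apply: (@bigO_difference _ a); first exact: cum_mono.
by move=> m; rewrite [leqRHS](cum_exact _ hx HJ) (colon_nzd _ zx) //; case: HJ.
Qed.

Definition posh x := exists2 a, (0 < a)%N & x \is whomog w a.

Fixpoint regseq J (xs : seq MP) : Prop :=
  if xs is x :: xs' then [/\ posh x, nzd J x & regseq (addp J x) xs'] else True.

Definition diff J N := fun n => (hf J n - hf N n)%N.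

Lemma cum_diff J N m : ring_ideal J -> ring_ideal N -> (forall g, J g -> N g) ->
  (cum (diff J N) m + cum (hf N) m = cum (hf J) m)%N.
Proof.
move=> IJ IN JN; rewrite /cum -big_split /=; apply: eq_bigr => i _.
by rewrite subnK // hf_le.
Qed.

(** Divide the submodule by powers of the first element until that element is
    regular modulo it; then the quotient by the element is a nonzero submodule
    with growth smaller by one order. *)
Lemma growth_submodule xs : forall J N p, hideal J -> hideal N -> (forall g, J g -> N g) ->
  (exists2 u, N u & ~ J u) -> regseq J xs -> bigO p (cum (diff J N)) -> (size xs <= p)%N.
Proof.
elim: xs => // x xs IHxs J N p HJ HN JN [u0 Nu0 nJu0] [[a a0 hx] zx reg] Op.
pose Nc c := iter c (colon^~ x) N.
have HNc c : hideal (Nc c) by elim: c => // c IHc; apply: (colon_hideal hx IHc).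
have NcS c g : Nc c g -> Nc c.+1 g by move=> Ng; apply: ring_idealMr => //; case: (HNc c).
have Ncle c c' g : (c <= c')%N -> Nc c g -> Nc c' g.
  by move/subnK <-; elim: (c' - c)%N => // l IHl /IHl; apply: NcS.
have JNc c g : J g -> Nc c g by move=> Jg; apply: (@Ncle 0%N c g (leq0n c)); apply: JN.
have Oc c : bigO p (cum (diff J (Nc c))).
  elim: c => [|c IHc]; first exact: Op.
  apply: (@bigO_shift _ a) IHc => m.
  have IJ : ring_ideal J by case: HJ.
  have e1 := cum_diff m IJ (HNc c.+1).1 (JNc c.+1).
  have e2 := cum_diff (m + a) IJ (HNc c).1 (JNc c).
  have e3 := cum_exact m hx HJ; rewrite (colon_nzd _ zx) // in e3.
  have e4 : cum (hf (Nc c)) (m + a) = (cum (hf (addp (Nc c) x)) (m + a) + cum (hf (Nc c.+1)) m)%N.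
    exact: cum_exact m hx (HNc c).
  have le : (cum (hf (addp (Nc c) x)) (m + a) <= cum (hf (addp J x)) (m + a))%N.
    apply: cum_le => n; apply: hf_le; try apply: addp_ideal => //; first by case: (HNc c).
    by move=> g [u ju]; exists u; apply: JNc.
  by move: le e1 e2 e3 e4; clear; lia.
have [c stab] : exists c, colon (Nc c) x = Nc c.
  have [|_ [[c ->] _ Mmax]] := @mpoly_max_ideal K nu (fun M => exists c, M = Nc c) (Nc 0%N) _ (ex_intro _ 0%N erefl).
    by move=> _ [c ->]; case: (HNc c).
  exists c; apply/funext => g; apply: propext; split; last exact: NcS.
  by apply: (Mmax (Nc c.+1)); [exists c.+1|exact: NcS].
have := Oc c; have := HNc c; have := JNc c; have nN : exists2 u, Nc c u & ~ J u.
  by exists u0 => //; exact: (@Ncle 0%N c u0 (leq0n c) Nu0).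
move: (Nc c) stab nN => M stab [u1 Mu1 nJu1] JM HM OM.
have IJ : ring_ideal J by case: HJ.
have IM : ring_ideal M by case: HM.
have zM : nzd M x by move=> u Mu; rewrite -stab.
have HJx := addp_hideal hx HJ; have HMx := addp_hideal hx HM.
have JMx g : addp J x g -> addp M x g by case=> u ju; exists u; apply: JM.
have strict : exists2 u, addp M x u & ~ addp J x u.
  apply: contrapT => H.
  have sub g : M g -> addp J x g.
    by move=> Mg; apply: contrapT => ng; apply: H; exists g => //; apply: addp_sub.
  have hom n g : g \is whomog w n -> M g -> J g.
    elim/ltn_ind: n g => n IHn g hg Mg; have [u ju] := sub g Mg.
    have [lt|le] := ltnP n a.
      by have := HJ.2 n _ ju; rewrite raddfB /= (pihomogM0r _ hx lt) subr0 pihomog_dE.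
    have := HJ.2 n _ ju; rewrite raddfB /= pihomog_dE // -{1}(subnKC le) pihomogMr // => ju'.
    have Mu : M (pih (n - a) u).
      apply: zM; rewrite -[X in M X](subKr g); apply: ring_idealB => //; exact: JM.
    rewrite -(subrK (pih (n - a) u * x) g); case: (IJ) => _ JD JMl; apply: JD => //.
    by apply: ring_idealMr => //; apply: (IHn (n - a)%N) => //; [lia|exact: pihomogP].
  apply: nJu1; rewrite (@pihomog_partitionE _ _ (mwt w) _ u1 (leqnn _)).
  by apply: ring_ideal_sum => // i _; apply: hom (pihomogP _ _ _) _; apply: HM.2.
have mono : {homo cum (diff (addp J x) (addp M x)) : m n / (m <= n)%N} by apply: cum_mono.
have rel m : (cum (diff (addp J x) (addp M x)) (m + a) + cum (diff J M) m <= cum (diff J M) (m + a))%N.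
  have e1 := cum_diff m IJ IM JM; have e2 := cum_diff (m + a) IJ IM JM.
  have e3 := cum_exact m hx HJ; rewrite (colon_nzd _ zx) // in e3.
  have e4 := cum_exact m hx HM; rewrite stab in e4.
  have e5 := cum_diff (m + a) HJx.1 HMx.1 JMx; lia.
case: p Op Oc OM => [|p] _ _ OM.
  exfalso; have z := bigO_difference0 mono rel OM.
  have [u Mu nJu] := strict.
  have [n [Mn nJn]] : exists n, addp M x (pih n u) /\ ~ addp J x (pih n u).
    apply: contrapT => H; apply: nJu.
    rewrite (@pihomog_partitionE _ _ (mwt w) _ u (leqnn _)).
    apply: ring_ideal_sum; [by case: HJx|move=> i _; apply: contrapT => nJ].
    by apply: H; exists i; split=> //; apply: HMx.2.
  have lt := hf_lt HJx.1 HMx.1 JMx (pihomogP _ _ _) Mn nJn.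
  have := z n; rewrite /cum big_ord_recr /= /diff; lia.
exact: IHxs HJx HMx JMx strict reg (bigO_difference mono rel OM).
Qed.

End HilbertFunction.

(** * Regular sequences *)

Section RegularSequences.
Variables (K : closedFieldType) (nu : nat) (w : 'I_nu -> nat).
Hypothesis w_gt0 : forall i, (0 < w i)%N.
Hypothesis charK : [pchar K] =i pred0.
Local Notation MP := {mpoly K[nu]}.
Local Notation pih := (pihomog (mwt w)).
Local Notation posh := (posh w).
Local Notation regseq := (regseq w).
Local Notation hideal := (hideal w).
Local Notation hf := (hf w).
Implicit Types (J N : MP -> Prop) (x u v g : MP).

Definition maxann J u := ~ J u /\
  forall v, ~ J v -> (forall g, J (g * u) -> J (g * v)) -> forall g, J (g * v) -> J (g * u).

Lemma maxann_above J v : ring_ideal J -> ~ J v ->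
  exists2 u, maxann J u & forall g, J (g * v) -> J (g * u).
Proof.
move=> IJ nv; pose Fam (M : MP -> Prop) := exists2 u, ~ J u & M = colon J u.
have [|_ [[u nu' ->] vu umax]] := @mpoly_max_ideal K nu Fam (colon J v) _ (ex_intro2 _ _ v nv erefl).
  by move=> _ [u _ ->]; apply: colon_ideal.
exists u => //; split=> // z nz uz; apply: (umax (colon J z)) => //; by exists z.
Qed.

Lemma maxann_prime J u a b : ring_ideal J -> maxann J u ->
  J (a * b * u) -> J (a * u) \/ J (b * u).
Proof.
move=> IJ [nu' umax] Jab; have [|nb] := EM (J (b * u)); first by right.
left; apply: (umax (b * u)) => //; last by rewrite mulrA.
by move=> g Jg; rewrite mulrCA; case: IJ => _ _; apply.
Qed.

(** Finiteness of associated primes: the elements with maximal annihilator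
    generate, up to J, an ideal generated by finitely many of them. *)
Lemma finite_maxann J : ring_ideal J -> exists m (u : nat -> MP),
  (forall i, (i < m)%N -> maxann J (u i)) /\
  forall v, ~ J v -> exists2 i, (i < m)%N & forall g, J (g * v) -> J (g * u i).
Proof.
move=> IJ; have [J0 JD JM] := IJ.
pose span m (u : nat -> MP) : MP -> Prop := fun g => exists a : nat -> MP, J (g - \sum_(i < m) a i * u i).
have span_ideal m (u : nat -> MP) : ring_ideal (span m u).
  split.
  - by exists (fun=> 0); rewrite big1 ?subrr // => i _; rewrite mul0r.
  - move=> g h [a ja] [b jb]; exists (fun i => a i + b i).
    rewrite (eq_bigr (fun i : 'I_m => a i * u i + b i * u i)); last by move=> i _; rewrite mulrDl.
    by rewrite big_split opprD addrACA; apply: JD.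
  - move=> g h [a ja]; exists (fun i => g * a i).
    rewrite (eq_bigr (fun i : 'I_m => g * (a i * u i))); last by move=> i _; rewrite mulrA.
    by rewrite -mulr_sumr -mulrBr; apply: JM.
pose Fam (M : MP -> Prop) := exists m (u : nat -> MP), (forall i, (i < m)%N -> maxann J (u i)) /\ M = span m u.
have [||M [[m [u [um ->]]] _ Mmax]] := @mpoly_max_ideal K nu Fam (span 0%N (fun=> 0)).
- by move=> _ [m [u [_ ->]]]; apply: span_ideal.
- by exists 0%N, (fun=> 0).
exists m, u; split=> // v nv; have [z zm vz] := maxann_above IJ nv.
have [a Ja] : span m u z.
  apply: (Mmax (span m.+1 (fun i => if (i < m)%N then u i else z))).
  - exists m.+1, (fun i => if (i < m)%N then u i else z); split=> // i _.
    by case: ifP => // /um.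
  - move=> g [b jb]; exists (fun i => if (i < m)%N then b i else 0).
    rewrite big_ord_recr /= ltnn mul0r addr0.
    by rewrite (eq_bigr (fun i : 'I_m => b i * u i)) // => i _; rewrite ltn_ord.
  - exists (fun i => if (i < m)%N then 0 else 1).
    rewrite big_ord_recr /= ltnn mul1r big1 ?add0r ?subrr // => i _.
    by rewrite ltn_ord mul0r.
apply: contrapT => H.
have /choice[b bP] : forall i : 'I_m, exists b, J (b * u i) /\ ~ J (b * z).
  move=> i; apply: contrapT => nb; apply: H; exists i; rewrite ?ltn_ord // => g /vz.
  apply: (um i (ltn_ord i)).2; first by case: zm.
  by move=> h Jh; apply: contrapT => nh; apply: nb; exists h.
have : J ((\prod_i b i) * z).
  rewrite -(subrK (\sum_(i < m) a i * u i) z) mulrDr; apply: JD; first exact: JM.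
  rewrite mulr_sumr; apply: ring_ideal_sum => // i _.
  rewrite (bigD1 i) //=; set Q := \prod_(_ | _) _.
  have -> : b i * Q * (a i * u i) = Q * a i * (b i * u i) by ring.
  by apply: JM; case: (bP i).
have : forall r : seq 'I_m, ~ J ((\prod_(i <- r) b i) * z); last by apply.
elim=> [|i r IHr]; first by rewrite big_nil mul1r; case: zm.
by rewrite big_cons => /(maxann_prime IJ zm)[|//]; case: (bP i).
Qed.

Definition nosoc J := forall u, (forall i, J ('X_i * u)) -> J u.

Lemma posh_multiple J x u : ring_ideal J -> posh x -> (forall i, J ('X_i * u)) -> J (x * u).
Proof.
move=> IJ [a a0 /dhomogP hx] Ju; rewrite [x]mpolyE mulr_suml big_seq.
apply: ring_ideal_sum => // m mx; have [i mi] : exists i, (0 < m i)%N.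
  apply: contrapT => H; have : mwt w m = a := hx m mx; have -> : m = 0%MM.
    apply/mnmP => i; rewrite mnm0E; apply/eqP; rewrite -leqn0 leqNgt; apply/negP => mi.
    by apply: H; exists i.
  by rewrite mwt0 => e; rewrite -e in a0.
have -> : m = (m - U_(i) + U_(i))%MM by rewrite submK // lep1mP -lt0n.
by rewrite mpolyXD scalerAl -mulrA; case: IJ => _ _; apply.
Qed.

Lemma posh_nosoc J x : ring_ideal J -> posh x -> nzd J x -> nosoc J.
Proof. by move=> IJ px zx u Ju; apply: zx; rewrite mulrC; apply: posh_multiple. Qed.

Lemma nosocX J k u : ring_ideal J -> nosoc J -> (forall i : 'I_nu, J ('X_i ^+ k i * u)) -> J u.
Proof.
move=> IJ ns Ju; have [_ _ JM] := IJ; apply: contrapT => nJu.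
pose E (m : 'X_{1..nu}) := ~ J ('X_[m] * u) /\ forall i, (m i <= k i)%N.
have [|m [[nm mk] mmax]] := @ex_min_nat _ E (fun m => (\sum_i k i) - mdeg m)%N.
  by exists 0%MM; split=> [|i]; rewrite ?mpolyX0 ?mul1r ?mnm0E.
apply: nm; apply: ns => i; rewrite mulrA; apply: contrapT => nXi.
have e : 'X_i * 'X_[m] = 'X_[(U_(i) + m)] :> MP by rewrite mpolyXD.
rewrite e in nXi.
have mki : (m i < k i)%N.
  rewrite ltn_neqAle mk andbT; apply/eqP => mi; apply: nXi.
  have -> : (U_(i) + m = (U_(i) + (m - U_(i) *+ k i)) + U_(i) *+ k i)%MM.
    rewrite -addmA submK //; apply/mnm_lepP => j; rewrite mulmnE mnm1E.
    by case: eqP => [<-|_]; rewrite ?mul1n ?mul0n // mi.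
  by rewrite mpolyXD -mulrA; apply: JM; rewrite -mpolyXn; apply: Ju.
have Em : E (U_(i) + m)%MM.
  split=> // j; rewrite mnmDE mnm1E; case: eqP => [<-|_]; rewrite ?add1n ?add0n //.
have := mmax _ Em; rewrite mdegD mdeg1.
have : (mdeg (U_(i) + m) <= \sum_j k j)%N by rewrite mdegE; apply: leq_sum => j _; case: Em.
rewrite mdegD mdeg1; lia.
Qed.

Let ell := (\prod_i w i)%N.
Let ee (i : 'I_nu) := (ell %/ w i)%N.

Definition theta (s : K) : MP := \sum_(i < nu) s ^+ i *: 'X_i ^+ ee i.

Lemma theta_posh s : posh (theta s).
Proof.
exists ell; first by apply: prodn_gt0.
apply: rpred_sum => i _; apply: rpredZ.
have -> : ell = (w i * ee i)%N by rewrite mulnC divnK // /ell (bigD1 i) //= dvdn_mulr.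
by apply: dhomogMn; apply: whomogX.
Qed.

Lemma vandermonde_span J (rs : 'I_nu -> K) u : ring_ideal J -> injective rs ->
  (forall l, J (theta (rs l) * u)) -> forall i, J ('X_i ^+ ee i * u).
Proof.
move=> IJ inj Jt i; pose V := Vandermonde nu (\row_l rs l).
have UV : V \in unitmx.
  rewrite unitmxE det_Vandermonde unitfE; apply/prodf_neq0 => k _; apply/prodf_neq0 => l kl.
  by rewrite !mxE subr_eq0; apply/eqP => /inj e; rewrite e ltnn in kl.
have -> : 'X_i ^+ ee i * u = \sum_l (invmx V l i *: (theta (rs l) * u)).
  rewrite (eq_bigr (fun l => (invmx V l i *: theta (rs l)) * u)); last by move=> l _; rewrite scalerAl.
  rewrite -mulr_suml; congr (_ * _); rewrite /theta.
  rewrite (eq_bigr (fun l => \sum_j (V j l * invmx V l i) *: 'X_j ^+ ee j)); last first.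
    by move=> l _; rewrite scaler_sumr; apply: eq_bigr => j _; rewrite scalerA !mxE mulrC.
  rewrite exchange_big /= (bigD1 i) //= -scaler_suml.
  have E j : \sum_l V j l * invmx V l i = (j == i)%:R.
    by have := congr1 (fun M : 'M_nu => M j i) (mulmxV UV); rewrite !mxE.
  rewrite E eqxx scale1r big1 ?addr0 // => j ji.
  by rewrite -scaler_suml E (negPf ji) scale0r.
apply: ring_ideal_sum => // l _; rewrite -mul_mpolyC; by case: IJ => _ _; apply.
Qed.

Lemma theta_bad J : ring_ideal J -> nosoc J -> exists B : nat,
  forall rs : seq K, uniq rs -> (forall s, s \in rs -> ~ nzd J (theta s)) -> (size rs <= B)%N.
Proof.
move=> IJ ns; have [m [u [um uP]]] := finite_maxann IJ; exists (m * nu)%N => rs Urs bad.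
pose bad_at i s := `[< J (theta s * u i) >].
have few i : (i < m)%N -> (count (bad_at i) rs <= nu)%N.
  move=> im; rewrite -size_filter leqNgt; apply/negP => lt.
  have := (um i im).1; apply; apply: (nosocX (k := ee)) => // j.
  set t := filter _ _ in lt; have Ut : uniq t by apply: filter_uniq.
  apply: (@vandermonde_span J (fun l : 'I_nu => nth 0 t l)) => //.
    move=> k l /eqP; rewrite nth_uniq //; first by move=> /eqP/val_inj.
      exact: ltn_trans (ltn_ord k) lt.
    exact: ltn_trans (ltn_ord l) lt.
  move=> l; have : nth 0 t l \in t by rewrite mem_nth // (ltn_trans (ltn_ord l) lt).
  by rewrite mem_filter => /andP[/asboolP].
have le : (size rs <= \sum_(i < m) count (bad_at i) rs)%N.
  elim: rs Urs bad {few} => [|s rs IHrs] /= ; first by rewrite big1.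
  move=> /andP[_ Urs] bad; rewrite big_split /= -add1n; apply: leq_add; last first.
    by apply: IHrs => // z zs; apply: bad; rewrite inE zs orbT.
  have [v [Jv nv]] : exists v, J (theta s * v) /\ ~ J v.
    apply: contrapT => H; apply: (bad s (mem_head _ _)) => v Jv.
    by apply: contrapT => nv; apply: H; exists v; rewrite mulrC.
  have [i im iP] := uP v nv; rewrite (bigD1 (Ordinal im)) //=.
  by rewrite /bad_at asboolT //; apply: iP.
apply: leq_trans le _; have -> : (m * nu = \sum_(i < m) nu)%N by rewrite sum_nat_const card_ord.
by apply: leq_sum => i _; apply: few.
Qed.

(** By the Vandermonde determinant only finitely many of the power sums are zero
    divisors modulo an ideal without socle, and the field is infinite. *)
Lemma generic_regular J1 J2 J3 : ring_ideal J1 -> ring_ideal J2 -> ring_ideal J3 ->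
  nosoc J1 -> nosoc J2 -> nosoc J3 ->
  exists x, [/\ posh x, nzd J1 x, nzd J2 x & nzd J3 x].
Proof.
move=> I1 I2 I3 n1 n2 n3.
have [B1 H1] := theta_bad I1 n1; have [B2 H2] := theta_bad I2 n2; have [B3 H3] := theta_bad I3 n3.
pose rs : seq K := [seq i%:R | i <- iota 0 (B1 + B2 + B3).+1].
have Urs : uniq rs.
  rewrite map_inj_uniq ?iota_uniq // => i j e.
  wlog ij : i j e / (i <= j)%N.
    by have [le|/ltnW le] := leqP i j => [/(_ i j e le)|/(_ j i (esym e) le) ->].
  have /eqP : (j - i)%:R = 0 :> K by rewrite natrB // e subrr.
  by rewrite (pcharf0P _).1 // => h; apply/eqP; rewrite eqn_leq ij /= -subn_eq0.
apply: contrapT => H.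
pose b1 s := `[< ~ nzd J1 (theta s) >]; pose b2 s := `[< ~ nzd J2 (theta s) >].
pose b3 s := `[< ~ nzd J3 (theta s) >].
have c1 : (count b1 rs <= B1)%N.
  by rewrite -size_filter; apply: H1; rewrite ?filter_uniq // => s; rewrite mem_filter => /andP[/asboolP].
have c2 : (count b2 rs <= B2)%N.
  by rewrite -size_filter; apply: H2; rewrite ?filter_uniq // => s; rewrite mem_filter => /andP[/asboolP].
have c3 : (count b3 rs <= B3)%N.
  by rewrite -size_filter; apply: H3; rewrite ?filter_uniq // => s; rewrite mem_filter => /andP[/asboolP].
have all : (size rs <= count b1 rs + count b2 rs + count b3 rs)%N.
  elim: rs {Urs c1 c2 c3} => //= s rs; suff : [|| b1 s, b2 s | b3 s].
    by case: (b1 s); case: (b2 s); case: (b3 s) => //=; lia.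
  rewrite -[X in is_true X]negbK; apply/negP => /norP[/asboolPn/contrapT z1].
  move=> /norP[/asboolPn/contrapT z2 /asboolPn/contrapT z3].
  by apply: H; exists (theta s); split=> //; apply: theta_posh.
move: all; rewrite size_map size_iota; lia.
Qed.

(** Depth does not depend on the first element of a regular sequence. *)
Lemma regular_exchange k : forall J ys x, ring_ideal J -> regseq J ys -> size ys = k ->
  posh x -> nzd J x -> exists zs, size zs = k.-1 /\ regseq (addp J x) zs.
Proof.
elim: k => [|[|k] IHk] J ys x IJ reg sz px zx; try by exists [::].
case: ys reg sz => [|y1 [|y2 ys]] //= [py1 zy1 reg1] [sz].
have [py2 zy2 reg2] := reg1.
have I1 := addp_ideal y1 IJ; have Ix := addp_ideal x IJ; have [J0 JD JM] := IJ.
have ns0 : nosoc J by apply: posh_nosoc zx.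
have ns1 : nosoc (addp J y1) by apply: posh_nosoc zy2.
have nsx : nosoc (addp J x).
  move=> u /choice[v vP]; apply: contrapT => nu'.
  have [t tP] : addp J x (y1 * u) by apply: posh_multiple => // i; exists (v i).
  have [s sP] : addp J y1 t; last first.
    apply: nu'; exists s; apply: zy1.
    have -> : (u - s * x) * y1 = (y1 * u - t * x) + (t - s * y1) * x by ring.
    by apply: JD => //; apply: ring_idealMr.
  apply: ns1 => i; exists (v i); apply: zx.
  have -> : ('X_i * t - v i * y1) * x = y1 * ('X_i * u - v i * x) - 'X_i * (y1 * u - t * x) by ring.
  by apply: ring_idealB => //; apply: JM.
have [th [pth z0 zth1 zthx]] := generic_regular IJ I1 Ix ns0 ns1 nsx.
have perm a b : nzd J a -> nzd (addp J a) b -> nzd (addp J b) a.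
  move=> za zb u [t Jt]; have [|s Js] := zb t; first by exists u; rewrite -opprB; apply: ring_idealN.
  exists s; apply: za; have -> : (u - s * b) * a = (u * a - t * b) + (t - s * a) * b by ring.
  by apply: JD => //; apply: ring_idealMr.
have [zs' [sz' reg']] := IHk _ (y2 :: ys) th I1 reg1 (congr1 succn sz) pth zth1.
have Ith := addp_ideal th IJ.
have regth : regseq (addp J th) (y1 :: zs') by split=> //; [exact: perm|rewrite addpC].
have [zs'' [sz'' reg'']] := IHk _ (y1 :: zs') x Ith regth (congr1 succn sz') px (perm _ _ zx zthx).
exists (th :: zs''); split; first by rewrite /= sz''.
by split=> //; rewrite addpC.
Qed.

Definition var_ideal (A : seq 'I_nu) : MP -> Prop :=
  fun g => forall m, m \in msupp g -> exists2 j, j \in A & (0 < m j)%N.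

Lemma var_ideal0 g : var_ideal [::] g <-> g = 0.
Proof.
split=> [H|->]; last by move=> m; rewrite msupp0.
by apply/eqP; rewrite -msupp_eq0; case e : (msupp g) => [//|m s]; have [|j] := H m; rewrite ?e ?mem_head.
Qed.

Lemma var_ideal_hideal A : hideal (var_ideal A).
Proof.
split; first split.
- by move=> m; rewrite msupp0.
- by move=> g h Ag Ah m /msuppD_le; rewrite mem_cat => /orP[/Ag|/Ah].
- move=> g h Ah m /msuppM_le/allpairsP[[m1 m2] /= [_ m2h ->]]; have [j jA mj] := Ah _ m2h.
  by exists j => //; rewrite mnmDE ltn_addl.
move=> n g Ag m; rewrite mcoeff_msupp => c; apply: Ag; rewrite mcoeff_msupp.
apply: contra c => /eqP g0; rewrite pihomogE raddf_sum /= big1 // => m' _.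
by rewrite mcoeffZ mcoeffX; case: eqP => [->|_]; rewrite ?g0 ?mul0r ?mulr0.
Qed.

Lemma var_ideal_nzd A i : i \notin A -> nzd (var_ideal A) 'X_i.
Proof.
move=> iA u Au m mu; have [|j jA] := Au (U_(i) + m)%MM; first by rewrite mcoeff_msupp mcoeffMX -mcoeff_msupp.
rewrite mnmDE mnm1E; case: eqP => [ij|_]; first by rewrite ij jA in iA.
by exists j.
Qed.

Lemma var_ideal_addp A i : addp (var_ideal A) 'X_i = var_ideal (i :: A).
Proof.
have IA : ring_ideal (var_ideal (i :: A)) by case: (var_ideal_hideal (i :: A)).
have mono A' B g : {subset A' <= B} -> var_ideal A' g -> var_ideal B g.
  by move=> AB Ag m /Ag[j /AB jB mj]; exists j.
apply/funext => g; apply: propext; split=> [[u Au]|Ag].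
  rewrite -(subrK (u * 'X_i) g); case: (IA) => _ D M; apply: D.
    by apply: mono Au => j jA; rewrite inE jA orbT.
  apply: M => m; rewrite msuppX inE => /eqP ->; exists i; rewrite ?mem_head //.
  by rewrite mnm1E eqxx.
exists (\sum_(m <- msupp g | (0 < m i)%N) g@_m *: 'X_[m - U_(i)]).
have -> : g - (\sum_(m <- msupp g | (0 < m i)%N) g@_m *: 'X_[m - U_(i)]) * 'X_i =
   \sum_(m <- msupp g | ~~ (0 < m i)%N) g@_m *: 'X_[m].
  have -> : (\sum_(m <- msupp g | (0 < m i)%N) g@_m *: 'X_[m - U_(i)]) * 'X_i =
      \sum_(m <- msupp g | (0 < m i)%N) g@_m *: 'X_[m].
    rewrite mulr_suml; apply: eq_bigr => m mi.
    by rewrite -scalerAl -mpolyXD submK // lep1mP -lt0n.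
  by rewrite {1}[g]mpolyE (bigID (fun m : 'X_{1..nu} => (0 < m i)%N)) /= addrAC subrr add0r.
rewrite big_seq_cond; apply: ring_ideal_sum; first by case: (var_ideal_hideal A).
move=> m /andP[mg mi]; rewrite -mul_mpolyC; case: (var_ideal_hideal A) => -[_ _ M] _; apply: M.
move=> m'; rewrite msuppX inE => /eqP->; have [j] := Ag m mg.
by rewrite inE => /orP[/eqP-> mi'|jA mj]; [rewrite mi' in mi|exists j].
Qed.

Lemma var_regseq A B : uniq A -> {in A, forall i, i \notin B} ->
  regseq (var_ideal B) [seq 'X_i | i <- A].
Proof.
elim: A B => //= i A IHA B /andP[iA UA] AB; split.
- by exists (w i) => //; apply: whomogX.
- by apply: var_ideal_nzd; apply: AB; rewrite mem_head.
rewrite var_ideal_addp; apply: IHA => // j jA; rewrite inE negb_or AB ?inE ?jA ?orbT //.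
by rewrite andbT; apply: contra iA => /eqP <-.
Qed.

(** Macaulay unmixedness, in the form used here: enough elements cutting the
    growth down by one each form a regular sequence. *)
Lemma growth_regular gs : forall J zs p, hideal J -> regseq J zs ->
  (forall x, x \in gs -> posh x) -> (p + size gs <= size zs)%N ->
  bigO p (cum (hf (foldl (@addp K nu) J gs))) -> regseq J gs.
Proof.
elim: gs => //= x gs IHgs J zs p HJ reg ph le Op.
have px : posh x by apply: ph; rewrite mem_head.
have [a a0 hx] := px; have HJx := addp_hideal hx HJ; have [IJ _] := HJ.
have phs y : y \in gs -> posh y by move=> yg; apply: ph; rewrite inE yg orbT.
have Ox : bigO (p + size gs) (cum (hf (addp J x))).
  elim: gs (addp J x) HJx phs Op {IHgs le ph} => [|y gs IHgs] M HM phs Op /=; first by rewrite addn0.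
  have [b b0 hy] := phs y (mem_head _ _).
  rewrite addnS; apply: (growth_quotient w_gt0 b0 hy HM); apply: IHgs => //; first exact: addp_hideal hy HM.
  by move=> z zg; apply: phs; rewrite inE zg orbT.
have zx : nzd J x.
  move=> u Ju; apply: contrapT => nu'.
  have HN := colon_hideal hx HJ.
  have JN g : J g -> colon J x g by move=> Jg; apply: ring_idealMr.
  suff : (size zs <= p + size gs)%N by lia.
  apply: (growth_submodule w_gt0 HJ HN JN) reg _; first by exists u.
  apply: (@bigO_shift _ a) Ox => m.
  have e1 := cum_exact w_gt0 m hx HJ; have e2 := cum_diff w_gt0 m IJ HN.1 JN.
  have e3 := cum_mono (hf J) (leq_addr a m); move: e1 e2 e3; clear; lia.
split=> //.
have [zs' [sz' reg']] := regular_exchange IJ reg erefl px zx.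
by apply: (IHgs _ zs' p) => //; rewrite sz'; lia.
Qed.

End RegularSequences.

(** * Quasi-polynomials *)

Lemma ceil_div L q k (c := ((k + L.-1) %/ L)%N) : (0 < L)%N -> (k <= q)%N ->
  (c <= q)%N /\ ((L * q - k) %/ L = q - c)%N.
Proof.
move=> L0 kq; have := divn_eq (k + L.-1) L; have := ltn_pmod (k + L.-1) L0.
rewrite -/c; move: ((k + L.-1) %% L)%N => s sL e.
have cq : (c <= q)%N.
  rewrite -ltnS /c ltn_divLR //; move: kq L0; clear; case: L => // L; nia.
split=> //; have -> : (L * q - k = (q - c) * L + (L.-1 - s))%N.
  move: sL e cq L0; clear; move: c => c; case: L => // L; rewrite /= => *; nia.
by rewrite divnMDl // divn_small ?addn0 //; move: sL L0; clear; lia.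
Qed.

Section SequenceAction.
Implicit Types (P Q : {poly int}) (u : nat -> int).

(** Action of polynomials on integer sequences, that is, multiplication of a
    power series by a polynomial. *)
Definition conv P u n : int := \sum_(k < n.+1) P`_k * u (n - k)%N.

Definition delta0 (n : nat) : int := (n == 0)%:R.

Lemma conv_trunc P u N n : (n <= N)%N -> conv P u n = (P * \poly_(i < N.+1) u i)`_n.
Proof.
move=> nN; rewrite coefM; apply: eq_bigr => k _; rewrite coef_poly.
by rewrite ltnS (leq_trans (leq_subr _ _) nN).
Qed.

Lemma conv_ext P u u' n : (forall m, (m <= n)%N -> u m = u' m) -> conv P u n = conv P u' n.
Proof. by move=> e; apply: eq_bigr => k _; rewrite e ?leq_subr. Qed.

Lemma convM P Q u n : conv (P * Q) u n = conv P (conv Q u) n.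
Proof.
rewrite (conv_trunc _ _ (leqnn n)) -mulrA coefM; apply: eq_bigr => k _.
by rewrite (@conv_trunc _ _ n) ?leq_subr.
Qed.

Lemma conv1 u n : conv 1 u n = u n.
Proof.
rewrite /conv big_ord_recl coef1 mul1r subn0 big1 ?addr0 // => k _.
by rewrite coef1 mul0r.
Qed.

Lemma convC P Q u n : conv P (conv Q u) n = conv Q (conv P u) n.
Proof. by rewrite -!convM mulrC. Qed.

Lemma conv_delta0 P n : conv P delta0 n = P`_n.
Proof.
rewrite /conv big_ord_recr /= subnn mulr1 big1 ?add0r // => k _.
by rewrite /delta0 subn_eq0 leqNgt ltn_ord mulr0.
Qed.

Lemma conv_inj P u v : P`_0 != 0 -> (forall n, conv P u n = conv P v n) -> u =1 v.
Proof.
move=> P0 e n; elim/ltn_ind: n => n IHn; have := e n.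
rewrite /conv !big_ord_recl !subn0 => h.
have : \sum_(i < n) P`_(fintype.lift ord0 i) * u (n - fintype.lift ord0 i)%N = \sum_(i < n) P`_(fintype.lift ord0 i) * v (n - fintype.lift ord0 i)%N.
  by apply: eq_bigr => i _; rewrite IHn // lift0; have := ltn_ord i; lia.
by move=> h'; move: h; rewrite h' => /addIr/(mulfI P0).
Qed.

Lemma conv_1X a u n : (0 < a)%N ->
  conv (1 - 'X^a) u n = u n - (if (a <= n)%N then u (n - a)%N else 0).
Proof.
move=> a0; rewrite /conv big_ord_recl coefB coef1 coefXn (ltn_eqF a0) subr0 mul1r subn0.
congr (_ + _); case: leqP => [le|lt]; last first.
  rewrite oppr0 big1 // => i _; rewrite coefB coef1 coefXn lift0 /=.
  by rewrite (ltn_eqF (leq_ltn_trans (ltn_ord i) lt)) subr0 mul0r.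
have lt : (a.-1 < n)%N by lia.
rewrite (bigD1 (Ordinal lt)) //= coefB coef1 coefXn /bump /= add1n prednK // eqxx sub0r mulN1r.
rewrite big1 ?addr0 // => i ia; rewrite coefB coef1 coefXn /bump /= add1n sub0r.
case: eqP => [e|_]; last by rewrite oppr0 mul0r.
by case/negP: ia; apply/eqP/val_inj; rewrite /= -e.
Qed.

End SequenceAction.

Lemma finite_difference (R : numFieldType) d (P : {poly R}) (x k : R) : (size P <= d.+1)%N ->
  \sum_(i < d.+1) (-1) ^+ i * ('C(d, i))%:R * P.[x - i%:R * k] = d`!%:R * P`_d * k ^+ d.
Proof.
elim: d P => [|d IHd] P sP.
  rewrite big_ord1 /= expr0 bin0 !mul1r mul0r subr0 mulr1 ?fact0 ?mul1r.
  by rewrite (size1_polyC sP) hornerC coefC.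
pose D := P - (P \Po ('X - k%:P)).
have coefD j : D`_j = P`_j - \sum_(l < size P) P`_l * (('X - k%:P) ^+ l)`_j.
  rewrite coefB; congr (_ - _); rewrite comp_polyE coef_sum; apply: eq_bigr => l _.
  by rewrite coefZ.
have coefX l j : (('X - k%:P) ^+ l)`_j = (- k) ^+ (l - j) *+ 'C(l, j).
  rewrite -polyCN exprDn_comm; last exact: mulrC.
  rewrite coef_sum; have [le|lt] := leqP j l; last first.
    rewrite bin_small // mulr0n big1 // => i _; rewrite coefMn -polyC_exp coefMC coefXn.
    by rewrite gtn_eqF ?mul0r ?mul0rn //; lia.
  have lt : (l - j < l.+1)%N by rewrite ltnS leq_subr.
  rewrite (bigD1 (Ordinal lt)) //= coefMn -polyC_exp coefMC coefXn subKn // eqxx mul1r bin_sub //.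
  rewrite big1 ?addr0 // => i il; rewrite coefMn -polyC_exp coefMC coefXn.
  case: eqP => [e|_]; last by rewrite mul0r mul0rn.
  case/negP: il; apply/eqP/val_inj => /=; have := ltn_ord i; lia.
have top : D`_d = d.+1%:R * k * P`_d.+1.
  have [lt|le] := ltnP d.+1 (size P); last first.
    have P0 : P`_d.+1 = 0 by rewrite nth_default.
    rewrite P0 mulr0 coefD; have [lt|le'] := ltnP d (size P); last first.
      rewrite nth_default // big1 ?subrr // => l _; rewrite coefX bin_small ?mulr0n ?mulr0 //.
      exact: leq_trans (ltn_ord l) le'.
    rewrite (bigD1 (Ordinal lt)) //= coefX subnn binn mulr1 big1 ?addr0 ?subrr // => l ld.
    rewrite coefX bin_small ?mulr0n ?mulr0 //; have := ltn_ord l.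
    move: ld; rewrite -val_eqE /= => ld ltd; rewrite ltn_neqAle ld -ltnS; exact: leq_trans ltd le.
  have lt' : (d < size P)%N by lia.
  rewrite coefD (bigD1 (Ordinal lt')) //= (bigD1 (Ordinal lt)) /=; last by rewrite -val_eqE /= gtn_eqF.
  rewrite !coefX subnn binn subSnn binSn big1 => [|l /andP[l1 l2]].
    by rewrite addr0 mulr1 expr1 opprD addrA subrr sub0r -mulr_natl; ring.
  rewrite coefX bin_small ?mulr0n ?mulr0 //; move: l1 l2; rewrite -!val_eqE /= => l1 l2.
  move: l1 l2 (leq_trans (ltn_ord l) sP); move: (nat_of_ord l) => l'; clear; lia.
have sD : (size D <= d.+1)%N.
  apply/leq_sizeP => j lej; rewrite coefD; have [lt|le'] := ltnP j (size P); last first.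
    rewrite nth_default // big1 ?subrr // => l _; rewrite coefX bin_small ?mulr0n ?mulr0 //.
    exact: leq_trans (ltn_ord l) le'.
  rewrite (bigD1 (Ordinal lt)) //= coefX subnn binn mulr1 big1 ?addr0 ?subrr // => l lj.
  rewrite coefX bin_small ?mulr0n ?mulr0 //; move: lj lej (leq_trans (ltn_ord l) sP); rewrite -val_eqE /=; move: (nat_of_ord l) => l'; clear; lia.
transitivity (\sum_(i < d.+1) (-1) ^+ i * ('C(d, i))%:R * D.[x - i%:R * k]); last first.
  by rewrite IHd // top factS natrM exprS; ring.
have hD y : D.[y] = P.[y] - P.[y - k].
  by rewrite /D hornerD hornerN horner_comp !hornerE.
rewrite big_ord_recl /= expr0 bin0 !mul1r mul0r subr0.
rewrite (eq_bigr (fun i : 'I_d.+1 => (-1) ^+ i.+1 * ('C(d, i.+1))%:R * P.[x - i.+1%:R * k] +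
   - ((-1) ^+ i * ('C(d, i))%:R * P.[x - i.+1%:R * k]))); last first.
  by move=> i _; rewrite /bump /= add1n binS natrD exprS; ring.
rewrite big_split /= big_ord_recr /= bin_small // mulr0 mul0r addr0.
rewrite [RHS](eq_bigr (fun i : 'I_d.+1 => (-1) ^+ i * ('C(d, i))%:R * P.[x - i%:R * k] +
   - ((-1) ^+ i * ('C(d, i))%:R * P.[x - i.+1%:R * k]))); last first.
  move=> i _; rewrite hD mulrBr; congr (_ - _ * P.[_]).
  by rewrite -natr1; ring.
rewrite big_split /= addrA; congr (_ + _).
by rewrite [RHS]big_ord_recl /= expr0 bin0 !mul1r mul0r subr0.
Qed.

Section HilbertSeries.
Variables (nu r d Lam : nat) (w : 'I_nu -> nat) (gam : 'I_r -> nat) (u : nat -> int).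
Hypothesis w0 : forall i, (0 < w i)%N.
Hypothesis gam0 : forall j, (0 < gam j)%N.
Hypothesis Lam0 : (0 < Lam)%N.

Definition cyclo_mult (I : finType) (a : I -> nat) (e : nat) : nat := \sum_i (e %| a i)%N.

Hypothesis nuE : nu = (d.+1 + r)%N.
Hypothesis pole_in : forall e, (1 < e)%N -> (e %| Lam)%N ->
  (cyclo_mult w e <= d + cyclo_mult gam e)%N.
Hypothesis pole_out : forall e, ~~ (e %| Lam)%N -> (cyclo_mult w e <= cyclo_mult gam e)%N.
Hypothesis recu : forall n, conv (\prod_i (1 - 'X^(w i))) u n = (\prod_j (1 - 'X^(gam j)))`_n.

Let cyclo_prod N n : (0 < n)%N -> (n <= N)%N ->
  'X^n - 1 = \prod_(e < N.+1) 'Phi_e ^+ (e %| n)%N :> {poly int}.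
Proof.
move=> n0 nN; rewrite -(prod_Cyclotomic n0).
rewrite -(big_mkord predT (fun e => 'Phi_e ^+ (e %| n)%N)).
rewrite [RHS](bigID (fun e => (e %| n)%N)) /= [X in _ * X]big1 ?mulr1; last first.
  by move=> e /negPf ->; rewrite expr0.
rewrite [RHS](eq_bigr (fun e => 'Phi_e)); last by move=> e ->; rewrite expr1.
rewrite -[RHS]big_filter; apply: perm_big; apply: uniq_perm.
- exact: divisors_uniq.
- by rewrite filter_uniq // iota_uniq.
move=> e; rewrite mem_filter mem_index_iota -dvdn_divisors //=; case en: (e %| n)%N => //=.
by rewrite ltnS (leq_trans (dvdn_leq n0 en) nN).
Qed.

Let cyclo_prods (I : finType) (a : I -> nat) N : (forall i, 0 < a i)%N -> (forall i, a i <= N)%N ->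
  \prod_i ('X^(a i) - 1) = \prod_(e < N.+1) 'Phi_e ^+ (cyclo_mult a e) :> {poly int}.
Proof.
move=> a0 aN; under eq_bigr => i _ do rewrite (cyclo_prod (a0 i) (aN i)).
by rewrite exchange_big; apply: eq_bigr => e _; rewrite /= prodrXr.
Qed.

Let bnd (I : finType) (a : I -> nat) : forall i, (a i <= \sum_j a j)%N.
Proof. by move=> i; rewrite (bigD1 i) //= leq_addr. Qed.

Let N0 := (\sum_i w i + \sum_j gam j + Lam)%N.

Let V' : {poly int} := ('X - 1) * ('X^Lam - 1) ^+ d.
Let V : {poly int} := (1 - 'X) * (1 - 'X^Lam) ^+ d.

Let mulN1r_sub (p : {poly int}) : (-1) * (1 - p) = p - 1.
Proof. by rewrite mulN1r opprB. Qed.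

Lemma numerator_exists : exists U : {poly int},
  V' * \prod_j ('X^(gam j) - 1) = U * \prod_i ('X^(w i) - 1).
Proof.
have N1 : (1 <= N0)%N by rewrite /N0; lia.
have NL : (Lam <= N0)%N by rewrite /N0; lia.
rewrite (@cyclo_prods _ w N0) //; last by move=> i; have := bnd w i; rewrite /N0; lia.
rewrite (@cyclo_prods _ gam N0) //; last by move=> i; have := bnd gam i; rewrite /N0; lia.
rewrite /V' -{1}[X in X - 1]expr1 (@cyclo_prod N0 1) // (@cyclo_prod N0 Lam) //.
rewrite -prodrXl -!big_split /=.
exists (\prod_(e < N0.+1) 'Phi_e ^+ ((e %| 1) + (e %| Lam) * d + cyclo_mult gam e - cyclo_mult w e)%N).
rewrite -big_split /=; apply: eq_bigr => e _; rewrite -!exprM -!exprD; congr (_ ^+ _).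
rewrite subnK //; have [eL|eL] := boolP (e %| Lam)%N; last first.
  exact: leq_trans (pole_out eL) (leq_addl _ _).
have [e1|] := ltnP 1 e; first by apply: leq_trans (pole_in e1 eL) _; rewrite mul1n; lia.
have e0 : e != 0%N :> nat by apply: contraTneq eL => ->; rewrite dvd0n; lia.
move=> e1; have {e0 e1} -> : e = 1%N :> nat by lia.
rewrite /cyclo_mult; under eq_bigr do rewrite dvd1n; under [X in (_ <= _ + X)%N]eq_bigr do rewrite dvd1n.
by rewrite !sum_nat_const !card_ord; clear -nuE; lia.
Qed.

Let sgn (I : finType) (a : I -> nat) :
  \prod_i ('X^(a i) - 1) = (-1) ^+ #|I| * \prod_i (1 - 'X^(a i)) :> {poly int}.
Proof.
rewrite -[#|I|]/(#|predT|) -prodr_const -big_split /=; apply: eq_bigr => i _.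
by rewrite mulN1r opprB.
Qed.

Let W0 : (\prod_i (1 - 'X^(w i)) : {poly int})`_0 != 0.
Proof.
rewrite -horner_coef0 horner_prod; apply/prodf_neq0 => i _.
by rewrite horner_coef0 coefB coef1 coefXn (ltn_eqF (w0 i)) subr0.
Qed.

Let V0 : V`_0 != 0.
Proof.
by rewrite -horner_coef0 hornerM horner_exp !horner_coef0 !coefB coefX !coef1 coefXn (ltn_eqF Lam0) /= !subr0 expr1n.
Qed.

Definition vd p n : int := ('C(n %/ Lam + p, p))%:R.

Let conv_vd p n : conv (1 - 'X^Lam) (vd p.+1) n = vd p n.
Proof.
rewrite conv_1X //; case: leqP => [le|lt]; last first.
  by rewrite subr0 /vd divn_small // !add0n !binn.
have -> : (n = (n - Lam) + Lam)%N by rewrite subnK.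
rewrite addnK /vd divnDr // divnn Lam0 addn1 addSn addnS binS natrD addrAC subrr add0r.
by rewrite addSn.
Qed.

Let conv_V n : conv V (vd d) n = delta0 n.
Proof.
have h p m : conv ((1 - 'X^Lam) ^+ p) (vd p) m = vd 0 m.
  elim: p m => [|p IHp] m; first by rewrite expr0 conv1.
  by rewrite exprSr convM -IHp; apply: conv_ext => k _; rewrite conv_vd.
rewrite /V convM (conv_ext _ (fun m _ => h d m)) -['X]expr1 conv_1X //.
by rewrite /vd !bin0 /delta0; case: n => [|n] /=; rewrite ?subr0 ?subrr.
Qed.

Lemma hilbert_function_numerator : exists U : {poly int},
  (forall n, u n = conv U (vd d) n) /\
  U.[1] * (\prod_i w i)%:R = (Lam ^ d * \prod_j gam j)%:R.
Proof.
have [U UE] := numerator_exists; exists U; split.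
  apply: (conv_inj V0) => n; rewrite [RHS]convC (conv_ext _ (fun m _ => conv_V m)).
  move: n; apply: (conv_inj W0) => n; rewrite convC (conv_ext _ (fun m _ => recu m)).
  rewrite -[RHS]convM conv_delta0.
  rewrite (conv_ext V (u' := fun m => conv (\prod_j (1 - 'X^(gam j))) delta0 m)); last first.
    by move=> m _; rewrite conv_delta0.
  rewrite -convM conv_delta0; congr ((polyseq _)`_n).
  have sE : (-1) ^+ nu = (-1) ^+ d.+1 * (-1) ^+ r :> {poly int} by rewrite nuE exprD.
  move: UE; rewrite !sgn !card_ord sE.
  have -> : V' = (-1) ^+ d.+1 * V.
    rewrite /V' /V -[X in X * _ = _]mulN1r_sub -[X in _ * X ^+ d = _]mulN1r_sub exprMn exprS; ring.
  move=> e; apply: (@mulfI _ ((-1) ^+ d.+1 * (-1) ^+ r)); first by rewrite mulf_neq0 // signr_eq0.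
  rewrite -[LHS]mulrACA e mulrACA mulrC; ring.
have sub1 n : ('X^n - 1 : {poly int}) = ('X - 1) * \sum_(i < n) 'X^i.
  by rewrite subrX1.
move: UE; rewrite /V' (sub1 Lam) exprMn_comm; last exact: mulrC.
under eq_bigr do rewrite sub1; under [X in _ = _ * X]eq_bigr do rewrite sub1.
rewrite !big_split /= !prodr_const !card_ord => UE.
have XE : ('X - 1) ^+ nu = ('X - 1) ^+ d.+1 * ('X - 1) ^+ r :> {poly int} by rewrite nuE exprD.
have X1 : ('X - 1 : {poly int}) != 0 by rewrite polyXsubC_eq0.
have {UE} UE : (\sum_(i < Lam) 'X^i) ^+ d * \prod_(i < r) \sum_(i0 < gam i) 'X^i0 =
   U * \prod_i \sum_(i0 < w i) 'X^i0 :> {poly int}.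
  apply: (mulfI (expf_neq0 nu X1)); rewrite [RHS]mulrCA -UE XE exprS; ring.
have ev1 n : (\sum_(i < n) 'X^i : {poly int}).[1] = n%:R.
  rewrite horner_sum (eq_bigr (fun=> 1)) ?sumr_const ?card_ord // => i _.
  by rewrite hornerXn expr1n.
move/(congr1 (horner^~ 1)): UE; rewrite !hornerM horner_exp !horner_prod ev1.
under eq_bigr do rewrite ev1; under [X in _ = _ * X]eq_bigr do rewrite ev1.
by rewrite natrM natrX !natr_prod => ->.
Qed.

Definition binpoly (c : nat) : {poly rat} :=
  (d`!%:R)^-1 *: \prod_(i < d) ('X + (d%:R - i%:R - c%:R)%:P).

Let binpolyE c q : (c <= q)%N -> (binpoly c).[q%:R] = ('C(q - c + d, d))%:R.
Proof.
move=> cq; rewrite hornerZ horner_prod; apply: (canLR (mulKf _)); first by rewrite pnatr_eq0 -lt0n fact_gt0.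
rewrite -natrM mulnC bin_ffact ffact_prod natr_prod; apply: eq_bigr => i _.
rewrite hornerD hornerX hornerC natrB; last by rewrite (leq_trans (ltnW (ltn_ord i))) ?leq_addl.
rewrite natrD natrB //; ring.
Qed.

Let size_binpoly c : (size (binpoly c) <= d.+1)%N.
Proof.
apply: leq_trans (size_scale_leq _ _) _.
rewrite (eq_bigr (fun i : 'I_d => 'X - (- (d%:R - i%:R - c%:R))%:P)) ?size_prod_XsubC
  // => [|i _]; last by rewrite polyCN opprK.
by rewrite /index_enum -enumT size_enum_ord.
Qed.

Let lead_binpoly c : (binpoly c)`_d = (d`!%:R)^-1.
Proof.
have e : \prod_(i < d) ('X + (d%:R - i%:R - c%:R)%:P) =
    \prod_(i < d) ('X - (- (d%:R - i%:R - c%:R))%:P) :> {poly rat}.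
  by apply: eq_bigr => i _; rewrite polyCN opprK.
rewrite coefZ e -[RHS]mulr1; congr (_ * _).
have := monicP (monic_prod_XsubC (index_enum 'I_d) predT (fun i => - (d%:R - i%:R - c%:R) : rat)).
by rewrite lead_coefE size_prod_XsubC /index_enum -enumT size_enum_ord.
Qed.

(** The generating function is a polynomial over (1 - t)(1 - t^Lam)^d, and on
    the multiples of Lam the coefficients of the inverse of this denominator are
    binomial coefficients. *)
Lemma hilbert_function_polynomial : exists (Q : {poly rat}) q0,
  [/\ (size Q <= d.+1)%N,
      d`!%:R * Q`_d * (\prod_i w i)%:R = (Lam ^ d * \prod_j gam j)%:R &
      forall q, (q0 <= q)%N -> (u (Lam * q)%N)%:~R = Q.[q%:R]].
Proof.
have [U [uU U1]] := hilbert_function_numerator.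
pose c k := ((k + Lam.-1) %/ Lam)%N.
exists (\sum_(k < size U) (U`_k)%:~R *: binpoly (c k)), (size U); split.
- apply: leq_trans (size_sum _ _ _) _; apply/bigmax_leqP => k _.
  exact: leq_trans (size_scale_leq _ _) (size_binpoly _).
- have <- : (U.[1] * (\prod_i w i)%:R)%:~R = (Lam ^ d * \prod_j gam j)%:R :> rat.
    by rewrite U1 rmorph_nat.
  rewrite rmorphM /= rmorph_nat; congr (_ * _).
  rewrite coef_sum horner_coef rmorph_sum mulr_sumr; apply: eq_bigr => k _.
  rewrite coefZ lead_binpoly mulrCA divff ?mulr1 ?expr1n ?mulr1 //.
  by rewrite pnatr_eq0 -lt0n fact_gt0.
move=> q Uq; rewrite uU.
have le : (size U <= (Lam * q).+1)%N by apply: leq_trans Uq _; rewrite leqW // leq_pmull.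
have -> : conv U (vd d) (Lam * q) = \sum_(k < size U) U`_k * vd d (Lam * q - k)%N.
  rewrite /conv (big_ord_widen _ (fun k => U`_k * vd d (Lam * q - k)%N) le).
  rewrite (bigID (fun k : 'I_(Lam * q).+1 => (k < size U)%N)) /= [X in _ + X]big1 ?addr0 // => k.
  by rewrite -leqNgt => h; rewrite nth_default ?mul0r.
rewrite horner_sum rmorph_sum; apply: eq_bigr => k _.
rewrite rmorphM hornerZ; congr (_ * _).
have [ck e] := ceil_div Lam0 (leq_trans (ltnW (ltn_ord k)) Uq).
by rewrite binpolyE // /vd e rmorph_nat.
Qed.

End HilbertSeries.

(** * Growth of the coordinate ring *)

Section Dependence.
Variables (K : fieldType) (F : fieldType) (iota : {rmorphism K -> F}).

(** In transcendence degree d, any d+2 homogeneous elements of a graded ring of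
    functions satisfy a homogeneous relation: it is obtained by homogenizing a
    relation between d+1 fractions of degree zero. *)
Lemma homogeneous_relation d (y : 'I_d.+2 -> F) (n : 'I_d.+2 -> nat) :
  has_dim iota d -> (forall b, 0 < n b)%N ->
  exists P : {mpoly K[d.+2]}, exists N,
    [/\ P != 0, P \is whomog n N & ev iota y P = 0].
Proof.
move=> [_ dep] n0.
have [[b yb]|y0] := EM (exists b, y b = 0).
  exists 'X_b, (n b); split; [|exact: whomogX|exact: (etrans (evX _ _ _) yb)].
  by apply/eqP => /(congr1 (mcoeff U_(b)))/eqP; rewrite mcoeffX eqxx mcoeff0 oner_eq0.
have {}y0 b : y b != 0 by apply/eqP => e; apply: y0; exists b.
pose T (b : 'I_d.+1) := y (fintype.lift ord0 b) ^+ n ord0 / y ord0 ^+ n (fintype.lift ord0 b).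
have [p /not_implyP [pT p0]] : exists p : {mpoly K[d.+1]}, ~ (mmap iota T p = 0 -> p = 0).
  by apply/existsNP => h; apply: (dep T).
pose wt (m : 'X_{1..d.+1}) := (\sum_b m b * n (fintype.lift ord0 b))%N.
pose N := (\sum_(m <- msupp p) wt m)%N.
have wtN m : m \in msupp p -> (wt m <= N)%N.
  by move=> mp; rewrite /N (big_rem m) //= leq_addr.
pose h (m : 'X_{1..d.+1}) : 'X_{1..d.+2} :=
  [multinom (if unlift ord0 i is Some b then n ord0 * m b else N - wt m)%N | i < d.+2].
have h0 m : h m ord0 = (N - wt m)%N by rewrite mnmE unlift_none.
have hl m b : h m (fintype.lift ord0 b) = (n ord0 * m b)%N by rewrite mnmE liftK.
have hinj : injective h.
  move=> m1 m2 e; apply/mnmP => b; have := congr1 (fun m : 'X_{1..d.+2} => m (fintype.lift ord0 b)) e.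
  by rewrite /= !hl => /eqP; rewrite eqn_pmul2l // => /eqP.
pose P := \sum_(m <- msupp p) p@_m *: 'X_[h m] : {mpoly K[d.+2]}.
have Ph m : m \in msupp p -> P@_(h m) = p@_m.
  move=> mp; rewrite /P raddf_sum /= (big_rem m) //= mcoeffZ mcoeffX eqxx mulr1 big_seq big1 ?addr0 //.
  move=> m' m'r; rewrite mcoeffZ mcoeffX; case: eqP => [/hinj e|_]; last by rewrite mulr0.
  by move: m'r; rewrite e (rem_filter _ (msupp_uniq p)) mem_filter /= eqxx.
exists P, (n ord0 * N)%N; split.
- apply/eqP => P0; case: p0; apply/mpolyP => m; rewrite mcoeff0.
  by case: (boolP (m \in msupp p)) => [mp|/memN_msupp_eq0 //]; rewrite -Ph // P0 mcoeff0.
- rewrite /P big_seq; apply: rpred_sum => m mp; apply: rpredZ; rewrite dhomogX; apply/eqP.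
  rewrite -[LHS]/(mwt n (h m)) /mwt big_ord_recl h0; under eq_bigr => b _ do rewrite hl -mulnA.
  by rewrite -big_distrr /= mulnC -mulnDr subnK ?wtN.
have yT m : m \in msupp p -> mmap1 y (h m) = y ord0 ^+ N * mmap1 T m.
  move=> mp; rewrite {1}/mmap1 big_ord_recl h0 -{2}(subnK (wtN _ mp)) exprD -mulrA; congr (_ * _).
  rewrite /wt expr_sum -big_split /=; apply: eq_bigr => b _.
  by rewrite hl /T expr_div_n -!exprM [(m b * _)%N]mulnC mulrC divfK // expf_neq0.
rewrite /ev /P raddf_sum /= big_seq (eq_bigr (fun m => y ord0 ^+ N * (iota p@_m * mmap1 T m))); last first.
  by move=> m mp; rewrite mmapZ mmapX yT // mulrCA.
by rewrite -mulr_sumr -big_seq -[X in _ * X]/(mmap iota T p) pT mulr0.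
Qed.

Lemma variable_relation d nu (f : 'I_nu -> F) (w : 'I_nu -> nat) (t : 'I_d.+2 -> 'I_nu) :
  has_dim iota d -> (forall i, 0 < w i)%N -> injective t ->
  exists P : {mpoly K[nu]}, exists N, [/\ P != 0, P \is whomog w N, ev iota f P = 0 &
    forall m, m \in msupp P -> forall i, (0 < m i)%N -> exists b, i = t b].
Proof.
move=> dimF w0 tinj.
have [P [N [P0 hP Pf]]] := homogeneous_relation (f \o t) dimF (fun b => w0 (t b)).
pose rn (m : 'X_{1..d.+2}) : 'X_{1..nu} := (\sum_b U_(t b) *+ m b)%MM.
pose R := mmap (@mpolyC nu K) (fun b => 'X_(t b)) P.
have tX m : mmap1 (fun b => 'X_(t b)) m = 'X_[rn m] :> {mpoly K[nu]}.
  rewrite /mmap1 /rn (big_morph (fun m => 'X_[m] : {mpoly K[nu]}) (@mpolyXD nu K) (mpolyX0 nu K)).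
  by apply: eq_bigr => b _; rewrite mpolyXn.
have RE : R = \sum_(m <- msupp P) P@_m *: 'X_[rn m].
  by rewrite /R /mmap; apply: eq_bigr => m _; rewrite mul_mpolyC tX.
have rnE m b : rn m (t b) = m b.
  rewrite /rn mnm_sumE (bigD1 b) //= mulmnE mnm1E eqxx mul1n big1 ?addn0 // => c cb.
  by rewrite mulmnE mnm1E (inj_eq tinj) (negPf cb) mul0n.
have rninj : injective rn.
  by move=> m1 m2 e; apply/mnmP => b; rewrite -!rnE e.
have Rm m : m \in msupp P -> R@_(rn m) = P@_m.
  move=> mp; rewrite RE raddf_sum /= (big_rem m) //= mcoeffZ mcoeffX eqxx mulr1 big_seq big1 ?addr0 //.
  move=> m' m'r; rewrite mcoeffZ mcoeffX; case: eqP => [/rninj e|_]; last by rewrite mulr0.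
  by move: m'r; rewrite e (rem_filter _ (msupp_uniq P)) mem_filter /= eqxx.
exists R, N; split.
- apply: contra_neq P0 => R0; apply/mpolyP => m; rewrite mcoeff0.
  by case: (boolP (m \in msupp P)) => [mp|/memN_msupp_eq0 //]; rewrite -Rm // R0 mcoeff0.
- rewrite RE big_seq; apply: rpred_sum => m mp; apply: rpredZ; rewrite dhomogX; apply/eqP.
  move/dhomogP: hP => /(_ m mp) <-; rewrite -[LHS]/(mwt w (rn m)) -[RHS]/(mwt (fun b => w (t b)) m) /rn.
  rewrite (big_morph (mwt w) (mwtD w) (mwt0 w)); apply: eq_bigr => b _.
  transitivity (m b * mwt w U_(t b))%N; last by rewrite mwtU.
  rewrite /mwt big_distrr /=; under eq_bigr => i _ do rewrite mulmnE [(_ * m b)%N]mulnC -mulnA.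
  by [].
- rewrite RE -[RHS]Pf ev_sum -[RHS]/(\sum_(m <- msupp P) iota P@_m * mmap1 (f \o t) m).
  apply: eq_bigr => m _; rewrite evZ; congr (_ * _).
  rewrite -tX; transitivity (\prod_b ev iota f ('X_(t b) ^+ m b)); first exact: (rmorph_prod (ev iota f)).
  by apply: eq_bigr => b _; rewrite evXn evX.
move=> m; rewrite RE => /msupp_sum_le /flattenP [/= s /mapP [m' _ ->]].
move=> /msuppZ_le; rewrite msuppX inE => /eqP -> i.
rewrite /rn mnm_sumE lt0n sum_nat_eq0 negb_forall => /existsP [b]; rewrite /= mulmnE mnm1E => h.
exists b; apply/eqP; move: h; case: (t b =P i) => [<- _|_]; first exact: eqxx.
by rewrite mul0n.
Qed.

End Dependence.

Section CoordinateRing.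
Variables (K : closedFieldType) (F : fieldType) (iota : {rmorphism K -> F}).
Variables (d nu : nat) (f : 'I_nu -> F) (w : 'I_nu -> nat).
Hypothesis w_gt0 : forall i, (0 < w i)%N.
Hypothesis dimF : has_dim iota d.
Hypothesis f0 : forall i, f i != 0.
Local Notation MP := {mpoly K[nu]}.
Local Notation I := (tcs_ideal iota f w).
Local Notation hf := (hf w).
Local Notation piece := (@piece K nu w).

Lemma tcs_hideal : hideal w I.
Proof. by split=> [|n g]; [apply: tcs_ideal_ideal | apply: tcs_ideal_pihomog]. Qed.

(** Modulo the ideal, every polynomial is a combination of the monomials that
    are not multiples of leading monomials of the relations between d+2
    variables; at most d+1 exponents of such a monomial are large. *)
Lemma standard_monomials (std : 'X_{1..nu} -> bool) n M : (n <= M)%N ->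
  (forall m, ~~ std m -> exists P l, [/\ P != 0, P \is whomog w l, I P & (mlead P <= m)%MM]) ->
  (hf I n <= #|[set m : 'X_{1..nu < M.+1} | (mwt w m == n) && std m]%SET|)%N.
Proof.
move=> nM nstd; set A := [set m : 'X_{1..nu < M.+1} | _]%SET.
have II := tcs_ideal_ideal iota f w.
pose span (g : MP) := exists a : 'rV[K]_#|A|, I (g - \sum_i a 0 i *: 'X_[enum_val i : 'X_{1..nu < M.+1}]).
have spanZD c g h : span g -> span h -> span (c *: g + h).
  move=> [a ga] [b hb]; exists (c *: a + b).
  suff -> : c *: g + h - \sum_i (c *: a + b) 0 i *: 'X_[enum_val i : 'X_{1..nu < M.+1}] =
    c%:MP * (g - \sum_i a 0 i *: 'X_[enum_val i : 'X_{1..nu < M.+1}]) +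
    (h - \sum_i b 0 i *: 'X_[enum_val i : 'X_{1..nu < M.+1}]).
    by case: II => _ ID IM; apply: (ID) => //; apply: (IM).
  rewrite mul_mpolyC scalerBr scaler_sumr addrACA -opprD -big_split /=; congr (_ - _).
  by apply: eq_bigr => i _; rewrite !mxE scalerDl scalerA.
have span0 : span 0.
  exists 0; rewrite big1 ?subr0 => [|i _]; last by rewrite mxE scale0r.
  by case: II.
have span_sum (s : seq 'X_{1..nu}) (c : 'X_{1..nu} -> K) (h : 'X_{1..nu} -> 'X_{1..nu}) :
    (forall m, m \in s -> span 'X_[h m]) -> span (\sum_(m <- s) c m *: 'X_[h m]).
  elim: s => [|m s IHs] hs; first by rewrite big_nil.
  by rewrite big_cons; apply: spanZD; [apply: hs; rewrite mem_head | apply: IHs => m' m's; apply: hs; rewrite inE m's orbT].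
have spanX (m : 'X_{1..nu}) : mwt w m = n -> span 'X_[m].
  elim/(@ltmwf nu): m => m IHm hm.
  have [sm|/nstd [P [l [P0 hP IP le]]]] := boolP (std m).
    have mn : (mdeg m < M.+1)%N by rewrite ltnS; apply: leq_trans nM; rewrite -hm; apply: mdeg_mwt.
    have mA : BMultinom mn \in A by rewrite inE /= hm eqxx.
    exists (delta_mx 0 (enum_rank_in mA (BMultinom mn))).
    rewrite (bigD1 (enum_rank_in mA (BMultinom mn))) //= mxE !eqxx scale1r enum_rankK_in //=.
    rewrite big1 ?addr0 ?subrr => [|i ni]; last by rewrite mxE (negPf ni) andbF scale0r.
    by case: II.
  pose q := (m - mlead P)%MM; have mE : (m = q + mlead P)%MM by rewrite /q submK.
  have c0 : mleadc P != 0 by rewrite mleadc_eq0.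
  have PE : P = mleadc P *: 'X_[mlead P] + \sum_(m' <- rem (mlead P) (msupp P)) P@_m' *: 'X_[m'].
    by rewrite {1}[P]mpolyE (big_rem (mlead P)) ?mlead_supp.
  have e : 'X_[m] = (mleadc P)^-1 *: ('X_[q] * P) +
     \sum_(m' <- rem (mlead P) (msupp P)) (- ((mleadc P)^-1 * P@_m')) *: 'X_[(q + m')%MM] :> MP.
    have XP : 'X_[q] * P = mleadc P *: 'X_[m] + \sum_(m' <- rem (mlead P) (msupp P)) P@_m' *: 'X_[(q + m')%MM].
      rewrite {1}PE mulrDr -scalerAr -mpolyXD -mE mulr_sumr; congr (_ + _).
      by apply: eq_bigr => m' _; rewrite -scalerAr mpolyXD.
    rewrite XP scalerDr scalerA mulVf // scale1r -addrA scaler_sumr -big_split big1 ?addr0 // => m' _.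
    by rewrite /= scalerA scaleNr subrr.
  rewrite e; apply: spanZD.
    exists 0; rewrite big1 ?subr0 => [|i _]; last by rewrite mxE scale0r.
    by case: II => _ _; apply.
  apply: span_sum => m' m'r; have m'P : m' \in msupp P by apply: mem_rem m'r.
  have wP m'' : m'' \in msupp P -> mwt w m'' = l by move/dhomogP: hP => /(_ m'').
  apply: IHm; last by rewrite mwtD (wP _ m'P) -(wP _ (mlead_supp P0)) -mwtD -mE.
  rewrite mE ltmc_add2r lt_neqAle msupp_le_mlead // andbT.
  by apply: contraTneq m'r => ->; rewrite mem_rem_uniqF ?msupp_uniq.
have sub : piece n `&` I `<=` piece n by move=> u [].
have qd := hfP w_gt0 n II.
have hX (i : 'I_#|A|) : ('X_[enum_val i : 'X_{1..nu < M.+1}] : MP) \is whomog w n.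
  by rewrite dhomogX; have := enum_valP i; rewrite inE => /andP[].
have := qdim_leq (m := #|A|) (@piece_subspace K nu w n) (ideal_piece_subspace w n II) sub qd; apply.
exists (fun i : 'I_#|A| => 'X_[enum_val i : 'X_{1..nu < M.+1}]); split=> [i|g hg]; first exact: hX.
suff [a ga] : span g.
  exists a; split=> //; apply: rpredB => //; apply: rpred_sum => i _; apply: rpredZ; apply: hX.
rewrite [g]mpolyE; apply: (span_sum _ (fun m => g@_m) id) => m mg; apply: spanX.
by move/dhomogP: hg; apply.
Qed.

Lemma standard_count (std : 'X_{1..nu} -> bool) B D M : 
  (forall m, std m -> #|[set i | (B <= m i)%N]%SET| <= D)%N ->
  (#|[set m : 'X_{1..nu < M.+1} | std m]%SET| <= 2 ^ nu * B.+1 ^ nu * M.+1 ^ D)%N.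
Proof.
move=> hstd; pose A (m : 'X_{1..nu}) := [set i | (B <= m i)%N]%SET.
pose code (m : 'X_{1..nu < M.+1}) : {set 'I_nu} * {ffun 'I_nu -> 'I_B.+1} * {ffun 'I_D -> 'I_M.+1} :=
  (A m, [ffun i => inord (minn B (m i))], [ffun t : 'I_D => inord (nth 0%N [seq m i | i <- enum (A m)] t)]).
have ci : {in [set m : 'X_{1..nu < M.+1} | std m]%SET &, injective code}.
  move=> m1 m2; rewrite !inE => s1 s2 [e1 /ffunP e2 /ffunP e3]; apply/val_inj/mnmP => i.
  have bm (m : 'X_{1..nu < M.+1}) j : (m j < M.+1)%N.
    by apply: leq_ltn_trans (bmdeg m); rewrite mdegE (bigD1 j) //= leq_addr.
  have [iA|iA] := boolP (i \in A m1); last first.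
    have iA2 : i \notin A m2 by rewrite -e1.
    move: iA iA2; rewrite !inE -!ltnNge => l1 l2; have /(congr1 val) := e2 i; rewrite !ffunE /=.
    by rewrite !inordK ?ltnS ?geq_minl // !(minn_idPr (ltnW _)).
  have iE : i \in enum (A m1) by rewrite mem_enum.
  have it : (index i (enum (A m1)) < D)%N.
    by apply: leq_trans (hstd _ s1); rewrite -[X in (_ < X)%N]/#|A m1| cardE index_mem.
  have := e3 (Ordinal it); rewrite !ffunE /= => /(congr1 val) /=; rewrite -e1.
  by rewrite !(nth_map i) ?index_mem // nth_index // !inordK ?bm.
have cS : #|{set 'I_nu}| = (2 ^ nu)%N by rewrite -cardsT -powersetT card_powerset cardsT card_ord.
by have := leq_card_in _ _ ci; rewrite !card_prod !card_ffun !card_ord cS.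
Qed.

Lemma growth_tcs : bigO d.+1 (cum (hf I)).
Proof.
pose ok (t : {ffun 'I_d.+2 -> 'I_nu}) (P : MP) := injective t ->
  [/\ P != 0, exists l, P \is whomog w l, I P &
    forall m, m \in msupp P -> forall i, (0 < m i)%N -> exists b, i = t b].
have /choice[R Rok] : forall t, exists P, ok t P.
  move=> t; rewrite /ok; have [ti|nti] := EM (injective t); last by exists 0.
  have [P [N [P0 hP Pf Pt]]] := variable_relation f dimF w_gt0 ti.
  by exists P => _; split=> //; [exists N | apply/(tcs_ideal_homog iota f hP)].
pose B := (\sum_t mdeg (mlead (R t))).+1%N.
pose std m := ~~ `[< exists P l, [/\ P != 0, P \is whomog w l, I P & (mlead P <= m)%MM] >].
have hstd m : std m -> (#|[set i | (B <= m i)%N]%SET| <= d.+1)%N.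
  move=> /asboolP sm; rewrite leqNgt; apply/negP => lt; apply: sm.
  pose t := [ffun b : 'I_d.+2 => enum_val (widen_ord lt b)].
  have ti : injective t by move=> b b'; rewrite !ffunE => /enum_val_inj/(congr1 val)/= /val_inj.
  have [R0 [l hl] IR Rt] := Rok t ti; exists (R t), l; split=> //.
  have leB i : (mlead (R t) i <= B)%N.
    rewrite /B leqW // (bigD1 t) //=; apply: leq_trans (leq_addr _ _).
    by rewrite mdegE (bigD1 i) //= leq_addr.
  apply/mnm_lepP => i; have [->//|/(Rt _ (mlead_supp R0)) [b ->]] := posnP (mlead (R t) i).
  apply: leq_trans (leB _) _; have := enum_valP (widen_ord lt b).
  by rewrite inE ffunE.
exists (2 ^ nu * B.+1 ^ nu)%N => M; apply: leq_trans (standard_count M hstd).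
apply: (@leq_trans (\sum_(n < M.+1) #|[set m : 'X_{1..nu < M.+1} | (mwt w m == n) && std m]%SET|)%N).
  apply: leq_sum => n _; apply: standard_monomials => [|m]; first by rewrite -ltnS.
  by rewrite negbK => /asboolP.
under eq_bigr => n _ do rewrite -sum1dep_card big_mkcond.
rewrite exchange_big -sum1dep_card [X in (_ <= X)%N]big_mkcond; apply: leq_sum => m _ /=.
case: (std m); last by rewrite big1 // => n _; rewrite andbF.
under eq_bigr do rewrite andbT.
have [lt|le] := ltnP (mwt w m) M.+1; last first.
  by rewrite big1 // => n _; case: eqP => // e; move: (ltn_ord n); rewrite -e ltnNge le.
by rewrite (bigD1 (Ordinal lt)) //= eqxx big1 // => n; rewrite -val_eqE eq_sym /= => /negPf ->.
Qed.

End CoordinateRing.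

(** * The Hilbert polynomial of a complete intersection *)

Lemma whomog_prod (K : fieldType) nu (w : 'I_nu -> nat) (I : Type) (r : seq I)
    (p : I -> {mpoly K[nu]}) (n : I -> nat) :
  (forall i, p i \is whomog w (n i)) -> \prod_(i <- r) p i \is whomog w (\sum_(i <- r) n i).
Proof.
move=> h; elim: r => [|i r IHr]; first by rewrite !big_nil; apply: dhomog1.
by rewrite !big_cons; apply: dhomogM.
Qed.

Lemma qdim_geq (K : fieldType) (V : lmodType K) (Z B : set V) n (I : finType) (e : I -> V) :
  subspace Z -> subspace B -> B `<=` Z -> qdim Z B n -> (forall i, Z (e i)) ->
  (forall a : I -> K, B (\sum_i a i *: e i) -> forall i, a i = 0) -> (#|I| <= n)%N.
Proof.
move=> SZ SB BZ /(qdim_coord n SZ SB BZ) [c [cl _ cB]] Ze ind.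
have c0 : c 0 = 0.
  have Z0 : Z 0 by case: SZ.
  by apply/(cB _ Z0); case: SB.
have c_sum (a : I -> K) (s : seq I) : Z (\sum_(i <- s) a i *: e i) /\
    c (\sum_(i <- s) a i *: e i) = \sum_(i <- s) a i *: c (e i).
  elim: s => [|i s [IH1 IH2]]; first by rewrite !big_nil; split=> //; case: SZ.
  by rewrite !big_cons cl // IH2; split=> //; case: SZ => _; apply.
pose M := \matrix_(k < #|I|) c (e (enum_val k)).
suff /eqP <- : row_free M by apply: rank_leq_col.
apply/inj_row_free => v vM; apply/rowP => k; rewrite mxE.
have [Zs cs] := c_sum (fun i => v 0 (enum_rank i)) (index_enum I).
rewrite -(enum_valK k); apply: (ind (fun i => v 0 (enum_rank i))); apply/cB => //.
rewrite cs -[RHS]vM mulmx_sum_row (reindex (@enum_rank I)) /=; last exact: onW_bij (enum_rank_bij I).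
by apply: eq_bigr => i _; rewrite rowK enum_rankK.
Qed.

Lemma homog_large (K : fieldType) nu (w : 'I_nu -> nat) (J : {mpoly K[nu]} -> Prop) :
  (forall i, 0 < w i)%N -> ring_ideal J -> (forall i, exists k, J ('X_i ^+ k)) ->
  exists N, forall n, (N < n)%N -> forall h, h \is whomog w n -> J h.
Proof.
move=> w0 [J0 JD JM] /choice[k kP]; exists (\sum_i k i * w i)%N => n Nn h hh.
rewrite [h]mpolyE big_seq; apply: ring_ideal_sum => // m mh; rewrite -mul_mpolyC; apply: (JM).
have [i mi] : exists i, (k i <= m i)%N.
  apply: contrapT => no; move: Nn; rewrite ltnNge => /negP; apply.
  move/dhomogP: hh => /(_ m mh) <-; apply: leq_sum => i _; rewrite leq_pmul2r //.
  by rewrite ltnW // ltnNge; apply/negP => le; apply: no; exists i.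
have -> : 'X_[m] = 'X_[(m - U_(i) *+ k i)%MM] * 'X_i ^+ k i :> {mpoly K[nu]}.
  rewrite mpolyXn -mpolyXD submK //; apply/mnm_lepP => j; rewrite mulmnE mnm1E.
  by case: eqP => [<-|_]; rewrite ?mul1n ?mul0n.
by apply: (JM); apply: kP.
Qed.

Section Hilbert.
Variables (K : closedFieldType) (F : fieldType) (iota : {rmorphism K -> F}).
Variables (X : normal_variety iota) (d nu : nat) (degCl : {additive Cl X -> int}).
Variables (D0 : WDiv X) (f : 'I_nu -> F) (w : 'I_nu -> nat).
Hypothesis S : cox_setting d degCl D0 f w.
Local Notation MP := {mpoly K[nu]}.
Local Notation I := (tcs_ideal iota f w).
Local Notation hf := (hf w).
Local Notation piece := (@piece K nu w).
Local Notation evf := (ev iota f).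
Let w_gt0 := cs_w S.

Lemma homogeneous_fraction (a : F) : exists n G H,
  [/\ G \is whomog w n, H \is whomog w n, evf H != 0 & a = evf G / evf H].
Proof.
have [O [i _]] := exists_point S; have [e [Gs [Ges hGs]]] := chart_polynomial S i.
have [e0 s0 _] := Ges.
have [_ fr] := chart_affine i; have [b [c [Ab Ac ->]]] := fr a.
have [k1 [H1 [hH1 ->]]] := chart_fractionP S (conj Ges hGs) Ab.
have [k2 [H2 [hH2 ->]]] := chart_fractionP S (conj Ges hGs) Ac.
have hX k : Gs ^+ k \is whomog w (e * k) by apply: dhomogMn.
have [z|nz] := eqVneq (evf H2) 0.
  exists 0%N, 0, 1; rewrite ev0 ev1 z !mul0r invr0 mulr0 oner_eq0; split=> //; first exact: rpred0.
  exact: dhomog1.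
exists (e * k1 + e * k2)%N, (H1 * Gs ^+ k2), (Gs ^+ k1 * H2).
rewrite !evM !evXn; split; [exact: dhomogM|exact: dhomogM|by rewrite mulf_neq0 // expf_neq0|].
by rewrite !invfM invrK; field; rewrite ?nz ?expf_neq0.
Qed.

Lemma nmon_bound (i0 : 'I_nu) n : (nmon w n <= n.+1 ^ nu.-1)%N.
Proof.
pose J := {i : 'I_nu | i != i0}.
pose code (m : 'X_{1..nu < n.+1}) : {ffun J -> 'I_n.+1} := [ffun i => inord (m (val i))].
have bm (m : 'X_{1..nu < n.+1}) j : (m j < n.+1)%N.
  by apply: leq_ltn_trans (bmdeg m); rewrite mdegE (bigD1 j) //= leq_addr.
have ci : {in monos w n &, injective code}.
  move=> m1 m2; rewrite !inE => /eqP h1 /eqP h2 /ffunP e; apply/val_inj/mnmP => i.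
  have e' j : j != i0 -> m1 j = m2 j.
    by move=> ji; have := e (Sub j ji); rewrite !ffunE => /(congr1 val) /=; rewrite !inordK.
  have [->|] := eqVneq i i0; last exact: e'.
  have := etrans h1 (esym h2); rewrite /mwt (bigD1 i0) //= [RHS](bigD1 i0) //=.
  rewrite (eq_bigr (fun j => m2 j * w j)%N) => [|j /e' ->//] /addIn /eqP.
  by rewrite eqn_pmul2r ?(cs_w S) // => /eqP.
have := leq_card_in _ _ ci; rewrite card_ffun card_ord card_sig.
rewrite (eq_card (B := predC1 i0)) //; have := cardC1 i0; rewrite card_ord => -> //.
Qed.

Lemma nu_gt0 : (0 < nu)%N.
Proof.
rewrite lt0n; apply/negP => /eqP nu0.
have : 2%N = 1%N; last by [].
by apply: (weights_coprime S) => j; have := ltn_ord j; rewrite {2}nu0.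
Qed.

(** Over a common denominator, d independent fractions give about M^d
    independent elements of degree proportional to M, while the number of
    monomials of that degree grows at most like M to the number of variables
    minus one. *)
Lemma dim_lt_variables : (d < nu)%N.
Proof.
rewrite ltnNge; apply/negP => nud; have [[x xind] _] := cs_dim S.
have /choice[n hn] := fun k => homogeneous_fraction (x k).
have /choice[u hu] := hn; have {hu}/choice[v uv] := hu.
pose D := (\sum_k n k)%N.
have key M : (M.+1 ^ d <= (M * D).+1 ^ nu.-1)%N.
  apply: leq_trans (nmon_bound (Ordinal nu_gt0) _).
  rewrite -(@hf0 K nu w w_gt0); have II := tcs_ideal_ideal iota f w.
  pose e (a : {ffun 'I_d -> 'I_M.+1}) : MP := \prod_k (u k ^+ a k * v k ^+ (M - a k)).
  have -> : (M.+1 ^ d = #|{ffun 'I_d -> 'I_M.+1}|)%N by rewrite card_ffun !card_ord.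
  have he a : e a \is whomog w (M * D).
    rewrite /e /D big_distrr /=; apply: whomog_prod => k; have [hu hv _ _] := uv k.
    have ak : (a k <= M)%N by rewrite -ltnS.
    have -> : (M * n k = n k * a k + n k * (M - a k))%N by rewrite -mulnDr subnKC // mulnC.
    by apply: dhomogM; apply: dhomogMn.
  have I0 : ring_ideal (fun g => g = 0 :> MP).
    by split=> // [a b -> ->|a b ->]; rewrite ?addr0 ?mulr0.
  have sub : piece (M * D) `&` (fun g => g = 0) `<=` piece (M * D) by move=> g [].
  have := qdim_geq (e := e) (@piece_subspace K nu w _) (ideal_piece_subspace w _ I0) sub (hfP w_gt0 _ I0) he; apply.
  move=> a [_ s0] c; pose mn (c : {ffun 'I_d -> 'I_M.+1}) : 'X_{1..d} := [multinom (c k : nat) | k < d].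
  have mninj : injective mn.
    by move=> c1 c2 /mnmP ec; apply/ffunP => k; apply: val_inj; have := ec k; rewrite !mnmE.
  pose p := \sum_c a c *: 'X_[mn c] : {mpoly K[d]}.
  suff p0 : p = 0.
    have := congr1 (mcoeff (mn c)) p0; rewrite /p raddf_sum (bigD1 c) //= mcoeffZ mcoeffX eqxx mulr1 mcoeff0.
    rewrite big1 ?addr0 // => c' cc; rewrite mcoeffZ mcoeffX (inj_eq mninj) (negPf cc) mulr0 //.
  apply: xind; rewrite /p -[mmap iota x]/(ev iota x) ev_sum.
  have V0 : \prod_k evf (v k) ^+ M != 0.
    by apply/prodf_neq0 => k _; apply: expf_neq0; have [] := uv k.
  apply: (mulfI V0); rewrite mulr0 mulr_sumr -[RHS](ev0 iota f) -s0 ev_sum; apply: eq_bigr => c' _.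
  rewrite !evZ mulrCA; congr (_ * _).
  rewrite /ev mmapX /mmap1 -/(ev iota f _) -big_split /= /e.
  transitivity (\prod_k evf (u k ^+ c' k * v k ^+ (M - c' k))); last by rewrite -(rmorph_prod (ev iota f)).
  apply: eq_bigr => k _; rewrite evM !evXn mnmE; have [_ _ v0 {1}->] := uv k.
  have ck : (c' k <= M)%N by rewrite -ltnS.
  by rewrite expr_div_n -{1}(subnK ck) exprD mulrAC -mulrA divfK ?expf_neq0 // mulrC.
have := key (D.+1 ^ nu.-1)%N; set M := (D.+1 ^ nu.-1)%N => le.
have : (M.+1 ^ d <= M * M.+1 ^ nu.-1)%N.
  apply: leq_trans le _; rewrite {2}/M -expnMn leq_exp2r_weak //.
  by move: (M) (D); clear => M' D'; nia.
have -> : (d = nu.-1 + (d - nu.-1).-1.+1)%N by move: nud nu_gt0; clear; lia.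
rewrite expnD mulnC leq_pmul2r ?expn_gt0 // expnS leqNgt.
by rewrite (leq_trans (ltnSn M)) // leq_pmulr // expn_gt0.
Qed.

Implicit Types (J N : MP -> Prop) (s : seq MP).
Local Notation gen := (foldl (@addp K nu)).

Lemma gen_ideal J s : ring_ideal J -> ring_ideal (gen J s).
Proof. by elim: s J => //= x s IHs J IJ; apply: IHs; exact: (addp_ideal x IJ). Qed.

Lemma gen_sub J s g : J g -> gen J s g.
Proof. by elim: s J => //= x s IHs J Jg; apply: IHs; apply: addp_sub. Qed.

Lemma gen_mem J s g : ring_ideal J -> g \in s -> gen J s g.
Proof.
elim: s J => //= x s IHs J IJ; rewrite inE => /orP[/eqP ->|gs]; last by apply: IHs => //; exact: (addp_ideal x IJ).
by apply: gen_sub; have := addp_in x 1 IJ; rewrite mul1r.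
Qed.

Lemma gen_least J N s g : ring_ideal N -> (forall g, J g -> N g) -> (forall x, x \in s -> N x) ->
  gen J s g -> N g.
Proof.
move=> IN; elim: s J => [|x s IHs] J JN sN /=; first exact: JN.
apply: IHs => [h [u Ju]|y ys]; last by apply: sN; rewrite inE ys orbT.
have [_ ND NM] := IN; rewrite -(subrK (u * x) h); apply: (ND); first exact: JN.
by apply: (NM); apply: sN; rewrite mem_head.
Qed.

(** Each regular element of degree a multiplies the Hilbert series by 1 - t^a. *)
Lemma hf_regseq (T : Type) (g : T -> MP) (a : T -> nat) (s : seq T) J n :
  (forall i, 0 < a i)%N -> (forall i, g i \is whomog w (a i)) -> hideal w J ->
  regseq w J (map g s) ->
  conv (\prod_(i <- s) (1 - 'X^(a i))) (fun n => (hf J n)%:Z) n = (hf (gen J (map g s)) n)%:Z.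
Proof.
move=> a0 ga; elim: s J n => [|i s IHs] J n hJ; first by rewrite big_nil conv1.
rewrite /= => -[pi ni rs]; have hJ' := addp_hideal (ga i) hJ.
rewrite big_cons mulrC convM -IHs //; apply: conv_ext => m _; rewrite conv_1X //.
have [le|lt] := leqP (a i) m; last by rewrite subr0 (hf_small w_gt0 (ga i)).
have := hf_exact w_gt0 (m - a i) (ga i) hJ; rewrite subnKC // => ->.
by rewrite colon_nzd //; [rewrite PoszD addrK|case: hJ].
Qed.

Let J0 := @var_ideal K nu [::].
Let J0_hideal : hideal w J0. Proof. exact: var_ideal_hideal. Qed.

Lemma foldl_var_ideal (A B : seq 'I_nu) :
  gen (@var_ideal K nu B) [seq 'X_i | i <- A] = var_ideal (rev A ++ B).
Proof.
by elim: A B => [|i A IHA] B //=; rewrite (@var_ideal_addp K nu w) IHA rev_cons cat_rcons.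
Qed.

Lemma hf_eq0 J n : ring_ideal J -> (forall g, g \is whomog w n -> J g) -> hf J n = 0%N.
Proof.
move=> IJ h; apply: hf_unique => //; exists (fun=> 0); split=> [[]//|z hz].
exists 0; split=> [|c _]; last by apply/rowP; case.
by rewrite big_ord0 subr0; split=> //; apply: h.
Qed.

Lemma hf_degree0 J : ring_ideal J -> ~ J 1 -> hf J 0 = 1%N.
Proof.
move=> IJ J1; apply: hf_unique => //; exists (fun=> 1); split=> [_|z hz]; first exact: dhomog1.
have [c ->] := whomog0 w_gt0 hz.
have cE a : c%:MP - \sum_(i < 1) a 0 i *: 1 = (c - a 0 0)%:MP :> MP.
  by rewrite big_ord1 -mul_mpolyC mulr1 mpolyCB.
exists (const_mx c); split=> [|a]; rewrite cE.
  by rewrite mxE subrr mpolyC0; split; [apply: rpred0 | case: IJ].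
move=> [_ Ja]; apply/rowP => i; rewrite mxE (zmodp.ord1 i); apply/eqP; apply: contra_notT J1 => ca.
have [_ _ JM] := IJ; have := JM (c - a 0 0)^-1%:MP _ Ja.
by rewrite -mpolyCM mulVf ?subr_eq0.
Qed.

Lemma hf_all_variables n : hf (@var_ideal K nu (rev (enum 'I_nu) ++ [::])) n = (n == 0%N).
Proof.
set J := var_ideal _; have [IJ _] : hideal w J := var_ideal_hideal K w _.
case: n => [|n]; [apply: hf_degree0 => // | apply: hf_eq0 => // g /dhomogP hg m /hg].
  by move=> /(_ 0%MM); rewrite msupp1 inE eqxx => /(_ isT) [j _]; rewrite mnm0E.
move=> e; apply: contrapT => no; suff h : mwt w m = 0%N by have := e; rewrite -[LHS]/(mwt w m) h.
rewrite /mwt big1 // => i _; have [->//|mi] := posnP (m i); case: no; exists i => //.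
by rewrite cats0 mem_rev mem_enum.
Qed.

Lemma hf_polynomial_ring n :
  conv (\prod_(i < nu) (1 - 'X^(w i))) (fun n => (hf J0 n)%:Z) n = delta0 n.
Proof.
have := @hf_regseq _ (fun i => 'X_i) w (enum 'I_nu) J0 n w_gt0 (whomogX K w) J0_hideal.
rewrite big_enum foldl_var_ideal hf_all_variables => -> //.
  by rewrite /delta0; case: eqP.
by apply: (var_regseq K w_gt0) => //; apply: enum_uniq.
Qed.

Section Complete.
Variables (r : nat) (g : 'I_r -> MP) (gam : 'I_r -> nat).
Hypothesis nuE : nu = (d.+1 + r)%N.
Hypothesis g_hom : forall j, weighted_homog w (g j) (gam j).
Hypothesis g_gen : I = ideal_generated_by g.

Local Notation gs := [seq g j | j <- enum 'I_r].

Lemma g_whomog j : g j \is whomog w (gam j).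
Proof. by have := g_hom j => h; apply/whomog_weight => //; case: h. Qed.

Lemma tcs_ideal_nontrivial : ~ I 1.
Proof.
rewrite (tcs_ideal_homog iota f (dhomog1 _ _)) ev1 => /eqP; rewrite oner_eq0 //.
Qed.

Lemma tcs_ideal_g j : I (g j).
Proof.
rewrite g_gen; exists (fun i => (i == j)%:R); rewrite (bigD1 j) //= eqxx mul1r big1 ?addr0 //.
by move=> i /negPf ->; rewrite mul0r.
Qed.

Lemma gam_gt0 j : (0 < gam j)%N.
Proof.
rewrite lt0n; apply/negP => /eqP e; have := g_whomog j; rewrite e => /(whomog0 w_gt0) [c gc].
have [g0 _] := g_hom j; apply: tcs_ideal_nontrivial.
have c0 : c != 0 by apply: contraNneq g0 => c0; rewrite gc c0 mpolyC0.
have [_ _ IM] := tcs_ideal_ideal iota f w; have := IM c^-1%:MP _ (tcs_ideal_g j).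
by rewrite gc -mpolyCM mulVf.
Qed.

Lemma g_posh x : x \in gs -> posh w x.
Proof. by move=> /mapP [j _ ->]; exists (gam j); [apply: gam_gt0 | apply: g_whomog]. Qed.

Lemma tcs_gen : gen J0 gs = I.
Proof.
have II := tcs_ideal_ideal iota f w; have [IJ _] := J0_hideal.
apply/funext => h; apply/propext; split.
  apply: gen_least => // [{}h /var_ideal0 ->|x /mapP [j _ ->]]; last exact: tcs_ideal_g.
  by case: II.
rewrite g_gen => -[c ->]; have IG := gen_ideal gs IJ.
apply: ring_ideal_sum => // j _; have [_ _ GM] := IG; apply: (GM); apply: gen_mem => //.
by apply: map_f; rewrite mem_enum.
Qed.

Lemma g_regseq : regseq w J0 gs.
Proof.
apply: (growth_regular w_gt0 (cs_char S) (zs := [seq 'X_i | i <- enum 'I_nu]) (p := d.+1) J0_hideal).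
- by apply: (var_regseq K w_gt0) => //; apply: enum_uniq.
- exact: g_posh.
- have sz (T : Type) k (h : 'I_k -> T) : size [seq h i | i <- enum 'I_k] = k.
    by rewrite size_map size_enum_ord.
  by rewrite !sz nuE.
rewrite tcs_gen; exact: (growth_tcs f w_gt0 (cs_dim S)).
Qed.

Lemma hf_tcs n : conv (\prod_i (1 - 'X^(w i))) (fun n => (hf I n)%:Z) n =
  (\prod_j (1 - 'X^(gam j)))`_n.
Proof.
have h m : (hf I m)%:Z = conv (\prod_(j < r) (1 - 'X^(gam j))) (fun n => (hf J0 n)%:Z) m.
  rewrite -tcs_gen; have := hf_regseq m gam_gt0 g_whomog J0_hideal g_regseq.
  by rewrite big_enum => ->.
rewrite (conv_ext _ (fun m _ => h m)) convC (conv_ext _ (fun m _ => hf_polynomial_ring m)).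
exact: conv_delta0.
Qed.

Lemma bigO_weaken p q h : (p <= q)%N -> bigO p h -> bigO q h.
Proof.
move=> pq [C hC]; exists C => m; apply: leq_trans (hC m) _.
by rewrite leq_mul2l leq_pexp2l ?orbT.
Qed.

Lemma growth_gen J p (s : seq MP) : hideal w J -> (forall x, x \in s -> posh w x) ->
  bigO p (cum (hf (gen J s))) -> bigO (p + count (fun x => ~~ `[< J x >]) s) (cum (hf J)).
Proof.
elim: s J p => [|x s IHs] J p hJ hs /=; first by rewrite addn0.
have hs' y : y \in s -> posh w y by move=> ys; apply: hs; rewrite inE ys orbT.
have [a a0 xa] := hs x (mem_head _ _); have hJ' := addp_hideal xa hJ.
case: (asboolP (J x)) => Jx /= h.
  suff e : addp J x = J by rewrite e in h; exact: IHs.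
  apply/funext => y; apply/propext; split=> [[u Ju]|]; last exact: addp_sub.
  by have [[_ JD JM] _] := hJ; rewrite -(subrK (u * x) y); apply: (JD) => //; apply: (JM).
rewrite add1n addnS; apply: (growth_quotient w_gt0 a0 xa hJ).
have := IHs _ _ hJ' hs' h; set n1 := count _ _; set n2 := count _ _ => h1.
apply: bigO_weaken h1; rewrite leq_add2l; apply: sub_count => y /=; apply: contraNN => /asboolP Jy.
by apply/asboolP/addp_sub.
Qed.

(** The variables whose weight is not a multiple of e generate an ideal whose
    quotient is a polynomial ring; it contains the equations whose degree is not
    a multiple of e. *)
Lemma cyclo_mult_bound e p (B := [seq i <- enum 'I_nu | ~~ (e %| w i)%N]) :
  bigO p (cum (hf (gen (@var_ideal K nu B) gs))) -> (cyclo_mult w e <= p + cyclo_mult gam e)%N.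
Proof.
move=> h; have hB : hideal w (@var_ideal K nu B) := var_ideal_hideal K w B.
have := growth_gen hB g_posh h; set n := count _ _ => gB.
have nb : (n <= cyclo_mult gam e)%N.
  rewrite /n count_map -sum1_count /cyclo_mult -big_enum big_mkcond /=; apply: leq_sum => j _.
  have [ej|ej] := boolP (e %| gam j)%N; first by case: ifP.
  case: asboolP => //= ng; case: ng => m mg.
  have [_ hm] := g_hom j; apply: contrapT => no; case/negP: ej; rewrite -(hm m mg).
  apply: dvdn_sum => i _; have [ei|ei] := boolP (e %| w i)%N; first exact: dvdn_mull.
  have [->|mi] := posnP (m i); first by rewrite mul0n dvdn0.
  by case: no; exists i => //; rewrite mem_filter ei mem_enum.
apply: leq_trans (_ : p + n <= _)%N; last by rewrite leq_add2l.
pose A := [seq i <- enum 'I_nu | (e %| w i)%N].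
have -> : cyclo_mult w e = size [seq 'X_i : MP | i <- A].
  have -> : cyclo_mult w e = (\sum_(i <- enum 'I_nu) (e %| w i))%N by rewrite big_enum.
  rewrite size_map size_filter -sum1_count [RHS]big_mkcond /=.
  by apply: eq_bigr => i _; case: (e %| w i)%N.
apply: (growth_submodule w_gt0 (J := var_ideal B) (N := fun=> True)) => //.
- exists 1 => // /(_ 0%MM); rewrite msupp1 inE eqxx => /(_ isT) [j _]; by rewrite mnm0E.
- apply: (var_regseq K w_gt0); first by rewrite filter_uniq // enum_uniq.
  by move=> i; rewrite !mem_filter => /andP[-> _].
apply: bigO_le gB => m; apply: cum_le => k; rewrite /diff hf_full subn0 //.
Qed.

Lemma pole_orders (Lam : nat) : (forall m : int, (Lam %| m)%Z <-> forall x, tcs_hat iota f w x -> (wgcd w x %| m)%Z) ->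
  (forall e, (1 < e)%N -> (cyclo_mult w e <= d + cyclo_mult gam e)%N) /\
  (forall e, ~~ (e %| Lam)%N -> (cyclo_mult w e <= cyclo_mult gam e)%N).
Proof.
move=> LamP; have hB e := var_ideal_hideal K w [seq i <- enum 'I_nu | ~~ (e %| w i)%N].
have II := tcs_ideal_ideal iota f w.
have Isub e h : I h -> gen (@var_ideal K nu [seq i <- enum 'I_nu | ~~ (e %| w i)%N]) gs h.
  have [IB _] := hB e; have IG := gen_ideal gs IB; rewrite g_gen => -[c ->].
  apply: ring_ideal_sum => // j _; have [_ _ GM] := IG; apply: (GM); apply: gen_mem => //.
  by apply: map_f; rewrite mem_enum.
split=> e.
  move=> e1; apply: cyclo_mult_bound.
  have [i ei] : exists i, ~~ (e %| w i)%N.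
    apply: contrapT => no; suff : e = 1%N by move=> e2; rewrite e2 in e1.
    by apply: (weights_coprime S) => j; apply: contrapT => /negP ej; apply: no; exists j.
  apply: bigO_le (growth_nzd w_gt0 (whomogX K w i) (tcs_hideal iota f w) _ (growth_tcs f w_gt0 (cs_dim S))).
    move=> m; apply: cum_le => n; have [IB _] := hB e; apply: (hf_le w_gt0); first exact: addp_ideal.
      exact: gen_ideal.
    move=> h [u Iu]; rewrite -(subrK (u * 'X_i) h).
    have [_ GD GM] := gen_ideal gs IB; apply: (GD); first exact: Isub.
    apply: (GM); apply: gen_sub => m'; rewrite msuppX inE => /eqP ->; exists i.
      by rewrite mem_filter ei mem_enum.
    by rewrite mnm1E eqxx.
  move=> u /tcs_idealP Iu; apply/tcs_idealP => n; apply: (mulIf (cs_f0 S i)); rewrite mul0r.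
  have := Iu (w i + n)%N; rewrite mulrC (pihomogM _ _ (whomogX K w i)) evM evX mulrC.
  by move=> ->.
move=> eL; apply: leq_trans (_ : (0 + cyclo_mult gam e <= _)%N) => //; apply: cyclo_mult_bound.
have [IB _] := hB e; have IG := gen_ideal gs IB; set J := gen _ _.
have nil (i : 'I_nu) : exists k, J ('X_i ^+ k).
  apply: contrapT => no; have [k Jk|x [xJ xi]] := nullstellensatz (G := 'X_i) IG; first by apply: no; exists k.
  case/negP: eL; have : (wgcd w x %| Lam%:Z)%Z.
    move: (LamP Lam) => [/(_ (dvdzz _)) h _]; apply: h; split; last by exists i; rewrite mevalXU in xi.
    by move=> h Ih; apply: xJ; apply: Isub.
  rewrite dvdzE !absz_nat; apply: dvdn_trans; apply/dvdn_biggcdP => j xj.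
  apply: contrapT => /negP ej; case/eqP: xj; rewrite -[x j](mevalXU (R := K)); apply: xJ.
  apply: gen_sub => m'; rewrite msuppX inE => /eqP ->; exists j; last by rewrite mnm1E eqxx.
  by rewrite mem_filter ej mem_enum.
have [N hN] := homog_large w_gt0 IG nil.
have Jn n : (N < n)%N -> hf J n = 0%N by move=> /hN h; apply: hf_eq0.
exists (cum (hf J) N) => m; rewrite expn0 muln1.
have [le|lt] := leqP m N; first exact: cum_mono.
rewrite /cum -(subnKC (leqW lt)) -!(big_mkord predT) (@big_cat_nat _ _ _ N.+1) //= ?leq_addr //.
rewrite [X in (_ + X)%N]big1_seq ?addn0 // => i /andP[_]; rewrite mem_index_iota => /andP[h _].
exact: Jn.
Qed.

(** A pole at a primitive e-th root of unity has order at most d for e > 1, and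
    there is none unless e divides Lam, so the poles cancel against
    (1 - t)(1 - t^Lam)^d. *)
Lemma hilbert_polynomial (Lam : nat) : (0 < Lam)%N ->
  (forall m : int, (Lam %| m)%Z <-> forall x, tcs_hat iota f w x -> (wgcd w x %| m)%Z) ->
  exists (Q : {poly rat}) q0,
  [/\ (size Q <= d.+1)%N,
      d`!%:R * Q`_d * (\prod_i w i)%:R = (Lam ^ d * \prod_j gam j)%:R &
      forall q, (q0 <= q)%N -> (hf I (Lam * q)%N)%:R = Q.[q%:R]].
Proof.
move=> L0 LamP; have [p1 p2] := pole_orders LamP.
have [Q [q0 [sQ cQ Qq]]] := hilbert_function_polynomial w_gt0 gam_gt0 L0 nuE (fun e e1 _ => p1 e e1) p2 hf_tcs.
by exists Q, q0; split=> // q /Qq <-; rewrite -pmulrn.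
Qed.

End Complete.

End Hilbert.

(** * Cech complexes with bounded poles *)

Section ChartSystems.
Variables (n : nat) (F : fieldType).
Local Notation SI := {set 'I_n}.
Implicit Types (phi psi : SI -> F) (T sigma tau : SI) (P Q : SI -> set F).

Definition below (sigma : SI) (i : 'I_n) : nat := #|[set j in sigma | (j < i)%N]%SET|.

Definition dd phi : SI -> F := fun sigma =>
  \sum_(i in sigma) (-1) ^+ below sigma i * phi (sigma :\ i)%SET.

Lemma ddB phi psi sigma : dd (fun t => phi t - psi t) sigma = dd phi sigma - dd psi sigma.
Proof. by rewrite /dd -sumrB; apply: eq_bigr => i _; rewrite mulrBr. Qed.

Lemma ddD phi psi sigma : dd (fun t => phi t + psi t) sigma = dd phi sigma + dd psi sigma.
Proof. by rewrite /dd -big_split; apply: eq_bigr => i _; rewrite mulrDr. Qed.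

Lemma ddZ c phi sigma : dd (fun t => c * phi t) sigma = c * dd phi sigma.
Proof. by rewrite /dd mulr_sumr; apply: eq_bigr => i _; rewrite mulrCA. Qed.

Lemma dd_ext phi psi sigma : (forall i, i \in sigma -> phi (sigma :\ i)%SET = psi (sigma :\ i)%SET) ->
  dd phi sigma = dd psi sigma.
Proof. by move=> e; apply: eq_bigr => i /e ->. Qed.

Lemma below_remove sigma i j : i \in sigma -> below sigma j = (below (sigma :\ i) j + (i < j))%N.
Proof.
move=> si; rewrite /below (cardsD1 i) !inE si /= addnC; congr (_ + _)%N.
by apply: eq_card => l; rewrite !inE andbA.
Qed.

Hypothesis two_neq0 : (2%:R : F) != 0.

Lemma dd_dd phi sigma : dd (dd phi) sigma = 0.
Proof.
pose a i j := (-1) ^+ below sigma i * ((-1) ^+ below (sigma :\ i)%SET j * phi (sigma :\ i :\ j)%SET).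
have aC i j : i \in sigma -> j \in sigma -> i != j -> a i j = - a j i.
  move=> si sj ij; wlog lt : i j si sj ij / (i < j)%N.
    move=> W; case: (ltngtP i j) => [|lt|/val_inj e]; [exact: W| |by rewrite e eqxx in ij].
    by rewrite (W j i) ?opprK // eq_sym.
  rewrite /a !mulrA -!exprD (finset.setDDl sigma [set i] [set j]) (finset.setDDl sigma [set j] [set i]) finset.setUC.
  rewrite (below_remove j si) lt addn1 (below_remove i sj) [(j < i)%N]ltnNge ltnW //= addn0.
  by rewrite addSn exprS mulN1r mulNr opprK addnC.
have E : dd (dd phi) sigma = \sum_(i in sigma) \sum_(j in sigma | j != i) a i j.
  rewrite /dd; apply: eq_bigr => i si; rewrite mulr_sumr.
  by apply: eq_bigl => j; rewrite !inE andbC.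
have S2 : dd (dd phi) sigma = - dd (dd phi) sigma.
  transitivity (\sum_(j in sigma) \sum_(i in sigma | i != j) a i j).
    rewrite E (exchange_big_dep (mem sigma)) /=; last by move=> i j _ /andP[].
    by apply: eq_bigr => j sj; apply: eq_bigl => i; rewrite sj /= eq_sym.
  rewrite E -sumrN; apply: eq_bigr => j sj; rewrite -sumrN; apply: eq_bigr => i /andP[si ij].
  exact: aC.
apply/eqP; move/eqP: S2; rewrite -addr_eq0 -mulr2n -mulr_natl mulf_eq0 => /orP[|//].
by rewrite (negPf two_neq0).
Qed.

(** The faces of t + tau are tau and the t + (tau - i): up to signs, the
    coboundary splits accordingly. *)
Definition slice t phi : SI -> F := fun tau => (-1) ^+ below tau t * phi (t |: tau)%SET.

Lemma dd_split t phi tau : t \notin tau ->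
  (-1) ^+ below tau t * dd phi (t |: tau)%SET = phi tau - dd (slice t phi) tau.
Proof.
move=> ttau; rewrite /dd (big_setD1 t) ?finset.setU11 //= finset.setU1K // mulrDr mulrA -exprD.
have bt : below (t |: tau)%SET t = below tau t.
  by rewrite (below_remove t (finset.setU11 t tau)) finset.setU1K // ltnn addn0.
rewrite bt addnn -signr_odd odd_double mul1r; congr (_ + _).
rewrite mulr_sumr -sumrN; apply: eq_bigr => i itau.
have it : i != t by apply: contraNneq ttau => <-.
have e : (t |: tau) :\ i = t |: (tau :\ i) :> SI.
  by apply/setP => j; rewrite !inE; have [->|] := eqVneq j t; rewrite ?andbF ?(eq_sym t) ?it ?orbF //= orbF.
rewrite e /slice !mulrA -!exprD -mulNr; congr (_ * _).
have b1 : below (t |: tau)%SET i = (below tau i + (t < i))%N.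
  by rewrite (below_remove i (finset.setU11 t tau)) finset.setU1K.
have b2 := below_remove t itau.
rewrite b1 b2 -[RHS]mulN1r -exprS; have [lt|lt|/val_inj e'] := ltngtP t i; last by rewrite e' eqxx in it.
  by rewrite addn0 addn1 addnS addnC.
rewrite addn0 addn1 -signr_odd -[RHS]signr_odd; congr (_ ^+ _); congr nat_of_bool.
by rewrite addSn addnC.
Qed.

Definition subgroup (A : set F) := A 0 /\ forall a b, A a -> A b -> A (a - b).
Lemma subgroupD A a b : subgroup A -> A a -> A b -> A (a + b).
Proof. by move=> [A0 AB] Aa Ab; rewrite -[b]opprK -[- b]sub0r; apply: (AB) => //; apply: (AB). Qed.
Lemma subgroup_sum A (I : Type) (r : seq I) (p : pred I) (c : I -> F) : subgroup A ->
  (forall i, p i -> A (c i)) -> A (\sum_(i <- r | p i) c i).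
Proof.
move=> SA h; elim/big_ind : _ => //; first by case: SA.
by move=> a b; apply: subgroupD.
Qed.
Lemma subgroup_sign A m a : subgroup A -> A a -> A ((-1) ^+ m * a).
Proof.
move=> [A0 AB] Aa; rewrite -signr_odd; case: (odd m); last by rewrite mul1r.
by rewrite expr1 mulN1r -sub0r; apply: AB.
Qed.

Definition system P := (forall sigma, subgroup (P sigma)) /\
  forall sigma tau, sigma \subset tau -> P sigma `<=` P tau.

Lemma system_dd P T phi : system P -> (forall sigma, sigma \subset T -> P sigma (phi sigma)) ->
  forall sigma, sigma \subset T -> P sigma (dd phi sigma).
Proof.
move=> [SP MP] h sigma sT; apply: subgroup_sum => // i si; apply: subgroup_sign => //.
have sub : (sigma :\ i \subset sigma)%SET by apply: finset.subD1set.
have := h (sigma :\ i)%SET (fintype.subset_trans sub sT); exact: (MP _ _ sub).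
Qed.

(** Exactness of the complex of the quotient system P/Q over the subsets of T. *)
Definition exact_on T P Q := forall phi,
  (forall sigma, sigma \subset T -> P sigma (phi sigma)) ->
  (forall sigma, sigma \subset T -> Q sigma (dd phi sigma)) ->
  exists psi, (forall sigma, sigma \subset T -> P sigma (psi sigma)) /\
    forall sigma, sigma \subset T -> Q sigma (phi sigma - dd psi sigma).

Definition le_sys P Q := forall sigma, P sigma `<=` Q sigma.

Lemma exact_quotient T (A B B' : SI -> set F) : system A -> system B' -> system B ->
  le_sys B B' -> le_sys B' A ->
  exact_on T A B -> exact_on T B' B -> exact_on T A B'.
Proof.
move=> SA SB' SB BB' B'A exA exB phi Aphi Bd.
have [|psi [Bpsi h]] := exB (dd phi) Bd.
  by move=> sigma _; rewrite dd_dd; case: (SB) => /(_ sigma) [].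
have [sA _] := SA; have [sB' _] := SB'.
have [|sigma sT|chi [Achi h2]] := exA (fun t => phi t - psi t).
- by move=> sigma sT; have [_ AB] := sA sigma; apply: (AB); [apply: Aphi | apply: (B'A); apply: Bpsi].
- by rewrite ddB; apply: h.
exists chi; split=> // sigma sT.
have -> : phi sigma - dd chi sigma = (phi sigma - psi sigma - dd chi sigma) + psi sigma by ring.
by apply: subgroupD => //; [apply: BB'; apply: h2 | apply: Bpsi].
Qed.

Lemma exact_extension T (A A' B : SI -> set F) : system A -> system A' -> system B ->
  le_sys B A' -> le_sys A' A ->
  exact_on T A' B -> exact_on T A A' -> exact_on T A B.
Proof.
move=> SA SA' SB BA' A'A exB exA phi Aphi Bd.
have [|psi [Apsi h]] := exA phi Aphi; first by move=> sigma /Bd; apply: BA'.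
have [sA _] := SA.
have [|sigma sT|chi [Achi h2]] := exB (fun t => phi t - dd psi t); first exact: h.
  by rewrite ddB dd_dd subr0; apply: Bd.
exists (fun t => psi t + chi t); split=> sigma sT.
  by apply: subgroupD => //; [apply: Apsi | apply: A'A; apply: Achi].
by rewrite ddD opprD addrA; apply: h2.
Qed.

Definition sys_add P Q : SI -> set F := fun sigma => [set x | exists a b, [/\ P sigma a, Q sigma b & x = a + b]].
Definition sys_meet P Q : SI -> set F := fun sigma => [set x | P sigma x /\ Q sigma x].

Lemma sys_add_system P Q : system P -> system Q -> system (sys_add P Q).
Proof.
move=> [SP MP] [SQ MQ]; split=> [sigma|sigma tau st x [a [b [Pa Qb ->]]]]; last first.
  by exists a, b; split=> //; [apply: MP Pa | apply: MQ Qb].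
have [P0 PB] := SP sigma; have [Q0 QB] := SQ sigma; split; first by exists 0, 0; rewrite addr0.
move=> x y [a [b [Pa Qb ->]]] [a' [b' [Pa' Qb' ->]]]; exists (a - a'), (b - b').
by split; [apply: PB|apply: QB|rewrite opprD addrACA].
Qed.

Lemma sys_meet_system P Q : system P -> system Q -> system (sys_meet P Q).
Proof.
move=> [SP MP] [SQ MQ]; split=> [sigma|sigma tau st x [Px Qx]]; last first.
  by split; [apply: MP Px | apply: MQ Qx].
have [P0 PB] := SP sigma; have [Q0 QB] := SQ sigma; split=> // x y [Px Qx] [Py Qy].
by split; [apply: PB | apply: QB].
Qed.

Lemma exact_second_iso T P Q : system P -> system Q ->
  exact_on T P (sys_meet P Q) -> exact_on T (sys_add P Q) Q.
Proof.
move=> SP SQ ex phi hphi hd; have [sP mP] := SP; have [sQ mQ] := SQ.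
have /choice[a ha] : forall sigma, exists a, sigma \subset T -> P sigma a /\ Q sigma (phi sigma - a).
  move=> sigma; have [sT|_] := boolP (sigma \subset T); last by exists 0.
  by have [a [b [Pa Qb ->]]] := hphi _ sT; exists a => _; rewrite addrC addKr.
have Pa sigma : sigma \subset T -> P sigma (a sigma) by move=> /ha [].
have Qa sigma : sigma \subset T -> Q sigma (phi sigma - a sigma) by move=> /ha [].
have [//|sigma sT|psi [Ppsi h]] := ex a.
  split; first exact: (system_dd SP Pa).
  have := system_dd SQ Qa sT; rewrite ddB => h; have [_ QB] := sQ sigma.
  by have := QB _ _ (hd _ sT) h; rewrite opprB addrC subrK.
exists psi; split=> sigma sT.
  by exists (psi sigma), 0; split; [apply: Ppsi|case: (sQ sigma)|rewrite addr0].
have -> : phi sigma - dd psi sigma = (a sigma - dd psi sigma) + (phi sigma - a sigma) by ring.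
by apply: subgroupD => //; [case: (h _ sT) | apply: Qa].
Qed.

(** A constant system over a nonempty simplex is exact: cone over t. *)
Lemma exact_const T t (A B : set F) : subgroup A -> subgroup B -> t \in T ->
  exact_on T (fun=> A) (fun=> B).
Proof.
move=> SA SB tT phi Aphi Bd.
pose psi (sigma : SI) := if t \in sigma then 0 else slice t phi sigma.
have sub sigma : sigma \subset T -> (t |: sigma \subset T)%SET by move=> sT; rewrite finset.subUset finset.sub1set tT.
exists psi; split=> sigma sT.
  rewrite /psi; case: ifP => _; first by case: SA.
  by apply: subgroup_sign => //; apply: Aphi; apply: sub.
have [ts|ts] := boolP (t \in sigma); last first.
  have -> : dd psi sigma = dd (slice t phi) sigma.
    by apply: dd_ext => i _; rewrite /psi !inE (negPf ts) andbF.
  rewrite -dd_split //; apply: subgroup_sign => //; apply: Bd; exact: sub.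
have sE : sigma = (t |: (sigma :\ t))%SET by rewrite finset.setD1K.
have nt : t \notin (sigma :\ t)%SET by rewrite !inE eqxx.
have := dd_split psi nt; rewrite -sE.
have -> : dd (slice t psi) (sigma :\ t)%SET = 0.
  by rewrite /dd big1 // => i _; rewrite /slice /psi finset.setU11 !mulr0.
rewrite subr0 {2}/psi (negPf nt) /slice -sE => /(mulfI _) -> //; last by rewrite signr_eq0.
by rewrite subrr; case: SB.
Qed.

(** A quotient system that vanishes on the sets without t is a system over the
    subsets of T - t. *)
Lemma exact_link T t P Q : system P -> system Q -> t \in T ->
  (forall sigma, sigma \subset T -> t \notin sigma -> P sigma `<=` Q sigma) ->
  exact_on (T :\ t)%SET (fun tau => P (t |: tau)%SET) (fun tau => Q (t |: tau)%SET) ->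
  exact_on T P Q.
Proof.
move=> [SP MP] [SQ MQ] tT PQ ex phi Pphi Qd.
have sub tau : tau \subset (T :\ t)%SET -> [/\ (t |: tau \subset T)%SET, tau \subset T & t \notin tau].
  by rewrite finset.subsetD1 => /andP[sT nt]; rewrite finset.subUset finset.sub1set tT.
have [tau /sub [s1 s2 nt]|tau /sub [s1 s2 nt]|psi1 [P1 h]] := ex (slice t phi).
- by apply: subgroup_sign => //; apply: Pphi.
- have -> : dd (slice t phi) tau = phi tau - (-1) ^+ below tau t * dd phi (t |: tau)%SET.
    by rewrite dd_split // subKr.
  have [_ QB] := SQ (t |: tau)%SET; apply: (QB); last by apply: subgroup_sign => //; apply: Qd.
  by apply: (MQ tau); [apply: finset.subsetUr | apply: PQ => //; apply: Pphi].
pose psi (sigma : SI) := if t \in sigma then - ((-1) ^+ below (sigma :\ t)%SET t * psi1 (sigma :\ t)%SET) else 0.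
have sub2 sigma : sigma \subset T -> (sigma :\ t \subset T :\ t)%SET by move=> sT; apply: finset.setSD.
exists psi; split=> sigma sT.
  rewrite /psi; case: ifP => ts; last by case: (SP sigma).
  have [P0 PB] := SP sigma; rewrite -sub0r; apply: (PB) => //; apply: subgroup_sign => //.
  by have := P1 _ (sub2 _ sT); rewrite finset.setD1K.
have [ts|ts] := boolP (t \in sigma); last first.
  have -> : dd psi sigma = 0 by rewrite /dd big1 // => i _; rewrite /psi !inE (negPf ts) andbF mulr0.
  by rewrite subr0; apply: PQ => //; apply: Pphi.
have sE : (t |: (sigma :\ t))%SET = sigma by rewrite finset.setD1K.
have nt : t \notin (sigma :\ t)%SET by rewrite !inE eqxx.
have := dd_split psi nt; rewrite sE {2}/psi (negPf nt) sub0r.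
have -> : dd (slice t psi) (sigma :\ t)%SET = - dd psi1 (sigma :\ t)%SET.
  transitivity (dd (fun t => -1 * psi1 t) (sigma :\ t)%SET); last by rewrite ddZ mulN1r.
  apply: dd_ext => i _; rewrite /slice /psi finset.setU11 finset.setU1K; last by rewrite !inE eqxx andbF.
  by rewrite mulrN mulrA -exprD addnn -signr_odd odd_double mul1r mulN1r.
rewrite opprK => e; have := h _ (sub2 _ sT); rewrite sE -e /slice sE -mulrBr => hQ.
have := subgroup_sign (below (sigma :\ t)%SET t) (SQ sigma) hQ.
by rewrite mulrA -exprD addnn -signr_odd odd_double mul1r.
Qed.

Lemma exact_scale T c P Q : c != 0 -> exact_on T P Q ->
  exact_on T (fun sigma => [set x | P sigma (c * x)]) (fun sigma => [set x | Q sigma (c * x)]).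
Proof.
move=> c0 ex phi Pphi Qd; have [//|sigma sT|psi [Ppsi h]] := ex (fun t => c * phi t).
  by rewrite ddZ; apply: Qd.
exists (fun t => c^-1 * psi t); split=> sigma sT /=; first by rewrite mulrA divff // mul1r; apply: Ppsi.
by rewrite mulrBr ddZ mulrA divff // mul1r; apply: h.
Qed.

Lemma exact_ext T P Q P' Q' : (forall sigma, sigma \subset T -> P sigma = P' sigma) ->
  (forall sigma, sigma \subset T -> Q sigma = Q' sigma) -> exact_on T P Q -> exact_on T P' Q'.
Proof.
move=> eP eQ ex phi Pphi Qd; have [sigma sT|sigma sT|psi [Ppsi h]] := ex phi.
- by rewrite eP //; apply: Pphi.
- by rewrite eQ //; apply: Qd.
by exists psi; split=> sigma sT; rewrite -?eP -?eQ //; [apply: Ppsi|apply: h].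
Qed.

Lemma exact_refl T P : system P -> exact_on T P P.
Proof.
move=> SP phi Pphi _; exists (fun=> 0); split=> sigma sT; first by case: (SP) => /(_ sigma) [].
by rewrite /dd big1 ?subr0 => [|i _]; [apply: Pphi | rewrite mulr0].
Qed.

Lemma exact_triv T P Q : (forall sigma, sigma \subset T -> P sigma `<=` Q sigma) -> system P ->
  exact_on T P Q.
Proof.
move=> PQ [SP _] phi Pphi _; exists (fun=> 0); split=> sigma sT; first by case: (SP sigma).
by rewrite /dd big1 ?subr0 => [|i _]; [apply: PQ => //; apply: Pphi | rewrite mulr0].
Qed.

End ChartSystems.

Section GradedIdeals.
Variables (K : closedFieldType) (F : fieldType) (iota : {rmorphism K -> F}).
Variables (X : normal_variety iota) (d nu : nat) (degCl : {additive Cl X -> int}).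
Variables (D0 : WDiv X) (f : 'I_nu -> F) (w : 'I_nu -> nat).
Hypothesis S : cox_setting d degCl D0 f w.
Local Notation MP := {mpoly K[nu]}.
Local Notation evf := (ev iota f).
Local Notation sec := (sec D0).
Local Notation I := (tcs_ideal iota f w).
Let w_gt0 := cs_w S.
Implicit Types (A B : int -> set F).

(** Homogeneous ideals of the Cox ring are handled through their graded pieces,
    as subgroups of the function field. *)
Definition gideal A := [/\ forall m, subgroup (A m), forall m, A m `<=` sec m &
  forall m m' l r a, l = m + m' -> sec m' r -> A m a -> A l (r * a)].

Lemma gideal_mul A m m' l r a : gideal A -> sec m' r -> A m a -> l = m + m' -> A l (r * a).
Proof. by move=> [_ _ h] sr Aa lE; apply: h lE sr Aa. Qed.

Lemma sec_subgroup m : subgroup (sec m).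
Proof.
split=> [|a b sa sb]; first exact: sec00.
have -> : a - b = a + iota (- 1) * b by rewrite rmorphN1 mulN1r.
by apply: (secD S) => //; apply: secZ.
Qed.

Lemma sec_gideal : gideal sec.
Proof.
split; [exact: sec_subgroup|by move=> m a|move=> m m' l r a -> sr sa].
by rewrite addrC; apply: secM.
Qed.

Lemma sec1 : sec 0 1. Proof. by apply/secP => [|P]; rewrite ?oner_neq0 // vord0 ord1 //; apply: pd_dvr. Qed.

(** The homogeneous ideal generated by given homogeneous elements. *)
Definition gspan (Gam : int -> set F) : int -> set F := fun n =>
  [set x | forall H : set F, subgroup H ->
    (forall l r a, sec (n - l) r -> Gam l a -> H (r * a)) -> H x].

Lemma gspan_gideal Gam : (forall l, Gam l `<=` sec l) -> gideal (gspan Gam).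
Proof.
move=> Gs; split=> [m|m x h|m m' l r a -> sr ha H SH hH].
- split=> [H [] //|a b ha hb H SH hH].
  by have [_ HB] := SH; apply: (HB); [apply: ha | apply: hb].
- apply: h; first exact: sec_subgroup.
  by move=> l r a sr /Gs sa; rewrite -(subrK l m); apply: secM.
apply: (ha [set x | H (r * x)]).
  have [H0 HB] := SH; split=> [|x y hx hy] /=; first by rewrite mulr0.
  by rewrite mulrBr; apply: (HB).
move=> l' r' a' sr' ga' /=; rewrite mulrA; apply: (hH l') => //.
have -> : m + m' - l' = m' + (m - l') by ring.
exact: secM.
Qed.

Lemma gspan_mem Gam l a : Gam l a -> gspan Gam l a.
Proof. by move=> ga H _ hH; rewrite -[a]mul1r; apply: (hH l) => //; rewrite subrr; apply: sec1. Qed.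

Definition gpoly A : MP -> Prop := fun G => forall n : nat, A n%:Z (evf (pihomog (mwt w) n G)).

Lemma gpoly_ideal A : gideal A -> ring_ideal (gpoly A).
Proof.
move=> [SA AS AM]; split=> [n|G H hG hH n|C G hG].
- by rewrite raddf0 ev0; case: (SA n%:Z).
- by rewrite raddfD /= evD; apply: subgroupD.
rewrite [C]mpolyE mulr_suml => n.
have -> : forall H : 'X_{1..nu} -> MP, pihomog (mwt w) n (\sum_(m <- msupp C) H m) = \sum_(m <- msupp C) pihomog (mwt w) n (H m).
  by move=> H; apply: raddf_sum.
rewrite ev_sum; apply: subgroup_sum => // m _.
rewrite -scalerAl linearZ /= evZ.
have hX : ('X_[m] : MP) \is whomog w (mwt w m) by rewrite dhomogX.
have [le|lt] := leqP (mwt w m) n; last first.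
  by rewrite (pihomogM0 _ hX lt) // ev0 mulr0; case: (SA n%:Z).
rewrite -(subnKC le) (pihomogM _ _ hX) evM mulrA; apply: AM (hG _).
  by rewrite PoszD addrC.
by apply: secZ; apply: (sec_ev S).
Qed.

Lemma gpoly_homog A n G : gideal A -> G \is whomog w n -> gpoly A G <-> A n%:Z (evf G).
Proof.
move=> [SA _ _] hG; split=> [h|h m]; first by have := h n; rewrite pihomog_dE.
have [->|mn] := eqVneq m n; first by rewrite pihomog_dE.
by rewrite (pihomog_ne0 _ hG) ?ev0 ?(eq_sym n) //; case: (SA m%:Z).
Qed.

Variables (e : 'I_(nchart X) -> nat) (Gs : 'I_(nchart X) -> MP).
Hypothesis GsP : forall i, is_chart_poly D0 f w i (e i) (Gs i).
Definition ceq i := evf (Gs i).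
Let s := ceq.

Lemma e_gt0 i : (0 < e i)%N. Proof. by have [[]] := GsP i. Qed.
Lemma s_neq0 i : s i != 0. Proof. by have [[]] := GsP i. Qed.
Lemma s_sec i : sec (e i)%:Z (s i). Proof. by have [h _] := GsP i; apply: chart_eq_sec h. Qed.

Lemma chart_cover x : tcs_hat iota f w x -> exists i, (Gs i).@[x] != 0.
Proof.
move=> hx; have [i [e' [G' [[[e'0 s'0 s'P] hG'] G'x]]]] := hat_in_chart S hx.
have [[e0 s0 sP] hG] := GsP i; exists i.
have [D DP] : exists D : WDiv X, forall P : prime_divisor X, mult P D = (~~ `[< chart i `<=` P >])%:Z.
  have [l lP] := chart_boundary i; apply: (WDiv_of_function (s := l)) => P.
  by case: asboolP => // np _; apply: lP.
have d1 := dg_eq S (D := D) s0 (fun P => etrans (DP P) (esym (sP P))).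
have d2 := dg_eq S (D := D) s'0 (fun P => etrans (DP P) (esym (s'P P))).
have ee : e' = e i by apply/eqP; rewrite -eqz_nat -d2 d1.
have [c cE] : exists c, evf G' / evf (Gs i) = iota c.
  apply: (sec_degree0 S); apply/secP; first by rewrite mulf_neq0 ?invr_eq0.
  by move=> P; rewrite vord0 (ord_frac D0 (e i)%:Z P s'0 s0) sP -{1}ee s'P subrr.
have c0 : c != 0.
  apply: contraNneq s'0 => c0; move: cE; rewrite c0 rmorph0 => /eqP.
  by rewrite mulf_eq0 invr_eq0 (negPf s0) orbF.
have e1 : evf G' = evf (c *: Gs i) by rewrite evZ -cE divfK.
have [xb _] := hx; have hcG : c *: Gs i \is whomog w e' by rewrite ee; apply: rpredZ.
by move: G'x; rewrite (homog_value xb hG' hcG e1) mevalZ mulf_eq0 negb_or => /andP[].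
Qed.

(** The chart equations have no common zero, so their ideal contains all
    sections of large degree. *)
Lemma sec_generated : exists N : nat, forall (n : nat), (N < n)%N ->
  sec n%:Z `<=` gspan (fun l => [set a | exists2 i, l = (e i)%:Z & a = s i]) n%:Z.
Proof.
set Gam := fun l => [set a | exists2 i, l = (e i)%:Z & a = s i].
have gG : gideal (gspan Gam) by apply: gspan_gideal => l a [i -> ->]; apply: s_sec.
have IJ := gpoly_ideal gG.
have nil j : exists k, gpoly (gspan Gam) ('X_j ^+ k).
  apply: contrapT => no; have [k Jk|x [xJ xj]] := nullstellensatz (G := 'X_j) IJ.
    by apply: no; exists k.
  have hx : tcs_hat iota f w x.
    split=> [G IG|]; last by exists j; move: xj; rewrite mevalXU.
    apply: xJ => n; have /tcs_idealP -> := IG.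
    by have [SA _ _] := gG; case: (SA n%:Z).
  have [i /eqP] := chart_cover hx; apply; apply: xJ.
  have [_ hG] := GsP i; apply/(gpoly_homog gG hG); apply: gspan_mem; by exists i.
have [N hN] := homog_large w_gt0 IJ nil; exists N => n Nn a /(sec_lift S) [G hG ->].
by apply/(gpoly_homog gG hG); apply: hN hG.
Qed.

Lemma eventually_equal A B : gideal A -> gideal B -> (forall m, B m `<=` A m) ->
  (forall i m a, A m a -> B (m + (e i)%:Z) (s i * a)) ->
  exists j0 : nat, forall m : int, j0%:Z <= m -> A m `<=` B m.
Proof.
move=> gA gB BA sAB; have [N hN] := sec_generated.
have [gens [gensA gensP]] := mpoly_noetherian (gpoly_ideal gA).
pose Dm := (\sum_(g <- gens) \sum_(m <- msupp g) mwt w m)%N.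
have [SA AS AM] := gA; have [SB BS BM] := gB.
pose Gam l := [set a | B l a \/ (A l a /\ l <= Dm%:Z)].
have gG : gideal (gspan Gam).
  by apply: gspan_gideal => l a [/BS|[/AS]].
have sub (n : nat) : A n%:Z `<=` gspan Gam n%:Z.
  move=> a Aa; have [G hG aE] := sec_lift S (AS _ _ Aa); rewrite aE in Aa *.
  apply/(gpoly_homog gG hG); apply: gensP; [|exact: gpoly_ideal|].
    by apply/(gpoly_homog gA hG).
  move=> g gg n'; have [->|nz] := eqVneq (pihomog (mwt w) n' g) 0.
    by rewrite ev0; have [SG _ _] := gG; case: (SG n'%:Z).
  apply: gspan_mem; right; split; first exact: gensA.
  have [m mg <-] : exists2 m, m \in msupp g & mwt w m = n'.
    apply: contrapT => no; case/eqP: nz; rewrite /pihomog big_seq_cond big1 // => m /andP[mg /eqP e'].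
    by case: no; exists m.
  by rewrite lez_nat /Dm (big_rem g) //= (big_rem m) //= -addnA leq_addr.
exists (Dm + N).+1%N => m jm a Aa.
have [n mE] : exists n : nat, m = n%:Z by exists (absz m); rewrite gez0_abs //; apply: le_trans jm.
rewrite mE in jm Aa *; have := sub n a Aa; apply => // l r b sr [Bb|[Ab lD]].
  by apply: BM sr Bb; ring.
have [n' nE] : exists n' : nat, n%:Z - l = n'%:Z.
  exists (absz (n%:Z - l)); rewrite gez0_abs // subr_ge0; apply: le_trans lD _.
  by apply: le_trans jm; rewrite lez_nat leqW // leq_addr.
have Nn' : (N < n')%N.
  by move: jm lD nE; clear; lia.
rewrite nE in sr; apply: (hN _ Nn' _ sr [set r | B n%:Z (r * b)]).
  have [B0 BB] := SB n%:Z; split=> [|x y hx hy] /=; first by rewrite mul0r.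
  by rewrite mulrBl; apply: BB.
move=> l' r' a' sr' [i le' ae'] /=; rewrite ae'; rewrite le' in sr'.
have -> : r' * s i * b = s i * (r' * b) by ring.
have -> : n%:Z = (n%:Z - (e i)%:Z) + (e i)%:Z by rewrite subrK.
by apply: sAB; apply: AM sr' Ab; rewrite -nE; ring.
Qed.

(** The complex attached to a graded ideal A and pole orders k along the chart
    equations. *)
Implicit Types (k : 'I_(nchart X) -> nat) (T sigma tau : {set 'I_(nchart X)}).
Definition esum k sigma : nat := (\sum_(i in sigma) k i * e i)%N.
Definition sprod k sigma : F := \prod_(i in sigma) s i ^+ k i.
Definition poles A k (n : int) sigma : set F :=
  [set x | A (n + (esum k sigma)%:Z) (x * sprod k sigma)].

Lemma sprod_sec k sigma : sec (esum k sigma)%:Z (sprod k sigma).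
Proof.
rewrite /esum /sprod; elim/big_ind2 : _ => [|a m b m' sa sb|i _]; first exact: sec1.
  by rewrite PoszD; apply: secM.
by rewrite mulnC PoszM; apply: secX; apply: s_sec.
Qed.

Lemma sprod_neq0 k sigma : sprod k sigma != 0.
Proof. by apply/prodf_neq0 => i _; apply: expf_neq0; apply: s_neq0. Qed.

Lemma poles_system A k n : gideal A -> system (poles A k n).
Proof.
move=> gA; have [SA _ _] := gA; split=> [sigma|sigma tau st x].
  have [A0 AB] := SA (n + (esum k sigma)%:Z); split=> [|a b Aa Ab]; rewrite /poles /= ?mul0r //.
  by rewrite mulrBl; apply: AB.
rewrite /poles /= => Ax.
have eE : esum k tau = (esum k sigma + esum k (tau :\: sigma)%SET)%N.
  by rewrite /esum (big_setID sigma) /= (finset.setIidPr st).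
have -> : x * sprod k tau = sprod k (tau :\: sigma)%SET * (x * sprod k sigma).
  by rewrite /sprod [LHS](congr1 _ (big_setID sigma _)) /= (finset.setIidPr st); ring.
by apply: (gideal_mul gA (@sprod_sec k (tau :\: sigma)%SET) Ax); rewrite eE PoszD addrA.
Qed.

Lemma esumU k t tau : t \notin tau -> esum k (t |: tau)%SET = (k t * e t + esum k tau)%N.
Proof. by move=> nt; rewrite /esum big_setU1. Qed.

Lemma sprodU k t tau : t \notin tau -> sprod k (t |: tau)%SET = s t ^+ k t * sprod k tau.
Proof. by move=> nt; rewrite /sprod big_setU1. Qed.

Lemma poles_ext A k k' n sigma : (forall i, i \in sigma -> k i = k' i) ->
  poles A k n sigma = poles A k' n sigma.
Proof.
move=> h; rewrite /poles /esum /sprod.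
rewrite (eq_bigr (fun i => k' i * e i)%N) => [|i /h ->//].
by rewrite (eq_bigr (fun i => s i ^+ k' i)) => [|i /h ->//].
Qed.

Lemma polesU A k n t tau : t \notin tau ->
  poles A k n (t |: tau)%SET = [set x | poles A k (n + (k t * e t)%:Z) tau (s t ^+ k t * x)].
Proof.
move=> nt; apply/funext => x; rewrite /poles /= esumU // sprodU // PoszD addrA.
by congr (A _ _); ring.
Qed.

Definition annih A B t : int -> set F := fun m => [set a | A m a /\ B (m + (e t)%:Z) (s t * a)].
Definition add_mult A B t : int -> set F := fun m =>
  [set a | exists a1 b, [/\ A (m - (e t)%:Z) a1, B m b & a = s t * a1 + b]].

Lemma annih_gideal A B t : gideal A -> gideal B -> gideal (annih A B t).
Proof.
move=> [SA AS AM] [SB BS BM]; split=> [m|m a [/AS]//|m m' l r a lE sr [Aa Ba]].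
  have [A0 AB] := SA m; have [B0 BB] := SB (m + (e t)%:Z).
  split=> [|a b [Aa Ba] [Ab Bb]]; first by rewrite /annih /= mulr0.
  by split; [apply: AB | rewrite mulrBr; apply: BB].
split; first exact: AM lE sr Aa.
by rewrite mulrCA; apply: BM sr Ba; rewrite lE; ring.
Qed.

Lemma add_mult_gideal A B t : gideal A -> gideal B -> gideal (add_mult A B t).
Proof.
move=> [SA AS AM] [SB BS BM]; split=> [m|m _ [a [b [Aa Bb ->]]]|m m' l r _ lE sr [a [b [Aa Bb ->]]]].
- have [A0 AB] := SA (m - (e t)%:Z); have [B0 BB] := SB m.
  split=> [|_ _ [a [b [Aa Bb ->]]] [a' [b' [Aa' Bb' ->]]]]; first by exists 0, 0; rewrite mulr0 addr0.
  exists (a - a'), (b - b'); split; [exact: AB|exact: BB|by ring].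
- have [h1 h2] := (AS _ _ Aa, BS _ _ Bb); apply: (secD S) => //.
  have -> : m = (e t)%:Z + (m - (e t)%:Z) by ring.
  by apply: secM => //; apply: s_sec.
exists (r * a), (r * b); split; [|exact: BM lE sr Bb|by ring].
by apply: AM sr Aa; rewrite lE; ring.
Qed.

Let two0 : (2%:R : F) != 0.
Proof.
rewrite -(rmorph_nat iota) fmorph_eq0; have := cs_char S 2%N.
by rewrite !inE /= => ->.
Qed.

(** Induction on the charts whose equation does not annihilate A/B: the kernel
    and the cokernel of multiplication by one of the equations are annihilated
    by that equation as well. *)
Lemma exact_poles mm : forall T A B, (#|T| <= mm)%N -> gideal A -> gideal B ->
  (forall m, B m `<=` A m) ->
  (forall i m a, i \notin T -> A m a -> B (m + (e i)%:Z) (s i * a)) ->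
  exists j0 : nat, forall n : int, j0%:Z <= n -> forall k, exact_on T (poles A k n) (poles B k n).
Proof.
elim: mm => [|mm IHm] T A B cT gA gB BA sAB.
  have T0 : T = finset.set0 by apply/eqP; rewrite -cards_eq0 -leqn0.
  have [j0 hj] := eventually_equal gA gB BA (fun i m a => sAB i m a (eq_ind_r (fun T => i \notin T) (negbT (finset.in_set0 i)) T0)).
  exists j0 => n jn k; apply: exact_triv; last exact: poles_system.
  move=> sigma _ x; rewrite /poles /=; apply: hj; apply: le_trans jn _.
  by rewrite lerDl.
have [SA AS AM] := gA; have [SB BS BM] := gB.
have [T0|[t0 t0T]] := set_0Vmem T; first by apply: IHm => //; rewrite T0 cards0.
have IH1 : forall t, exists j1 : nat, t \in T -> forall n : int, j1%:Z <= n -> forall k,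
    exact_on (T :\ t)%SET (poles (annih A B t) k n) (poles B k n).
  move=> t; have [tT|_] := boolP (t \in T); last by exists 0%N.
  have [||i m a|j1 h] := IHm (T :\ t)%SET (annih A B t) B _ (annih_gideal t gA gB) gB.
  - by move: cT; rewrite (cardsD1 t) tT.
  - by move=> m a Ba; split; [apply: BA | apply: (gideal_mul gB (@s_sec t) Ba)].
  - rewrite !inE negb_and negbK => /orP[/eqP ->|iT] [Aa Ba] //; exact: sAB.
  - by exists j1.
have IH2 : forall t, exists j1 : nat, t \in T -> forall n : int, j1%:Z <= n -> forall k,
    exact_on (T :\ t)%SET (poles A k n) (poles (add_mult A B t) k n).
  move=> t; have [tT|_] := boolP (t \in T); last by exists 0%N.
  have [||i m a|j1 h] := IHm (T :\ t)%SET A (add_mult A B t) _ gA (add_mult_gideal t gA gB).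
  - by move: cT; rewrite (cardsD1 t) tT.
  - move=> m _ [a [b [Aa Bb ->]]]; apply: subgroupD; [exact: SA| |exact: BA].
    by apply: (gideal_mul gA (@s_sec t) Aa); rewrite subrK.
  - rewrite !inE negb_and negbK => /orP[/eqP ->|iT] Aa.
      by exists a, 0; split; [rewrite addrK|case: (SB (m + (e t)%:Z))|rewrite addr0].
    by exists 0, (s i * a); split; [case: (SA (m + (e i)%:Z - (e t)%:Z))|apply: sAB|rewrite mulr0 add0r].
  - by exists j1.
have [j1 h1] := boolp.choice IH1; have [j2 h2] := boolp.choice IH2.
exists (\sum_t (j1 t + j2 t))%N => n jn.
have le1 t : ((j1 t)%:Z <= n) * ((j2 t)%:Z <= n).
  have le : (j1 t + j2 t <= \sum_t (j1 t + j2 t))%N by rewrite (bigD1 t) //= leq_addr.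
  by split; apply: le_trans jn; rewrite lez_nat; apply: leq_trans le; rewrite ?leq_addr ?leq_addl.
move=> k; have [N] := ubnP (\sum_(i in T) k i)%N; elim: N k => // N IHN k; rewrite ltnS => kN.
have [[t /andP[tT kt]]|no] := EM (exists t, (t \in T) && (0 < k t)%N); last first.
  have k0 i : i \in T -> k i = 0%N.
    by move=> iT; apply/eqP; rewrite -leqn0 leqNgt; apply/negP => ki; apply: no; exists i; rewrite iT.
  have E A' sigma : sigma \subset T -> A' n = poles A' k n sigma.
    move=> sT; have k0' i : i \in sigma -> k i = 0%N by move=> is'; apply: k0; apply: (fintype.subsetP sT).
    rewrite (poles_ext A' n (k' := fun=> 0%N) k0') /poles /esum /sprod.
    rewrite big1 ?addr0 => [|i _]; last by rewrite mul0n.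
    by apply/funext => x /=; rewrite big1 ?mulr1 // => i _; rewrite expr0.
  apply: (exact_ext (P := fun=> A n) (Q := fun=> B n)) => [sigma sT|sigma sT|]; [exact: E|exact: E|].
  exact: (exact_const (SA n) (SB n) t0T).
pose k' i := if i == t then (k t).-1 else k i.
have k't : k t = (k' t).+1 by rewrite /k' eqxx prednK.
have kk' sigma i : t \notin sigma -> i \in sigma -> k' i = k i.
  by move=> nt is'; rewrite /k'; case: eqP => // it; rewrite -it is' in nt.
have sP := @poles_system A k' n gA; have sQ := @poles_system B k' n gB.
have sP' := @poles_system A k n gA; have sQ' := @poles_system B k n gB.
have QP' : le_sys (poles B k n) (poles A k n) by move=> sigma x; apply: BA.
have QP : le_sys (poles B k' n) (poles A k' n) by move=> sigma x; apply: BA.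
have incr A' : gideal A' -> le_sys (poles A' k' n) (poles A' k n).
  move=> gA' sigma; have [ts|nt] := boolP (t \in sigma); last first.
    by rewrite (poles_ext A' n (k' := k)) // => i; apply: kk'.
  have nt : t \notin (sigma :\ t)%SET by rewrite !inE eqxx.
  rewrite -(finset.setD1K ts) !polesU // => x; rewrite /poles /=.
  have [_ _ AM'] := gA'; move=> h.
  have eE : esum k (sigma :\ t)%SET = esum k' (sigma :\ t)%SET.
    by apply: eq_bigr => i is'; rewrite (kk' _ _ nt is').
  have pE : sprod k (sigma :\ t)%SET = sprod k' (sigma :\ t)%SET.
    by apply: eq_bigr => i is'; rewrite (kk' _ _ nt is').
  have -> : s t ^+ k t * x * sprod k (sigma :\ t)%SET = s t * (s t ^+ k' t * x * sprod k' (sigma :\ t)%SET).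
    by rewrite k't pE exprS; ring.
  by apply: (gideal_mul gA' (@s_sec t) h); rewrite eE k't mulSn PoszD; ring.
have hPQ : exact_on T (poles A k' n) (poles B k' n).
  apply: IHN; apply: leq_trans kN; rewrite (bigD1 t) //= [X in (_ < X)%N](bigD1 t) //= k't addSn ltnS leq_add2l.
  by apply: leq_sum => i /andP[_ it]; rewrite /k' (negPf it).
have sub tau : tau \subset (T :\ t)%SET -> t \notin tau by rewrite finset.subsetD1 => /andP[].
have base (m : nat) : n <= n + m%:Z by rewrite lerDl.
have hker : exact_on T (sys_meet (poles A k' n) (poles B k n)) (poles B k' n).
  apply: (exact_link (t := t)) => //; first exact: sys_meet_system.
    by move=> sigma sT nt x [_]; rewrite (poles_ext B n (k' := k')) // => i /(kk' _ _ nt).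
  have ex := h1 t tT _ (le_trans (le1 t).1 (base (k' t * e t)%N)) k'.
  apply: exact_ext (exact_scale (expf_neq0 (k' t) (s_neq0 t)) ex) => tau /sub nt; last by rewrite polesU.
  apply/funext => x; rewrite /sys_meet /= !polesU // /poles /annih /=.
  have eE : esum k tau = esum k' tau by apply: eq_bigr => i is'; rewrite (kk' _ _ nt is').
  have pE : sprod k tau = sprod k' tau by apply: eq_bigr => i is'; rewrite (kk' _ _ nt is').
  rewrite eE pE k't exprS mulSn PoszD; congr (_ /\ B _ _); ring.
have hE1 := exact_quotient two0 sP (sys_meet_system sP sQ') sQ (fun sigma x Qx => conj (QP sigma x Qx) (incr B gB sigma x Qx))
   (fun sigma x h => h.1) hPQ hker.
have hE3 := exact_second_iso sP sQ' hE1.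
have hcok : exact_on T (poles A k n) (sys_add (poles A k' n) (poles B k n)).
  apply: (exact_link (t := t)) => //; first exact: sys_add_system.
    move=> sigma sT nt x; rewrite (poles_ext A n (k' := k')) => [Ax|i /(kk' _ _ nt) //].
    exists x, 0; split; rewrite ?addr0 //; case: sQ' => /(_ sigma) [] //.
  have ex := h2 t tT _ (le_trans (le1 t).2 (base (k t * e t)%N)) k.
  apply: exact_ext (exact_scale (expf_neq0 (k t) (s_neq0 t)) ex) => tau /sub nt; first by rewrite polesU.
  apply/funext => x; apply/propext; rewrite /sys_add /= !polesU // /poles /add_mult /=.
  have eE : esum k tau = esum k' tau by apply: eq_bigr => i is'; rewrite (kk' _ _ nt is').
  have pE : sprod k tau = sprod k' tau by apply: eq_bigr => i is'; rewrite (kk' _ _ nt is').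
  have sp0 := sprod_neq0 k' tau; have st0 := s_neq0 t.
  have dE : n + (k t * e t)%:Z + (esum k tau)%:Z - (e t)%:Z = n + (k' t * e t)%:Z + (esum k' tau)%:Z.
    by rewrite eE k't mulSn PoszD; ring.
  split=> [[a1 [b [Aa Bb xE]]]|[a [b [Aa Bb xE]]]].
    exists (a1 / (s t ^+ k' t * sprod k' tau)), (b / (s t ^+ k t * sprod k tau)); split.
    - have -> : s t ^+ k' t * (a1 / (s t ^+ k' t * sprod k' tau)) * sprod k' tau = a1.
        by field; rewrite sp0 expf_neq0.
      by rewrite -dE.
    - by have -> : s t ^+ k t * (b / (s t ^+ k t * sprod k tau)) * sprod k tau = b by field; rewrite sprod_neq0 expf_neq0.
    - apply: (mulfI (expf_neq0 (k t) st0)); apply: (mulIf (sprod_neq0 k tau)); rewrite xE k't pE exprS.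
      by field; rewrite sp0 expf_neq0 // st0.
  exists (s t ^+ k' t * a * sprod k' tau), (s t ^+ k t * b * sprod k tau); split=> //; first by rewrite dE.
  by rewrite xE k't pE exprS; ring.
apply: (exact_extension two0 sP' (sys_add_system sP sQ') sQ' _ _ hE3 hcok).
  by move=> sigma x Qx; exists 0, x; rewrite add0r; split=> //; case: sP => /(_ sigma) [].
move=> sigma x [a [b [Pa Qb ->]]]; apply: subgroupD; [by case: sP' => /(_ sigma)|exact: incr Pa|exact: QP' Qb].
Qed.

Lemma poles_mono (c : int) k k' : (forall i, k i <= k' i)%N -> le_sys (poles sec k c) (poles sec k' c).
Proof.
move=> ab sigma x; rewrite /poles /= => sx; pose dlt i := (k' i - k i)%N.
have eE : esum k' sigma = (esum dlt sigma + esum k sigma)%N.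
  by rewrite /esum -big_split; apply: eq_bigr => i _; rewrite /= -mulnDl subnK.
have pE : sprod k' sigma = sprod dlt sigma * sprod k sigma.
  by rewrite /sprod -big_split; apply: eq_bigr => i _; rewrite /= -exprD subnK.
have -> : x * sprod k' sigma = sprod dlt sigma * (x * sprod k sigma) by rewrite pE; ring.
have -> : c + (esum k' sigma)%:Z = (esum dlt sigma)%:Z + (c + (esum k sigma)%:Z) by rewrite eE PoszD; ring.
by apply: secM => //; apply: sprod_sec.
Qed.

Lemma exact_pole_orders (c : int) : exists k0 : nat, forall k k', (forall i, k0 <= k i)%N ->
  (forall i, k i <= k' i)%N -> exact_on [set: 'I_(nchart X)]%SET (poles sec k' c) (poles sec k c).
Proof.
pose Bt t : int -> set F := add_mult sec (fun=> [set 0]) t.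
have gB t : gideal (Bt t).
  have g0 : gideal (fun=> [set 0]).
    split=> [m|m _ ->|m m' l r _ _ _ ->]; [|exact: sec00|by rewrite /= mulr0].
    by split=> // a b -> ->; rewrite subr0.
  exact: add_mult_gideal sec_gideal g0.
have BtP t m x : sec (m - (e t)%:Z) x -> Bt t m (s t * x) by move=> sx; exists x, 0; rewrite addr0.
have BtE t m x : Bt t m x -> exists2 y, sec (m - (e t)%:Z) y & x = s t * y.
  by move=> [y [b [sy -> ->]]]; exists y => //; rewrite addr0.
have H t : exists j1 : nat, forall n : int, j1%:Z <= n -> forall k,
    exact_on ([set: 'I_(nchart X)]%SET :\ t)%SET (poles sec k n) (poles (Bt t) k n).
  have [|i m a|j1 h] := exact_poles (leqnn #|([set: 'I_(nchart X)]%SET :\ t)%SET|) sec_gideal (gB t).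
  - by move=> m; case: (gB t) => _ h _; apply: h.
  - by rewrite !inE andbT negbK => /eqP -> sa; apply: BtP; rewrite addrK.
  - by exists j1.
have [j1 h1] := boolp.choice H; exists (absz c + \sum_t j1 t)%N => k k' k0 kk'.
have [N] := ubnP (\sum_i (k' i - k i))%N; elim: N k' kk' => // N IHN k' kk'; rewrite ltnS => kN.
have sk := @poles_system sec k c sec_gideal.
have [[t kt]|no] := EM (exists t, (k t < k' t)%N); last first.
  have -> : poles sec k' c = poles sec k c; last exact: exact_refl.
  apply/funext => sigma; apply: poles_ext => i _; apply/eqP; rewrite eqn_leq kk' andbT leqNgt.
  by apply/negP => h; apply: no; exists i.
pose k'' i := if i == t then (k' t).-1 else k' i.
have k't : k' t = (k'' t).+1 by rewrite /k'' eqxx prednK // (leq_trans _ kt).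
have k''E sigma i : t \notin sigma -> i \in sigma -> k'' i = k' i.
  by move=> nt is'; rewrite /k''; case: eqP => // it; rewrite -it is' in nt.
have kk'' i : (k i <= k'' i)%N.
  by rewrite /k''; case: eqP => [->|_]; rewrite ?kk' // -ltnS prednK // (leq_trans _ kt).
have hIH : exact_on [set: 'I_(nchart X)]%SET (poles sec k'' c) (poles sec k c).
  apply: IHN => //; apply: leq_trans kN; rewrite (bigD1 t) //= [X in (_ < X)%N](bigD1 t) //= k't subSn //.
  rewrite addSn ltnS leq_add2l; apply: leq_sum => i it; by rewrite /k'' (negPf it).
have sk' := @poles_system sec k' c sec_gideal; have sk'' := @poles_system sec k'' c sec_gideal.
have hstep : exact_on [set: 'I_(nchart X)]%SET (poles sec k' c) (poles sec k'' c).
  apply: (exact_link (t := t)) => //.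
    by move=> sigma _ nt x; rewrite (poles_ext sec c (k' := k'')) // => i /(k''E _ _ nt).
  have le : (j1 t)%:Z <= c + (k' t * e t)%:Z.
    have h2 : (absz c + j1 t <= k' t * e t)%N.
      apply: leq_trans (_ : k t <= _)%N; last by apply: leq_trans (kk' t) _; rewrite leq_pmulr // e_gt0.
      by apply: leq_trans (k0 t); rewrite leq_add2l (bigD1 t) //= leq_addr.
    by move: h2; clear; move: (k' t * e t)%N (j1 t); lia.
  apply: exact_ext (exact_scale (expf_neq0 (k' t) (s_neq0 t)) (h1 t _ le k')) => tau.
    by rewrite finset.subsetD1 => /andP[_ nt]; rewrite polesU.
  rewrite finset.subsetD1 => /andP[_ nt]; apply/funext => x; apply/propext; rewrite polesU // /poles /=.
  have eE : esum k' tau = esum k'' tau by apply: eq_bigr => i is'; rewrite (k''E _ _ nt is').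
  have pE : sprod k' tau = sprod k'' tau by apply: eq_bigr => i is'; rewrite (k''E _ _ nt is').
  have dE : c + (k' t * e t)%:Z + (esum k' tau)%:Z - (e t)%:Z = c + (k'' t * e t)%:Z + (esum k'' tau)%:Z.
    by rewrite eE k't mulSn PoszD; ring.
  have xE : s t ^+ k' t * x * sprod k' tau = s t * (s t ^+ k'' t * x * sprod k'' tau).
    by rewrite k't pE exprS; ring.
  split=> [/BtE [y]|h]; first by rewrite dE xE => sy /(mulfI (s_neq0 t)) ->.
  by rewrite xE; apply: BtP; rewrite dE.
apply: (exact_extension two0 sk' sk'' sk _ _ hIH hstep); apply: poles_mono => //.
by move=> i; rewrite /k''; case: eqP => // ->; apply: leq_pred.
Qed.

(** The divisors that miss the intersection of the charts are the zeros of the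
    product of their equations. *)
Lemma spec_chart_sub (i : 'I_(nchart X)) O : spec (chart i) O -> chart i `<=` O.
Proof.
move=> [p [[_ [_ p1] _ _] _] ->] a Aa; have [A1 _ _] := chart_subring i.
by exists a, 1; rewrite divr1.
Qed.

Let one := (fun _ : 'I_(nchart X) => 1%N).

Lemma vord_sprod (P : prime_divisor X) sigma : vord D0 (esum one sigma)%:Z P (sprod one sigma) =
  \sum_(i in sigma) (~~ `[< chart i `<=` P >])%:Z.
Proof.
have [//] : sprod one sigma != 0 /\ vord D0 (esum one sigma)%:Z P (sprod one sigma) =
  \sum_(i in sigma) (~~ `[< chart i `<=` P >])%:Z.
rewrite /esum /sprod; elim/big_rec3 : _ => [|i y1 y2 y3 is' [h1 h2]].
  by rewrite oner_neq0 vord0 ord1 //; apply: pd_dvr.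
rewrite expr1 mul1n PoszD; split; first by rewrite mulf_neq0 ?s_neq0.
rewrite (vordM _ _ _ _ (s_neq0 i) h1) h2; congr (_ + _).
by have [[_ _ h] _] := GsP i; apply: h.
Qed.

Lemma chart_interP (P : prime_divisor X) sigma : chart_inter sigma P <->
  vord D0 (esum one sigma)%:Z P (sprod one sigma) = 0.
Proof.
rewrite vord_sprod; split=> [h|h i is'].
  by rewrite big1 // => i /h /spec_chart_sub sp; rewrite asboolT.
apply: point_in_chart; first exact: pd_point.
have := psumr_eq0P _ h is'; case: asboolP => // _ /(_ _) h'.
by suff : (1%:Z = 0) by []; apply: h' => j _; case: asboolP.
Qed.

Lemma esum_const (k : nat) sigma : esum (fun=> k) sigma = (esum one sigma * k)%N.
Proof. by rewrite /esum big_distrl; apply: eq_bigr => i _; rewrite /= /one mul1n mulnC. Qed.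

Lemma sprod_const (k : nat) sigma : sprod (fun=> k) sigma = sprod one sigma ^+ k.
Proof. by rewrite /sprod -prodrXl; apply: eq_bigr => i _; rewrite expr1. Qed.

Lemma chart_inter_sections (c : int) sigma x :
  sections (D0 *~ c) (chart_inter sigma) x <-> exists k : nat, poles sec (fun=> k) c sigma x.
Proof.
have [->|x0] := eqVneq x 0.
  split=> _; last by rewrite /sections /= eqxx.
  by exists 0%N; rewrite /poles /= mul0r; apply: sec00.
have sp0 := sprod_neq0 one sigma.
have vE (P : prime_divisor X) : ord P x + mult P (D0 *~ c) = vord D0 c P x by rewrite multMz.
split=> [h|[k h] _ P].
  have [|P vP|k hk] := clear_poles (n := c) (a := x) x0 sp0 (e := (esum one sigma)%:Z) (D0 := D0).
  - by move=> P; rewrite vord_sprod sumr_ge0.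
  - by rewrite -vE; apply: h => //; apply/chart_interP.
  exists k; rewrite /poles /= esum_const sprod_const PoszM; exact: hk.
move=> /chart_interP hP; rewrite vE; move: h; rewrite /poles /= => /secP h.
have := h (mulf_neq0 x0 (sprod_neq0 _ _)) P; rewrite (vordM _ _ _ _ x0 (sprod_neq0 _ _)).
by rewrite esum_const sprod_const PoszM (vordX _ _ _ _ sp0) hP mul0r addr0.
Qed.

Lemma exact_sections (c : int) : exists k0 : nat, forall k : nat, (k0 <= k)%N ->
  exact_on [set: 'I_(nchart X)]%SET (fun sigma => sections (D0 *~ c) (chart_inter sigma)) (poles sec (fun=> k) c).
Proof.
have [k0 hk] := exact_pole_orders c; exists k0 => k kk phi Pphi dphi.
have /choice[l hl] : forall sigma, exists l, poles sec (fun=> l) c sigma (phi sigma).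
  by move=> sigma; apply/chart_inter_sections; apply: Pphi; apply: finset.subsetT.
pose m := (k + \sum_sigma l sigma)%N.
have [|sigma _|//|psi [Ppsi h]] := hk (fun=> k) (fun=> m) (fun=> kk) _ phi.
- by move=> _; apply: leq_addr.
- apply: poles_mono (hl sigma) => i; rewrite /m (bigD1 sigma) //= addnCA; exact: leq_addr.
by exists psi; split=> // sigma sT; apply/chart_inter_sections; exists m; apply: Ppsi.
Qed.

End GradedIdeals.

(** * Euler characteristic and self-intersection *)

(** An F-module, seen as a module over the ground field. *)
Definition kmod (K F : fieldType) (iota : {rmorphism K -> F}) (V : lmodType F) : Type := V.

Section KModule.
Variables (K F : fieldType) (iota : {rmorphism K -> F}) (V : lmodType F).
Local Notation kV := (kmod iota V).
HB.instance Definition _ := GRing.Zmodule.on kV.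

Let kscale (c : K) (v : kV) : kV := (iota c *: (v : V) : V).
Fact kscaleA a b v : kscale a (kscale b v) = kscale (a * b) v.
Proof. by rewrite /kscale scalerA rmorphM. Qed.
Fact kscale1 : left_id 1 kscale. Proof. by move=> v; rewrite /kscale rmorph1 scale1r. Qed.
Fact kscaleDr : right_distributive kscale +%R. Proof. by move=> a u v; rewrite /kscale scalerDr. Qed.
Fact kscaleDl v : {morph kscale^~ v : a b / a + b}.
Proof. by move=> a b; rewrite /kscale rmorphD scalerDl. Qed.
HB.instance Definition _ := GRing.Zmodule_isLmodule.Build K kV kscaleA kscale1 kscaleDr kscaleDl.
Lemma kscaleE c (v : kV) : c *: v = (iota c *: (v : V) : V). Proof. by []. Qed.
End KModule.

Lemma qdim_add (K : fieldType) (V : lmodType K) (Z C B : set V) a b :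
  subspace Z -> subspace C -> subspace B -> B `<=` C -> C `<=` Z ->
  qdim C B a -> qdim Z C b -> qdim Z B (a + b).
Proof.
move=> SZ SC SB BC CZ [e2 [Ce2 h2]] [e1 [Ze1 h1]].
pose e (i : 'I_(a + b)) := match split i with inl i => e2 i | inr i => e1 i end.
have eE (c : 'rV[K]_(a + b)) : \sum_i c 0 i *: e i =
    \sum_i (lsubmx c) 0 i *: e2 i + \sum_i (rsubmx c) 0 i *: e1 i.
  rewrite big_split_ord /=; congr (_ + _); apply: eq_bigr => i _; rewrite /e.
    by rewrite (unsplitK (inl i)) mxE.
  by rewrite (unsplitK (inr i)) mxE.
exists e; split=> [i|z Zz]; first by rewrite /e; case: (split i) => j; [apply: CZ|].
have [u [hu uu]] := h1 z Zz; have [v [hv uv]] := h2 _ hu.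
exists (row_mx v u); split=> [|c hc].
  rewrite eE row_mxKl row_mxKr; suff -> : forall x y t : V, x - (y + t) = x - t - y by [].
  by move=> x y t; rewrite opprD addrA addrAC.
have e2C : C (\sum_i (lsubmx c) 0 i *: e2 i).
  by apply: subspace_sum => [//|i _]; apply: subspaceZ.
have xE : z - \sum_i (rsubmx c) 0 i *: e1 i - \sum_i (lsubmx c) 0 i *: e2 i = z - \sum_i c 0 i *: e i.
  by rewrite eE opprD addrA addrAC.
have cu : u = rsubmx c.
  apply: uu; rewrite -[X in C X](subrK (\sum_i (lsubmx c) 0 i *: e2 i)); apply: subspaceD => //.
  by rewrite xE; apply: BC.
have cv : v = lsubmx c by apply: uv; rewrite cu xE.
by rewrite cu cv hsubmxK.
Qed.

Section Cochains.
Variables (K : closedFieldType) (F : fieldType) (iota : {rmorphism K -> F}).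
Variable X : normal_variety iota.
Hypothesis two0 : (2%:R : F) != 0.
Local Notation SI := {set 'I_(nchart X)}.
Local Notation CF := (kmod iota (cech_fun X)).
Local Notation Fk := (kmod iota F^o).
Implicit Types (V : SI -> set Fk) (sigma tau : SI) (phi psi : CF) (p : nat).

Definition cochain V p : set CF := [set phi : CF | forall sigma : SI,
  if (0 < #|sigma|)%N && (#|sigma| == p) then V sigma ((phi : cech_fun X) sigma) else (phi : cech_fun X) sigma = 0].

Definition cocycle V p : set CF := cochain V p `&` [set phi : CF | coboundary (phi : cech_fun X) = 0].
Definition cobound V p : set CF := (@coboundary K F iota X : CF -> CF) @` cochain V p.

Definition ksystem V := (forall sigma, subspace (V sigma)) /\
  forall sigma tau, sigma \subset tau -> V sigma `<=` V tau.

Lemma coboundaryE (phi : CF) sigma : (coboundary (phi : cech_fun X) : cech_fun X) sigma = dd (phi : cech_fun X) sigma.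
Proof. by rewrite ffunE. Qed.

Lemma CFD (u v : CF) sigma : ((u + v : CF) : cech_fun X) sigma = (u : cech_fun X) sigma + (v : cech_fun X) sigma.
Proof. by rewrite [LHS]ffunE. Qed.
Lemma CFZ a (u : CF) sigma : ((a *: u : CF) : cech_fun X) sigma = iota a * (u : cech_fun X) sigma.
Proof. by rewrite -[LHS]/((iota a *: (u : cech_fun X)) sigma) ffunE. Qed.

Lemma coboundary_linear a (phi psi : CF) : (coboundary (a *: phi + psi : CF) : CF) = a *: (coboundary phi : CF) + coboundary psi.
Proof.
apply/ffunP => sigma; rewrite coboundaryE [RHS]CFD [X in _ = X + _]CFZ !coboundaryE -ddZ -ddD.
by apply: dd_ext => i _; rewrite CFD CFZ.
Qed.

Lemma cob_dd (phi : CF) : coboundary (coboundary (phi : cech_fun X)) = 0.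
Proof.
apply/ffunP => sigma; rewrite coboundaryE [RHS]ffunE -[RHS](dd_dd two0 (phi : cech_fun X) sigma).
by apply: dd_ext => i _; rewrite coboundaryE.
Qed.

Lemma zero_subspace (U : lmodType K) : subspace [set 0 : U].
Proof. by split=> // c u v -> ->; rewrite scaler0 addr0. Qed.

Lemma cochain_subspace V p : ksystem V -> subspace (cochain V p).
Proof.
move=> [SV _]; split=> [sigma|c u v hu hv sigma].
  by rewrite ffunE; case: ifP => // _; case: (SV sigma).
have := hu sigma; have := hv sigma; rewrite CFD CFZ.
case: ifP => _ hv' hu'; first by have [_ h] := SV sigma; exact: (h c _ _ hu' hv').
by rewrite hv' hu' addr0 mulr0.
Qed.

Lemma cocycle_subspace V p : ksystem V -> subspace (cocycle V p).
Proof.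
move=> SV; have [C0 CZ] := cochain_subspace p SV; split=> [|c u v [hu du] [hv dv]].
  split=> //; have := coboundary_linear 0 0 0; rewrite scale0r add0r => h.
  by have := coboundary_linear 1 0 0; rewrite !scale1r addr0 => /eqP; rewrite -subr_eq0 opprD addrA subrr sub0r oppr_eq0 => /eqP.
split; first exact: CZ.
by rewrite /= (coboundary_linear c u v); move: du dv => /= -> ->; rewrite scaler0 addr0.
Qed.

Lemma coboundary0 : (coboundary (0 : cech_fun X) : CF) = 0.
Proof. by apply/ffunP => sigma; rewrite coboundaryE /dd big1 ?ffunE // => i _; rewrite ffunE mulr0. Qed.

Lemma cobound_subspace V p : ksystem V -> subspace (cobound V p).
Proof.
move=> SV; have [C0 CZ] := cochain_subspace p SV; split=> [|c _ _ [u hu <-] [v hv <-]].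
  by exists 0 => //; apply: coboundary0.
by exists (c *: u + v); [apply: CZ | apply: coboundary_linear].
Qed.

Lemma subspace_subgroup (A : set Fk) : subspace A -> subgroup (A : set F).
Proof. by move=> SA; split=> [|a b]; [case: SA | apply: (subspaceB (V := Fk) SA)]. Qed.

Lemma coboundary_cochain V p phi : ksystem V -> cochain V p phi -> cochain V p.+1 (coboundary (phi : cech_fun X)).
Proof.
move=> [SV MV] h sigma; rewrite coboundaryE.
have [cs|cs] := eqVneq #|sigma| p.+1; last first.
  rewrite andbF /dd big1 // => i is'; have := h (sigma :\ i)%SET.
  have ci : (#|sigma :\ i| == p) = false.
    by apply/negbTE; apply: contraNneq cs => e; rewrite (cardsD1 i) is' e.
  by rewrite ci andbF => ->; rewrite mulr0.
rewrite cs /=; have SV' := SV sigma; rewrite /dd; have SG := subspace_subgroup SV'.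
apply: (subgroup_sum _ SG) => i is'; apply: (subgroup_sign _ SG).
have := h (sigma :\ i)%SET; case: ifP => _; first by apply: MV; apply: finset.subD1set.
by move=> ->; case: SV'.
Qed.

Lemma cobound_cocycle V p : ksystem V -> cobound V p `<=` cocycle V p.+1.
Proof.
move=> SV _ [phi hphi <-]; split; first exact: coboundary_cochain.
exact: cob_dd.
Qed.

Lemma qdim_cochain V (h : SI -> nat) p : ksystem V -> (forall sigma, (0 < #|sigma|)%N -> qdim (V sigma) [set 0] (h sigma)) ->
  qdim (cochain V p) [set 0] (\sum_(sigma : SI | (0 < #|sigma|)%N && (#|sigma| == p)) h sigma).
Proof.
move=> SV hV; have [sV _] := SV.
pose CL (l : seq SI) : set CF := [set phi : CF | forall sigma, if sigma \in l then V sigma ((phi : cech_fun X) sigma) else (phi : cech_fun X) sigma = 0].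
have SCL l : subspace (CL l).
  split=> [sigma|c u v hu hv sigma]; first by rewrite ffunE; case: ifP => // _; case: (sV sigma).
  have := hu sigma; have := hv sigma; rewrite CFD CFZ.
  case: ifP => _ hv' hu'; first by have [_ hh] := sV sigma; exact: (hh c _ _ hu' hv').
  by rewrite hv' hu' addr0 mulr0.
have main l : uniq l -> (forall sigma, sigma \in l -> (0 < #|sigma|)%N) -> qdim (CL l) [set 0] (\sum_(sigma <- l) h sigma).
  elim: l => [|sigma l IHl] /=.
    move=> _ _; rewrite big_nil; exists (fun=> 0); split=> [[]//|z hz]; exists 0; split=> [|c _].
      by rewrite big_ord0 subr0; apply/ffunP => sigma; have := hz sigma; rewrite ffunE.
    by apply/rowP; case.
  move=> /andP[sl ul] hl; rewrite big_cons addnC.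
  have sub : CL l `<=` CL (sigma :: l).
    move=> phi hphi tau; have := hphi tau; rewrite inE; case: eqP => [->|_] //=.
    by rewrite (negPf sl) => ->; case: (sV sigma).
  apply: (@qdim_add _ _ _ (CL l)) => //; [exact: zero_subspace|by move=> _ ->; case: (SCL l)| |].
    by apply: IHl => // tau tl; apply: hl; rewrite inE tl orbT.
  pose inc (x : Fk) : CF := ([ffun tau => if tau == sigma then (x : F^o) else 0] : cech_fun X).
  have S0 := zero_subspace Fk.
  apply: (qdim_iso (phi := inc) (sV sigma) S0 _ (SCL _) (SCL l) sub _ _ _ _ (hV sigma (hl _ (mem_head _ _)))).
  - by move=> _ ->; case: (sV sigma).
  - move=> a u v _ _; apply/ffunP => tau; rewrite [RHS]ffunE [X in _ = X + _]ffunE !ffunE.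
    by case: eqP => // _; rewrite addr0; symmetry; apply: mulr0.
  - move=> x Vx tau; rewrite ffunE inE; case: eqP => [->//|_] /=; case: ifP => // _; by case: (sV tau).
  - move=> phi hphi; have hs := hphi sigma; rewrite mem_head in hs; exists ((phi : cech_fun X) sigma) => //.
    move=> tau; rewrite [X in V tau X]ffunE [X in V tau (_ + X)]ffunE !ffunE.
    have := hphi tau; rewrite inE; case: eqP => [->|_] /=; first by rewrite (negPf sl) subrr.
    by rewrite subr0.
  - move=> x Vx; split=> [->|hx].
      by rewrite (_ : inc 0 = 0); [case: (SCL l) | apply/ffunP => tau; rewrite !ffunE; case: eqP].
    by have := hx sigma; rewrite (negPf sl) ffunE eqxx.
pose l := enum [pred sigma : SI | (0 < #|sigma|)%N && (#|sigma| == p)].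
have -> : (\sum_(sigma : SI | (0 < #|sigma|)%N && (#|sigma| == p)) h sigma = \sum_(sigma <- l) h sigma)%N.
  by rewrite big_enum; apply: eq_bigl.
suff -> : cochain V p = CL l.
  by apply: main; rewrite ?enum_uniq // => sigma; rewrite mem_enum => /andP[].
apply/funext => phi; apply/propext; split=> hp sigma; have := hp sigma; by rewrite mem_enum inE.
Qed.

Lemma qdim_cohomology V (h : SI -> nat) : ksystem V -> (forall sigma, (0 < #|sigma|)%N -> qdim (V sigma) [set 0] (h sigma)) ->
  exists hh : nat -> nat, (forall p, qdim (cocycle V p.+1) (cobound V p) (hh p)) /\
    \sum_(q < nchart X) (-1) ^+ q * (hh q)%:Z = \sum_(sigma : SI | (0 < #|sigma|)%N) (-1) ^+ #|sigma|.-1 * (h sigma)%:Z.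
Proof.
move=> SV hV; pose n p := (\sum_(sigma : SI | (0 < #|sigma|)%N && (#|sigma| == p)) h sigma)%N.
have S0 := zero_subspace CF; have Z0 p : [set 0] `<=` cocycle V p by move=> _ ->; case: (cocycle_subspace p SV).
have ZC p : cocycle V p `<=` cochain V p by move=> u [].
have /choice[z hz] : forall p, exists z, qdim (cocycle V p) [set 0] z /\ exists b, qdim (cochain V p) (cocycle V p) b /\ (z + b = n p)%N.
  move=> p; have [a [b [ha hb ab]]] := qdim_split (cochain_subspace p SV) (cocycle_subspace p SV) S0 (Z0 p) (@ZC p) (qdim_cochain p SV hV).
  by exists a; split=> //; exists b.
have /choice[b hb] : forall p, exists b, qdim (cochain V p) (cocycle V p) b /\ (z p + b = n p)%N by move=> p; case: (hz p).
have hB p : qdim (cobound V p) [set 0] (b p).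
  apply: (qdim_iso (phi := @coboundary K F iota X : CF -> CF) (cochain_subspace p SV) (cocycle_subspace p SV) (@ZC p) (cobound_subspace p SV) S0 _ _ _ _ _ (hb p).1).
  - by move=> _ ->; case: (cobound_subspace p SV).
  - by move=> a u v _ _; apply: coboundary_linear.
  - by move=> u hu; exists u.
  - by move=> _ [u hu <-]; exists u => //; rewrite subrr.
  - by move=> u hu; split=> [[]|].
have /choice[hh hhP] : forall p, exists c, qdim (cocycle V p.+1) (cobound V p) c /\ (b p + c = z p.+1)%N.
  move=> p; have B0 : [set 0] `<=` cobound V p by move=> _ ->; case: (cobound_subspace p SV).
  have [a [c [ha hc ac]]] := qdim_split (cocycle_subspace p.+1 SV) (cobound_subspace p SV) S0 B0 (@cobound_cocycle V p SV) (hz p.+1).1.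
  by exists c; rewrite (qdim_uniq (cobound_subspace p SV) S0 B0 (hB p) ha).
exists hh; split=> [p|]; first by case: (hhP p).
have n0 : n 0%N = 0%N by rewrite /n big1 // => sigma /andP[]; case: #|sigma|.
have nbig : n (nchart X).+1 = 0%N.
  rewrite /n big1 // => sigma /andP[_ /eqP cs]; have := max_card (mem sigma).
  by rewrite cs card_ord ltnn.
have b0 : b 0%N = 0%N by have := (hb 0%N).2; rewrite n0; case: (b 0%N) => // m; rewrite addnS.
have bN : b (nchart X) = 0%N.
  have := (hb (nchart X).+1).2; have := (hhP (nchart X)).2; rewrite nbig; clear; lia.
have tele M : \sum_(q < M) (-1) ^+ q * (hh q)%:Z = \sum_(q < M) (-1) ^+ q * (n q.+1)%:Z + (-1) ^+ M * (b M)%:Z.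
  elim: M => [|M IHM]; first by rewrite !big_ord0 b0 mulr0 addr0.
  rewrite !big_ord_recr /= IHM exprS; have := (hb M.+1).2; have := (hhP M).2.
  move=> h1 h2; rewrite -h2 PoszD -h1 PoszD; ring.
rewrite tele bN mulr0 addr0.
transitivity (\sum_(q < nchart X) \sum_(sigma : SI | (0 < #|sigma|)%N && (#|sigma| == q.+1)) (-1) ^+ q * (h sigma)%:Z).
  by apply: eq_bigr => q _; rewrite /n (big_morph Posz PoszD (erefl 0%:Z)) mulr_sumr.
rewrite (exchange_big_dep (fun sigma : SI => (0 < #|sigma|)%N)) /=; last by move=> ? ? _ /andP[].
apply: eq_bigr => sigma cs.
have lt : (#|sigma|.-1 < nchart X)%N.
  by rewrite prednK //; have := max_card (mem sigma); rewrite card_ord.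
rewrite (big_pred1 (Ordinal lt)) //= => q.
rewrite cs /=; apply/eqP/eqP => [e|->]; last by rewrite /= prednK.
by apply: val_inj; rewrite /= e.
Qed.

End Cochains.

Section EulerCharacteristic.
Variables (K : closedFieldType) (F : fieldType) (iota : {rmorphism K -> F}).
Variables (X : normal_variety iota) (d nu : nat) (degCl : {additive Cl X -> int}).
Variables (D0 : WDiv X) (f : 'I_nu -> F) (w : 'I_nu -> nat).
Hypothesis S : cox_setting d degCl D0 f w.
Local Notation MP := {mpoly K[nu]}.
Local Notation evf := (ev iota f).
Local Notation sec := (sec D0).
Local Notation I := (tcs_ideal iota f w).
Local Notation SI := {set 'I_(nchart X)}.
Local Notation CF := (kmod iota (cech_fun X)).
Local Notation Fk := (kmod iota F^o).
Let w_gt0 := cs_w S.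
Let two0 : (2%:R : F) != 0.
Proof.
rewrite -(rmorph_nat iota) fmorph_eq0; have := cs_char S 2%N.
by rewrite !inE /= => ->.
Qed.

Variables (e : 'I_(nchart X) -> nat) (Gs : 'I_(nchart X) -> MP).
Hypothesis GsP : forall i, is_chart_poly D0 f w i (e i) (Gs i).
Local Notation poles := (poles f e Gs sec).
Local Notation esum := (esum e).
Local Notation sprod := (sprod f Gs).

Lemma poles_ksystem (k : nat) c : ksystem (X := X) (iota := iota) (poles (fun=> k) c).
Proof.
have [SP MP'] := poles_system GsP (fun=> k) c (sec_gideal S); split=> // sigma.
have [P0 PB] := SP sigma; split=> // a u v Pu Pv; apply: subgroupD => //.
have -> : (a *: (u : Fk)) = iota a * (u : F) :> F by [].
by rewrite /poles /= -mulrA; apply: secZ.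
Qed.

Definition sys_inf c : SI -> set Fk := fun sigma => sections (D0 *~ c) (chart_inter sigma).

Lemma sys_inf_ksystem c : ksystem (X := X) (iota := iota) (sys_inf c).
Proof.
split=> [sigma|sigma tau st x /(chart_inter_sections GsP) [k h]]; last first.
  by apply/(chart_inter_sections GsP); exists k; have [_ M] := poles_ksystem k c; apply: M st _ h.
split=> [|a u v /(chart_inter_sections GsP) [k h] /(chart_inter_sections GsP) [k' h']].
  by rewrite /sys_inf /sections /= eqxx.
apply/(chart_inter_sections GsP); exists (k + k')%N.
have [SP _] := poles_ksystem (k + k')%N c; have [_ Z] := SP sigma; apply: Z.
  by apply: (poles_mono GsP) h => i; apply: leq_addr.
by apply: (poles_mono GsP) h' => i; apply: leq_addl.
Qed.

(** Only the functions with poles of bounded order matter for the cohomology. *)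
Lemma cohomology_bounded c : exists k0 : nat, forall k : nat, (k0 <= k)%N -> forall p h,
  qdim (cocycle (poles (fun=> k) c : SI -> set Fk) p.+1) (cobound (poles (fun=> k) c : SI -> set Fk) p) h ->
  qdim (cocycle (sys_inf c) p.+1) (cobound (sys_inf c) p) h.
Proof.
have [k0 hk0] := exact_sections S GsP c; exists k0 => k kk p h.
have SVk := poles_ksystem k c; have SVi := sys_inf_ksystem c; have ex := hk0 k kk.
set Vk : SI -> set Fk := poles (fun=> k) c in SVk *.
have le : forall sigma, Vk sigma `<=` sys_inf c sigma.
  by move=> sigma x hx; apply/(chart_inter_sections GsP); exists k.
have lec q : cochain Vk q `<=` cochain (sys_inf c) q.
  by move=> phi hp sigma; have := hp sigma; case: ifP => // _; apply: le.
have e0 x : sys_inf c finset.set0 x -> Vk finset.set0 x.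
  have E k1 : poles (fun=> k1) c finset.set0 = poles (fun=> 0%N) c finset.set0.
    by apply: poles_ext => i; rewrite finset.in_set0.
  by move=> /(chart_inter_sections GsP) [k' h']; rewrite /Vk E -(E k').
pose restr q (psi : SI -> F) : CF := ([ffun sigma : SI => if (0 < #|sigma|)%N && (#|sigma| == q) then psi sigma else 0] : cech_fun X).
have restrP V q psi : ksystem (X := X) (iota := iota) V -> (forall sigma, V sigma (psi sigma)) -> cochain V q (restr q psi).
  by move=> [SV _] hpsi sigma; rewrite ffunE; case: ifP => hc; rewrite ?hc //; exact: hpsi.
have dc (V : SI -> set Fk) (q : nat) (phi : CF) (sigma : SI) : cochain V q phi -> #|sigma| != q.+1 -> dd (phi : cech_fun X) sigma = 0.
  move=> hp cs; rewrite /dd big1 // => i is'; have := hp (sigma :\ i)%SET.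
  have ci : (#|sigma :\ i| == q) = false.
    by apply/negbTE; apply: contraNneq cs => ee; rewrite (cardsD1 i) is' ee.
  by rewrite ci andbF => ->; rewrite mulr0.
have drestr (q : nat) (psi : SI -> F) (sigma : SI) : (0 < q)%N -> #|sigma| = q.+1 -> dd (restr q psi : cech_fun X) sigma = dd psi sigma.
  move=> q0 cs; apply: dd_ext => i is'; rewrite ffunE.
  have -> : #|sigma :\ i| = q by move: cs; rewrite (cardsD1 i) is' => -[].
  by rewrite q0 eqxx.
have T (sigma : SI) : sigma \subset [set: 'I_(nchart X)]%SET by apply: finset.subsetT.
apply: (qdim_iso (phi := id) (cocycle_subspace _ SVk) (cobound_subspace _ SVk) _ (cocycle_subspace _ SVi) (cobound_subspace _ SVi)).
- by apply: cobound_cocycle.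
- by apply: cobound_cocycle.
- by [].
- by move=> z [hz dz]; split=> //; apply: lec.
- move=> z [hz dz].
  have [sigma _|sigma _|psi [Ppsi hpsi]] := ex (z : cech_fun X).
  + have := hz sigma; case: ifP => _ // ->; by case: SVi => /(_ sigma) [].
  + have : (coboundary (z : cech_fun X)) sigma = 0 by rewrite (dz : coboundary _ = 0) ffunE.
    have V0 : Vk sigma 0 by case: SVk => /(_ sigma) [].
    by rewrite coboundaryE => h1; exact: (eq_ind_r (Vk sigma) V0 h1).
  have cpsi : cochain (sys_inf c) p (restr p psi) by apply: restrP => // sigma; apply: Ppsi.
  pose b : CF := coboundary (restr p psi : cech_fun X).
  have cb : cochain (sys_inf c) p.+1 b by apply: coboundary_cochain.
  exists (z - b); last by exists (restr p psi) => //; rewrite opprB addrC subrK.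
  split; last first.
    have [_ CZ] := cocycle_subspace p.+1 SVi.
    have bz : cocycle (sys_inf c) p.+1 b by split=> //; apply: cob_dd.
    have := subspaceB (cocycle_subspace p.+1 SVi) (conj hz dz) bz; by case.
  move=> sigma; have hb : (z - b : cech_fun X) sigma = (z : cech_fun X) sigma - dd (restr p psi : cech_fun X) sigma.
    by rewrite ffunE [X in _ + X]ffunE coboundaryE.
  rewrite hb; case: ifP => [/andP[cs0 /eqP cs]|cs]; last first.
    have := hz sigma; rewrite cs => ->; have := cb sigma; rewrite cs coboundaryE => ->; by rewrite subr0.
  have [p0|p0] := posnP p; last by rewrite drestr //; apply: hpsi.
  have z0 : dd (restr p psi : cech_fun X) sigma = 0.
    rewrite /dd big1 // => i is'; rewrite ffunE p0.
    by case: #|_| => [|m]; rewrite ?mulr0 //= ?mulr0.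
  have -> : (z : cech_fun X) sigma - dd (restr p psi : cech_fun X) sigma = ((z : cech_fun X) sigma - dd psi sigma) + dd psi sigma.
    by rewrite z0 subrK subr0.
  have [SVs MVs] := SVk; apply: subspaceD (SVs sigma) (hpsi _ (T sigma)) _.
  have SG := subspace_subgroup (SVs sigma).
  rewrite /dd; apply: (subgroup_sum _ SG) => i is'; apply: (subgroup_sign _ SG).
  have ei : (sigma :\ i)%SET = finset.set0.
    by apply/eqP; rewrite -cards_eq0; move: cs; rewrite p0 (cardsD1 i) is' add1n => -[->].
  by rewrite ei; apply: (MVs finset.set0); [apply: finset.sub0set | apply: e0; apply: Ppsi].
move=> z [hz dz]; split=> [[psi hpsi <-]|[psi hpsi zE]]; first by exists psi => //; apply: lec.
have [p0|p0] := posnP p.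
  exists 0; first by case: (cochain_subspace p SVk).
  rewrite coboundary0 -zE; apply/ffunP => sigma; rewrite coboundaryE /dd big1 ?ffunE // => i is'.
  have := hpsi (sigma :\ i)%SET; rewrite p0; case: ifP => [/andP[c1 /eqP c2]|_ ->]; last by rewrite mulr0.
  by rewrite c2 in c1.
have [sigma _|sigma _|chi [Pchi hchi]] := ex (psi : cech_fun X).
- have := hpsi sigma; case: ifP => _ // ->; by case: SVi => /(_ sigma) [].
- have h1 : dd (psi : cech_fun X) sigma = (z : cech_fun X) sigma by rewrite -zE coboundaryE.
  have Vz : Vk sigma ((z : cech_fun X) sigma).
    by have := hz sigma; case: ifP => _ // ->; case: SVk => /(_ sigma) [].
  exact: (eq_ind_r (Vk sigma) Vz h1).
exists (restr p (fun t => (psi : cech_fun X) t - dd chi t)); first by apply: restrP => // sigma; apply: hchi.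
rewrite -zE; apply/ffunP => sigma; rewrite !coboundaryE.
have [cs|cs] := eqVneq #|sigma| p.+1.
  by rewrite drestr // ddB dd_dd // subr0.
rewrite (dc _ _ _ _ hpsi cs); apply: (dc Vk p) => //; apply: restrP => // tau; exact: hchi.
Qed.

Lemma cohom_dim_general D : exists k0 : nat, forall k : nat, (k0 <= k)%N -> forall p h,
  qdim (cocycle (poles (fun=> k) (dg degCl D) : SI -> set Fk) p.+1) (cobound (poles (fun=> k) (dg degCl D) : SI -> set Fk) p) h ->
  cohom_dim D p = h.
Proof.
set c := dg degCl D; have [k0 hk] := cohomology_bounded c; exists k0 => k kk p h /(hk k kk) hq.
have [a a0 aD] := divisor_degree S D.
pose VD : SI -> set Fk := fun sigma => sections D (chart_inter sigma).
have VDP sigma x : VD sigma x <-> sys_inf c sigma (a * x).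
  rewrite /VD /sys_inf /sections /=; have [->|x0] := eqVneq x 0; first by rewrite mulr0 eqxx.
  have ax0 : a * x != 0 by rewrite mulf_neq0.
  have E (P : prime_divisor X) : ord P x + mult P D = ord P (a * x) + mult P (D0 *~ c).
    have := vordM D0 c 0 P a0 x0; rewrite addr0 vord0 -aD multMz /vord => ->; by rewrite addrC.
  by rewrite ax0; split=> hx _ P UP; [rewrite -E; apply: hx | rewrite E; apply: hx].
have SVi := sys_inf_ksystem c.
have SVD : ksystem (X := X) (iota := iota) VD.
  have [SP M] := SVi; split=> [sigma|sigma tau st x /VDP h']; last by apply/VDP; apply: M st _ h'.
  have [P0 PZ] := SP sigma; split=> [|b u v /VDP hu /VDP hv]; apply/VDP; first by rewrite mulr0.
  have -> : a * (b *: (u : Fk) + v : F) = (b *: (a * u : Fk) + (a * v : Fk) : Fk).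
    by rewrite mulrDr; congr (_ + _); apply: mulrCA.
  exact: PZ.
pose mu (phi : CF) : CF := ([ffun sigma => a^-1 * (phi : cech_fun X) sigma] : cech_fun X).
have ma x : a * (a^-1 * x) = x by rewrite mulrA divff // mul1r.
have dmu (phi : CF) sigma : dd (mu phi : cech_fun X) sigma = a^-1 * dd (phi : cech_fun X) sigma.
  by rewrite -ddZ; apply: dd_ext => i _; rewrite ffunE.
have cobmu phi : coboundary (mu phi : cech_fun X) = mu (coboundary (phi : cech_fun X)).
  apply/ffunP => sigma; have := dmu phi sigma; rewrite -coboundaryE => ->.
  by rewrite [RHS]ffunE coboundaryE.
have cmu q (phi : CF) : cochain (sys_inf c) q phi <-> cochain VD q (mu phi).
  split=> hp sigma; have := hp sigma; rewrite ffunE; case: ifP => _; rewrite ?VDP ?ma //.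
    by move=> ->; rewrite mulr0.
  by move=> /(congr1 ( *%R a)); rewrite ma mulr0.
pose nu' (phi : CF) : CF := ([ffun sigma => a * (phi : cech_fun X) sigma] : cech_fun X).
have munu phi : mu (nu' phi) = phi by apply/ffunP => sigma; rewrite !ffunE mulrA mulVf ?mul1r.
have mu0 : mu 0 = 0 by apply/ffunP => sigma; rewrite !ffunE mulr0.
have mu_inj phi : mu phi = 0 -> phi = 0.
  move=> m0; apply/ffunP => sigma; have := congr1 (fun u : cech_fun X => a * u sigma) m0.
  by rewrite !ffunE ma mulr0.
have zmu q phi : cocycle (sys_inf c) q phi <-> cocycle VD q (mu phi).
  split=> -[h1 h2]; split; try exact/cmu; rewrite /= in h2 *; first by rewrite cobmu h2.
  by apply: mu_inj; rewrite -cobmu.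
have bmu q phi : cobound (sys_inf c) q phi <-> cobound VD q (mu phi).
  split=> [[u hu <-]|[u hu uE]]; first by exists (mu u); [apply/cmu | rewrite cobmu].
  exists (nu' u); first by apply/cmu; rewrite munu.
  apply/eqP; rewrite -subr_eq0; apply/eqP; apply: mu_inj; apply/ffunP => sigma.
  have := congr1 (fun v : cech_fun X => v sigma) uE; rewrite -{1}(munu u) cobmu !ffunE => hh.
  by rewrite mulrBr [X in X - _]hh subrr.
have BZi : cobound (sys_inf c) p `<=` cocycle (sys_inf c) p.+1 by apply: cobound_cocycle.
have BZD : cobound VD p `<=` cocycle VD p.+1 by apply: cobound_cocycle.
have qD : qdim (cocycle VD p.+1) (cobound VD p) h.
  have lin a1 (u v : CF) : cocycle (sys_inf c) p.+1 u -> cocycle (sys_inf c) p.+1 v -> mu (a1 *: u + v) = a1 *: mu u + mu v.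
    have muE (u0 : CF) (sg : SI) : (mu u0 : cech_fun X) sg = a^-1 * (u0 : cech_fun X) sg by rewrite ffunE.
    move=> _ _; apply/ffunP => sigma; rewrite [RHS]CFD [X in _ = X + _]CFZ !muE CFD CFZ mulrDr.
    by congr (_ + _); apply: mulrCA.
  have zP z : cocycle (sys_inf c) p.+1 z -> cocycle VD p.+1 (mu z) by move=> /zmu.
  have sP z : cocycle VD p.+1 z -> exists2 z0, cocycle (sys_inf c) p.+1 z0 & cobound VD p (z - mu z0).
    move=> hz; exists (nu' z); first by apply/zmu; rewrite munu.
    by rewrite munu subrr; case: (cobound_subspace p SVD).
  have kP z : cocycle (sys_inf c) p.+1 z -> (cobound (sys_inf c) p z <-> cobound VD p (mu z)) by move=> _; apply: bmu.
  exact: (qdim_iso (cocycle_subspace p.+1 SVi) (cobound_subspace p SVi) BZi (cocycle_subspace p.+1 SVD) (cobound_subspace p SVD) BZD lin zP sP kP hq).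
apply: xget_unique; first exact: qD.
move=> m hm; exact: (qdim_uniq (cocycle_subspace p.+1 SVD) (cobound_subspace p SVD) BZD hm qD).
Qed.

Lemma poles_dim (k : nat) c sigma (m : nat) : m%:Z = c + (esum (fun=> k) sigma)%:Z ->
  qdim (poles (fun=> k) c sigma : set Fk) [set 0] (hf w I m).
Proof.
move=> mE; have II := tcs_ideal_ideal iota f w; have [SV _] := poles_ksystem k c.
have sp0 := sprod_neq0 GsP (fun=> k) sigma.
pose phi (G : MP) : Fk := (evf G / sprod (fun=> k) sigma : F).
apply: (qdim_iso (phi := phi) (@piece_subspace K nu w m) (ideal_piece_subspace w m II) _ (SV sigma) (zero_subspace _) _ _ _ _ _ (hfP w_gt0 m II)).
- by move=> u [].
- by move=> _ ->; case: (SV sigma).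
- by move=> a u v _ _; rewrite /phi evD evZ mulrDl -mulrA.
- by move=> G hG; rewrite /poles /= -mE /phi divfK //; apply: (sec_ev S).
- move=> x; rewrite /poles /= -mE => /(sec_lift S) [G hG xE]; exists G => //.
  by rewrite /phi -xE mulfK // subrr.
move=> G hG; split=> [[_ /(tcs_ideal_homog iota f hG) G0]|h].
  by rewrite /phi /= G0 mul0r.
split=> //; apply/(tcs_ideal_homog iota f hG); apply/eqP.
by have /eqP := (h : evf G / sprod (fun=> k) sigma = 0); rewrite mulf_eq0 invr_eq0 (negPf sp0) orbF.
Qed.

(** The functions with poles of bounded order form finite-dimensional spaces,
    whose dimensions are values of the Hilbert function. *)
Lemma euler_char_hilbert D : exists k0 : nat, forall k : nat, (k0 <= k)%N -> forall m : SI -> nat,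
  (forall sigma : SI, (0 < #|sigma|)%N -> (m sigma)%:Z = dg degCl D + (esum (fun=> k) sigma)%:Z) ->
  euler_char D = \sum_(sigma : SI | (0 < #|sigma|)%N) (-1) ^+ #|sigma|.-1 * (hf w I (m sigma))%:Z.
Proof.
have [k0 hk] := cohom_dim_general D; exists k0 => k kk m hm.
have [hh [hhP <-]] := qdim_cohomology two0 (poles_ksystem k (dg degCl D)) (fun sigma s0 => poles_dim (hm sigma s0)).
by apply: eq_bigr => q _; rewrite (hk k kk q _ (hhP q)).
Qed.

End EulerCharacteristic.

Section SelfIntersection.
Variables (K : closedFieldType) (F : fieldType) (iota : {rmorphism K -> F}).
Variables (X : normal_variety iota) (d nu : nat) (degCl : {additive Cl X -> int}).
Variables (D0 : WDiv X) (f : 'I_nu -> F) (w : 'I_nu -> nat).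
Hypothesis S : cox_setting d degCl D0 f w.
Local Notation MP := {mpoly K[nu]}.
Local Notation I := (tcs_ideal iota f w).
Local Notation SI := {set 'I_(nchart X)}.
Let w_gt0 := cs_w S.
Variables (r : nat) (g : 'I_r -> MP) (gam : 'I_r -> nat).
Hypothesis nuE : nu = (d.+1 + r)%N.
Hypothesis g_hom : forall j, weighted_homog w (g j) (gam j).
Hypothesis g_gen : I = ideal_generated_by g.

Lemma alternating_subsets n : (0 < n)%N ->
  \sum_(sigma : {set 'I_n} | (0 < #|sigma|)%N) (-1) ^+ #|sigma|.-1 = 1 :> rat.
Proof.
move=> n0; pose i0 := Ordinal n0.
have h : \sum_(sigma : {set 'I_n}) (-1) ^+ #|sigma| = 0 :> rat.
  pose tog (sigma : {set 'I_n}) := if i0 \in sigma then (sigma :\ i0)%SET else (i0 |: sigma)%SET.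
  have togK : involutive tog.
    move=> sigma; rewrite /tog; case is' : (i0 \in sigma).
      by rewrite !inE eqxx /= finset.setD1K.
    by rewrite !inE eqxx /= finset.setU1K // is'.
  have E : \sum_(sigma : {set 'I_n}) (-1) ^+ #|sigma| = - \sum_(sigma : {set 'I_n}) (-1) ^+ #|sigma| :> rat.
    rewrite {1}(reindex_inj (inv_inj togK)) -sumrN; apply: eq_bigr => sigma _; rewrite /tog.
    case: ifP => is'; first by rewrite [in RHS](cardsD1 i0) is' exprS mulN1r opprK.
    by rewrite cardsU1 is' exprS mulN1r.
  by apply/eqP; move/eqP: E; rewrite -addr_eq0 -mulr2n -mulr_natl mulf_eq0.
rewrite (bigID (fun sigma : {set 'I_n} => (0 < #|sigma|)%N)) /= in h.
rewrite [X in _ + X](big_pred1 finset.set0) in h; last first.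
  by move=> sigma; rewrite -leqNgt leqn0 cards_eq0.
rewrite cards0 expr0 in h; apply/eqP; rewrite -subr_eq0 -oppr_eq0 opprB addrC.
apply/eqP; rewrite -[RHS]h; congr (_ + _); rewrite -sumrN; apply: eq_bigr => sigma cs.
by rewrite -{2}(prednK cs) exprS mulN1r.
Qed.

(** Each nonempty set of charts contributes a value of the Hilbert polynomial,
    and the alternating number of these sets is one. *)
Lemma cartier_self_intersectionE D : cartier D ->
  (cartier_self_intersection d D)%:~R =
    (dg degCl D)%:~R ^+ d * (\prod_j (gam j)%:R / \prod_i (w i)%:R) :> rat.
Proof.
move=> cD; have [Lam [L0 LP]] := local_orders_lcm S.
have /dvdzP [del delE] := (cartierP S LP D).1 cD.
have [Q [q0 [sQ cQ Qq]]] := hilbert_polynomial S nuE g_hom g_gen L0 LP.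
have /choice[eG eGP] : forall i : 'I_(nchart X), exists eG : nat * MP, is_chart_poly D0 f w i eG.1 eG.2.
  by move=> i; have [e [G h]] := chart_polynomial S i; exists (e, G).
pose e i := (eG i).1; pose G i := (eG i).2; have GsP i : is_chart_poly D0 f w i (e i) (G i) := eGP i.
have n0 : (0 < nchart X)%N.
  have [O [i _]] := exists_point S; exact: leq_ltn_trans (leq0n _) (ltn_ord i).
pose es (sigma : SI) := (\sum_(i in sigma) e i)%N.
have es1 (sigma : SI) : (0 < #|sigma|)%N -> (1 <= es sigma)%N.
  move=> /card_gt0P [i is']; rewrite /es (bigD1 i) //=; apply: leq_trans (leq_addr _ _).
  by have [[]] := GsP i.
have dgD i : dg degCl (- (D *+ i)) = - (del * Lam%:Z * i%:Z).
  have -> : - (D *+ i) = D *~ (- i%:Z) by rewrite mulrNz.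
  by rewrite dgMz delE mulrN.
have /choice[k0 hk] := fun i : 'I_d.+1 => euler_char_hilbert S GsP (- (D *+ i)).
pose k1 := (\sum_i k0 i + absz del * d + q0)%N.
have k1P (i : 'I_d.+1) : (k0 i <= Lam * k1)%N.
  by apply: leq_trans (leq_pmull _ L0); rewrite /k1 (bigD1 i) //= -!addnA leq_addr.
pose q (sigma : SI) (i : nat) : nat := absz (k1%:Z * (es sigma)%:Z - del * i%:Z)%R.
have qE (sigma : SI) (i : 'I_d.+1) : (0 < #|sigma|)%N ->
    (q sigma i)%:Z = k1%:Z * (es sigma)%:Z - del * i%:Z /\ (q0 <= q sigma i)%N.
  move=> /es1 e1; have id : (i <= d)%N by rewrite -ltnS.
  have le1 : (k1 <= k1 * es sigma)%N by rewrite leq_pmulr.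
  have le2 : (absz del * i <= absz del * d)%N by rewrite leq_mul2l id orbT.
  have hle : q0%:Z <= k1%:Z * (es sigma)%:Z - del * i%:Z.
    have h1 : del * i%:Z <= (absz del * i)%N%:Z by rewrite PoszM ler_wpM2r // abszE ler_norm.
    have h2 : (q0 + absz del * d <= k1)%N by rewrite /k1; lia.
    move: h1 h2 le1 le2; rewrite -PoszM; move: (k1 * es sigma)%N (del * i%:Z) (absz del * i)%N (absz del * d)%N.
    by clear; lia.
  have E : (q sigma i)%:Z = k1%:Z * (es sigma)%:Z - del * i%:Z.
    by rewrite /q gez0_abs //; apply: le_trans hle.
  by split=> //; rewrite -lez_nat E.
have chi (i : 'I_d.+1) : (euler_char (- (D *+ i)))%:~R =
    \sum_(sigma : SI | (0 < #|sigma|)%N) (-1) ^+ #|sigma|.-1 * Q.[(k1 * es sigma)%N%:R - i%:R * del%:~R] :> rat.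
  rewrite (hk i (Lam * k1)%N (k1P i) (fun sigma => Lam * q sigma i)%N) => [|sigma s0]; last first.
    rewrite dgD PoszM (qE _ _ s0).1 /esum.
    have -> : (\sum_(i0 in sigma) Lam * k1 * e i0 = Lam * k1 * es sigma)%N by rewrite -big_distrr.
    by rewrite !PoszM; ring.
  rewrite rmorph_sum; apply: eq_bigr => sigma s0; have [E qq] := qE sigma i s0.
  rewrite rmorphM rmorphXn rmorphN1 /= -pmulrn Qq //; congr (_ * Q.[_]).
  have -> : (q sigma i)%:R = ((q sigma i)%:Z)%:~R :> rat by [].
  rewrite E; have -> : ((k1 * es sigma)%N%:R : rat) = ((k1%:Z * (es sigma)%:Z)%:~R : rat) by rewrite -PoszM -pmulrn.
  by rewrite rmorphB; congr (_ - _); rewrite rmorphM /= -pmulrn mulrC.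
rewrite /cartier_self_intersection rmorph_sum /=.
transitivity (\sum_(sigma : SI | (0 < #|sigma|)%N) (-1) ^+ #|sigma|.-1 * (d`!%:R * Q`_d * del%:~R ^+ d) : rat).
  rewrite (eq_bigr (fun i : 'I_d.+1 => \sum_(sigma : SI | (0 < #|sigma|)%N) (-1) ^+ #|sigma|.-1 *
     ((-1) ^+ i * ('C(d, i))%:R * Q.[(k1 * es sigma)%N%:R - i%:R * del%:~R]))) => [|i _].
    by rewrite exchange_big; apply: eq_bigr => sigma _; rewrite -mulr_sumr finite_difference.
  rewrite !rmorphM rmorphXn rmorphN1 /= -pmulrn chi mulr_sumr; apply: eq_bigr => sigma _; ring.
rewrite -mulr_suml alternating_subsets // mul1r.
have w0 : (\prod_i (w i)%:R : rat) != 0 by apply/prodf_neq0 => i _; rewrite pnatr_eq0 -lt0n.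
have cQ' : d`!%:R * Q`_d * \prod_i (w i)%:R = Lam%:R ^+ d * \prod_j (gam j)%:R :> rat.
  by rewrite -!natr_prod -natrX -natrM.
apply: (mulIf w0); rewrite mulrAC cQ' delE rmorphM /= -pmulrn -[RHS]mulrA divfK // exprMn.
ring.
Qed.

Lemma self_intersectionE (c : Cl X) :
  self_intersection d c = (degCl c)%:~R ^+ d * (\prod_j (gam j)%:R / \prod_i (w i)%:R).
Proof.
have key m D : (0 < m)%N -> cartier D -> cl D = c *+ m ->
    (cartier_self_intersection d D)%:~R / m%:R ^+ d = (degCl c)%:~R ^+ d * (\prod_j (gam j)%:R / \prod_i (w i)%:R) :> rat.
  move=> m0 cD cE; rewrite (cartier_self_intersectionE cD).
  have -> : dg degCl D = degCl c * m%:Z by rewrite /dg cE raddfMn -mulr_natr natz.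
  have mr : (m%:R : rat) != 0 by rewrite pnatr_eq0 -lt0n.
  by apply: (mulIf (expf_neq0 d mr)); rewrite divfK ?expf_neq0 // rmorphM /= -pmulrn exprMn mulrAC.
have [Lam [L0 LP]] := local_orders_lcm S; have [D DE] := cl_surj c.
apply: xget_unique.
  exists Lam, (D *+ Lam); have cE : cl (D *+ Lam) = c *+ Lam by rewrite DE pmulrn clMz -pmulrn.
  have cD : cartier (D *+ Lam).
    by apply/(cartierP S LP); rewrite /dg cE raddfMn -mulr_natr natz dvdz_mull.
  by split=> //; rewrite key.
by move=> q [m [D' [m0 cD' cE' ->]]]; apply: key.
Qed.

End SelfIntersection.

(** * Derivations and uniqueness of the canonical class *)

Lemma subring_det (F : fieldType) (A : set F) n (U : 'M[F]_n) : is_subring A ->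
  (forall i j, A (U i j)) -> A (\det U).
Proof.
move=> SA hU; rewrite /determinant; apply: (@subring_sum F A _ _ _ _ SA) => s _; apply: (subringM SA).
  by apply: (subringX _ SA); apply: (subringN SA); case: SA.
by apply: (@subring_prod F A _ _ _ _ SA).
Qed.

Section Calculus.
Variables (K F : fieldType) (iota : {rmorphism K -> F}).
Hypothesis charK : [pchar K] =i pred0.

Lemma natr_neq0 n : (n.+1%:R : K) != 0.
Proof. by move/pcharf0P: charK => ->. Qed.

Section Derivatives.
Variable n : nat.
Implicit Types (p : {mpoly K[n]}) (i : 'I_n).

Lemma msize_mderiv i p : p^`M(i) != 0 -> (msize p^`M(i) < msize p)%N.
Proof.
move=> d0; have := mlead_supp d0; rewrite mcoeff_msupp mcoeff_deriv => h.
have mp : (mlead p^`M(i) + U_(i))%MM \in msupp p.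
  by rewrite mcoeff_msupp; apply: contraNneq h => ->; rewrite mul0rn.
have := msize_mdeg_lt mp; rewrite mdegD mdeg1 addn1; apply: leq_ltn_trans.
by rewrite -mlead_deg.
Qed.

Lemma mderiv_eq0 i p : p^`M(i) = 0 -> forall m, m \in msupp p -> m i = 0%N.
Proof.
move=> p0 m mp; apply/eqP; apply: contraLR mp; rewrite -lt0n => mi.
have := congr1 (mcoeff (m - U_(i))%MM) p0; rewrite mcoeff_deriv mcoeff0 submK; last first.
  by apply/mnm_lepP => j; rewrite mnm1E; case: eqP => [<-|].
rewrite mcoeff_msupp negbK -mulr_natr => /eqP; rewrite mulf_eq0 => /orP[//|].
by rewrite (negPf (natr_neq0 _)).
Qed.

Lemma mderiv_const p : (forall i, p^`M(i) = 0) -> p = (p@_0%MM)%:MP.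
Proof.
move=> h; apply/mpolyP => m; rewrite mcoeffC; have [->|m0] := eqVneq m 0%MM; first by rewrite mulr1.
rewrite mulr0; apply: memN_msupp_eq0; apply: contraNN m0 => mp.
by apply/eqP/mnmP => i; rewrite (mderiv_eq0 (h i) mp) mnm0E.
Qed.

Lemma derivation0 (delta : F -> F) : derivation iota delta -> delta 0 = 0.
Proof. by move=> [d0 _ _]; have := d0 0; rewrite rmorph0. Qed.

Lemma derivation_sum (delta : F -> F) (I : Type) (r : seq I) (P : pred I) (a : I -> F) :
  derivation iota delta -> delta (\sum_(j <- r | P j) a j) = \sum_(j <- r | P j) delta (a j).
Proof.
move=> dd; have d0 := derivation0 dd; have [_ dD _] := dd.
by elim/big_rec2 : _ => // j y1 y2 _ <-; rewrite dD.
Qed.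

(** Chain rule. *)
Lemma derivation_mmap (delta : F -> F) (y : 'I_n -> F) p : derivation iota delta ->
  delta (ev iota y p) = \sum_i ev iota y p^`M(i) * delta (y i).
Proof.
move=> dd; have [dc dD dM] := dd; have d0 := derivation0 dd.
have d1 : delta 1 = 0 by rewrite -(rmorph1 iota).
have mon (m : 'X_{1..n}) : delta (ev iota y 'X_[m]) = \sum_i ev iota y ('X_[m])^`M(i) * delta (y i).
  have [k] := ubnP (mdeg m); elim: k m => // k IHk m; rewrite ltnS => mk.
  have [m0|[j mj]] : m = 0%MM \/ exists j, (0 < m j)%N.
    have [m0|/eqP] := eqVneq (mdeg m) 0%N; first by left; apply/eqP; rewrite -mdeg_eq0 m0.
    rewrite mdegE => h; right; apply: contrapT => no; apply: h; rewrite big1 // => j _.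
    by apply/eqP; rewrite -leqn0 leqNgt; apply/negP => mj; apply: no; exists j.
    rewrite m0 mpolyX0 ev1 d1 big1 // => i _; by rewrite -mpolyC1 mderivC ev0 mul0r.
  have mE : m = (U_(j) + (m - U_(j)))%MM.
    rewrite addmC submK //; apply/mnm_lepP => l; rewrite mnm1E; by case: eqP => [<-|].
  have lt : (mdeg (m - U_(j)) < k)%N.
    by move: mk; rewrite {1}mE mdegD mdeg1 add1n.
  rewrite mE mpolyXD evM evX dM IHk //.
  under [RHS]eq_bigr => i _ do rewrite mderivM evD !evM evX mulrDl.
  rewrite big_split /=; congr (_ + _).
    have UU : (U_(j) - U_(j))%MM = 0%MM :> 'X_{1..n} by apply/mnmP => l; rewrite mnmBE subnn mnm0E.
    rewrite (bigD1 j) //= mderivX mnm1E eqxx scale1r UU mpolyX0 ev1 mul1r big1 ?addr0 1?mulrC // => l lj.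
    by rewrite mderivX mnm1E eq_sym (negPf lj) scale0r ev0 !mul0r.
  by rewrite mulr_sumr; apply: eq_bigr => i _; rewrite mulrA.
rewrite [p]mpolyE ev_sum derivation_sum //.
rewrite (eq_bigr (fun m => \sum_i iota p@_m * (ev iota y ('X_[m])^`M(i) * delta (y i)))); last first.
  by move=> m _; rewrite evZ dM dc mul0r add0r mon mulr_sumr.
rewrite exchange_big; apply: eq_bigr => i _; rewrite (linear_sum (mderiv i)) ev_sum mulr_suml.
apply: eq_bigr => m _; have e : ev iota y (mderiv i (p@_m *: 'X_[m])) = iota p@_m * ev iota y (mderiv i 'X_[m]).
  by rewrite mderivZ evZ.
by rewrite mulrA -e.
Qed.

End Derivatives.

(** A relation of least degree would have vanishing partial derivatives. *)
Lemma alg_indep_det d (x : 'I_d -> F) (delta : 'I_d -> F -> F) :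
  (forall k, derivation iota (delta k)) -> \det (\matrix_(k, j) delta k (x j)) != 0 -> alg_indep iota x.
Proof.
move=> dd det0 p px; apply: contrapT => p0.
have [q [[q0 qx] qmin]] := @ex_min_nat _ (fun q => q <> 0 /\ ev iota x q = 0) (fun q => msize q) (ex_intro _ p (conj p0 px)).
have dq j : ev iota x q^`M(j) = 0.
  pose v : 'cV[F]_d := \col_j ev iota x q^`M(j).
  have Av : (\matrix_(k, j) delta k (x j)) *m v = 0.
    apply/colP => k; rewrite !mxE; transitivity (delta k (ev iota x q)); last by rewrite qx (derivation0 (dd k)).
    rewrite (derivation_mmap x q (dd k)).
    by apply: eq_bigr => l _; rewrite !mxE mulrC.
  have : v = 0.
    have U : (\matrix_(k, j) delta k (x j)) \in unitmx by rewrite unitmxE unitfE.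
    by rewrite -[v]mul1mx -(mulVmx U) -mulmxA Av mulmx0.
  by move/colP/(_ j); rewrite !mxE.
have dq0 j : q^`M(j) = 0.
  apply: contrapT => h; have := qmin _ (conj h (dq j)); rewrite leqNgt msize_mderiv //; exact/eqP.
have qc := mderiv_const dq0; apply: q0; move: qx; rewrite qc evC => /eqP; rewrite fmorph_eq0 => /eqP ->.
by rewrite mpolyC0.
Qed.

(** A relation of least degree between a and the coordinates has a nonzero
    derivative with respect to a, in characteristic zero. *)
Lemma differentials_span d (x : 'I_d -> F) (a : F) : has_dim iota d -> alg_indep iota x ->
  exists J : 'I_d -> F, forall delta, derivation iota delta -> delta a = \sum_k J k * delta (x k).
Proof.
move=> [_ dep] xi; pose y (i : 'I_d.+1) := if unlift ord0 i is Some k then x k else a.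
have y0 : y ord0 = a by rewrite /y unlift_none.
have yl k : y (fintype.lift ord0 k) = x k by rewrite /y liftK.
have [p /not_implyP [py p0]] : exists p : {mpoly K[d.+1]}, ~ (mmap iota y p = 0 -> p = 0).
  by apply/existsNP => h; apply: (dep y).
have [q [[q0 qy] qmin]] := @ex_min_nat _ (fun q => q <> 0 /\ ev iota y q = 0) (fun q => msize q) (ex_intro _ p (conj p0 py)).
have dq : ev iota y q^`M(ord0) != 0.
  apply/eqP => dq0; have d0 : q^`M(ord0) = 0.
    apply: contrapT => h; have := qmin _ (conj h dq0); rewrite leqNgt msize_mderiv //; exact/eqP.
  have h0 := mderiv_eq0 d0.
  pose rs (m : 'X_{1..d.+1}) : 'X_{1..d} := [multinom m (fintype.lift ord0 k) | k < d].
  pose Q := \sum_(m <- msupp q) q@_m *: 'X_[rs m] : {mpoly K[d]}.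
  have Q0 : Q = 0.
    apply: xi; rewrite -[LHS]/(ev iota x Q) -qy [in RHS](mpolyE q) !ev_sum big_seq [RHS]big_seq.
    apply: eq_bigr => m mq; rewrite !evZ; congr (_ * _).
    rewrite /ev !mmapX /mmap1 big_ord_recl (h0 m mq) expr0 mul1r.
    by apply: eq_bigr => k _; rewrite yl mnmE.
  apply: q0; apply/mpolyP => m; rewrite mcoeff0.
  have [mq|/memN_msupp_eq0 //] := boolP (m \in msupp q).
  have := congr1 (mcoeff (rs m)) Q0; rewrite mcoeff0 /Q raddf_sum /= (bigD1_seq m) //= mcoeffZ mcoeffX eqxx mulr1.
  rewrite big_seq_cond big1 ?addr0 // => m' /andP[m'q m'm]; rewrite mcoeffZ mcoeffX.
  case: eqP => [e|_]; last by rewrite mulr0.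
  case/eqP: m'm; apply/mnmP => i; case: (unliftP ord0 i) => [k ->|->]; last by rewrite !h0.
  by have := congr1 (fun m : 'X_{1..d} => m k) e; rewrite /= !mnmE.
exists (fun k => - ev iota y q^`M(fintype.lift ord0 k) / ev iota y q^`M(ord0)) => delta dd.
have := derivation_mmap y q dd; rewrite qy derivation0 // big_ord_recl y0 => e.
apply: (mulfI dq); apply/eqP; rewrite -subr_eq0 -[X in _ == X]/(0 : F); apply/eqP; rewrite [RHS]e.
congr (_ + _); rewrite mulr_sumr -sumrN; apply: eq_bigr => k _; rewrite yl.
by field.
Qed.

End Calculus.

Section CanonicalUniqueness.
Variables (K F : fieldType) (iota : {rmorphism K -> F}) (X : normal_variety iota) (d : nat).
Hypothesis charK : [pchar K] =i pred0.
Hypothesis dimF : has_dim iota d.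
Implicit Types (P : prime_divisor X) (x : 'I_d -> F) (delta : 'I_d -> F -> F).

Lemma derivation_comb (c : 'I_d -> F) delta : (forall i, derivation iota (delta i)) ->
  derivation iota (fun a => \sum_i c i * delta i a).
Proof.
move=> dd; split=> [k|a b|a b].
- by rewrite big1 // => i _; have [-> _ _] := dd i; rewrite mulr0.
- by rewrite -big_split; apply: eq_bigr => i _; have [_ -> _] := dd i; rewrite mulrDr.
rewrite mulr_suml mulr_sumr -big_split; apply: eq_bigr => i _; have [_ _ ->] := dd i.
by rewrite mulrDr mulrA [c i * (a * _)]mulrCA.
Qed.

Lemma basis_jacobian_neq0 P x delta : alg_indep iota x -> derivation_basis iota P delta ->
  \det (\matrix_(i, j) delta i (x j)) != 0.
Proof.
move=> xi [dP bP]; apply/negP => /det0P [v v0 vA].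
have dd i : derivation iota (delta i) by have [] := dP i.
have SP := pd_subring P; have [P1 PB PM] := SP.
have [s s0 sv] : exists2 s : F, s != 0 & forall i, (P : set F) (s * v 0 i).
  have [t [t0 Pt _ ot _]] := dvr_uniformizer (pd_dvr P).
  pose N := (\sum_i absz (ord P (v 0%R i)))%N; exists (t ^+ N); first exact: expf_neq0.
  move=> i; have [->|vi] := eqVneq (v 0 i) 0; first by rewrite mulr0 -(subrr 1); apply: PB.
  apply/(ord_ge0 (pd_dvr P)); first by rewrite mulf_neq0 // expf_neq0.
  rewrite (ordM (pd_dvr P)) // ?expf_neq0 // (ordX (pd_dvr P)) // ot -mulr_natr mul1r natz.
  have : (absz (ord P (v 0%R i)) <= N)%N by rewrite /N (bigD1 i) //= leq_addr.
  by clear; lia.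
pose eps a := \sum_i (s * v 0 i) * delta i a.
have de : derivation iota eps by apply: derivation_comb.
have eps_x j : eps (x j) = 0.
  have := congr1 (fun M : 'rV[F]_d => M 0 j) vA; rewrite !mxE => e.
  have -> : eps (x j) = s * (\sum_k v 0 k * (\matrix_(i, j) delta i (x j)) k j).
    by rewrite mulr_sumr; apply: eq_bigr => i _; rewrite mxE mulrA.
  by rewrite e mulr0.
have eps0 a : eps a = 0.
  have [J ->] := differentials_span charK a dimF xi; rewrite // big1 // => k _; by rewrite eps_x mulr0.
have P0 : (P : set F) 0 by rewrite -(subrr 1); apply: PB.
have dPe : derivation_of iota P eps by split=> // a _; rewrite eps0.
have [c [_ uc]] := bP eps dPe.
have e1 : c = \row_i (s * v 0 i).
  by apply: uc; split=> [i|a]; rewrite ?mxE //; apply: eq_bigr => i _; rewrite mxE.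
have e2 : c = 0.
  by apply: uc; split=> [i|a]; rewrite ?mxE // eps0 big1 // => i _; rewrite mxE mul0r.
case/eqP: v0; apply/rowP => i; have := congr1 (fun M : 'rV[F]_d => M 0 i) (etrans (esym e1) e2).
by rewrite !mxE => /eqP; rewrite mulf_eq0 (negPf s0) => /eqP.
Qed.

Lemma basis_change P delta delta' x : alg_indep iota x ->
  derivation_basis iota P delta -> derivation_basis iota P delta' ->
  ord P (\det (\matrix_(i, j) delta' i (x j))) = ord P (\det (\matrix_(i, j) delta i (x j))).
Proof.
have SP := pd_subring P; have [P1 PB PM] := SP.
have le (de de' : 'I_d -> F -> F) : alg_indep iota x -> derivation_basis iota P de -> derivation_basis iota P de' ->
    ord P (\det (\matrix_(i, j) de i (x j))) <= ord P (\det (\matrix_(i, j) de' i (x j))).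
  move=> xi b b'; have n0 := basis_jacobian_neq0 xi b; have n0' := basis_jacobian_neq0 xi b'.
  have [_ bP] := b; have [dP' _] := b'.
  have /choice[c hc] : forall i, exists c : 'rV[F]_d, (forall j, (P : set F) (c 0 j)) /\ forall a, de' i a = \sum_j c 0 j * de j a.
    by move=> i; have [c [hc _]] := bP _ (dP' i); exists c.
  have e : \matrix_(i, j) de' i (x j) = (\matrix_(i, j) c i 0 j) *m (\matrix_(i, j) de i (x j)).
    by apply/matrixP => i j; rewrite !mxE (hc i).2; apply: eq_bigr => k _; rewrite !mxE.
  rewrite e det_mulmx; have U0 : \det (\matrix_(i, j) c i 0 j) != 0.
    by move: n0'; rewrite e det_mulmx mulf_eq0 negb_or => /andP[].
  rewrite (ordM (pd_dvr P)) // lerDr; apply/(ord_ge0 (pd_dvr P)) => //.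
  by apply: (subring_det SP) => i j; rewrite mxE; apply: (hc i).1.
move=> xi b b'; apply/eqP; rewrite eq_le; apply/andP; split; exact: le.
Qed.

(** Two canonical divisors differ by the divisor of the ratio of the forms. *)
Lemma canonical_unique (D D' : WDiv X) : canonical_divisor d D -> canonical_divisor d D' -> cl D = cl D'.
Proof.
move=> [g [x [g0 xi hD]]] [g' [x' [g'0 xi' hD']]].
have /choice[J hJ] := fun j => differentials_span charK (x' j) dimF xi.
pose h := \det (\matrix_(k, j) J j k).
have key (delta : 'I_d -> F -> F) : (forall i, derivation iota (delta i)) ->
    \det (\matrix_(i, j) delta i (x' j)) = \det (\matrix_(i, j) delta i (x j)) * h.
  move=> dd; rewrite -det_mulmx; congr (\det _); apply/matrixP => i j; rewrite !mxE (hJ j _ (dd i)).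
  by apply: eq_bigr => k _; rewrite !mxE mulrC.
have dder P delta : derivation_basis iota P delta -> forall i, derivation iota (delta i).
  by move=> [dP _] i; case: (dP i).
apply/cl_eqP; have [Pd|noP] := EM (exists P : prime_divisor X, True); last first.
  by exists 1; rewrite ?oner_neq0 // => P; case: noP; exists P.
have [P _] := Pd; have h0 : h != 0.
  have [de b _] := hD P; have := basis_jacobian_neq0 xi' b; rewrite key; last exact: dder b.
  by rewrite mulf_eq0 negb_or => /andP[].
exists (g / (g' * h)); first by rewrite mulf_neq0 // invr_eq0 mulf_neq0.
move=> Q; have [de b ->] := hD Q; have [de' b' ->] := hD' Q.
have n0 := basis_jacobian_neq0 xi b; have n0' := basis_jacobian_neq0 xi' b'.
rewrite [in RHS]ordB ?mulf_neq0 //; last exact: pd_dvr.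
rewrite !(ordM (pd_dvr Q)) // (basis_change xi' b b') key; last exact: dder b.
by rewrite (ordM (pd_dvr Q)) //; ring.
Qed.

End CanonicalUniqueness.

(** * The Jacobian along a prime divisor *)

Section ResidueDeterminants.
Variables (F : fieldType) (A p : set F).
Hypothesis SA : is_subring A.
Hypothesis pA : proper_ideal A p.

Lemma prod_congruent (I : Type) (s : seq I) (a b : I -> F) : (forall i, A (a i)) -> (forall i, A (b i)) ->
  (forall i, p (a i - b i)) -> p (\prod_(i <- s) a i - \prod_(i <- s) b i).
Proof.
move=> Aa Ab pab; have [_ [p0 _] pD pM] := pA.
elim: s => [|i s IHs]; first by rewrite !big_nil subrr.
have Apb : A (\prod_(j <- s) b j) by apply: (@subring_prod F A _ _ _ _ SA).
rewrite !big_cons; have -> : a i * \prod_(j <- s) a j - b i * \prod_(j <- s) b j =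
  a i * (\prod_(j <- s) a j - \prod_(j <- s) b j) + \prod_(j <- s) b j * (a i - b i) by ring.
by apply: (pD); apply: (pM).
Qed.

Lemma det_congruent n (U V : 'M[F]_n) : (forall i j, A (U i j)) -> (forall i j, A (V i j)) ->
  (forall i j, p (U i j - V i j)) -> p (\det U - \det V).
Proof.
move=> AU AV pUV; have [_ _ _ pM] := pA; rewrite /determinant -sumrB.
apply: (@proper_ideal_sum F A p _ _ _ _ pA) => s _; rewrite -mulrBr; apply: (pM).
  by apply: (subringX _ SA); apply: (subringN SA); case: SA.
by apply: prod_congruent.
Qed.

End ResidueDeterminants.

Lemma whomog_mderiv (K : fieldType) nu (w : 'I_nu -> nat) n i (G : {mpoly K[nu]}) :
  G \is whomog w n -> G^`M(i) \is whomog w (n - w i).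
Proof.
move=> /dhomogP hG; apply/dhomogP => m; rewrite mcoeff_msupp mcoeff_deriv => h.
have mp : (m + U_(i))%MM \in msupp G by rewrite mcoeff_msupp; apply: contraNneq h => ->; rewrite mul0rn.
have := hG _ mp; rewrite -![_ (_ + _)%MM]/(mwt w _) mwtD mwtU => <-; by rewrite addnK.
Qed.

Lemma euler_identity (K : fieldType) nu (w : 'I_nu -> nat) n (G : {mpoly K[nu]}) :
  G \is whomog w n -> \sum_i (w i)%:R *: ('X_i * G^`M(i)) = n%:R *: G.
Proof.
move=> /dhomogP hG; apply/mpolyP => m; rewrite raddf_sum /= mcoeffZ.
transitivity (\sum_i G@_m * (m i * w i)%:R).
  apply: eq_bigr => i _; rewrite mcoeffZ; have [mi|mi] := posnP (m i).
    rewrite mi mul0n mulr0; have -> : ('X_i * G^`M(i))@_m = 0; last by rewrite mulr0.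
    apply: memN_msupp_eq0; apply/negP => /msuppM_le /allpairsP [[m1 m2] /= [h1 _ mE]].
    move: h1; rewrite msuppX inE => /eqP m1E; move: mi; rewrite mE mnmDE m1E mnm1E eqxx; lia.
  have mE : m = (U_(i) + (m - U_(i)))%MM.
    by rewrite addmC submK //; apply/mnm_lepP => l; rewrite mnm1E; case: eqP => [<-|].
  have -> : ('X_i * G^`M(i))@_m = G^`M(i)@_(m - U_(i))%MM by rewrite {1}mE mulrC mcoeffMX.
  rewrite mcoeff_deriv addmC -mE; have -> : ((m - U_(i))%MM i).+1 = m i.
    by rewrite mnmBE mnm1E eqxx /=; lia.
  by rewrite -mulr_natr natrM; ring.
rewrite -mulr_sumr -natr_sum; have [mG|/memN_msupp_eq0 ->] := boolP (m \in msupp G); last by rewrite mul0r mulr0.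
by rewrite -[(\sum_i m i * w i)%N]/(mwt w m) (hG _ mG) mulrC.
Qed.

Section LocalEvaluation.
Variables (K : closedFieldType) (F : fieldType) (iota : {rmorphism K -> F}).
Variables (X : normal_variety iota) (d nu : nat) (degCl : {additive Cl X -> int}).
Variables (D0 : WDiv X) (f : 'I_nu -> F) (w : 'I_nu -> nat).
Hypothesis S : cox_setting d degCl D0 f w.
Variables (P : prime_divisor X) (tau : F).
Hypothesis tau0 : tau != 0.
Hypothesis ord_tau : ord P tau = - mult P D0.
Implicit Types (G H : {mpoly K[nu]}) (B : {set 'I_nu}).
Local Notation evf := (ev iota f).
Local Notation vord := (vord D0).
Local Notation sec := (sec D0).
Local Notation I := (tcs_ideal iota f w).
Local Notation O := (P : set F).
Let w_gt0 := cs_w S.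
Let SP := pd_subring P.
Let dP := pd_dvr P.

(** Coordinates of a lift of the generic point to the total coordinate space,
    chosen so that it specializes along P to a point of the punctured space. *)
Definition lift_coord i := f i / tau ^+ w i.
Local Notation tev := (ev iota lift_coord).

Lemma tev_homog n G : G \is whomog w n -> tev G = evf G / tau ^+ n.
Proof.
move=> /dhomogP hG; rewrite (mpolyE G) !ev_sum mulr_suml big_seq [RHS]big_seq; apply: eq_bigr => m mG.
rewrite !evZ -mulrA; congr (_ * _); have <- : mwt w m = n := hG _ mG.
rewrite /ev !mmapX /mmap1 /mwt -prodrXr -prodf_div; apply: eq_bigr => i _.
by rewrite expr_div_n -exprM mulnC.
Qed.

Lemma ord_tev n G : G \is whomog w n -> evf G != 0 -> ord P (tev G) = vord n%:Z P (evf G).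
Proof.
move=> hG G0; rewrite (tev_homog hG) ordB ?expf_neq0 //.
rewrite (ordX dP) // ord_tau /vord -mulr_natr natz; ring.
Qed.

Lemma lift_coordX i : lift_coord i = tev 'X_i. Proof. by rewrite evX. Qed.

Lemma lift_coord_neq0 i : lift_coord i != 0.
Proof. by rewrite mulf_neq0 ?(cs_f0 S) // invr_eq0 expf_neq0. Qed.

Lemma lift_coord_regular i : O (lift_coord i).
Proof.
apply/(ord_ge0 dP); first exact: lift_coord_neq0.
rewrite lift_coordX (@ord_tev (w i)) ?evX ?(cs_f0 S) //; last exact: whomogX.
by have /(secP _ _ (cs_f0 S i)) := @f_sec K F iota X d nu degCl D0 f w S i; apply.
Qed.

Lemma tev_regular G : O (tev G).
Proof.
rewrite (mpolyE G) ev_sum; apply: (@subring_sum F O _ _ _ _ SP) => m _; rewrite evZ; apply: (subringM SP).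
  exact: pd_scalars.
rewrite /ev mmapX; apply: (@subring_prod F O _ _ _ _ SP) => i _.
by apply: (subringX _ SP); apply: lift_coord_regular.
Qed.

Lemma tev_tcs G : I G -> forall n, G \is whomog w n -> tev G = 0.
Proof. by move=> IG n hG; rewrite (tev_homog hG) (_ : evf G = 0) ?mul0r //; apply/(tcs_ideal_homog iota f hG). Qed.

(** Multiply by the equation of the polar divisor, which does not contain P. *)
Lemma regular_fraction a : O a -> exists n G H,
  [/\ G \is whomog w n, H \is whomog w n, tev H != 0, O (tev H)^-1 & a = tev G / tev H].
Proof.
move=> Oa; have [->|a0] := eqVneq a 0.
  exists 0%N, 0, 1; split; rewrite ?ev0 ?ev1 ?oner_neq0 ?mul0r //; first exact: dhomog0.
    exact: dhomog1.
  by rewrite invr1; case: SP.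
have [s hs] := finite_support X a0.
have [D DE] : exists D : WDiv X, forall Q : prime_divisor X, mult Q D = if ord Q a < 0 then - ord Q a else 0.
  apply: (@WDiv_of_function _ _ _ X _ s) => Q h; apply: hs; apply: contraNneq h => ->; by rewrite ltxx.
have [h h0 hh] := divisor_degree S D; set n := dg degCl D in hh.
have sh : sec n h.
  by apply/secP => // Q; rewrite -hh DE; case: ifP => // /ltW; rewrite oppr_ge0.
have n0 := sec_degree_ge0 S sh h0; case: n n0 hh sh => // n _ hh sh.
have sah : sec n%:Z (a * h).
  apply/secP => [|Q]; first by rewrite mulf_neq0.
  rewrite -[n%:Z]add0r vordM // vord0 -hh DE; case: ifP => [_|/negbT]; first by rewrite addrN.
  by rewrite -leNgt addr0.
have [H hH hE] := sec_lift S sh; have [G hG gE] := sec_lift S sah.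
have H0 : evf H != 0 by rewrite -hE.
have tn : tau ^+ n != 0 by rewrite expf_neq0.
have tH0 : tev H != 0 by rewrite (tev_homog hH) mulf_neq0 // invr_eq0.
have aP : 0 <= ord P a by apply/(ord_ge0 dP).
have [] : is_unit O (tev H).
  apply/(ord_unit dP) => //; rewrite (ord_tev hH) // -hE -hh DE; case: ifP => //.
  by rewrite ltNge aP.
move=> _ _ Hinv; exists n, G, H; split=> //; rewrite (tev_homog hH) (tev_homog hG) -gE -hE.
by field; rewrite h0 tn.
Qed.

Definition vanishes G := nonunits O (tev G).

Let pP := dvr_nonunits dP.
Let qP : proper_ideal O (nonunits O). Proof. by case: pP. Qed.

Lemma vanishes_homog n G : G \is whomog w n -> vanishes G <-> evf G = 0 \/ 0 < vord n%:Z P (evf G).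
Proof.
move=> hG; have [G0|G0] := eqVneq (evf G) 0.
  rewrite /vanishes (tev_homog hG) G0 mul0r; split=> _; first by left.
  exact: prime_ideal0 pP.
have t0 : tev G != 0 by rewrite (tev_homog hG) mulf_neq0 // invr_eq0 expf_neq0.
rewrite -(ord_tev hG G0); split=> [/(ord_gt0 dP t0)|[e|/(ord_gt0 dP t0)]] //; first by right.
by rewrite e eqxx in G0.
Qed.

Lemma some_coordinate_unit : exists i, ~ vanishes 'X_i.
Proof.
apply: contrapT => no; have van i : nonunits O (lift_coord i).
  by rewrite lift_coordX; apply: contrapT => h; apply: no; exists i.
have [c [p pc PE]] := pd_point P; have [e [s sP]] := chart_equation S c; have [e0 s0 sv] := sP.
have [G hG GE] := sec_lift S (chart_eq_sec sP).
have cP : chart c `<=` O by rewrite PE; apply: localization_sub pc; apply: chart_subring.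
have : ~ vanishes G.
  move/(vanishes_homog hG); rewrite -GE sv; case: asboolP => //= _ [h|]; last by rewrite ltxx.
  by rewrite h eqxx in s0.
apply; rewrite /vanishes (mpolyE G) ev_sum big_seq; apply: (@proper_ideal_sum F O _ _ _ _ _ qP) => m mG.
have [m0|[i mi]] : m = 0%MM \/ exists i, (0 < m i)%N.
- have [m0|/eqP] := eqVneq (mdeg m) 0%N; first by left; apply/eqP; rewrite -mdeg_eq0 m0.
  rewrite mdegE => h; right; apply: contrapT => no'; apply: h; rewrite big1 // => j _.
  by apply/eqP; rewrite -leqn0 leqNgt; apply/negP => mj; apply: no'; exists j.
- have : mwt w m = e by move/dhomogP: hG => /(_ m mG).
  by rewrite m0 mwt0 => e'; rewrite -e' in e0.
have [_ _ _ pM] := qP; rewrite evZ; apply: (pM); first exact: pd_scalars.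
rewrite /ev mmapX /mmap1 (bigD1 i) //= mulrC; apply: (pM).
  by apply: (@subring_prod F O _ _ _ _ SP) => j _; apply: (subringX _ SP); apply: lift_coord_regular.
by rewrite -(prednK mi) exprSr; apply: (pM) => //; apply: (subringX _ SP); apply: lift_coord_regular.
Qed.

Definition supported B G := forall m, m \in msupp G -> forall i, i \notin B -> m i = 0%N.

(** The variables of B are independent on the divisor. *)
Definition independent B := forall n G, G \is whomog w n -> supported B G -> vanishes G -> G = 0.

Section Equation.
Variables (e : nat) (s : F).
Hypothesis e0 : (0 < e)%N.
Hypothesis s0 : s != 0.
Hypothesis s_ord : forall Q, vord e%:Z Q s = (Q == P)%:Z.

Lemma divisible_by_equation n G : G \is whomog w n -> vanishes G ->
  evf G = 0 \/ exists l, n = (l + e)%N /\ sec l%:Z (evf G / s).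
Proof.
move=> hG /(vanishes_homog hG); have [->|G0 [h|ord_G]] := eqVneq (evf G) 0; try by left.
right; have sq : sec (n%:Z - e%:Z) (evf G / s).
  apply/secP => [|Q]; first by rewrite mulf_neq0 // invr_eq0.
  rewrite vordM ?invr_eq0 // vordV // s_ord.
  have : 0 <= vord n%:Z Q (evf G) by have /(secP _ _ G0) := sec_ev S hG; apply.
  by case: eqP => [->|_]; move: ord_G; [|move=> _]; clear; lia.
have := sec_degree_ge0 S sq; rewrite mulf_neq0 ?invr_eq0 // => /(_ isT) ge.
have E : n%:Z - e%:Z = (n - e)%N%:Z by move: ge; clear; lia.
by exists (n - e)%N; rewrite -E; split=> //; move: ge; clear; lia.
Qed.

(** An independent set of variables stays independent on the whole variety,
    where the equation of the divisor joins it. *)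
Lemma independent_card B : independent B -> (#|B| <= d)%N.
Proof.
move=> iB; rewrite leqNgt; apply/negP => dB.
pose t (k : 'I_d.+1) : 'I_nu := enum_val (widen_ord dB k).
have tB k : t k \in B by apply: enum_valP.
have tinj : injective t by move=> k l /enum_val_inj /(congr1 val) /= h; apply: val_inj.
pose f' (i : 'I_nu.+1) := if unlift ord0 i is Some k then f k else s.
pose w' (i : 'I_nu.+1) := if unlift ord0 i is Some k then w k else e.
have f'0 : f' ord0 = s by rewrite /f' unlift_none.
have w'0 : w' ord0 = e by rewrite /w' unlift_none.
have f'l k : f' (fintype.lift ord0 k) = f k by rewrite /f' liftK.
have w'l k : w' (fintype.lift ord0 k) = w k by rewrite /w' liftK.
have w'gt i : (0 < w' i)%N by rewrite /w'; case: (unlift ord0 i) => [k|//]; apply: w_gt0.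
pose t' (b : 'I_d.+2) := if unlift ord0 b is Some k then fintype.lift ord0 (t k) else ord0.
have t'inj : injective t'.
  move=> b c; rewrite /t'; case: (unliftP ord0 b) => [k ->|->]; case: (unliftP ord0 c) => [l ->|->] //.
  by move/lift_inj/tinj => ->.
have [P1 [N1 [P10 hP1 P1f P1s]]] := variable_relation f' (cs_dim S) w'gt t'inj.
pose rel N := exists R : {mpoly K[nu.+1]}, [/\ R != 0, R \is whomog w' N, ev iota f' R = 0 &
    forall m, m \in msupp R -> forall i, (0 < m i)%N -> exists b, i = t' b].
have [N [[R [R0 hR Rf Rs]] Nmin]] := @ex_min_nat nat rel id (ex_intro _ N1 (ex_intro _ P1 (And4 P10 hP1 P1f P1s))).
have subK (m : 'X_{1..nu.+1}) : (0 < m ord0)%N -> m = (U_(ord0) + (m - U_(ord0)))%MM.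
  by move=> m0; rewrite addmC submK //; apply/mnm_lepP => l; rewrite mnm1E; case: eqP => [<-|].
have wR m : m \in msupp R -> mwt w' m = N by move/dhomogP: hR => /(_ m).
(* a relation of least degree has a term free of the equation *)
have [m0 m0R m00] : exists2 m0, m0 \in msupp R & m0 ord0 = 0%N.
  apply: contrapT => no; have pos m : m \in msupp R -> (0 < m ord0)%N.
    by move=> mR; rewrite lt0n; apply/eqP => h; apply: no; exists m.
  pose R1 := \sum_(m <- msupp R) R@_m *: 'X_[m - U_(ord0)].
  have RE : R = 'X_ord0 * R1.
    rewrite {1}(mpolyE R) /R1 mulr_sumr big_seq [RHS]big_seq; apply: eq_bigr => m mR.
    by rewrite -scalerAr -mpolyXD -subK // pos.
  have R10 : R1 != 0 by apply: contra_neq R0 => h; rewrite RE h mulr0.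
  have Rne : exists m, m \in msupp R.
    by exists (mlead R); apply: mlead_supp.
  have : rel (N - e)%N.
    exists R1; split=> //.
    - rewrite /R1 big_seq; apply: rpred_sum => m mR; apply: rpredZ; rewrite dhomogX; apply/eqP.
      by have := wR _ mR; rewrite {1}(subK _ (pos _ mR)) mwtD mwtU w'0 => <-; rewrite addKn.
    - move: Rf; rewrite RE evM evX f'0 => /eqP; rewrite mulf_eq0 (negPf s0) => /eqP //.
    move=> m; rewrite /R1 => /msupp_sum_le /flattenP [/= l /mapP [m' m'R ->]].
    move=> /msuppZ_le; rewrite msuppX inE => /eqP -> i; rewrite mnmBE => h.
    by apply: (Rs m'); [move: m'R; rewrite mem_filter => /andP[]|apply: leq_trans h _; apply: leq_subr].
  move/Nmin; have [m mR] := Rne; have := wR _ mR; rewrite (subK _ (pos _ mR)) mwtD mwtU w'0.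
  by move: e0; clear; lia.
pose rs (m : 'X_{1..nu.+1}) : 'X_{1..nu} := [multinom m (fintype.lift ord0 k) | k < nu].
have rsE m k : rs m k = m (fintype.lift ord0 k) by rewrite mnmE.
have rsw m : mwt w' m = (m ord0 * e + mwt w (rs m))%N.
  rewrite /mwt big_ord_recl w'0; congr (_ + _)%N; apply: eq_bigr => k _; by rewrite w'l rsE.
have rsf (m : 'X_{1..nu.+1}) : \prod_i f' i ^+ m i = s ^+ m ord0 * \prod_k f k ^+ rs m k.
  by rewrite big_ord_recl f'0; congr (_ * _); apply: eq_bigr => k _; rewrite f'l rsE.
pose G := \sum_(m <- msupp R | m ord0 == 0%N) R@_m *: 'X_[rs m].
have hG : G \is whomog w N.
  rewrite /G big_seq_cond; apply: rpred_sum => m /andP[mR /eqP h]; apply: rpredZ; rewrite dhomogX; apply/eqP.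
  by have := wR _ mR; rewrite rsw h mul0n add0n.
have sG : supported B G.
  move=> m; rewrite /G => /msupp_sum_le /flattenP [/= l /mapP [m' m'R ->]].
  move=> /msuppZ_le; rewrite msuppX inE => /eqP -> i iB'; apply/eqP; rewrite -leqn0 leqNgt; apply/negP.
  rewrite rsE => h; have m'R' : m' \in msupp R by move: m'R; rewrite mem_filter => /andP[].
  have [b] := Rs m' m'R' _ h; rewrite /t'; case: (unlift ord0 b) => [k /lift_inj ik|].
    by rewrite ik tB in iB'.
  by move/eqP; rewrite eq_sym (negPf (neq_lift _ _)).
have secG : exists2 b, sec (N%:Z - e%:Z) b & evf G = s * b.
  pose b : F := \sum_(m <- msupp R | m ord0 != 0%N) iota R@_m * (s ^+ (m ord0).-1 * \prod_k f k ^+ rs m k).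
  exists (iota (- 1) * b).
    have sg : subgroup (sec (N%:Z - e%:Z)) by apply: (sec_subgroup S).
    apply: secZ; rewrite /b big_seq_cond; apply: (@subgroup_sum F _ _ _ _ _ sg) => m /andP[mR mz]; apply: secZ.
    have se : sec e%:Z s by apply/secP => // Q; rewrite s_ord; case: eqP.
    have h1 : sec (e%:Z * (m ord0).-1%:Z) (s ^+ (m ord0).-1) by apply: secX.
    have h2 : sec (mwt w (rs m))%:Z (evf 'X_[rs m]) by apply: (sec_ev S); rewrite dhomogX.
    have := secM h1 h2; rewrite /ev mmapX; congr (sec _ _).
    have := wR _ mR; rewrite rsw; move: mz; clear; case: (m ord0) => //= k _ <-.
    by rewrite mulSn !PoszD PoszM; ring.
  have := Rf; rewrite {1}(mpolyE R) ev_sum (bigID (fun m : 'X_{1..nu.+1} => m ord0 == 0%N)) /= => /eqP.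
  rewrite addr_eq0 => /eqP; rewrite rmorphN1 mulN1r /G ev_sum mulrN /b mulr_sumr => h.
  have E m : ev iota f' (R@_m *: 'X_[m]) = iota R@_m * (s ^+ m ord0 * \prod_k f k ^+ rs m k).
    by rewrite evZ /ev mmapX /mmap1 rsf.
  have -> : \sum_(m <- msupp R | m ord0 == 0%N) evf (R@_m *: 'X_[rs m]) =
      \sum_(m <- msupp R | m ord0 == 0%N) ev iota f' (R@_m *: 'X_[m]).
    by apply: eq_bigr => m /eqP h0; rewrite E h0 expr0 mul1r evZ /ev mmapX.
  rewrite h; congr (- _); apply: eq_bigr => m mz; rewrite E.
  by rewrite -{1}(prednK (n := m ord0)) ?lt0n // exprS; ring.
have vG : vanishes G.
  apply/(vanishes_homog hG); have [b sb ->] := secG; have [->|b0] := eqVneq b 0; first by left; rewrite mulr0.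
  right; rewrite -[N%:Z](subrK e%:Z) addrC vordM // s_ord eqxx.
  have vb : 0 <= vord (N%:Z - e%:Z) P b by have /(secP _ _ b0) := sb; apply.
  by apply: (@lt_le_trans _ _ (true%:Z)) => //; rewrite lerDl.
have G0 := iB _ _ hG sG vG; have := congr1 (mcoeff (rs m0)) G0; rewrite mcoeff0 /G raddf_sum /=.
rewrite big_mkcond (bigD1_seq m0) //= m00 eqxx mcoeffZ mcoeffX eqxx mulr1 big1_seq ?addr0; last first.
  move=> m /andP[mm0 mR]; case: eqP => // mz; rewrite mcoeffZ mcoeffX; case: eqP => [E|_]; last by rewrite mulr0.
  case/eqP: mm0; apply/mnmP => i; case: (unliftP ord0 i) => [k ->|->]; last by rewrite m00 mz.
  by rewrite -!rsE E.
by apply/eqP; rewrite -mcoeff_msupp.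
Qed.

End Equation.

Section CompleteIntersection.
Variables (r : nat) (g : 'I_r -> {mpoly K[nu]}) (gam : 'I_r -> nat).
Hypothesis nuE : nu = (d.+1 + r)%N.
Hypothesis g_hom : forall j, weighted_homog w (g j) (gam j).
Hypothesis g_gen : I = ideal_generated_by g.

Lemma tev_equation j : tev (g j) = 0.
Proof. by apply: tev_tcs (g_whomog g_hom j); apply: tcs_ideal_g. Qed.

(** Jacobian criterion along P: beyond a transcendence basis of the residue
    field, each variable satisfies a separable equation, whose gradient is a
    combination of those of the defining equations. *)
Lemma unit_minor : exists c : 'I_r -> 'I_nu,
  ~ nonunits O (\det (\matrix_(j, l) tev (g j)^`M(c l))).
Proof.
have charK := cs_char S.
have [e [s [e0 s0 s_ord]]] := prime_divisor_equation S P.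
have se : sec e%:Z s by apply/secP => // Q; rewrite s_ord; case: eqP.
have [sh hsh shE] := sec_lift S se.
have sh_van : nonunits O (tev sh) by apply/(vanishes_homog hsh); right; rewrite -shE s_ord eqxx.
have ind0 : independent finset.set0.
  move=> n G hG sG; have -> : G = (G@_0%MM)%:MP.
    apply/mpolyP => m; rewrite mcoeffC; have [->|m0] := eqVneq m 0%MM; first by rewrite mulr1.
    rewrite mulr0; apply: memN_msupp_eq0; apply: contraNN m0 => mG; apply/eqP/mnmP => i.
    by rewrite (sG _ mG) ?inE // mnm0E.
  rewrite /vanishes evC => -[_ nu_]; have [-> //|c0] := eqVneq (G@_0%MM) 0.
  case: nu_; split; rewrite ?fmorph_eq0 //; first exact: pd_scalars.
  by rewrite -fmorphV; apply: pd_scalars.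
(* a transcendence basis, among the variables, of the residue field of the
   cone over P *)
have [B iB Bmax] : exists2 B, independent B & forall B', independent B' -> (#|B'| <= #|B|)%N.
  have /asboolP h0 := ind0; case: (@arg_maxnP _ finset.set0 (fun B => `[< independent B >]) (fun B => #|B|) h0).
  by move=> B /asboolP iB Bm; exists B => // B' /asboolP; apply: Bm.
have Bd := independent_card e0 s0 s_ord iB.
have cB : (r.+1 <= #|~: B|%SET)%N.
  rewrite -(leq_add2l #|B|) cardsC card_ord; apply: (@leq_trans (d + r.+1)%N); first by rewrite leq_add2r.
  by rewrite [X in (_ <= X)%N]nuE addSnnS.
pose rho (i : 'I_r.+1) : 'I_nu := enum_val (widen_ord cB i).
have rhoB i : rho i \notin B by have := enum_valP (widen_ord cB i); rewrite inE.
have rho_inj : injective rho by move=> k l /enum_val_inj /(congr1 val) /= h; apply: val_inj.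
pose isrel i (G : {mpoly K[nu]}) := exists n, [/\ G \is whomog w n, supported (rho i |: B)%SET G, vanishes G & G <> 0].
have /choice[h hP] : forall i, exists G, isrel i G /\ ~ vanishes G^`M(rho i).
  move=> i; have [G1 G1P] : exists G, isrel i G.
    apply: contrapT => no; have : independent (rho i |: B)%SET.
      move=> n G hG sG vG; apply: contrapT => G0; apply: no; exists G, n; split=> //.
    by move/Bmax; rewrite cardsU1 rhoB add1n ltnn.
  have [G [[n [hG sG vG G0]] Gmin]] := @ex_min_nat _ (isrel i) (fun G => msize G) (ex_intro _ G1 G1P).
  exists G; split; first by exists n.
  move=> dv; have dG0 : G^`M(rho i) = 0.
    apply: contrapT => dG; have : isrel i G^`M(rho i).
      exists (n - w (rho i))%N; split=> //; first exact: whomog_mderiv.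
      move=> m; rewrite mcoeff_msupp mcoeff_deriv => hm j jB.
      have mp : (m + U_(rho i))%MM \in msupp G by rewrite mcoeff_msupp; apply: contraNneq hm => ->; rewrite mul0rn.
      by have := sG _ mp j jB; rewrite mnmDE => /eqP; rewrite addn_eq0 => /andP[/eqP].
    by move/Gmin; rewrite leqNgt msize_mderiv //; apply/eqP.
  apply: G0; apply: (iB n) => // m mG j jB; have [->|ji] := eqVneq j (rho i).
    exact: (mderiv_eq0 charK dG0 mG).
  by apply: (sG m mG); rewrite !inE negb_or ji.
have /choice[c1 /choice[c2 cE]] : forall i, exists c1 : 'I_r -> {mpoly K[nu]}, exists c2,
    h i = \sum_j c1 j * g j + c2 * sh.
  move=> i; have [[n [hG _ vG _]] _] := hP i.
  have [G0|[l [nE /(sec_lift S)[C hC CE]]]] := divisible_by_equation s0 s_ord hG vG.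
    have : I (h i) by apply/(tcs_ideal_homog iota f hG).
    by rewrite g_gen => -[c cE]; exists c, 0; rewrite mul0r addr0.
  have : I (h i - C * sh).
    have hCs : C * sh \is whomog w n by rewrite nE; apply: dhomogM.
    apply/(@tcs_ideal_homog K F iota nu f w n); first by apply: rpredB.
    by rewrite evB evM -CE -shE divfK ?subrr.
  by rewrite g_gen => -[c cE]; exists c, C; rewrite -cE subrK.
pose gg (a : 'I_r.+1) := if unlift ord0 a is Some j then g j else sh.
pose cc i (a : 'I_r.+1) := if unlift ord0 a is Some j then c1 i j else c2 i.
have ggv a : nonunits O (tev (gg a)).
  by rewrite /gg; case: (unlift ord0 a) => // j; rewrite tev_equation; apply: prime_ideal0 pP.
have hE i : h i = \sum_a cc i a * gg a.
  rewrite big_ord_recl /cc /gg unlift_none cE addrC; congr (_ + _).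
  by apply: eq_bigr => j _; rewrite !liftK.
pose J : 'M[F]_r.+1 := \matrix_(a, k) tev (gg a)^`M(rho k).
pose C : 'M[F]_r.+1 := \matrix_(i, a) tev (cc i a).
pose H : 'M[F]_r.+1 := \matrix_(i, k) tev (h i)^`M(rho k).
have [pO _ pD pM] := qP.
(* modulo the nonunits, the gradients of the h_i are combinations of those of
   the g_j and of the equation of P *)
have HCJ i k : nonunits O (H i k - (C *m J) i k).
  rewrite !mxE hE (linear_sum (mderiv (rho k))) ev_sum -sumrB.
  apply: (@proper_ideal_sum F O _ _ _ _ _ qP) => a _; rewrite !mxE.
  have -> : tev (cc i a * gg a)^`M(rho k) - tev (cc i a) * tev (gg a)^`M(rho k) =
      tev (cc i a)^`M(rho k) * tev (gg a) by rewrite mderivM evD !evM addrK.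
  by apply: (pM) => //; apply: tev_regular.
have HO i k : O (H i k) by rewrite mxE; apply: tev_regular.
have CJO i k : O ((C *m J) i k).
  by rewrite mxE; apply: (@subring_sum F O _ _ _ _ SP) => a _; rewrite !mxE; apply: (subringM SP); apply: tev_regular.
(* outside B, only the variable rho i occurs in h_i *)
have detH : ~ nonunits O (\det H).
  have -> : H = diag_mx (\row_i H i i).
    apply/matrixP => i k; rewrite !mxE; case: eqP => [->|ik]; first by rewrite mulr1n.
    have [[n [hG sG _ _]] _] := hP i; rewrite mulr0n; have -> : (h i)^`M(rho k) = 0; last by rewrite ev0.
    apply/mpolyP => m; rewrite mcoeff_deriv mcoeff0; have [mG|/memN_msupp_eq0 ->] := boolP ((m + U_(rho k))%MM \in msupp (h i)).
      have := sG _ mG (rho k); rewrite !inE negb_or rhoB andbT (inj_eq rho_inj) eq_sym => /(_ (introN eqP ik)).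
      by rewrite mnmDE mnm1E eqxx addn1.
    by rewrite mul0rn.
  rewrite det_diag; have [_ prm] := pP.
  have nup (I : Type) (l : seq I) (a : I -> F) : (forall i, O (a i)) -> (forall i, ~ nonunits O (a i)) ->
      ~ nonunits O (\prod_(i <- l) a i).
    move=> aO na; elim: l => [|i l IHl]; first by rewrite big_nil; exact: prime_idealN1 pP.
    rewrite big_cons; apply: contra_not IHl => /prm[] //; last by move/na.
    by apply: (@subring_prod F O _ _ _ _ SP).
  by apply: nup => i; rewrite !mxE; [apply: tev_regular|have [_] := hP i].
have detJ : ~ nonunits O (\det J).
  move=> dJ; apply: detH; have := det_congruent SP qP HO CJO HCJ; rewrite det_mulmx => hh.
  rewrite -[\det H](subrK (\det C * \det J)); apply: (pD) => //; apply: (pM) => //.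
  by apply: (subring_det SP) => i a; rewrite mxE; apply: tev_regular.
have [k kP] : exists k, ~ nonunits O (cofactor J ord0 k).
  apply: contrapT => no; apply: detJ; rewrite (expand_det_row _ ord0).
  apply: (@proper_ideal_sum F O _ _ _ _ _ qP) => k _; apply: (pM); first by rewrite mxE; apply: tev_regular.
  by apply: contrapT => hh; apply: no; exists k.
exists (fun l => rho (fintype.lift k l)); apply: contra_not kP => hh; rewrite /cofactor; apply: (pM).
  by apply: (subringX _ SP); apply: (subringN SP); case: SP.
congr (nonunits O (\det _)): hh; apply/matrixP => j l; rewrite !mxE /gg liftK //.
Qed.

End CompleteIntersection.
End LocalEvaluation.

(** * A basis of derivations along a prime divisor *)

Section ComplementaryMinors.
Variables (F : fieldType) (m r : nat).
Implicit Types (p : 'M[F]_(m + r)) (W : 'M[F]_(m, m + r)) (M B : 'M[F]_(r, m + r)).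

(** For W spanning the kernel of M, the function of B on either side is the
    same multilinear form up to a constant: complementary minors of W and M are
    proportional. *)
Lemma complementary_minors W M (A : 'M_(m + r, m)) B B' : W *m M^T = 0 -> \det (row_mx A M^T) != 0 ->
  \det (col_mx W B) * \det (B' *m M^T) = \det (col_mx W B') * \det (B *m M^T).
Proof.
move=> WM d0; have E C : \det (col_mx W C) * \det (row_mx A M^T) = \det (W *m A) * \det (C *m M^T).
  by rewrite -det_mulmx mul_col_row WM det_lblock.
by apply: (mulIf d0); rewrite mulrAC E [RHS]mulrAC E mulrAC.
Qed.

Lemma orthogonal_blocks p : p *m p^T = 1%:M ->
  [/\ usubmx p *m (usubmx p)^T = 1%:M, usubmx p *m (dsubmx p)^T = 0,
      dsubmx p *m (usubmx p)^T = 0 & dsubmx p *m (dsubmx p)^T = 1%:M].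
Proof.
rewrite -{1 2}(vsubmxK p) tr_col_mx mul_col_row (@scalar_mx_block F m r 1) => /eq_block_mx [-> -> -> ->].
by split.
Qed.

Lemma orthogonal_det p : p *m p^T = 1%:M -> \det p * \det p = 1.
Proof. by move=> /(congr1 determinant); rewrite det_mulmx det_tr det1. Qed.

Lemma det_complement W p : p *m p^T = 1%:M ->
  \det (col_mx W (dsubmx p)) * \det p = \det (W *m (usubmx p)^T).
Proof.
move=> pp; have [_ _ BU BB] := orthogonal_blocks pp; rewrite -(det_tr p) -det_mulmx.
have -> : p^T = row_mx (usubmx p)^T (dsubmx p)^T by rewrite -tr_col_mx vsubmxK.
by rewrite mul_col_row BU BB det_ublock det1 mulr1.
Qed.

Lemma complete_minor M p : p *m p^T = 1%:M -> \det (dsubmx p *m M^T) != 0 ->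
  \det (row_mx (usubmx p)^T M^T) != 0.
Proof.
move=> pp; have [UU _ BU _] := orthogonal_blocks pp; apply: contra_neq => d0.
have : \det (p *m row_mx (usubmx p)^T M^T) = 0 by rewrite det_mulmx d0 mulr0.
by rewrite -{1}(vsubmxK p) mul_col_row UU BU det_ublock det1 mul1r.
Qed.

End ComplementaryMinors.

(** Completion of a kernel vector to a frame of the kernel, by projecting
    coordinate vectors along the rows selected by an invertible minor. *)
Lemma adapted_frame (F : fieldType) d r (p : 'M[F]_(1 + d + r)) (M : 'M_(r, 1 + d + r)) (E : 'rV_(1 + d + r))
    (U := usubmx p) (B := dsubmx p)
    (V := dsubmx U *m (1%:M - M^T *m invmx (B *m M^T) *m B)) :
  p *m p^T = 1%:M -> E *m M^T = 0 -> B *m M^T \in unitmx ->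
  col_mx E V *m M^T = 0 /\ \det (col_mx (col_mx E V) B) * \det p = (E *m (usubmx U)^T) 0 0.
Proof.
move=> pp EM NU; have [UU UB BU BB] := orthogonal_blocks pp.
set Pi := 1%:M - _ in V *; have PM : Pi *m M^T = 0.
  by rewrite mulmxBl mul1mx -!mulmxA mulVmx // mulmx1 subrr.
have PU : Pi *m U^T = U^T by rewrite mulmxBl mul1mx -!mulmxA BU !mulmx0 subr0.
have EP : E *m Pi = E by rewrite mulmxBr mulmx1 !mulmxA EM !mul0mx subr0.
split; first by rewrite mul_col_mx EM -mulmxA PM mulmx0 col_mx0.
rewrite det_complement // -/U; have -> : col_mx E V = col_mx E (dsubmx U) *m Pi by rewrite mul_col_mx EP.
rewrite -mulmxA PU; have -> : U^T = row_mx (usubmx U)^T (dsubmx U)^T by rewrite -tr_col_mx vsubmxK.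
have [uu uv vu vv] : [/\ usubmx U *m (usubmx U)^T = 1%:M, usubmx U *m (dsubmx U)^T = 0,
    dsubmx U *m (usubmx U)^T = 0 & dsubmx U *m (dsubmx U)^T = 1%:M].
  move: UU; rewrite -/U -{1 2}(vsubmxK U) tr_col_mx mul_col_row (@scalar_mx_block F 1 d 1).
  by move=> /eq_block_mx [-> -> -> ->].
by rewrite mul_col_row vu vv det_ublock det1 mulr1 det_mx11.
Qed.

Lemma det_border (F : fieldType) d (A : 'M[F]_(1 + d)) (a := A (lshift d ord0) (lshift d ord0)) : a != 0 ->
  \det A = a * \det (\matrix_(k, j) (A (rshift 1 k) (rshift 1 j) -
     A (rshift 1 k) (lshift d ord0) / a * A (lshift d ord0) (rshift 1 j))).
Proof.
move=> a0; pose R := block_mx 1%:M (- (a^-1 *: ursubmx A)) 0 1%:M : 'M[F]_(1 + d).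
have dR : \det R = 1 by rewrite det_ublock !det1 mulr1.
have ulE : ulsubmx A = a%:M.
  by apply/matrixP => i j; rewrite !zmodp.ord1 !mxE mulr1n.
rewrite -[LHS]mulr1 -dR -det_mulmx -{1}(submxK A) mulmx_block !mulmx1 !mulmx0 !addr0 ulE.
have -> : a%:M *m - (a^-1 *: ursubmx A) + ursubmx A = 0.
  by rewrite mulmxN mul_scalar_mx scalerA divff // scale1r addNr.
rewrite det_lblock det_scalar1; congr (_ * \det _); apply/matrixP => k j.
rewrite !mxE big_ord1 !mxE addrC; congr (_ + _); rewrite mulrN; congr (- _); ring.
Qed.

Lemma det_rescale (F : fieldType) n (A : 'M[F]_n) (a b : 'I_n -> F) :
  \det (\matrix_(i, j) (a i * A i j * b j)) = \prod_i a i * \det A * \prod_j b j.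
Proof.
have -> : \matrix_(i, j) (a i * A i j * b j) = diag_mx (\row_i a i) *m A *m diag_mx (\row_j b j).
  by rewrite mul_mx_diag mul_diag_mx; apply/matrixP => i j; rewrite !mxE.
rewrite !det_mulmx !det_diag; congr (_ * _ * _); apply: eq_bigr => i _; by rewrite mxE.
Qed.

Lemma perm_mx_orthogonal (F : fieldType) n (s : {perm 'I_n}) : perm_mx s *m (perm_mx s)^T = 1%:M :> 'M[F]_n.
Proof. by rewrite tr_perm_mx -perm_mxM fingroup.mulgV perm_mx1. Qed.

Lemma mul_row_selection (F : fieldType) n q (s : {perm 'I_n}) (A : 'M[F]_(n, q)) i j :
  (perm_mx s *m A) i j = A (s i) j.
Proof. by rewrite -row_permE mxE. Qed.

Lemma complete_to_permutation d r (c : 'I_r -> 'I_(1 + d + r)) (i0 : 'I_(1 + d + r)) :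
  injective c -> (forall l, c l != i0) ->
  exists s : {perm 'I_(1 + d + r)}, s (lshift r (lshift d ord0)) = i0 /\ forall l, s (rshift (1 + d) l) = c l.
Proof.
move=> cinj ci0; pose C : {set 'I_(1 + d + r)} := (~: (i0 |: [set c l | l in 'I_r]))%SET.
have i0C : i0 \notin [set c l | l in 'I_r]%SET.
  by apply/imsetP => -[l _ e]; have := ci0 l; rewrite e eqxx.
have cC : #|C| = d.
  have := cardsC (i0 |: [set c l | l in 'I_r])%SET; rewrite -/C cardsU1 i0C card_imset // !card_ord => e.
  have {}e : (1 + r + #|C| = 1 + d + r)%N by exact: e.
  by move: e; generalize #|C|; clear; lia.
pose h (x : 'I_(1 + d + r)) : 'I_(1 + d + r) := match split x with
  | inl y => match split y with inl _ => i0 | inr k => enum_val (cast_ord (esym cC) k) end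
  | inr l => c l end.
have hk k : enum_val (cast_ord (esym cC) k) \in C by apply: enum_valP.
have hl l : h (rshift (1 + d) l) = c l by rewrite /h (unsplitK (inr l)).
have hu y : h (lshift r y) = match split y with inl _ => i0 | inr k => enum_val (cast_ord (esym cC) k) end.
  by rewrite /h (unsplitK (inl y)).
have hinj : injective h.
  have nC k l : enum_val (cast_ord (esym cC) k) != c l.
    apply/eqP => e; have := hk k; rewrite e !inE negb_or => /andP[_ /negP]; apply; exact: imset_f.
  have nC0 k : enum_val (cast_ord (esym cC) k) != i0.
    by apply/eqP => e; have := hk k; rewrite e !inE eqxx.
  move=> x y; case: (split_ordP x) => [x1|x1] ->; case: (split_ordP y) => [y1|y1] ->; rewrite ?hl ?hu.
  - case: (split_ordP x1) => [x2|x2] ->; case: (split_ordP y1) => [y2|y2] ->.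
    + by rewrite !zmodp.ord1.
    + by move/esym/eqP; rewrite (negPf (nC0 _)).
    + by move/eqP; rewrite (negPf (nC0 _)).
    + by move/enum_val_inj/cast_ord_inj => ->.
  - case: (split_ordP x1) => [x2|x2] -> /eqP; last by rewrite (negPf (nC _ _)).
    by rewrite eq_sym (negPf (ci0 _)).
  - case: (split_ordP y1) => [y2|y2] -> /eqP; first by rewrite (negPf (ci0 _)).
    by rewrite eq_sym (negPf (nC _ _)).
  by move/cinj ->.
exists (perm hinj); split=> [|l]; rewrite permE ?hl // hu (unsplitK (inl ord0)) //.
Qed.

Section IntegralMatrices.
Variables (F : fieldType) (A : set F).
Hypothesis SA : is_subring A.

Definition integral_mx m n (U : 'M[F]_(m, n)) := forall i j, A (U i j).

Lemma integral_mul m n q (U : 'M_(m, n)) (V : 'M_(n, q)) :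
  integral_mx U -> integral_mx V -> integral_mx (U *m V).
Proof.
move=> hU hV i j; rewrite mxE; apply: (@subring_sum F A _ _ _ _ SA) => k _.
by apply: (subringM SA).
Qed.

Lemma integral_inv n (U : 'M_n) : integral_mx U -> U \in unitmx -> A (\det U)^-1 -> integral_mx (invmx U).
Proof.
move=> hU uU dU i j; rewrite /invmx uU !mxE; apply: (subringM SA) => //; rewrite /cofactor.
apply: (subringM SA); first by apply: (subringX _ SA); apply: (subringN SA); case: SA.
by apply: (subring_det SA) => k l; rewrite !mxE.
Qed.

End IntegralMatrices.

Lemma mderiv_low_degree (K : fieldType) nu (w : 'I_nu -> nat) n i (G : {mpoly K[nu]}) :
  G \is whomog w n -> (n < w i)%N -> G^`M(i) = 0.
Proof.
move=> /dhomogP hG lt; apply/mpolyP => m; rewrite mcoeff_deriv mcoeff0.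
have [mG|/memN_msupp_eq0 ->] := boolP ((m + U_(i))%MM \in msupp G); last by rewrite mul0rn.
have := hG _ mG; rewrite -![_ (_ + _)%MM]/(mwt w _) mwtD mwtU => e; move: lt; rewrite -e; lia.
Qed.

Section CanonicalDivisor.
Variables (K : closedFieldType) (F : fieldType) (iota : {rmorphism K -> F}).
Variables (X : normal_variety iota) (d r : nat) (degCl : {additive Cl X -> int}).
Local Notation nu := (1 + d + r)%N.
Variables (D0 : WDiv X) (f : 'I_nu -> F) (w : 'I_nu -> nat).
Hypothesis S : cox_setting d degCl D0 f w.
Variables (g : 'I_r -> {mpoly K[nu]}) (gam : 'I_r -> nat).
Hypothesis g_hom : forall j, weighted_homog w (g j) (gam j).
Local Notation I := (tcs_ideal iota f w).
Hypothesis g_gen : I = ideal_generated_by g.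
Local Notation evf := (ev iota f).
Implicit Types (G H : {mpoly K[nu]}) (v : 'rV[F]_nu).
Let w_gt0 := cs_w S.
Let charK := cs_char S.

Lemma natF_neq0 n : (0 < n)%N -> (n%:R : F) != 0.
Proof. by case: n => // n _; rewrite -(rmorph_nat iota) fmorph_eq0 natr_neq0. Qed.

Section AtDivisor.
Variables (P : prime_divisor X) (tau : F).
Hypothesis tau0 : tau != 0.
Hypothesis ord_tau : ord P tau = - mult P D0.
Local Notation O := (P : set F).
Local Notation ft := (lift_coord f w tau).
Local Notation tev := (ev iota ft).
Let SP := pd_subring P.
Let dP := pd_dvr P.
Let ft0 i : ft i != 0. Proof. exact: (lift_coord_neq0 S tau0). Qed.
Let tevO G : O (tev G). Proof. exact: (tev_regular S tau0 ord_tau). Qed.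
Let tevg j : tev (g j) = 0. Proof. exact: (tev_equation tau g_hom g_gen). Qed.

Definition jacobian : 'M[F]_(r, nu) := \matrix_(j, i) tev (g j)^`M(i).
Definition euler_vector : 'rV[F]_nu := \row_i ((w i)%:R * ft i).
Local Notation M := jacobian.
Local Notation E := euler_vector.

Definition grad v G : F := \sum_i v 0 i * tev G^`M(i).

Lemma gradD v G H : grad v (G + H) = grad v G + grad v H.
Proof. by rewrite /grad -big_split; apply: eq_bigr => i _; rewrite mderivD evD mulrDr. Qed.

Lemma gradN v G : grad v (- G) = - grad v G.
Proof. by rewrite /grad -sumrN; apply: eq_bigr => i _; rewrite mderivN (rmorphN tev) mulrN. Qed.

Lemma gradM v G H : grad v (G * H) = grad v G * tev H + tev G * grad v H.
Proof.
rewrite /grad mulr_suml mulr_sumr -big_split; apply: eq_bigr => i _ /=.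
by rewrite mderivM evD !evM; ring.
Qed.

Lemma gradC v c : grad v c%:MP = 0.
Proof. by rewrite /grad big1 // => i _; rewrite mderivC ev0 mulr0. Qed.

Lemma gradX v i k : grad v ('X_i ^+ k) = k%:R * ft i ^+ k / ft i * v 0 i.
Proof.
have g1 : grad v 'X_i = v 0 i.
  rewrite /grad (bigD1 i) //= mderivX mnm1E eqxx scale1r big1 => [|j ji].
    have -> : (U_(i) - U_(i))%MM = 0%MM :> 'X_{1..nu} by apply/mnmP => l; rewrite mnmBE subnn mnm0E.
    by rewrite mpolyX0 ev1 mulr1 addr0.
  by rewrite mderivX mnm1E eq_sym (negPf ji) scale0r ev0 mulr0.
elim: k => [|k IHk]; first by rewrite expr0 -mpolyC1 gradC !mul0r.
by rewrite exprS gradM g1 IHk evX evXn evX exprS -natr1; field.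
Qed.

Lemma grad_tcs v G : v *m M^T = 0 -> I G -> grad v G = 0.
Proof.
move=> vM; rewrite g_gen => -[c ->].
have vg j : grad v (g j) = 0.
  have := congr1 (fun A : 'rV_r => A 0 j) vM; rewrite !mxE => e; rewrite -[RHS]e.
  by apply: eq_bigr => i _; rewrite !mxE.
apply: (big_ind (fun G => grad v G = 0)) => [|G1 G2 h1 h2|j _].
- by rewrite -mpolyC0 gradC.
- by rewrite gradD h1 h2 addr0.
by rewrite gradM vg tevg !mulr0 addr0.
Qed.

Lemma euler_kernel : E *m M^T = 0.
Proof.
apply/rowP => j; rewrite !mxE; have := congr1 tev (euler_identity (g_whomog g_hom j)).
rewrite evZ tevg mulr0 ev_sum => e; rewrite -[RHS]e; apply: eq_bigr => i _.
by rewrite !mxE evZ evM evX rmorph_nat; ring.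
Qed.

Lemma grad_euler n G : G \is whomog w n -> grad E G = n%:R * tev G.
Proof.
move=> hG; have := congr1 tev (euler_identity hG); rewrite evZ rmorph_nat ev_sum => <-.
by apply: eq_bigr => i _; rewrite !mxE evZ evM evX rmorph_nat; ring.
Qed.

(** The tangent vector v determines a derivation of the function field, since
    functions are homogeneous fractions of degree zero. *)
Definition derivation_along v (delta : F -> F) := forall n G H a,
  G \is whomog w n -> H \is whomog w n -> tev H != 0 -> a = tev G / tev H ->
  delta a = (grad v G - a * grad v H) / tev H.

Lemma fraction_rep a : exists n G H,
  [/\ G \is whomog w n, H \is whomog w n, tev H != 0 & a = tev G / tev H].
Proof.
have [n [G [H [hG hH H0 aE]]]] := homogeneous_fraction S a; exists n, G, H.
have tn : tau ^+ n != 0 by rewrite expf_neq0.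
split=> //; rewrite (tev_homog iota f tau hH) ?mulf_neq0 ?invr_eq0 //.
by rewrite (tev_homog iota f tau hG) aE; field; rewrite H0 tn.
Qed.

Lemma derivation_along_exists v : v *m M^T = 0 ->
  exists2 delta, derivation iota delta & derivation_along v delta.
Proof.
move=> vM; have /choice[delta dd] : forall a, exists b, forall n G H,
    G \is whomog w n -> H \is whomog w n -> tev H != 0 -> a = tev G / tev H ->
    b = (grad v G - a * grad v H) / tev H.
  move=> a; have [n [G [H [hG hH H0 aE]]]] := fraction_rep a.
  exists ((grad v G - a * grad v H) / tev H) => n' G' H' hG' hH' H'0 aE'.
  have : grad v (G * H' - G' * H) = 0.
    apply: grad_tcs => //; have h1 : G * H' \is whomog w (n + n') by apply: dhomogM.
    have h2 : G' * H \is whomog w (n + n') by rewrite (addnC n n'); apply: dhomogM.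
    have h3 : G * H' - G' * H \is whomog w (n + n') by apply: rpredB.
    apply/(tcs_ideal_homog iota f h3); have tn : tau ^+ (n + n') != 0 by rewrite expf_neq0.
    apply: (mulIf (x := (tau ^+ (n + n'))^-1)); first by rewrite invr_eq0.
    rewrite mul0r -(tev_homog iota f tau h3) evB !evM; have := aE; rewrite aE' => /eqP.
    rewrite eqr_div // => /eqP e; apply/eqP; rewrite subr_eq0; apply/eqP.
    by rewrite -e; ring.
  rewrite gradD gradN !gradM => e.
  have GE : tev G = a * tev H by rewrite aE divfK.
  have GE' : tev G' = a * tev H' by rewrite aE' divfK.
  have e' : grad v G * tev H' - a * grad v H * tev H' = grad v G' * tev H - a * grad v H' * tev H.
    apply/eqP; rewrite -subr_eq0 -[X in _ == X]e GE GE'; apply/eqP; ring.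
  apply/eqP; rewrite eqr_div // !mulrBl; apply/eqP; exact: e'.
have da : derivation_along v delta by move=> n G H a hG hH H0 aE; apply: (dd a n G H).
exists delta => //; split=> [c|a b|a b].
- have hc : (c%:MP : {mpoly K[nu]}) \is whomog w 0.
    by apply/dhomogP => m; rewrite msuppC; case: eqP => //= _; rewrite inE => /eqP->; apply: mwt0.
  have h1 : (1 : {mpoly K[nu]}) \is whomog w 0 by apply: dhomog1.
  rewrite (da _ _ _ (iota c) hc h1) ?ev1 ?evC ?oner_neq0 ?divr1 //.
  by rewrite gradC -mpolyC1 gradC mulr0 subr0.
- have [n [G [H [hG hH H0 aE]]]] := fraction_rep a; have [n' [G' [H' [hG' hH' H'0 bE]]]] := fraction_rep b.
  have h1 : G * H' + G' * H \is whomog w (n + n').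
    by apply: rpredD; [apply: dhomogM|rewrite (addnC n n'); apply: dhomogM].
  have h2 : H * H' \is whomog w (n + n') by apply: dhomogM.
  rewrite (da _ _ _ _ hG hH H0 aE) (da _ _ _ _ hG' hH' H'0 bE) (da _ _ _ (a + b) h1 h2).
  + by rewrite gradD !gradM evM aE bE; field; rewrite H0 H'0.
  + by rewrite evM mulf_neq0.
  by rewrite evD !evM aE bE; field; rewrite H0 H'0.
have [n [G [H [hG hH H0 aE]]]] := fraction_rep a; have [n' [G' [H' [hG' hH' H'0 bE]]]] := fraction_rep b.
have h1 : G * G' \is whomog w (n + n') by apply: dhomogM.
have h2 : H * H' \is whomog w (n + n') by apply: dhomogM.
rewrite (da _ _ _ _ hG hH H0 aE) (da _ _ _ _ hG' hH' H'0 bE) (da _ _ _ (a * b) h1 h2).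
+ by rewrite !gradM evM aE bE; field; rewrite H0 H'0.
+ by rewrite evM mulf_neq0.
by rewrite !evM aE bE; field; rewrite H0 H'0.
Qed.

Lemma derivation_is_along eps : derivation iota eps ->
  (\row_i eps (ft i)) *m M^T = 0 /\ derivation_along (\row_i eps (ft i)) eps.
Proof.
move=> de; have [_ _ dM] := de.
have ch G : eps (tev G) = grad (\row_i eps (ft i)) G.
  rewrite (derivation_mmap ft G de); apply: eq_bigr => i _; by rewrite mxE mulrC.
split.
  apply/rowP => j; rewrite !mxE; transitivity (eps (tev (g j))); last by rewrite tevg (derivation0 de).
  by rewrite ch; apply: eq_bigr => i _; rewrite !mxE.
move=> n G H a hG hH H0 aE; have := dM a (tev H); rewrite {1}aE divfK // !ch => ->.
by rewrite addrK mulfK.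
Qed.

Lemma derivation_along_regular v delta : derivation iota delta -> derivation_along v delta ->
  integral_mx O v -> derivation_of iota P delta.
Proof.
move=> dd da vO; split=> // a Oa.
have [n [G [H [hG hH H0 Hi aE]]]] := regular_fraction S tau0 ord_tau Oa.
have gO J : O (grad v J) by apply: (@subring_sum F O _ _ _ _ SP) => i _; apply: (subringM SP).
rewrite (da _ _ _ _ hG hH H0 aE); apply: (subringM SP) => //; have [_ PB _] := SP.
by apply: (PB) => //; apply: (subringM SP).
Qed.

(** Changing the lift of the generic point rescales rows and columns. *)
Lemma minor_scaling (c : 'I_r -> 'I_nu) : \det (\matrix_(j, l) tev (g j)^`M(c l)) =
  \det (\matrix_(j, l) evf (g j)^`M(c l)) * tau ^ (\sum_l (w (c l))%:Z - \sum_j (gam j)%:Z).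
Proof.
have -> : \matrix_(j, l) tev (g j)^`M(c l) = \matrix_(j, l)
   ((tau ^+ gam j)^-1 * (\matrix_(j, l) evf (g j)^`M(c l)) j l * tau ^+ w (c l)).
  apply/matrixP => j l; rewrite !mxE; have [le|lt] := leqP (w (c l)) (gam j); last first.
    by rewrite (mderiv_low_degree (g_whomog g_hom j) lt) !ev0 mulr0 mul0r.
  rewrite (tev_homog iota f tau (whomog_mderiv (c l) (g_whomog g_hom j))).
  by rewrite -{2}(subnK le) exprD; field; rewrite !expf_neq0.
rewrite det_rescale prodfV !prodrXr.
rewrite [_ ^- _ * _]mulrC -mulrA; congr (_ * _); rewrite expfzDr // mulrC; congr (_ * _).
  by rewrite -[_ ^+ _]/(tau ^ (_%:Z)); congr (tau ^ _); exact: (big_morph Posz PoszD (erefl 0%:Z)).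
by rewrite exprnN; congr (tau ^ (- _)); exact: (big_morph Posz PoszD (erefl 0%:Z)).
Qed.

(** The variables outside a unit minor of the Jacobian do not all vanish at P:
    by the Euler relation the others would vanish too. *)
Lemma unit_minor_numbering : exists t : {perm 'I_nu},
  ~ nonunits O (\det (\matrix_(j, l) tev (g j)^`M(t (rshift (1 + d) l)))) /\
  ~ nonunits O (ft (t (lshift r (lshift d ord0)))).
Proof.
have unitP a : a != 0 -> O a -> ~ nonunits O a -> is_unit O a.
  by move=> a0 Oa na; apply: contrapT => h; apply: na.
have [c cu] := unit_minor S tau0 ord_tau (erefl nu) g_hom g_gen.
have [qP _] := dvr_nonunits dP; have [_ [n0 _] nD nM] := qP.
set N0 := \matrix_(j, l) _ in cu.
have dN0 : \det N0 != 0 by apply/eqP => e; apply: cu; rewrite e.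
have cinj : injective c.
  move=> l l' e; apply/eqP; apply: contraTT dN0 => ll; rewrite negbK; apply/eqP; rewrite -det_tr.
  by apply: (determinant_alternate ll) => j; rewrite !mxE e.
have ON0 : integral_mx O N0 by move=> j l; rewrite mxE.
have uN0 : is_unit O (\det N0) by apply: unitP => //; apply: (subring_det SP).
have [i0 i0u ci0] : exists2 i0, ~ nonunits O (ft i0) & forall l, c l != i0.
  apply: contrapT => no; have [i iu] := some_coordinate_unit S tau0 ord_tau.
  rewrite /vanishes evX in iu; have outc j : (forall l, c l != j) -> nonunits O (ft j).
    by move=> h; apply: contrapT => ju; apply: no; exists j.
  have [[l cl]|nc] := EM (exists l, c l = i); last first.
    by apply: iu; apply: outc => l; apply/eqP => e; apply: nc; exists l.
  pose y : 'cV[F]_r := \col_l ((w (c l))%:R * ft (c l)).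
  have Ny j : nonunits O ((N0 *m y) j 0).
    have := congr1 (fun A : 'rV_r => A 0 j) euler_kernel; rewrite !mxE.
    rewrite (bigID (fun i => i \in [set c l | l in 'I_r]%SET)) /= big_imset /=; last by move=> ? ? _ _; apply: cinj.
    move=> /eqP; rewrite addr_eq0 => /eqP e.
    have -> : \sum_k N0 j k * y k 0 = \sum_(k in 'I_r) E 0 (c k) * M^T (c k) j.
      by apply: eq_bigr => k _; rewrite !mxE mulrC.
    rewrite e; apply: (proper_idealN SP qP); apply: (@proper_ideal_sum F O _ _ _ _ _ qP) => k kc.
    rewrite !mxE mulrC; apply: (nM) => //; apply: (nM); first by rewrite -(rmorph_nat iota); apply: pd_scalars.
    by apply: outc => l'; apply: contraNneq kc => <-; apply: imset_f.
  have uN : N0 \in unitmx by rewrite unitmxE unitfE.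
  have yE : y = invmx N0 *m (N0 *m y) by rewrite mulmxA mulVmx // mul1mx.
  have iN := integral_inv SP ON0 uN (let: And3 _ _ h := uN0 in h).
  have yl : nonunits O (y l 0).
    rewrite yE mxE; apply: (@proper_ideal_sum F O _ _ _ _ _ qP) => k _; exact: (nM).
  apply: iu; rewrite -cl; move: yl; rewrite mxE => yl.
  have -> : ft (c l) = ((w (c l))%:R)^-1 * ((w (c l))%:R * ft (c l)) by rewrite mulKf // natF_neq0.
  by apply: (nM) => //; rewrite -(rmorph_nat iota) -fmorphV; apply: pd_scalars.
have [t [ti0 tc]] := complete_to_permutation cinj ci0.
exists t; rewrite ti0; split=> //; move: cu; congr (~ nonunits O (\det _)).
by apply/matrixP => j l; rewrite !mxE tc.
Qed.

Section Coordinates.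
(** A numbering of the variables whose last members carry a nonzero minor of
    the Jacobian; the others give coordinates x of the function field. *)
Variable s : {perm 'I_nu}.
Let o := s (lshift r (lshift d ord0)).
Let sg (j : 'I_d) := s (lshift r (rshift 1 j)).
Let c0 (l : 'I_r) := s (rshift (1 + d) l).

Definition coordinate (j : 'I_d) : F := f (sg j) ^+ w o / f o ^+ w (sg j).
Local Notation x := coordinate.

Lemma derivation_coordinate v delta j : derivation_along v delta ->
  delta (x j) = x j * (w o)%:R / ft (sg j) * (v 0 (sg j) - v 0 o / ((w o)%:R * ft o) * ((w (sg j))%:R * ft (sg j))).
Proof.
move=> da; have h1 : ('X_(sg j) : {mpoly K[nu]}) ^+ w o \is whomog w (w (sg j) * w o).
  by apply: dhomogMn; apply: whomogX.
have h2 : ('X_o : {mpoly K[nu]}) ^+ w (sg j) \is whomog w (w (sg j) * w o).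
  by rewrite mulnC; apply: dhomogMn; apply: whomogX.
have H0 : tev ('X_o ^+ w (sg j)) != 0 by rewrite evXn evX expf_neq0.
have xE : x j = tev ('X_(sg j) ^+ w o) / tev ('X_o ^+ w (sg j)).
  have tn : tau ^+ (w (sg j) * w o) != 0 by rewrite expf_neq0.
  have fo : f o ^+ w (sg j) != 0 by rewrite expf_neq0 // (cs_f0 S).
  rewrite (tev_homog iota f tau h1) (tev_homog iota f tau h2) !evXn !evX /x; by field; rewrite tn fo.
rewrite (da _ _ _ _ h1 h2 H0 xE) !gradX; move: H0 xE; rewrite !evXn !evX => H0 xE.
have wo : ((w o)%:R : F) != 0 by apply: natF_neq0.
have -> : ft (sg j) ^+ w o = x j * ft o ^+ w (sg j) by rewrite xE divfK.
by field; rewrite wo H0 !ft0.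
Qed.

(** The determinant of the values at the coordinates is a minor of the frame of
    the kernel, complementary to a minor of the Jacobian; the frame itself is
    adapted to a minor that is invertible at P. *)
Lemma local_derivations : \det (\matrix_(j, l) evf (g j)^`M(c0 l)) != 0 ->
  exists delta : 'I_d -> F -> F, derivation_basis iota P delta /\
   exists2 u, is_unit O u & \det (\matrix_(k, j) delta k (x j)) =
     u * (\prod_j x j * \det (\matrix_(j, l) evf (g j)^`M(c0 l)) / (f o * \prod_j f (sg j))
       * tau ^ (\sum_i (w i)%:Z - \sum_j (gam j)%:Z)).
Proof.
move=> det0.
have unitP a : a != 0 -> O a -> ~ nonunits O a -> is_unit O a.
  by move=> a0 Oa na; apply: contrapT => h; apply: na.
have [t [cu i0u]] := unit_minor_numbering; pose i0 := t (lshift r (lshift d ord0)).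
have [qP _] := dvr_nonunits dP; have [_ [n0 _] nD nM] := qP.
set N0 := \matrix_(j, l) _ in cu.
have dN0 : \det N0 != 0 by apply/eqP => e; apply: cu; rewrite e.
have ON0 : integral_mx O N0 by move=> j l; rewrite mxE.
have uN0 : is_unit O (\det N0) by apply: unitP => //; apply: (subring_det SP).
pose p : 'M[F]_nu := perm_mx t; pose p0 : 'M[F]_nu := perm_mx s.
have pp : p *m p^T = 1%:M by apply: perm_mx_orthogonal.
have pp0 : p0 *m p0^T = 1%:M by apply: perm_mx_orthogonal.
have pO : integral_mx O p.
  have [O1 _ _] := SP; move=> i j; rewrite !mxE; case: (_ == _) => //; exact: (subring0 SP).
have dsel (q : {perm 'I_nu}) k (A : 'M[F]_(nu, k)) l j : (dsubmx (perm_mx q) *m A) l j = A (q (rshift (1 + d) l)) j.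
  by rewrite -mul_row_selection [RHS]mxE mxE; apply: eq_bigr => i _; rewrite !mxE.
have usel (q : {perm 'I_nu}) k (A : 'M[F]_(nu, k)) l j : (usubmx (perm_mx q) *m A) l j = A (q (lshift r l)) j.
  by rewrite -mul_row_selection [RHS]mxE mxE; apply: eq_bigr => i _; rewrite !mxE.
pose B := dsubmx p; pose U := usubmx p; pose N := B *m M^T.
have NE : N = N0^T by apply/matrixP => l j; rewrite dsel !mxE.
have dNE : \det N = \det N0 by rewrite NE det_tr.
have uN : N \in unitmx by rewrite unitmxE unitfE dNE.
(* the frame W of the kernel starts with the Euler vector; completed by the
   rows B it is unimodular at P *)
have [WM WB] := adapted_frame pp euler_kernel uN.
set V := dsubmx _ *m _ in WM WB; set W := col_mx E V in WM WB.
have EO : integral_mx O E.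
  by move=> i j; rewrite !mxE; apply: (subringM SP); [rewrite -(rmorph_nat iota); apply: pd_scalars|exact: (lift_coord_regular S)].
have MO : integral_mx O M^T by move=> i j; rewrite !mxE.
have BO : integral_mx O B by move=> i j; rewrite mxE.
have NO : integral_mx O N by apply: integral_mul.
have uNd : O (\det N)^-1 by rewrite dNE; case: uN0.
have VO : integral_mx O V.
  apply: (integral_mul SP); first by move=> i j; rewrite 2!mxE; apply: pO.
  have IB m n (C1 C2 : 'M[F]_(m, n)) : integral_mx O C1 -> integral_mx O C2 -> integral_mx O (C1 - C2).
    by have [_ PB _] := SP; move=> h1 h2 i j; rewrite !mxE; apply: (PB).
  apply: IB; last by apply: (integral_mul SP) => //; apply: (integral_mul SP) => //; apply: (integral_inv SP).
  by have [O1 _ _] := SP; move=> i j; rewrite mxE; case: (_ == _) => //; exact: (subring0 SP).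
have WO : integral_mx O W by move=> i j; rewrite mxE; case: (split i) => k; [apply: EO|apply: VO].
have Eu : (E *m (usubmx (usubmx p))^T) 0 0 = (w i0)%:R * ft i0.
  have -> : (E *m (usubmx (usubmx p))^T) = (usubmx (usubmx p) *m E^T)^T by rewrite trmx_mul trmxK.
  rewrite mxE; have -> : (usubmx (usubmx p) *m E^T) 0 0 = (usubmx p *m E^T) (lshift d ord0) 0.
    by rewrite !mxE; apply: eq_bigr => i _; rewrite !mxE.
  by rewrite usel !mxE.
rewrite Eu in WB.
have dp := orthogonal_det pp; have dp0 := orthogonal_det pp0.
have detp_unit (q : 'M[F]_nu) : q *m q^T = 1%:M -> integral_mx O q -> is_unit O (\det q).
  move=> qq qO; have e := orthogonal_det qq; have q0 : \det q != 0.
    by apply: contra_eq_neq e => ->; rewrite mul0r eq_sym oner_neq0.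
  split=> //; first by apply: (subring_det SP).
  by have -> : (\det q)^-1 = \det q; [apply: (mulfI q0); rewrite divff|apply: (subring_det SP)].
have p0O : integral_mx O p0.
  have [O1 _ _] := SP; move=> i j; rewrite !mxE; case: (_ == _) => //; exact: (subring0 SP).
have up := detp_unit _ pp pO; have up0 := detp_unit _ pp0 p0O.
have unat n : (0 < n)%N -> is_unit O (n%:R : F).
  by move=> n1; split; rewrite ?natF_neq0 // -(rmorph_nat iota) -?fmorphV; apply: pd_scalars.
have ui0 : is_unit O (ft i0) by apply: unitP => //; exact: (lift_coord_regular S).
have pn0 : \det p != 0 by case: up.
pose T := col_mx W B.
have TE : \det T = (w i0)%:R * ft i0 / \det p by rewrite -WB mulfK.
have uT : is_unit O (\det T).
  by rewrite TE; apply: (is_unitM SP); [apply: (is_unitM SP) => //; exact: unat|apply: is_unitV].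
have [T0 _ OTi] := uT.
have uTm : T \in unitmx by rewrite unitmxE unitfE.
have TO : integral_mx O T by move=> i j; rewrite mxE; case: (split i) => k; [apply: WO|apply: BO].
have VM k : row k V *m M^T = 0.
  by rewrite -row_mul; move: WM; rewrite mul_col_mx -col_mx0 => /eq_col_mx [_ ->]; rewrite row0.
have /choice[delta dP'] : forall k, exists dl, derivation iota dl /\ derivation_along (row k V) dl.
  by move=> k; have [dl h1 h2] := derivation_along_exists (VM k); exists dl.
pose J : 'M[F]_d := \matrix_(k, j) delta k (x j).
pose A := W *m (usubmx p0)^T.
have AE i k : A i k = W i (s (lshift r k)).
  have -> : A = (usubmx p0 *m W^T)^T by rewrite trmx_mul trmxK.
  by rewrite mxE usel mxE.
have a0 : (w o)%:R * ft o != 0 by rewrite mulf_neq0 // natF_neq0.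
have ulA : A (lshift d ord0) (lshift d ord0) = (w o)%:R * ft o.
  by rewrite AE (col_mxEu E V) mxE.
(* Schur complement of the entry of the Euler row at o *)
have JE : \det J * ((w o)%:R * ft o) = \det A * \prod_j (x j * (w o)%:R / ft (sg j)).
  have := @det_border F d A; rewrite ulA => /(_ a0) ->.
  rewrite -[RHS]mulrA [LHS]mulrC; congr (_ * _).
  have := det_rescale (\matrix_(k, j) (A (rshift 1 k) (rshift 1 j) -
     A (rshift 1 k) (lshift d ord0) / ((w o)%:R * ft o) * A (lshift d ord0) (rshift 1 j)))
     (fun=> 1) (fun j => x j * (w o)%:R / ft (sg j)).
  rewrite big1_eq mul1r => <-; congr (\det _); apply/matrixP => k j.
  have rV i : row k V 0 i = V k i by rewrite [LHS]mxE.
  have Ei i : E 0 i = (w i)%:R * ft i by rewrite [LHS]mxE.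
  have Au l : A (rshift 1 k) l = V k (s (lshift r l)) by rewrite AE (col_mxEd E V).
  have Ao l : A (lshift d ord0) l = E 0 (s (lshift r l)) by rewrite AE (col_mxEu E V).
  rewrite [LHS]mxE [RHS]mxE [(\matrix_(_, _) _) k j]mxE (derivation_coordinate j (dP' k).2).
  by rewrite !Au !Ao !rV !Ei mul1r mulrC.
have B0E : dsubmx p0 *m M^T = (\matrix_(j, l) tev (g j)^`M(c0 l))^T.
  by apply/matrixP => l j; rewrite dsel !mxE.
have dB0 : \det (dsubmx p0 *m M^T) = \det (\matrix_(j, l) evf (g j)^`M(c0 l)) *
    tau ^ (\sum_l (w (c0 l))%:Z - \sum_j (gam j)%:Z).
  by rewrite B0E det_tr minor_scaling.
have A0 : \det A = \det (col_mx W (dsubmx p0)) * \det p0 by rewrite det_complement.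
(* passage from the minor adapted to P to the numbering s *)
have CM := complementary_minors (dsubmx p0) B WM (complete_minor pp (_ : \det (dsubmx p *m M^T) != 0)).
have dN1 : \det (dsubmx p *m M^T) != 0 by rewrite -/N dNE.
have {}CM := CM dN1.
have ftE i : ft i = f i * tau ^ (- (w i)%:Z) by rewrite /lift_coord -exprnN.
have fE i : f i != 0 by apply: (cs_f0 S).
have pft : ft o * \prod_j ft (sg j) = f o * \prod_j f (sg j) * tau ^ (- ((w o)%:Z + \sum_j (w (sg j))%:Z)).
  rewrite opprD expfzDr // ftE mulrACA; congr (_ * _); rewrite (eq_bigr _ (fun j _ => ftE (sg j))) big_split /=.
  congr (_ * _).
  by rewrite -sumrN (big_morph (fun k : int => tau ^ k) (id1 := 1) (op1 := *%R)) ?expr0z // => k l; rewrite expfzDr.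
have pfn : ft o * \prod_j ft (sg j) != 0 by rewrite mulf_neq0 //; apply/prodf_neq0 => j _.
have sumE : \sum_i (w i)%:Z = (w o)%:Z + \sum_j (w (sg j))%:Z + \sum_l (w (c0 l))%:Z.
  by rewrite (reindex_inj (@perm_inj _ s)) /= big_split_ord /= big_split_ord /= big_ord1.
pose u := (w o)%:R ^+ d / (w o)%:R * \det p0 * \det T / \det N : F.
have uu : is_unit O u.
  have uw := unat _ (w_gt0 o); have uwd : is_unit O ((w o)%:R ^+ d : F).
    elim: (d) => [|k IHk]; rewrite ?expr0 ?exprS; first by apply: is_unit1.
    exact: (is_unitM SP).
  rewrite /u dNE; do 3![apply: (is_unitM SP); last by try apply: is_unitV].
  by apply: (is_unitM SP) => //; apply: is_unitV.
have detJ : \det J = u * (\prod_j x j * \det (\matrix_(j, l) evf (g j)^`M(c0 l)) / (f o * \prod_j f (sg j))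
       * tau ^ (\sum_i (w i)%:Z - \sum_j (gam j)%:Z)).
  have ftau k : tau ^ k != 0 by rewrite expfz_neq0.
  have -> : f o * \prod_j f (sg j) = ft o * \prod_j ft (sg j) * tau ^ ((w o)%:Z + \sum_j (w (sg j))%:Z).
    by rewrite pft -mulrA -expfzDr // addNr expr0z mulr1.
  have -> : tau ^ (\sum_i (w i)%:Z - \sum_j (gam j)%:Z) = tau ^ ((w o)%:Z + \sum_j (w (sg j))%:Z) *
      tau ^ (\sum_l (w (c0 l))%:Z - \sum_j (gam j)%:Z) by rewrite sumE -addrA; apply: expfzDr.
  apply: (mulIf a0); rewrite JE A0.
  have -> : \det (col_mx W (dsubmx p0)) = \det T * \det (dsubmx p0 *m M^T) / \det N.
    by rewrite -CM mulfK // dNE.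
  have -> : \prod_j (x j * (w o)%:R / ft (sg j)) = \prod_j x j * (w o)%:R ^+ d / \prod_j ft (sg j).
    by rewrite prodf_div big_split /= prodr_const card_ord.
  rewrite dB0 /u; have pf1 : \prod_j ft (sg j) != 0 by apply/prodf_neq0.
  have dN1' : \det N != 0 by rewrite dNE.
  set wd := _%:R ^+ d; have wo := natF_neq0 (w_gt0 o).
  by field; rewrite ?dN1' ?pf1 ?ft0 ?wo ?ftau.
have J0 : \det J != 0.
  have [u0 _ _] := uu; rewrite detJ; apply: mulf_neq0 => //; apply: mulf_neq0; last exact: expfz_neq0.
  apply: mulf_neq0; last by rewrite invr_eq0 mulf_neq0 //; apply/prodf_neq0.
  by apply: mulf_neq0 => //; apply/prodf_neq0 => j _; rewrite mulf_neq0 ?invr_eq0 ?expf_neq0.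
have JkE k j : J k j = delta k (x j) by rewrite mxE.
exists delta; split; last by exists u.
split=> [k|eps [de epsO]].
  have [h1 h2] := dP' k; apply: (derivation_along_regular h1 h2) => i j; rewrite mxE; exact: VO.
have [vM va] := derivation_is_along de; set v := \row_i eps (ft i) in vM va.
have vO : integral_mx O v by move=> i j; rewrite mxE; apply: epsO; exact: (lift_coord_regular S).
(* coordinates of a tangent vector; those along B vanish *)
pose y : 'rV_nu := v *m invmx T.
have yO : integral_mx O y by apply: (integral_mul SP) => //; apply: (integral_inv SP).
have vE : v = lsubmx y *m W + rsubmx y *m B by rewrite -mul_row_col hsubmxK /y mulmxKV.
have y20 : rsubmx y = 0.
  move: vM; rewrite vE mulmxDl -!mulmxA WM mulmx0 add0r => e.
  by rewrite -[rsubmx y](mulmxK uN) /N e mul0mx.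
rewrite y20 mul0mx addr0 in vE.
pose mu := lsubmx (lsubmx y) 0 0; pose cc := rsubmx (lsubmx y).
have vE' i : v 0 i = mu * E 0 i + \sum_k cc 0 k * V k i.
  rewrite vE -{1}(hsubmxK (lsubmx y)) mul_row_col mxE; congr (_ + _); last by rewrite mxE.
  by rewrite mxE big_ord1.
have epsE a : eps a = \sum_k cc 0 k * delta k a.
  have [n [G [H [hG hH H0 aE]]]] := fraction_rep a.
  have gE Q q : Q \is whomog w q -> grad v Q = mu * (q%:R * tev Q) + \sum_k cc 0 k * grad (row k V) Q.
    move=> hQ; rewrite -(grad_euler hQ) /grad mulr_sumr.
    under [X in _ + X]eq_bigr => k _ do rewrite mulr_sumr.
    rewrite exchange_big -big_split; apply: eq_bigr => i _ /=; rewrite vE' mulrDl mulr_suml mulrA; congr (_ + _).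
    by apply: eq_bigr => k _; rewrite [row _ _ _ _]mxE mulrA.
  rewrite (va _ _ _ _ hG hH H0 aE) (gE _ _ hG) (gE _ _ hH).
  have -> : tev G = a * tev H by rewrite aE divfK.
  rewrite mulrDr opprD addrACA; have -> : mu * (n%:R * (a * tev H)) - a * (mu * (n%:R * tev H)) = 0 by ring.
  rewrite add0r mulr_sumr -sumrB mulr_suml; apply: eq_bigr => k _.
  by rewrite ((dP' k).2 _ _ _ _ hG hH H0 aE); ring.
exists cc; split; first by split=> // k; rewrite 2!mxE; apply: yO.
move=> c' [_ c'E]; have uJ : J \in unitmx by rewrite unitmxE unitfE.
apply: (can_inj (mulmxK uJ)); apply/rowP => j; rewrite [LHS]mxE [RHS]mxE.
transitivity (eps (x j)); [rewrite epsE|rewrite c'E]; by apply: eq_bigr => k _; rewrite JkE.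
Qed.

End Coordinates.
End AtDivisor.
End CanonicalDivisor.

(** * The canonical class *)

Section AnticanonicalDegree.
Variables (K : closedFieldType) (F : fieldType) (iota : {rmorphism K -> F}).
Variables (X : normal_variety iota) (d r : nat) (degCl : {additive Cl X -> int}).
Local Notation nu := (1 + d + r)%N.
Variables (D0 : WDiv X) (f : 'I_nu -> F) (w : 'I_nu -> nat).
Hypothesis S : cox_setting d degCl D0 f w.
Variables (g : 'I_r -> {mpoly K[nu]}) (gam : 'I_r -> nat).
Hypothesis g_hom : forall j, weighted_homog w (g j) (gam j).
Hypothesis g_gen : tcs_ideal iota f w = ideal_generated_by g.
Local Notation kappa := (\sum_i (w i)%:Z - \sum_j (gam j)%:Z).

Lemma lift_parameter (P : prime_divisor X) : exists2 tau : F, tau != 0 & ord P tau = - mult P D0.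
Proof.
have [t [t0 _ _ ot _]] := dvr_uniformizer (pd_dvr P); exists (t ^ (- mult P D0)); first exact: expfz_neq0.
by rewrite (ordXz (pd_dvr P)) // ot mul1r.
Qed.

(** The form dx_1 ... dx_d is multiplied by the monomial and the minor that occur
    in its value on local derivations, which leaves a power of tau. *)
Lemma canonical_divisor_degree : canonical_divisor d (D0 *~ (- kappa)).
Proof.
have [P0 _] := exists_prime_divisor S; have [tau0 t00 ot0] := lift_parameter P0.
have [s [su _]] := unit_minor_numbering S g_hom g_gen t00 ot0.
have det0 : \det (\matrix_(j, l) ev iota f (g j)^`M(s (rshift (1 + d) l))) != 0.
  apply/eqP => e; apply: su; rewrite (minor_scaling iota f g_hom t00) e mul0r.
  by apply: prime_ideal0; apply: dvr_nonunits; apply: pd_dvr.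
set o := s (lshift r (lshift d ord0)); set M0 := \det _ in det0.
pose x := coordinate f w s; pose pf := f o * \prod_j f (s (lshift r (rshift 1 j))).
have f0 := cs_f0 S; have x0 j : x j != 0 by rewrite mulf_neq0 ?invr_eq0 ?expf_neq0.
have px0 : \prod_j x j != 0 by apply/prodf_neq0.
have pf0 : pf != 0 by rewrite mulf_neq0 //; apply/prodf_neq0.
have loc (P : prime_divisor X) : exists (tau : F) (delta : 'I_d -> F -> F) (u : F), [/\ tau != 0, ord P tau = - mult P D0,
    derivation_basis iota P delta, is_unit (P : set F) u &
    \det (\matrix_(k, j) delta k (x j)) = u * (\prod_j x j * M0 / pf * tau ^ kappa)].
  have [tau t0 ot] := lift_parameter P.
  have [delta [db [u uu uE]]] := local_derivations S g_hom g_gen t0 ot det0.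
  by exists tau, delta, u.
exists (pf / (\prod_j x j * M0)), x; split.
- by apply: mulf_neq0 => //; rewrite invr_eq0; apply: mulf_neq0.
- have [tau [delta [u [t0 _ [db _] [u0 _ _] uE]]]] := loc P0.
  apply: (alg_indep_det (cs_char S) (delta := delta)) => [k|]; first by case: (db k).
  rewrite uE; apply: mulf_neq0 => //; apply: mulf_neq0; last exact: expfz_neq0.
  by apply: mulf_neq0; [apply: mulf_neq0|rewrite invr_eq0].
move=> P; have [tau [delta [u [t0 ot db uu uE]]]] := loc P; exists delta => //.
have [u0 _ _] := uu; have dP := pd_dvr P.
have -> : pf / (\prod_j x j * M0) * \det (\matrix_(k, j) delta k (x j)) = u * tau ^ kappa.
  by rewrite uE; field; rewrite ?px0 ?pf0 ?det0.
rewrite (ordM dP) ?expfz_neq0 // (ordXz dP) // ot multMz.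
by have /(ord_unit dP u0) -> := uu; rewrite add0r mulrN mulNr.
Qed.

Lemma anticanonical_degree_numbered : degCl (- canonical_class X d) = kappa.
Proof.
have -> : canonical_class X d = cl (D0 *~ (- kappa)).
  apply: xget_unique; first by exists (D0 *~ (- kappa)) => //; apply: canonical_divisor_degree.
  move=> c [D hD ->]; exact: (canonical_unique (cs_char S) (cs_dim S) hD canonical_divisor_degree).
rewrite raddfN -[degCl _]/(dg degCl (D0 *~ (- kappa))) dgMz (dgD0 S) mul1r opprK //.
Qed.

End AnticanonicalDegree.

(** Adjunction formula. *)
Lemma anticanonical_degree (K : closedFieldType) (F : fieldType) (iota : {rmorphism K -> F})
    (X : normal_variety iota) (d nu r : nat) (degCl : {additive Cl X -> int})
    (D0 : WDiv X) (f : 'I_nu -> F) (w : 'I_nu -> nat) (g : 'I_r -> {mpoly K[nu]}) (gam : 'I_r -> nat) :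
  cox_setting d degCl D0 f w -> nu = (1 + d + r)%N -> (forall j, weighted_homog w (g j) (gam j)) ->
  tcs_ideal iota f w = ideal_generated_by g ->
  degCl (- canonical_class X d) = \sum_i (w i)%:Z - \sum_j (gam j)%:Z.
Proof. move=> S nuE gh gg; subst nu; exact: (anticanonical_degree_numbered S gh gg). Qed.

Theorem proposition2p5 (K : closedFieldType) (F : fieldType)
    (iota : {rmorphism K -> F}) (X : normal_variety iota) (d nu : nat)
    (degCl : {additive Cl X -> int}) (D0 : WDiv X)
    (f : 'I_nu -> F) (w : 'I_nu -> nat)
    (charK : [pchar K] =i pred0)
    (X_complete : complete X)
    (dim_X : has_dim iota d)
    (degCl_bij : bijective degCl)
    (D0_gen : degCl (cl D0) = 1)
    (w_gt0 : forall i, (0 < w i)%N)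
    (f_gen : cox_ring D0 = range (cox_eval iota f w))
    (f_prime : forall i, prime_in (cox_ring D0) (cox_elt (f i) (w i)))
    (f_nonassoc : forall i j, i != j ->
       ~ associated_in (cox_ring D0) (cox_elt (f i) (w i)) (cox_elt (f j) (w j))) :
  [/\ forall xb : 'I_nu -> K, tcs_hat iota f w xb ->
        closed_points X (tcs_quot X f w xb) /\
        has_order (local_Cl X (tcs_quot X f w xb))
                  (\big[gcdn/0%N]_(i | xb i != 0) w i),
      exists (c : set F -> nat) (N : nat),
        [/\ forall x, closed_points X x -> has_order (local_Cl X x) (c x),
            has_order (Cl_mod_Pic X) N
          & is_lcm (closed_points X) c N]
    & forall (g : 'I_(nu - d - 1) -> {mpoly K[nu]}) (gamma : 'I_(nu - d - 1) -> nat),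
        (forall j, weighted_homog w (g j) (gamma j)) ->
        tcs_ideal iota f w = ideal_generated_by g ->
        [/\ degCl (- canonical_class X d)
              = \sum_i (w i)%:Z - \sum_j (gamma j)%:Z,
            self_intersection d (- canonical_class X d)
              = (\sum_i (w i)%:Q - \sum_j (gamma j)%:Q) ^+ d
                * (\prod_j (gamma j)%:Q / \prod_i (w i)%:Q)
          & fano X d <-> (\sum_j gamma j < \sum_i w i)%N]].
Proof.
have f0 i : f i != 0.
  have [_ n0 _ _] := f_prime i; apply: contra_neq n0 => e.
  by rewrite /cox_elt e scale0r rmorph0.
have S : cox_setting d degCl D0 f w by split.
split.
- move=> xb hx; rewrite (tcs_quotE S hx); split; first exact: (pt_closed S hx).
  exact: (local_Cl_order S hx).
- exact: (picard_index S).
move=> g gamma g_hom g_gen; have dn := dim_lt_variables S.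
have nuE : nu = (1 + d + (nu - d - 1))%N by move: dn; clear; lia.
have deg := anticanonical_degree S nuE g_hom g_gen.
split=> //.
  rewrite (self_intersectionE S (nuE : nu = (d.+1 + (nu - d - 1))%N) g_hom g_gen) deg; congr (_ ^+ d * _).
  by rewrite rmorphB !rmorph_sum.
apply: (iff_trans (ampleP S _)); rewrite deg subr_gt0.
by rewrite -!(big_morph Posz PoszD (erefl 0%:Z)) ltz_nat.
Qed.
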